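(* A stochastically continuous pure jump process $\xi$ is time-stable if and only if $$\xi(t)\overset{d}{=}\sum_{i=1}^\infty\varepsilon_i(\Gamma_i^{-1}t),\quad t\geq0,$$ where $\{\Gamma_i\}$ form a homogeneous unit-intensity Poisson point process on $(0,\infty)$, and $\{\varepsilon_i,i\ge1\}$ are independent copies of a random step function $\varepsilon$ which is independent of $\{\Gamma_i\}$ and satisfies $$\mathbb{E}\int_0^\infty\min(1,|\varepsilon(t)|)t^{-2}dt<\infty.$$
   Context: $\overset{d}{=}$ denotes equality of finite-dimensional distributions. A pure jump process is a process $\xi(t)$, $t\ge0$, whose paths are c\`adl\`ag piecewise constant functions vanishing at $0$ with finitely many jumps in each bounded subset of $[0,\infty)$. A random step function is a random c\`adl\`ag piecewise constant function on $[0,\infty)$. For a process $\eta$ and $a>0$, $(a\circ\eta)(t)=\eta(at)$. A stochastically continuous real-valued process $\xi$ is time-stable if for each integer $n\ge2$, $\xi_1+\cdots+\xi_n\overset{d}{=}n\circ\xi$, where $\xi_1,\dots,\xi_n$ are i.i.d. copies of $\xi$. *)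

(* Defs.v *)
From HB Require Import structures.
From mathcomp Require Import all_boot all_order all_algebra.
From mathcomp Require Import all_classical all_reals all_analysis.
Set Implicit Arguments. Unset Strict Implicit. Unset Printing Implicit Defensive.
Import Order.TTheory GRing.Theory Num.Theory.
Import numFieldNormedType.Exports.
Local Open Scope classical_set_scope.
Local Open Scope ring_scope.

(* A real-valued process indexed by time t >= 0 is represented as
   X : R -> Ω -> R; only the values at t >= 0 are ever used. *)

Definition is_process d (T : measurableType d) (R : realType)
  (X : R -> T -> R) : Prop :=
  forall t : R, 0 <= t -> measurable_fun [set: T] (X t).

Definition fdd_eq d1 d2 (T1 : measurableType d1) (T2 : measurableType d2)
  (R : realType) (P1 : probability T1 R) (P2 : probability T2 R)
  (X : R -> T1 -> R) (Y : R -> T2 -> R) : Prop :=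
  forall (n : nat) (ts : n.-tuple R), all (fun s => 0 <= s) ts ->
  forall B : set (n.-tuple R), measurable B ->
    P1 [set w | B (map_tuple (fun s => X s w) ts)] =
    P2 [set w | B (map_tuple (fun s => Y s w) ts)].

(* f restricted to [0,oo) is a cadlag piecewise constant function with
   finitely many jumps in every bounded subset of [0,oo): every [0,T) is
   covered by finitely many intervals [s_j, s_{j+1}) on which f is constant *)
Definition step_fun (R : realType) (f : R -> R) : Prop :=
  forall T : R, 0 < T -> exists (k : nat) (s : nat -> R),
    s 0%N = 0 /\ (forall j, (j < k)%N -> s j < s j.+1) /\ T <= s k /\
    forall j, (j < k)%N -> forall x, s j <= x < s j.+1 -> f x = f (s j).

Definition pure_jump_fun (R : realType) (f : R -> R) : Prop :=
  step_fun f /\ f 0 = 0.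

Definition pure_jump_process (T : Type) (R : realType) (X : R -> T -> R) : Prop :=
  forall w, pure_jump_fun (fun t => X t w).

Definition random_step_fun (T : Type) (R : realType) (X : R -> T -> R) : Prop :=
  forall w, step_fun (fun t => X t w).

Definition stoch_cont d (T : measurableType d) (R : realType)
  (P : probability T R) (X : R -> T -> R) : Prop :=
  forall t : R, 0 <= t -> forall e : R, 0 < e -> forall eta : R, 0 < eta ->
  exists delta : R, 0 < delta /\
    forall s : R, 0 <= s -> `|s - t| < delta ->
      (P [set w | (e < `|X s w - X t w|)%R] <= eta%:E)%E.

Definition mutually_independent d (T : measurableType d) (R : realType)
  (P : probability T R) (I : eqType) (F : I -> set (set T)) : Prop :=
  forall (J : seq I) (A : I -> set T), uniq J ->
    (forall i, i \in J -> F i (A i)) ->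
    P (\big[setI/setT]_(i <- J) A i) = (\prod_(i <- J) P (A i))%E.

Definition sigma_proc d (T : measurableType d) (R : realType)
  (X : R -> T -> R) : set (set T) :=
  <<s \bigcup_(t in [set t : R | 0 <= t])
        preimage_set_system [set: T] (X t) measurable >>.

Definition sigma_seq d (T : measurableType d) (R : realType)
  (G : nat -> T -> R) : set (set T) :=
  <<s \bigcup_(i in [set: nat]) preimage_set_system [set: T] (G i) measurable >>.

Definition point_count (T : Type) (R : realType) (G : nat -> T -> R)
  (A : set R) (w : T) : \bar R :=
  (\sum_(i <oo) (\1_A (G i w))%:E)%E.

(* Poisson probability of k with mean m >= 0 (with 0^0 = 1) *)
Definition poisson_p (R : realType) (m : R) (k : nat) : R :=
  expR (- m) * m ^+ k / (k`!)%:R.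

Definition unit_poisson_pp d (T : measurableType d) (R : realType)
  (P : probability T R) (G : nat -> T -> R) : Prop :=
  (forall i, measurable_fun [set: T] (G i)) /\
  (forall i w, 0 < G i w) /\
  forall (k : nat) (A : 'I_k -> set R) (m : 'I_k -> nat),
    (forall j, measurable (A j) /\ A j `<=` (`]0, +oo[%classic : set R) /\
               (@lebesgue_measure R (A j) < +oo)%E) ->
    (forall i j, i != j -> A i `&` A j = set0) ->
    P (\big[setI/setT]_(j < k) [set w | point_count G (A j) w = ((m j)%:R)%:E]) =
    (\prod_(j < k) (poisson_p (fine (@lebesgue_measure R (A j))) (m j))%:E)%E.

Definition time_stable d (T : measurableType d) (R : realType)
  (P : probability T R) (X : R -> T -> R) : Prop :=
  forall n : nat, (2 <= n)%N ->
  forall (d' : measure_display) (T' : measurableType d') (P' : probability T' R)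
         (Xs : 'I_n -> R -> T' -> R),
    (forall i, is_process (Xs i)) ->
    (forall i, fdd_eq P' P (Xs i) X) ->
    mutually_independent P' (fun i => sigma_proc (Xs i)) ->
    fdd_eq P' P (fun t w => \sum_(i < n) Xs i t w) (fun t w => X (n%:R * t) w).

Definition lepage_partial (T : Type) (R : realType) (G : nat -> T -> R)
  (E : nat -> R -> T -> R) (t : R) (w : T) (n : nat) : R :=
  \sum_(i < n) E i (t / G i w) w.

Definition lepage_sum (T : Type) (R : realType) (G : nat -> T -> R)
  (E : nat -> R -> T -> R) (t : R) (w : T) : R :=
  limn (lepage_partial G E t w).

(* Main.v *)
Require Import Defs.
From HB Require Import structures.
From mathcomp Require Import all_boot all_order all_algebra.
From mathcomp Require Import all_classical all_reals all_analysis.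
From mathcomp Require Import measurable_realfun ring lra.
Set Implicit Arguments. Unset Strict Implicit. Unset Printing Implicit Defensive.
Import Order.TTheory GRing.Theory Num.Theory.
Import numFieldNormedType.Exports.
Local Open Scope classical_set_scope.
Local Open Scope ring_scope.

(* Finite-dimensional laws of a process are laws on the sequence space nat -> R, and
   time-stability says that the n-fold convolution of the law of (xi(t_k))_k is the law
   of (xi(n t_k))_k.

   For a LePage sum, keep the Gamma_i < L and move each of them to the left end of its
   cell in a grid of mesh h.  The resulting law is, up to N h^2, the convolution over the
   N cells of (1 - q) delta_0 + q law(eps(t / (c h))), with q = 1 - exp(-h).  Its n-fold
   convolution is again of this form up to an error of order 1/N, for the mesh n h and
   the same cell laws at the times n t, and this gives stability in the limit.

   Conversely, stability gives P(xi jumps before x) <= K x, and then the quantities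
   n P(xi(t / n) in E, first jump of xi(. / n) in [x, y[) converge at the rate 1/n to
   an intensity which is homogeneous of degree 1 under time scaling.
   The mark eps has the intensity restricted to first jumps in [a, 2a[, normalized by
   1 / ln 2 and completed by the zero path; rescaling this window over a grid covers every
   first jump time with total weight sum_{j/2 < c <= j} 1/c -> ln 2.  Hence xi and the
   LePage sum S with marks eps satisfy m P(. (t / m) in E) = intensity + O(1/m) uniformly
   in the sets E avoiding 0, so their laws at t / m differ by O(1/m^2); taking m-fold
   convolutions and letting m tend to infinity shows that xi and S have the same laws. *)

(** * Laws on the sequence space and their convolution *)

(** Two closeness relations are used. Cutting off the tail of a general LePage sum leaves an error
    that is small only in probability, so stability is compared through [ble], which allows a
    displacement of the coordinates. In the converse the marks vanish before a positive time, so
    only finitely many Gamma_i act on a bounded time interval and total variation, [dle], is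
    available. There an error of order 1/m^2 gets multiplied by m, so all rates have to be uniform
    over the measurable sets.

    The intensity is reached only through vectors of observations, so eps does not come from a
    measure on path space. Its values at rational times come from a consistent family of laws, the
    regularity of its paths is inherited from xi as an event of full measure, and right limits
    supply the other times. Homogeneity is derived for rational ratios of scales; hence the window
    [a, 2a[ starts at the reciprocal of an integer, and laws are compared at rational times before
    right-continuity takes over. *)

Definition iseq (T : Type) : Type := nat -> T.
(** Sealed with [Qed], so that structure inference keeps the display of the sequence space apart
    from that of [T]. *)
Definition iseq_display : measure_display -> measure_display.
Proof. exact. Qed.

HB.instance Definition _ (T : Type) := gen_eqMixin (iseq T).
HB.instance Definition _ (T : Type) := gen_choiceMixin (iseq T).
HB.instance Definition _ (T : pointedType) := isPointed.Build (iseq T) (fun=> point).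

Section iseq_measurable.
Context d (T : measurableType d).

Definition iseq_gen : set (set (iseq T)) :=
  \bigcup_k preimage_set_system [set: iseq T] (fun x : iseq T => x k) measurable.

Let iseq_set0 : <<s iseq_gen >> set0.
Proof. exact: sigma_algebra0. Qed.
Let iseq_setC A : <<s iseq_gen >> A -> <<s iseq_gen >> (~` A).
Proof. exact: sigma_algebraC. Qed.
Let iseq_bigcup (F : _^nat) : (forall i, <<s iseq_gen >> (F i)) ->
  <<s iseq_gen >> (\bigcup_i (F i)).
Proof. exact: sigma_algebra_bigcup. Qed.

HB.instance Definition _ := @isMeasurable.Build (iseq_display d)
  (iseq T) <<s iseq_gen >> iseq_set0 iseq_setC iseq_bigcup.

Lemma measurable_coord k : measurable_fun [set: iseq T] (fun x : iseq T => x k).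
Proof.
move=> _ Y mY; rewrite setTI; apply: sub_sigma_algebra.
by exists k => //; exists Y => //; rewrite setTI.
Qed.

Lemma measurable_to_iseq d' (U : measurableType d') (f : U -> iseq T) :
  (forall k, measurable_fun [set: U] (fun u => f u k)) ->
  measurable_fun [set: U] f.
Proof.
move=> mf; apply: (measurability iseq_gen) => // _ [_ [k _ [B mB <-]] <-].
by rewrite !setTI -comp_preimage -[X in measurable X]setTI; apply: mf.
Qed.

Definition cyl (s : seq (nat * set T)) : set (iseq T) :=
  [set x | forall p, p \in s -> p.2 (x p.1)].

Lemma cyl_cons p s : cyl (p :: s) = [set x | p.2 (x p.1)] `&` cyl s.
Proof.
apply/seteqP; split => x /= h.
  by split; [apply: h; rewrite mem_head|move=> q qs; apply: h; rewrite inE qs orbT].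
by move=> q; rewrite inE => /orP[/eqP ->|]; [case: h|case: h => _; apply].
Qed.

Lemma cyl_nil : cyl [::] = setT.
Proof. by apply/seteqP; split. Qed.

Lemma cyl_cat s1 s2 : cyl (s1 ++ s2) = cyl s1 `&` cyl s2.
Proof.
by elim: s1 => [|p s ih] /=; rewrite ?cyl_nil ?setTI// !cyl_cons ih setIA.
Qed.

Definition cyls (G : set (set T)) : set (set (iseq T)) :=
  [set A | exists2 s, A = cyl s & forall p, p \in s -> G p.2].

Lemma measurable_cyl s : (forall p, p \in s -> measurable p.2) ->
  measurable (cyl s).
Proof.
elim: s => [_|p s ih h]; first by rewrite cyl_nil.
rewrite cyl_cons; apply: measurableI; last by apply: ih => q qs; apply: h; rewrite inE qs orbT.
by rewrite -[X in measurable X]setTI; apply: measurable_coord => //; apply: h; rewrite mem_head.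
Qed.

Lemma setI_closed_cyls G : setI_closed (cyls G).
Proof.
move=> _ _ [s1 -> h1] [s2 -> h2]; exists (s1 ++ s2); first by rewrite cyl_cat.
by move=> p; rewrite mem_cat => /orP[/h1|/h2].
Qed.

(** Preimages under a coordinate commute with generation of sigma-algebras, so sides taken from a
    generator [G] are enough. Closure of the cylinders under intersection then makes them a class on
    which laws can be compared. *)
Lemma measurable_iseqE (G : set (set T)) : measurable = <<s G >> ->
  @measurable _ (iseq T) = <<s cyls G >>.
Proof.
move=> mG; rewrite eqEsubset; split; last first.
  apply: smallest_sub; first exact: sigma_algebra_measurable.
  move=> _ [s -> h]; apply: measurable_cyl => p /h Gp.
  by rewrite mG; exact: sub_sigma_algebra.
apply: smallest_sub; first exact: smallest_sigma_algebra.
move=> A [k _].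
suff : preimage_set_system [set: iseq T] (fun x : iseq T => x k) measurable `<=`
    <<s cyls G >> by move=> h /h.
rewrite mG -g_sigma_preimageE.
apply: smallest_sub; first exact: smallest_sigma_algebra.
move=> _ [B GB <-]; apply: sub_sigma_algebra.
exists [:: (k, B)]; last by move=> p; rewrite inE => /eqP ->.
by rewrite setTI cyl_cons cyl_nil setIT.
Qed.

Lemma iseq_measure_unique (R : realType) (G : set (set T))
    (m1 m2 : probability (iseq T) R) : measurable = <<s G >> ->
  (forall s, (forall p, p \in s -> G p.2) -> m1 (cyl s) = m2 (cyl s)) ->
  forall A, measurable A -> m1 A = m2 A.
Proof.
move=> mG h A mA; apply: (measure_unique (cyls G) (fun=> setT)) => //.
- exact: measurable_iseqE.
- exact: setI_closed_cyls.
- by move=> i; exists [::] => //; rewrite cyl_nil.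
- by rewrite bigcup_const//; exists 0%N.
- by move=> _ [s -> hs]; apply: h.
- by move=> k; rewrite (le_lt_trans (probability_le1 m1 measurableT)) ?ltry.
Qed.

End iseq_measurable.
Arguments measurable_coord {d T}.

Section law.
Context d (T : measurableType d) d' (U : measurableType d') (R : realType).

Definition law (P : probability T R) (X : T -> U) (mX : measurable_fun setT X) :
    probability U R :=
  distribution P (HB.pack_for {mfun T >-> U} X (isMeasurableFun.Build _ _ _ _ X mX)).

Lemma lawE P X mX A : @law P X mX A = P (X @^-1` A).
Proof. by []. Qed.
End law.

Section pr.
Context d (T : measurableType d) (R : realType) (P : probability T R).
Implicit Types A B : set T.

Definition pr A : R := fine (P A).

Lemma prE A : measurable A -> P A = (pr A)%:E.
Proof. by move=> mA; rewrite fineK// fin_num_measure. Qed.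

Lemma pr_ge0 A : 0 <= pr A. Proof. by rewrite fine_ge0. Qed.

Lemma le_pr A B : measurable A -> measurable B -> A `<=` B -> pr A <= pr B.
Proof.
move=> mA mB AB; apply: fine_le; rewrite ?fin_num_measure//.
by apply: le_measure => //; rewrite inE.
Qed.

Lemma pr_setT : pr setT = 1. Proof. by rewrite /pr probability_setT. Qed.
Lemma pr_set0 : pr set0 = 0. Proof. by rewrite /pr measure0. Qed.

Lemma pr_le1 A : measurable A -> pr A <= 1.
Proof. by move=> mA; rewrite -pr_setT; apply: le_pr. Qed.

Lemma pr_setC A : measurable A -> pr (~` A) = 1 - pr A.
Proof.
move=> mA; have := probability_setC P mA.
by rewrite (prE mA) (prE (measurableC mA)) => -[].
Qed.

Lemma prU A B : measurable A -> measurable B -> A `&` B = set0 ->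
  pr (A `|` B) = pr A + pr B.
Proof.
move=> mA mB AB; have : P (A `|` B) = (P A + P B)%E by rewrite measureU.
by rewrite (prE mA) (prE mB) (prE (measurableU _ _ mA mB)) => -[].
Qed.

Lemma prU_le A B : measurable A -> measurable B -> pr (A `|` B) <= pr A + pr B.
Proof.
move=> mA mB; have : (P (A `|` B) <= P A + P B)%E by exact: measureU2.
by rewrite (prE mA) (prE mB) (prE (measurableU _ _ mA mB)) lee_fin.
Qed.

Lemma pr_split A B : measurable A -> measurable B ->
  pr A = pr (A `&` B) + pr (A `&` ~` B).
Proof.
move=> mA mB; have mBc := measurableC mB; rewrite -prU; last first.
- by rewrite setIACA setICr setI0.
- exact: measurableI.
- exact: measurableI.
by rewrite -setIUr setUCr setIT.
Qed.

Lemma pr_sum_le (I : Type) (s : seq I) (F : I -> set T) :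
  (forall i, measurable (F i)) ->
  pr (\big[setU/set0]_(i <- s) F i) <= \sum_(i <- s) pr (F i).
Proof.
move=> mF; elim: s => [|i s ih]; first by rewrite !big_nil pr_set0.
rewrite !big_cons; apply: (le_trans (prU_le _ _)) => //.
  exact: bigsetU_measurable.
exact: lerD.
Qed.

Lemma le_pr_near A B C : measurable A -> measurable B -> measurable C ->
  A `&` C `<=` B -> pr A <= pr B + pr (~` C).
Proof.
move=> mA mB mC ACB; rewrite (pr_split mA mC); apply: lerD.
  by apply: le_pr => //; exact: measurableI.
by apply: le_pr => //; [apply: measurableI => //|]; exact: measurableC.
Qed.

End pr.

Section conv.
Variable R : realType.
Notation V := (iseq R).

Definition vadd (x y : V) : V := fun k => x k + y k.
Definition v0 : V := fun=> 0.

Lemma vaddA x y z : vadd x (vadd y z) = vadd (vadd x y) z.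
Proof. by apply/funext => k; rewrite /vadd addrA. Qed.
Lemma vaddC x y : vadd x y = vadd y x.
Proof. by apply/funext => k; rewrite /vadd addrC. Qed.
Lemma vadd0 x : vadd x v0 = x.
Proof. by apply/funext => k; rewrite /vadd addr0. Qed.
Lemma v0add x : vadd v0 x = x.
Proof. by rewrite vaddC vadd0. Qed.

Lemma measurable_vadd_fun d (T : measurableType d) (f g : T -> V) :
  measurable_fun setT f -> measurable_fun setT g ->
  measurable_fun setT (fun x => vadd (f x) (g x)).
Proof.
move=> mf mg; apply: measurable_to_iseq => k; apply: measurable_funD.
- exact: (measurableT_comp (measurable_coord k) mf).
- exact: (measurableT_comp (measurable_coord k) mg).
Qed.

Lemma measurable_vadd : measurable_fun setT (fun p : V * V => vadd p.1 p.2).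
Proof. exact: (measurable_vadd_fun measurable_fst measurable_snd). Qed.

Lemma measurable_vaddl x : measurable_fun setT (vadd x).
Proof.
apply: (@measurable_vadd_fun _ _ (fun=> x) id); [exact: measurable_cst|exact: measurable_id].
Qed.

Definition shift (x : V) (E : set V) : set V := [set y | E (vadd x y)].

Lemma measurable_shift x E : measurable E -> measurable (shift x E).
Proof. by move=> mE; rewrite -[X in measurable X]setTI; apply: measurable_vaddl. Qed.

Definition conv (mu nu : probability V R) : probability V R :=
  law (mu \x nu)%E measurable_vadd.

Lemma convE mu nu E : measurable E ->
  conv mu nu E = (\int[mu]_x nu (shift x E))%E.
Proof.
move=> mE; rewrite /conv lawE /product_measure1 /=; apply: eq_integral => x _ /=.
by congr (nu _); rewrite /xsection; apply/seteqP; split => y /=; rewrite inE.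
Qed.

(** Recognizes a joint law as a product from its values on rectangles. Commutativity of the
    convolution and the law of a sum of independent vectors both go through it. *)
Lemma conv_rect (mu nu : probability V R) (m : {measure set (V * V) -> \bar R}) E : measurable E ->
  (forall A B, measurable A -> measurable B -> m (A `*` B) = (mu A * nu B)%E) ->
  conv mu nu E = m [set p | E (vadd p.1 p.2)].
Proof.
move=> mE h; rewrite /conv lawE; apply: product_measure_unique => //.
by rewrite -[X in measurable X]setTI; apply: measurable_vadd.
Qed.

Lemma convC mu nu E : measurable E -> conv mu nu E = conv nu mu E.
Proof.
move=> mE.
have msw : measurable_fun setT (fun p : V * V => (p.2, p.1)).
  exact: measurable_swap.
pose m : {measure set (V * V) -> \bar R} := law (nu \x mu)%E msw.
have m_E A : m A = (nu \x mu)%E ((fun p => (p.2, p.1)) @^-1` A) by [].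
rewrite (conv_rect (m := m)) //.
  rewrite m_E /conv lawE; congr (_ _).
  by apply/seteqP; split => -[x y] /=; rewrite vaddC.
move=> A B mA mB; rewrite m_E.
have -> : (fun p : V * V => (p.2, p.1)) @^-1` (A `*` B) = B `*` A.
  by apply/seteqP; split => -[x y] /= [].
by rewrite product_measure1E// muleC.
Qed.

Definition deq (mu nu : probability V R) := forall E, measurable E -> mu E = nu E.
(** One-sided, yet equivalent to total variation distance at most [e]: complements reverse the
    inequality, see [dleC]. Hence only one of two opposite bounds ever has to be proved. *)
Definition dle (mu nu : probability V R) (e : R) :=
  forall E, measurable E -> pr mu E <= pr nu E + e.

End conv.

Section conv_theory.
Variable R : realType.
Notation V := (iseq R).
Implicit Types (mu nu rho : probability V R) (d e : R).

Definition delta0 : probability V R := \d_(@v0 R).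

Lemma measurable_shift_prob nu E : measurable E ->
  measurable_fun setT (fun x => nu (shift x E)).
Proof.
move=> mE; pose A := (fun p : V * V => vadd p.1 p.2) @^-1` E.
have mA : measurable A by rewrite -[X in measurable X]setTI; apply: measurable_vadd.
rewrite [X in measurable_fun _ X](_ : _ = nu \o xsection A).
  exact: measurable_fun_xsection.
apply/funext => x /=; congr (nu _).
by rewrite /xsection; apply/seteqP; split => y /=; rewrite inE.
Qed.

Lemma deqC mu nu : deq mu nu -> deq nu mu.
Proof. by move=> h E mE; rewrite h. Qed.

Lemma deq_trans nu mu rho : deq mu nu -> deq nu rho -> deq mu rho.
Proof. by move=> h1 h2 E mE; rewrite h1// h2. Qed.

Lemma conv_deq mu nu mu' nu' : deq mu mu' -> deq nu nu' ->
  deq (conv mu nu) (conv mu' nu').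
Proof.
have aux (m n n' : probability V R) : deq n n' -> deq (conv m n) (conv m n').
  move=> nn' E mE; rewrite !convE//; apply: eq_integral => x _.
  by rewrite nn'//; exact: measurable_shift.
move=> h1 h2; apply: (@deq_trans (conv mu nu')); first exact: aux.
by move=> E mE; rewrite convC// (aux _ _ _ h1)// convC.
Qed.

Lemma conv_delta0l mu : deq (conv delta0 mu) mu.
Proof.
move=> E mE; rewrite convE// integral_dirac//; last exact: measurable_shift_prob.
rewrite diracT mul1e; congr (mu _).
by apply/seteqP; split => x; rewrite /shift /= v0add.
Qed.

Lemma conv_delta0r mu : deq (conv mu delta0) mu.
Proof. by move=> E mE; rewrite convC// conv_delta0l. Qed.

Lemma convA mu nu rho : deq (conv mu (conv nu rho)) (conv (conv mu nu) rho).
Proof.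
move=> E mE; rewrite convE// [RHS]convE//.
rewrite /conv /law ge0_integral_distribution//; last exact: measurable_shift_prob.
rewrite /= fubini_tonelli1//=; last first.
  exact: (measurableT_comp (measurable_shift_prob rho mE) (@measurable_vadd R)).
apply: eq_integral => x _; rewrite [LHS]convE; last exact: measurable_shift.
apply: eq_integral => y _ /=; congr (rho _).
by apply/seteqP; split => z; rewrite /shift /= vaddA.
Qed.

Lemma dle_trans nu mu rho d e : dle mu nu d -> dle nu rho e -> dle mu rho (d + e).
Proof.
by move=> h1 h2 E mE; have := h1 _ mE; have := h2 _ mE; lra.
Qed.

Lemma deq_dle mu nu : deq mu nu -> dle mu nu 0.
Proof. by move=> h E mE; rewrite addr0 /pr h. Qed.

Lemma dle_le mu nu d e : d <= e -> dle mu nu d -> dle mu nu e.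
Proof. by move=> de h E mE; rewrite (le_trans (h _ mE))// lerD2l. Qed.

Lemma dleC mu nu e : dle mu nu e -> dle nu mu e.
Proof.
move=> h E mE; have := h _ (measurableC mE); rewrite !pr_setC// => {}h.
lra.
Qed.

Lemma dle_convr mu nu nu' e : 0 <= e -> dle nu nu' e ->
  dle (conv mu nu) (conv mu nu') e.
Proof.
move=> e0 h E mE; rewrite -lee_fin EFinD -!prE// !convE//.
rewrite -[e%:E]mule1 -(probability_setT mu) -integral_cst// -ge0_integralD//; last exact: measurable_shift_prob.
apply: ge0_le_integral => //.
- exact: measurable_shift_prob.
- by apply: emeasurable_funD; [exact: measurable_shift_prob|exact: measurable_cst].
- move=> x _; have mS := measurable_shift x mE.
  by rewrite (prE nu mS) (prE nu' mS) -EFinD lee_fin h.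
Qed.

Lemma dle_conv mu nu mu' nu' d e : 0 <= d -> 0 <= e -> dle mu mu' d -> dle nu nu' e ->
  dle (conv mu nu) (conv mu' nu') (d + e).
Proof.
move=> d0 e0 h1 h2; rewrite addrC; apply: dle_trans (dle_convr mu e0 h2) _.
move=> E mE; rewrite /pr !(convC _ nu')//; exact: dle_convr.
Qed.

Definition convs (s : seq (probability V R)) : probability V R :=
  foldr (@conv R) delta0 s.
Definition convn mu n := convs (nseq n mu).

Lemma convs_cat s1 s2 : deq (convs (s1 ++ s2)) (conv (convs s1) (convs s2)).
Proof.
elim: s1 => [|m s ih] /=; first exact/deqC/conv_delta0l.
by apply: (deq_trans (conv_deq _ ih)); [|exact: convA].
Qed.

Lemma convs_perm (I : eqType) (f : I -> probability V R) s1 s2 : perm_eq s1 s2 ->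
  deq (convs (map f s1)) (convs (map f s2)).
Proof.
move=> p12; pose Q s := deq (convs (map f s1)) (convs (map f s)).
apply: (@catCA_perm_ind _ Q _ s1 s2 p12) => //; rewrite {}/Q.
move=> t1 t2 t3; rewrite !map_cat !catA => h; apply: (deq_trans h).
apply: deq_trans (convs_cat _ _) _; apply: deq_trans (deqC (convs_cat _ _)).
apply: conv_deq => //; apply: deq_trans (convs_cat _ _) _.
by apply: deq_trans (deqC (convs_cat _ _)) => E mE; exact: convC.
Qed.

Lemma convs_deq (I : eqType) (f g : I -> probability V R) s :
  (forall i, i \in s -> deq (f i) (g i)) -> deq (convs (map f s)) (convs (map g s)).
Proof.
elim: s => [//|i s ih] h /=; apply: conv_deq; first by apply: h; rewrite mem_head.
by apply: ih => j js; apply: h; rewrite inE js orbT.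
Qed.

Lemma convs_dle (I : eqType) (f g : I -> probability V R) s e : 0 <= e ->
  (forall i, i \in s -> dle (f i) (g i) e) ->
  dle (convs (map f s)) (convs (map g s)) ((size s)%:R * e).
Proof.
move=> e0; elim: s => [|i s ih] h /=; first by rewrite mul0r; exact: deq_dle.
rewrite -natr1 mulrDl mul1r addrC; apply: dle_conv => //.
- by rewrite mulr_ge0.
- by apply: h; rewrite mem_head.
- by apply: ih => j js; apply: h; rewrite inE js orbT.
Qed.

Lemma conv4 (a b c d : probability V R) : deq (conv (conv a b) (conv c d)) (conv (conv a c) (conv b d)).
Proof.
apply: deq_trans (deqC (convA _ _ _)) _; apply: deq_trans _ (convA _ _ _).
apply: conv_deq => //; apply: deq_trans (convA _ _ _) _.
apply: deq_trans _ (deqC (convA _ _ _)); apply: conv_deq => //.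
by move=> E mE; exact: convC.
Qed.

Lemma convs_conv (I : eqType) (f g : I -> probability V R) s :
  deq (convs (map (fun i => conv (f i) (g i)) s)) (conv (convs (map f s)) (convs (map g s))).
Proof.
elim: s => [|i s ih] /=; first exact/deqC/conv_delta0l.
by apply: (deq_trans (conv_deq _ ih)) => //; exact: conv4.
Qed.

Lemma convn_convs (I : eqType) (f : I -> probability V R) s n :
  deq (convn (convs (map f s)) n) (convs (map (fun i => convn (f i) n) s)).
Proof.
rewrite /convn; elim: n => [|n ih] /=.
  elim: s => [//|i s ihs] /=; apply: deq_trans _ (conv_deq _ ihs); last by [].
  exact/deqC/conv_delta0l.
apply: deq_trans (conv_deq _ ih) _; first by [].
exact/deqC/convs_conv.
Qed.

Lemma convn_deq mu nu n : deq mu nu -> deq (convn mu n) (convn nu n).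
Proof. by move=> h; rewrite /convn; elim: n => [//|n ih] /=; exact: conv_deq. Qed.

Lemma convn_dle mu nu n e : 0 <= e -> dle mu nu e ->
  dle (convn mu n) (convn nu n) (n%:R * e).
Proof.
move=> e0 h; rewrite /convn; elim: n => [|n ih] /=; first by rewrite mul0r; exact: deq_dle.
by rewrite -natr1 mulrDl mul1r addrC; apply: dle_conv => //; rewrite mulr_ge0.
Qed.

(* Boxes are preserved by translations, so closeness on boxes, unlike weak
   convergence, passes directly through convolutions. *)
Definition box (s : seq (nat * R)) : set V := [set x | forall p, p \in s -> x p.1 <= p.2].
Definition box_up (d : R) (s : seq (nat * R)) := [seq (p.1, p.2 + d) | p <- s].

Lemma box_cyl s : box s = cyl [seq (p.1, `]-oo, p.2]%classic) | p <- s].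
Proof.
apply/seteqP; split => x /= h p.
  by move=> /mapP[q qs ->] /=; rewrite in_itv/= h.
move=> ps; have /(_ (map_f _ ps)) /= := h (p.1, `]-oo, p.2]%classic).
by rewrite in_itv.
Qed.

Lemma measurable_box s : measurable (box s).
Proof.
by rewrite box_cyl; apply: measurable_cyl => p /mapP[q qs ->]; exact: measurable_itv.
Qed.

Lemma shift_box x s : shift x (box s) = box [seq (p.1, p.2 - x p.1) | p <- s].
Proof.
apply/seteqP; split => y /= h p.
  by move=> /mapP[q /h + ->] /=; rewrite /vadd lerBrDl.
by move=> ps; rewrite /vadd -lerBrDl; exact: (h (p.1, p.2 - x p.1) (map_f _ ps)).
Qed.

(** A one-sided Lévy-type closeness: [d] bounds a displacement of the coordinates, [e] the
    probability of an exceptional event. *)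
Definition ble mu nu (d e : R) := forall s, pr mu (box s) <= pr nu (box (box_up d s)) + e.

Lemma box_upD d e s : box_up d (box_up e s) = box_up (e + d) s.
Proof. by rewrite /box_up -map_comp; apply: eq_map => p /=; rewrite addrA. Qed.

Lemma box_up0 s : box_up 0 s = s.
Proof. by rewrite /box_up -[RHS]map_id; apply: eq_map => -[p q] /=; rewrite addr0. Qed.

Lemma ble_trans nu mu rho d e d' e' : ble mu nu d e -> ble nu rho d' e' ->
  ble mu rho (d + d') (e + e').
Proof.
move=> h1 h2 s; apply: (le_trans (h1 s)); have := h2 (box_up d s).
rewrite box_upD; lra.
Qed.

Lemma dle_ble mu nu e : dle mu nu e -> ble mu nu 0 e.
Proof. by move=> h s; rewrite box_up0; apply: h; exact: measurable_box. Qed.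

Lemma ble_convr mu nu nu' d e : 0 <= e -> ble nu nu' d e ->
  ble (conv mu nu) (conv mu nu') d e.
Proof.
move=> e0 h s; have mE := measurable_box s; have mE' := measurable_box (box_up d s).
rewrite -lee_fin EFinD -!prE// !convE//.
rewrite -[e%:E]mule1 -(probability_setT mu) -integral_cst// -ge0_integralD//; last exact: measurable_shift_prob.
apply: ge0_le_integral => //.
- exact: measurable_shift_prob.
- by apply: emeasurable_funD; [exact: measurable_shift_prob|exact: measurable_cst].
- move=> x _; have mS := measurable_shift x mE; have mS' := measurable_shift x mE'.
  rewrite (prE nu mS) (prE nu' mS') -EFinD lee_fin !shift_box.
  rewrite (le_trans (h _))// lerD2r /pr (_ : box_up _ _ = [seq (p.1, p.2 - x p.1) | p <- box_up d s])//.
  by rewrite /box_up -!map_comp; apply: eq_map => p /=; rewrite addrAC.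
Qed.

Lemma ble_conv mu nu mu' nu' d e d' e' : 0 <= e -> 0 <= e' ->
  ble mu mu' d e -> ble nu nu' d' e' -> ble (conv mu nu) (conv mu' nu') (d' + d) (e' + e).
Proof.
move=> e0 e0' h1 h2; apply: ble_trans (ble_convr mu e0' h2) _.
move=> s; rewrite /pr !(convC _ nu')//; [|exact: measurable_box..].
exact: ble_convr.
Qed.

Lemma ble_convn mu nu d e n : 0 <= e -> ble mu nu d e ->
  ble (convn mu n) (convn nu n) (n%:R * d) (n%:R * e).
Proof.
move=> e0 h; rewrite /convn; elim: n => [|n ih] /=.
  by rewrite !mul0r; apply: dle_ble; exact: deq_dle.
by rewrite -!natr1 !mulrDl !mul1r; apply: ble_conv => //; rewrite mulr_ge0.
Qed.

(** Boxes are closed, so the enlarged boxes decrease to the box itself and continuity from above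
    removes the slack. *)
Lemma ble_lim mu nu : (forall e, 0 < e -> ble mu nu e e) -> forall s,
  pr mu (box s) <= pr nu (box s).
Proof.
move=> h s; pose F n := box (box_up n.+1%:R^-1 s).
have bF : \bigcap_n F n = box s.
  apply/seteqP; split => x /= hx.
    move=> p ps; apply/ler_addgt0Pr => e e0.
    have [n /ltW hn] : exists n, n.+1%:R^-1 < e.
      by exists (Num.truncn e^-1); rewrite invf_plt ?posrE// truncnS_gt.
    have /= := hx n I (p.1, p.2 + n.+1%:R^-1) (map_f _ ps).
    by move=> /le_trans; apply; rewrite lerD2l.
  move=> n _ p /mapP[q qs ->] /=; rewrite (le_trans (hx _ qs))// lerDl invr_ge0//.
have c1 : (nu \o F) n @[n --> \oo] --> nu (\bigcap_n F n).
  apply: nonincreasing_cvg_mu => //.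
  - by rewrite (le_lt_trans (probability_le1 nu _)) ?ltry//; exact: measurable_box.
  - by move=> n; exact: measurable_box.
  - by rewrite bF; exact: measurable_box.
  - move=> m n mn; rewrite subsetEset => x hx p /mapP[q qs ->] /=.
    have := hx (q.1, q.2 + n.+1%:R^-1) (map_f _ qs) => /= /le_trans; apply.
    by rewrite lerD2l lef_pV2 ?posrE// ler_nat.
have c2 : pr nu (F n) + n.+1%:R^-1 @[n --> \oo] --> pr nu (box s) + 0.
  apply: cvgD; last exact: cvg_harmonic.
  by rewrite -bF; apply: fine_cvg; rewrite fineK ?fin_num_measure// bF; exact: measurable_box.
rewrite addr0 in c2.
rewrite -(cvg_lim _ c2)//; apply: limr_ge; first exact: cvgP c2.
by near=> n; apply: h; rewrite invr_gt0.
Unshelve. all: by end_near. Qed.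

Lemma RGenInftyC_measurableE :
  @measurable _ R = <<s [set A : set R | exists x, A = `]-oo, x]%classic] >>.
Proof.
rewrite eqEsubset; split; last first.
  apply: smallest_sub; first exact: sigma_algebra_measurable.
  by move=> _ [x ->]; exact: measurable_itv.
have -> : @measurable _ R = <<s RGenOInfty.G (R := R) >> by exact: RGenOInfty.measurableE.
apply: smallest_sub; first exact: smallest_sigma_algebra.
move=> _ [x ->]; rewrite -setCitvl; apply: sigma_algebraC.
by apply: sub_sigma_algebra; exists x.
Qed.

Lemma box_deq mu nu : (forall s, pr mu (box s) = pr nu (box s)) -> deq mu nu.
Proof.
move=> h E mE; apply: (iseq_measure_unique RGenInftyC_measurableE) => // s hs.
suff [t ->] : exists t, cyl s = box t.
  by rewrite (prE mu (measurable_box t)) (prE nu (measurable_box t)) h.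
elim: s hs => [|p s ih] hs.
  by exists [::]; rewrite cyl_nil; apply/seteqP; split.
have [t tE] : exists t, cyl s = box t by apply: ih => q qs; apply: hs; rewrite inE qs orbT.
have [x xE] := hs p (mem_head _ _); exists ((p.1, x) :: t).
rewrite cyl_cons tE xE; apply/seteqP; split => y /=.
  by rewrite in_itv/= => -[yx yt] q; rewrite inE => /orP[/eqP ->|/yt].
by move=> hy; split; [rewrite in_itv/= (hy (p.1, x)) ?mem_head|
  move=> q qt; apply: hy; rewrite inE qt orbT].
Qed.

Lemma ble_deq mu nu : (forall e, 0 < e -> ble mu nu e e) ->
  (forall e, 0 < e -> ble nu mu e e) -> deq mu nu.
Proof. by move=> h1 h2; apply: box_deq => s; apply/eqP; rewrite eq_le !ble_lim. Qed.

End conv_theory.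

(** * First-order expansion of convolutions on sets avoiding 0 *)

Section first_order.
Variable R : realType.
Notation V := (iseq R).
Implicit Types (mu nu rho : probability V R) (d e p q h : R).

Definition nz : set V := ~` [set @v0 R].

Lemma measurable_nz : measurable nz.
Proof.
apply: measurableC.
rewrite (_ : [set _] = \bigcap_k [set x : V | x k = 0]).
  apply: bigcapT_measurable => k; rewrite -[X in measurable X]setTI.
  by apply: (measurable_coord k measurableT [set 0 : R]); exact: measurable_set1.
apply/seteqP; split => x /=; first by move=> -> k _.
by move=> h; apply/funext => k; exact: h.
Qed.

(** A set containing 0 is replaced by its complement. This is what makes the expansions below
    usable: they hold only on sets avoiding 0, where the dominant mass at 0 does not count. *)
Lemma dle_avoid0 mu nu e :
  (forall E, measurable E -> ~ E (@v0 R) -> `|pr mu E - pr nu E| <= e) -> dle mu nu e.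
Proof.
move=> h E mE; have [E0|E0] := pselect (E (@v0 R)); last first.
  by have := h E mE E0; rewrite ler_norml => /andP[_]; lra.
have := h _ (measurableC mE) (fun n => n E0); rewrite !pr_setC// ler_norml => /andP[+ _].
lra.
Qed.

Lemma prod_rect mu nu A B : measurable A -> measurable B ->
  ((mu \x nu)%E : probability (V * V)%type R) (A `*` B) = (mu A * nu B)%E.
Proof. exact: product_measure1E. Qed.

Let half1 (E : set V) := [set p : V * V | E p.1].
Let half2 (E : set V) := [set p : V * V | E p.2].

Let pr_half1 mu nu E : measurable E -> pr (mu \x nu)%E (half1 E) = pr mu E.
Proof.
move=> mE; rewrite /pr (_ : half1 E = E `*` setT).
  by rewrite prod_rect// (@probability_setT _ _ _ nu) mule1.
by apply/seteqP; split => -[x y] //= [].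
Qed.

Let pr_half2 mu nu E : measurable E -> pr (mu \x nu)%E (half2 E) = pr nu E.
Proof.
move=> mE; rewrite /pr (_ : half2 E = setT `*` E).
  by rewrite prod_rect// (@probability_setT _ _ _ mu) mul1e.
by apply/seteqP; split => -[x y] //= [].
Qed.

Let measurable_half1 E : measurable E -> measurable (half1 E).
Proof. by move=> mE; rewrite -[X in measurable X]setTI; apply: measurable_fst. Qed.

Let measurable_half2 E : measurable E -> measurable (half2 E).
Proof. by move=> mE; rewrite -[X in measurable X]setTI; apply: measurable_snd. Qed.

Let measurable_sumset E : measurable E -> measurable [set p : V * V | E (vadd p.1 p.2)].
Proof. by move=> mE; rewrite -[X in measurable X]setTI; apply: measurable_vadd. Qed.

Lemma pr_conv_nz mu nu : pr (conv mu nu) nz <= pr mu nz + pr nu nz.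
Proof.
have mn := measurable_nz.
rewrite -(pr_half1 mu nu mn) -(pr_half2 mu nu mn).
apply: le_trans (prU_le _ _ _); [|exact: measurable_half1|exact: measurable_half2].
have -> : pr (conv mu nu) nz = pr (mu \x nu)%E [set p | nz (vadd p.1 p.2)] by [].
apply: le_pr; first exact: measurable_sumset.
  by apply: measurableU; [exact: measurable_half1|exact: measurable_half2].
move=> [x y] /= xy; have [x0|x0] := pselect (x = @v0 R); last by left.
by right => y0; apply: xy; have {}y0 : y = v0 R := y0; rewrite /= x0 y0 vadd0.
Qed.

(** Unless both summands are non-zero, which has probability [pr mu nz * pr nu nz], one of them is 0
    and the sum lies in [E] exactly when the other one does. On the exceptional event the two terms
    may both be counted, whence the factor 2. *)
Lemma conv_first_order mu nu E : measurable E -> ~ E (@v0 R) ->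
  `|pr (conv mu nu) E - (pr mu E + pr nu E)| <= 2 * (pr mu nz * pr nu nz).
Proof.
move=> mE E0; set P := (mu \x nu)%E; have mn := measurable_nz.
have m1 := measurable_half1 mE; have m2 := measurable_half2 mE.
pose D := nz `*` nz; have mD : measurable D by exact: measurableX.
have PD : pr P D = pr mu nz * pr nu nz.
  by rewrite /pr /P prod_rect// fineM// fin_num_measure.
have mA := measurable_sumset mE; set A := [set p : V * V | _] in mA.
have convA : pr (conv mu nu) E = pr P A by [].
rewrite convA -(pr_half1 mu nu mE) -(pr_half2 mu nu mE) -PD -/P.
have nzP x : ~ nz x -> x = @v0 R by move=> /contrapT.
have ub : pr P A <= pr P (half1 E) + pr P (half2 E) + pr P D.
  apply: (@le_trans _ _ (pr P (half1 E `|` half2 E) + pr P D)); last first.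
    by rewrite lerD2r; exact: prU_le.
  apply: le_trans (prU_le _ (measurableU _ _ m1 m2) mD).
  apply: le_pr => //; first by do ?apply: measurableU.
  move=> [x y] /= xyE; have [Dxy|Dxy] := pselect (D (x, y)); [by right|left].
  have [nx|/nzP nx] := pselect (nz x); last by right; rewrite /= /A /= nx v0add in xyE *.
  have [ny|/nzP ny] := pselect (nz y); first by exfalso; apply: Dxy.
  by left; rewrite /= /A /= ny vadd0 in xyE *.
have lb : pr P (half1 E) + pr P (half2 E) <= pr P A + 2 * pr P D.
  rewrite (pr_split P m1 mD) (pr_split P m2 mD).
  have h1 : pr P (half1 E `&` D) <= pr P D by apply: le_pr => //; exact: measurableI.
  have h2 : pr P (half2 E `&` D) <= pr P D by apply: le_pr => //; exact: measurableI.
  have mDc := measurableC mD.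
  have : pr P (half1 E `&` ~` D) + pr P (half2 E `&` ~` D) <= pr P A.
    rewrite -prU; [|exact: measurableI|exact: measurableI|]; last first.
      apply/seteqP; split => -[x y] //= [[Ex nD] [Ey _]]; apply: nD; split => /= h.
        by apply: E0; rewrite -h.
      by apply: E0; rewrite -h.
    apply: le_pr => //; first by apply: measurableU; exact: measurableI.
    move=> [x y] /= [[Ex nD]|[Ey nD]]; rewrite /A /=.
      have nx : nz x by move=> h; apply: E0; rewrite -h.
      have -> : y = @v0 R by apply: nzP => ny; apply: nD.
      by rewrite vadd0.
    have ny : nz y by move=> h; apply: E0; rewrite -h.
    have -> : x = @v0 R by apply: nzP => nx; apply: nD.
    by rewrite v0add.
  move: h1 h2.
  move: (pr P (half1 E `&` D)) (pr P (half2 E `&` D)) (pr P (half1 E `&` ~` D)).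
  move: (pr P (half2 E `&` ~` D)) (pr P A) (pr P D).
  by clear=> a1 a2 a3 a4 a5 a6 *; lra.
have D0 := pr_ge0 P D; move: D0 ub lb.
move: (pr P A) (pr P D) (pr P (half1 E)) (pr P (half2 E)).
by clear=> a1 a2 a3 a4 *; rewrite ler_norml; apply/andP; split; lra.
Qed.

Lemma delta0E E : delta0 R E = (\1_E (@v0 R))%:E.
Proof. by []. Qed.

Lemma pr_delta0 E : ~ E (@v0 R) -> pr (delta0 R) E = 0.
Proof. by move=> E0; rewrite /pr delta0E indicE memNset. Qed.

Lemma pr_convs_nz (I : eqType) (f : I -> probability V R) s p :
  (forall i, i \in s -> pr (f i) nz <= p) -> pr (convs (map f s)) nz <= (size s)%:R * p.
Proof.
elim: s => [|i s ih] h; first by rewrite mul0r pr_delta0//; apply.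
apply: (le_trans (pr_conv_nz _ _)); rewrite /= -natr1 mulrDl mul1r addrC; apply: lerD.
  by apply: ih => j js; apply: h; rewrite inE js orbT.
by apply: h; rewrite mem_head.
Qed.

(** The square is the right shape for the induction: the step from n to n + 1 costs 2 p (n p), and
    (n p)^2 + 2 p (n p) stays below ((n + 1) p)^2. *)
Lemma convs_first_order (I : eqType) (f : I -> probability V R) s p E :
  0 <= p -> (forall i, i \in s -> pr (f i) nz <= p) -> measurable E -> ~ E (@v0 R) ->
  `|pr (convs (map f s)) E - \sum_(i <- s) pr (f i) E| <= ((size s)%:R * p) ^+ 2.
Proof.
move=> p0 + mE E0; elim: s => [|i s ih] h.
  by rewrite big_nil pr_delta0// subr0 normr0 sqr_ge0.
rewrite big_cons; have hs : forall j, j \in s -> pr (f j) nz <= p.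
  by move=> j js; apply: h; rewrite inE js orbT.
have := conv_first_order (f i) (convs (map f s)) mE E0.
have hi : pr (f i) nz <= p by apply: h; rewrite mem_head.
have hn := pr_convs_nz hs; have := ih hs.
set n := size s in hn *; rewrite [size _]/= -/n -natr1 => h1 h2.
have hm : pr (f i) nz * pr (convs (map f s)) nz <= p * (n%:R * p).
  by apply: ler_pM => //; exact: pr_ge0.
have n0 : (0 : R) <= n%:R by [].
move: h1 h2; rewrite [map _ (_ :: _)]/= [convs (_ :: _)]/= !ler_norml => /andP[a b] /andP[c d].
have pn : 0 <= p * (n%:R * p) by rewrite !mulr_ge0.
have pp : 0 <= p * p by rewrite mulr_ge0.
set X := (X in X ^+ 2); have XE : X ^+ 2 = (n%:R * p) ^+ 2 + 2 * (p * (n%:R * p)) + p * p.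
  by rewrite /X; ring.
by apply/andP; split; lra.
Qed.

Lemma convn_first_order mu n E : measurable E -> ~ E (@v0 R) ->
  `|pr (convn mu n) E - n%:R * pr mu E| <= (n%:R * pr mu nz) ^+ 2.
Proof.
move=> mE E0; have := @convs_first_order _ (fun _ : unit => mu) (nseq n tt) (pr mu nz) E
  (pr_ge0 _ _) (fun _ _ => lexx _) mE E0.
rewrite map_nseq size_nseq.
by rewrite big_const_seq count_predT size_nseq iter_addr_0 -(mulr_natl (pr mu E)).
Qed.

End first_order.

(** * Mixtures with the unit mass at 0 *)

Section mixture.
Variable R : realType.
Notation V := (iseq R).
Variables (q : R) (q01 : 0 <= q <= 1) (nu : probability V R).

Let q0 : 0 <= q. Proof. by case/andP : q01. Qed.
Let q1 : 0 <= 1 - q. Proof. by case/andP : q01; rewrite subr_ge0. Qed.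

Definition mix : set V -> \bar R :=
  measure_add (mscale (NngNum q1) (delta0 R)) (mscale (NngNum q0) nu).

HB.instance Definition _ := Measure.on mix.

Let mix_setT : mix setT = 1%E.
Proof.
transitivity ((1 - q)%:E * delta0 R setT + q%:E * nu setT)%E; first exact: measure_addE.
by rewrite !probability_setT !mule1 -EFinD subrK.
Qed.

HB.instance Definition _ := Measure_isProbability.Build _ _ _ mix mix_setT.
End mixture.

Section mixture_theory.
Variable R : realType.
Notation V := (iseq R).
Implicit Types (mu nu rho : probability V R) (d e p q h : R).

Lemma mixE q (q01 : 0 <= q <= 1) nu E :
  (mix q01 nu : probability V R) E = ((1 - q)%:E * delta0 R E + q%:E * nu E)%E.
Proof. exact: measure_addE. Qed.

Lemma pr_mix q (q01 : 0 <= q <= 1) nu E : measurable E ->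
  pr (mix q01 nu) E = (1 - q) * pr (delta0 R) E + q * pr nu E.
Proof.
move=> mE; have f1 : delta0 R E \is a fin_num by exact: fin_num_measure.
have f2 : nu E \is a fin_num by exact: fin_num_measure.
by rewrite /pr mixE fineD ?fineM ?fin_numM.
Qed.

Lemma poisson_mixP h : 0 <= h -> 0 <= 1 - expR (- h) <= 1.
Proof.
move=> h0; rewrite subr_ge0 lerBlDr lerDl expR_ge0 andbT.
by rewrite -[leRHS]expR0 ler_expR oppr_le0.
Qed.

(** Law contributed by a cell of length [h]: it is hit by a Poisson point with probability 1 -
    exp(-h), and then carries one mark of law [nu]. The type of [h] supplies the bounds on the
    weight. *)
Definition pmix (h : {nonneg R}) (nu : probability V R) : probability V R :=
  mix (@poisson_mixP h%:num ltac:(by [])) nu.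

Lemma pr_pmix (h : {nonneg R}) nu E : measurable E -> ~ E (@v0 R) ->
  pr (pmix h nu) E = (1 - expR (- h%:num)) * pr nu E.
Proof. by move=> mE E0; rewrite pr_mix// pr_delta0// mulr0 add0r. Qed.

Lemma one_sub_expN h : 0 <= h -> h - h ^+ 2 <= 1 - expR (- h) <= h.
Proof.
move=> h0; have h1 := expR_ge1Dx (- h).
have h2 := expR_ge1Dx h; have e0 := expR_gt0 (- h).
apply/andP; split; last by lra.
have : expR (- h) * (1 + h) <= 1.
  by rewrite -[leRHS](expR0) -(addNr h) expRD ler_pM2l.
move=> h3; have : expR (- h) <= 1 - h + h ^+ 2.
  rewrite -(@ler_pM2r _ (1 + h)) ?(le_trans h3)//; last by lra.
  have : 0 <= h ^+ 3 by rewrite exprn_ge0.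
  have -> : (1 - h + h ^+ 2) * (1 + h) = 1 + h ^+ 3 by ring.
  lra.
lra.
Qed.

(** Both sides have first-order term [h' * nu E]. One [h'^2] is the error of the n-fold convolution,
    the other bounds the difference between n (1 - exp(-h)) and 1 - exp(-h'). *)
Lemma convn_pmix (h h' : {nonneg R}) nu n : h'%:num = n%:R * h%:num ->
  dle (convn (pmix h nu) n) (pmix h' nu) (2 * h'%:num ^+ 2).
Proof.
move=> hE; apply: dle_avoid0 => E mE E0.
have := convn_first_order (pmix h nu) n mE E0.
rewrite !pr_pmix//; [|exact: measurable_nz|by apply].
have h0 : 0 <= h%:num by []. have h0' : 0 <= h'%:num by []. move: (h0) (h0').
have := one_sub_expN h0; have := one_sub_expN h0'.
move: h0 h0' => _ _.
set a := 1 - expR _; set a' := 1 - expR _; rewrite hE; set x := h%:num.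
have v0 := pr_ge0 nu E; have v1 := pr_le1 nu mE.
have w0 := pr_ge0 nu (@nz R); have w1 := pr_le1 nu (@measurable_nz R).
move=> /andP[a1 a2] /andP[b1 b2] x0 x0' c.
have n0 : (0 : R) <= n%:R by [].
have aa0 : 0 <= a' by rewrite /a' subr_ge0 -[leRHS]expR0 ler_expR oppr_le0.
have k1 : (n%:R * (a' * pr nu (@nz R))) ^+ 2 <= (n%:R * x) ^+ 2.
  rewrite ler_sqr ?nnegrE ?mulr_ge0//; apply: ler_wpM2l => //.
  by rewrite -[leRHS]mulr1; apply: ler_pM.
have k2 : n%:R * x ^+ 2 <= (n%:R * x) ^+ 2.
  rewrite exprMn; apply: ler_wpM2r; first exact: sqr_ge0.
  by rewrite -natrX ler_nat; case: (n) => // m; rewrite -mulnn leq_pmulr.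
have k3 : `|n%:R * a' - a| <= (n%:R * x) ^+ 2.
  have : n%:R * (x - x ^+ 2) <= n%:R * a' by apply: ler_wpM2l.
  have : n%:R * a' <= n%:R * x by apply: ler_wpM2l.
  by rewrite mulrBr => u1 u2; rewrite ler_norml; apply/andP; split; lra.
have k4 : `|n%:R * (a' * pr nu E) - a * pr nu E| <= (n%:R * x) ^+ 2.
  rewrite mulrA -mulrBl normrM (ger0_norm v0).
  by rewrite -[leRHS]mulr1; apply: ler_pM.
move: c k4; rewrite !ler_norml => /andP[c1 c2] /andP[d1 d2].
by apply/andP; split; lra.
Qed.

Definition compound (h : {nonneg R}) (nu : nat -> probability V R) N :=
  convs (map (fun c => pmix h (nu c)) (iota 0 N)).

End mixture_theory.

(** * Laws of sums of independent vectors *)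

Section indep_sum.
Context d (T : measurableType d) (R : realType) (P : probability T R).
Notation V := (iseq R).

(** The event [A] is carried along so that the result can be iterated, and so that later the
    positions of the Poisson points can be fixed while the marks remain random. *)
Lemma indep_sum2 (mu nu : probability V R) (X Y : T -> V) (A : set T) :
  measurable_fun setT X -> measurable_fun setT Y -> measurable A ->
  (forall B C, measurable B -> measurable C ->
    P (A `&` (X @^-1` B `&` Y @^-1` C)) = (P A * (mu B * nu C))%E) ->
  forall E, measurable E ->
    P (A `&` [set w | E (vadd (X w) (Y w))]) = (P A * conv mu nu E)%E.
Proof.
move=> mX mY mA h E mE.
have mXY : measurable_fun setT (fun w => (X w, Y w)) by exact: measurable_fun_pair.
have mS : measurable [set p : V * V | E (vadd p.1 p.2)].
  by rewrite -[X in measurable X]setTI; apply: measurable_vadd.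
have mSw : measurable [set w | E (vadd (X w) (Y w))].
  rewrite -[X in measurable X]setTI.
  exact: (measurable_vadd_fun mX mY).
(* The proof uses the joint law conditioned on [A], so a null [A] is treated apart. *)
have [A0|A0] := eqVneq (P A) 0%E.
  rewrite A0 mul0e; apply/eqP; rewrite eq_le measure_ge0 andbT -A0.
  apply: le_measure; rewrite ?inE//; exact: measurableI.
have Afin : P A \is a fin_num by exact: fin_num_measure.
have pA0 : 0 < pr P A by rewrite fine_gt0// lt0e A0 measure_ge0/= ltey_eq Afin.
have iA0 : 0 <= (pr P A)^-1 by rewrite invr_ge0 ltW.
pose m' : {measure set (V * V) -> \bar R} :=
  mscale (NngNum iA0) (pushforward (mrestr P mA) (fun w => (X w, Y w))).
pose m := m' mXY.
have m_E D : m D = ((pr P A)^-1%:E * P ((fun w => (X w, Y w)) @^-1` D `&` A))%E by [].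
rewrite (@conv_rect R mu nu m E mE); last first.
  move=> B C mB mC; rewrite m_E setIC (_ : _ @^-1` _ = X @^-1` B `&` Y @^-1` C)// h//.
  by rewrite (prE P mA) muleA -EFinM mulVf ?gt_eqF// mul1e.
rewrite m_E muleA {1}(prE P mA) -EFinM divff ?gt_eqF// mul1e setIC.
by [].
Qed.

Definition vsum (I : Type) (X : I -> T -> V) (s : seq I) (w : T) : V :=
  fun k => \sum_(i <- s) X i w k.

Lemma vsum_cons I (X : I -> T -> V) i s w : vsum X (i :: s) w = vadd (X i w) (vsum X s w).
Proof. by apply/funext => k; rewrite /vsum big_cons. Qed.

Lemma vsum_nil I (X : I -> T -> V) w : vsum X [::] w = v0 R.
Proof. by apply/funext => k; rewrite /vsum big_nil. Qed.

Lemma measurable_vsum I (X : I -> T -> V) s : (forall i, measurable_fun setT (X i)) ->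
  measurable_fun setT (vsum X s).
Proof.
move=> mX; apply: measurable_to_iseq => k; apply: measurable_sum => i.
exact: (measurableT_comp (measurable_coord k) (mX i)).
Qed.

Lemma indep_vsum (I : eqType) (F : I -> set (set T)) (X : I -> T -> V)
    (mX : forall i, measurable_fun setT (X i)) (s J : seq I) (A : I -> set T) :
  mutually_independent P F ->
  (forall i B, i \in s -> measurable B -> F i (X i @^-1` B)) ->
  (forall j, j \in J -> F j (A j)) ->
  (forall j, j \in J -> measurable (A j)) ->
  uniq (s ++ J) ->
  forall E, measurable E ->
    P ((\big[setI/setT]_(j <- J) A j) `&` (vsum X s) @^-1` E) =
    (P (\big[setI/setT]_(j <- J) A j) * convs (map (fun i => law P (mX i)) s) E)%E.
Proof.
move=> ind; elim: s J A => [|i s ih] J A FX FA mA /= uJ E mE.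
  rewrite /convs /= delta0E; have [E0|E0] := pselect (E (v0 R)).
    rewrite indicE mem_set// mule1; congr (P _); rewrite -[RHS]setIT; congr (_ `&` _).
    by apply/seteqP; split => w //= _; rewrite vsum_nil.
  rewrite indicE memNset// mule0 (_ : _ @^-1` E = set0) ?setI0 ?measure0//.
  by apply/seteqP; split => w //=; rewrite vsum_nil.
have mBJ : measurable (\big[setI/setT]_(j <- J) A j).
  elim: (J) mA => [|j J' ihJ] mA'; first by rewrite big_nil.
  rewrite big_cons; apply: measurableI; first by apply: mA'; rewrite mem_head.
  by apply: ihJ => k kJ; apply: mA'; rewrite inE kJ orbT.
have -> : vsum X (i :: s) @^-1` E = [set w | E (vadd (X i w) (vsum X s w))].
  by apply/seteqP; split => w /=; rewrite vsum_cons.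
apply: indep_sum2 => //; first exact: measurable_vsum.
move: uJ => /andP[]; rewrite mem_cat negb_or => /andP[is_ iJ] uJ B C mB mC.
(* The event on the first summand joins the carried events, and the induction hypothesis is applied
   to [i :: J]. *)
pose A' j := if j == i then X i @^-1` B else A j.
have A'J : \big[setI/setT]_(j <- J) A' j = \big[setI/setT]_(j <- J) A j.
  apply: eq_big_seq => j jJ; rewrite /A'; case: eqP => // ji.
  by move: iJ; rewrite -ji jJ.
have mpre (j : I) D : measurable D -> measurable (X j @^-1` D).
  by move=> mD; have := mX j measurableT D mD; rewrite setTI.
have FA' j : j \in i :: J -> F j (A' j).
  rewrite inE /A'; case: eqP => [->|_] /=; last exact: FA.
  by move=> _; apply: FX; rewrite ?mem_head.
have mA' j : j \in i :: J -> measurable (A' j).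
  rewrite inE /A'; case: eqP => [_|_] /=; last exact: mA.
  by move=> _; exact: mpre.
have uiJ : uniq (s ++ i :: J).
  by rewrite -cat1s uniq_catCA /= mem_cat negb_or is_ iJ uJ.
have FX' k D : k \in s -> measurable D -> F k (X k @^-1` D).
  by move=> ks; apply: FX; rewrite inE ks orbT.
have iJu : uniq (i :: J) by move: uiJ; rewrite cat_uniq => /and3P[].
have uJ' : uniq J by move: iJu => /= /andP[].
have FA'' j : j \in J -> F j (A' j) by move=> jJ; apply: FA'; rewrite inE jJ orbT.
have A'i : A' i = X i @^-1` B by rewrite /A' eqxx.
have := ind J A' uJ' FA''; rewrite A'J => h1.
have := ind (i :: J) A' iJu FA'; rewrite !big_cons A'J A'i -h1 => h2.
have := ih (i :: J) A' FX' FA' mA' uiJ C mC; rewrite big_cons A'J A'i h2 => h3.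
rewrite (_ : _ `&` _ = X i @^-1` B `&` \big[setI/setT]_(j <- J) A j `&` vsum X s @^-1` C).
  by rewrite h3 muleA (muleC (P (\big[setI/setT]_(j <- J) A j))).
by rewrite setIA (setIC (X i @^-1` B)).
Qed.

End indep_sum.

(** * Observations of processes *)

Section paths.
Variable R : realType.
Notation V := (iseq R).

(* A list of observation times; [None] marks a coordinate that is frozen at 0. *)
Definition times := nat -> option R.
Definition nonneg_times (tt : times) := forall k t, tt k = Some t -> 0 <= t.
Definition scale_times (a : R) (tt : times) : times := fun k => omap ( *%R a) (tt k).
Definition no_times : times := fun=> None.
Definition tuple_times n (ts : n.-tuple R) : times :=
  fun k => if (k < n)%N then Some (nth 0 ts k) else None.

Definition obs (T : Type) (X : R -> T -> R) (tt : times) (w : T) : V :=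
  fun k => if tt k is Some t then X t w else 0.

Lemma nonneg_scale a tt : 0 <= a -> nonneg_times tt -> nonneg_times (scale_times a tt).
Proof.
move=> a0 h k t; rewrite /scale_times; case E: (tt k) => [s|]//= [<-].
by rewrite mulr_ge0// (h _ _ E).
Qed.

Lemma nonneg_tuple n (ts : n.-tuple R) : all (fun s => 0 <= s) ts ->
  nonneg_times (tuple_times ts).
Proof.
move=> /allP h k t; rewrite /tuple_times; case: ltnP => // kn [<-].
by apply: h; rewrite mem_nth// size_tuple.
Qed.

Lemma scale_timesM a b tt : scale_times a (scale_times b tt) = scale_times (a * b) tt.
Proof.
by apply/funext => k; rewrite /scale_times; case: (tt k) => //= t; rewrite mulrA.
Qed.

Lemma scale_times1 tt : scale_times 1 tt = tt.
Proof.
by apply/funext => k; rewrite /scale_times; case: (tt k) => //= t; rewrite mul1r.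
Qed.

Section measurable_obs.
Context d (T : measurableType d) (X : R -> T -> R).

Lemma measurable_obs tt : is_process X -> nonneg_times tt -> measurable_fun setT (obs X tt).
Proof.
move=> mX htt; apply: measurable_to_iseq => k; rewrite /obs.
by case E: (tt k) => [t|]; [apply: mX; exact: htt E|exact: measurable_cst].
Qed.

(** The measurability of the observation is proved again with the sample space carrying only the
    sigma-algebra generated by the process. *)
Lemma sigma_proc_obs tt B : is_process X -> nonneg_times tt -> measurable B ->
  sigma_proc X (obs X tt @^-1` B).
Proof.
move=> mX htt.
pose U := g_sigma_algebraType (\bigcup_(t in [set t : R | 0 <= t])
        preimage_set_system [set: T] (X t) measurable).
have : measurable_fun [set: U] (obs X tt : U -> V).
  apply: measurable_to_iseq => k; rewrite /obs.
  case E: (tt k) => [t|]; last exact: measurable_cst.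
  move=> _ C mC; rewrite setTI; apply: sub_sigma_algebra.
  by exists t; [exact: htt E|exists C => //; rewrite setTI].
by move=> h mB; have := h measurableT B mB; rewrite setTI.
Qed.

End measurable_obs.

Lemma fdd_obs d1 d2 (T1 : measurableType d1) (T2 : measurableType d2)
  (P1 : probability T1 R) (P2 : probability T2 R) (X : R -> T1 -> R) (Y : R -> T2 -> R)
  tt (mX : measurable_fun setT (obs X tt)) (mY : measurable_fun setT (obs Y tt)) :
  fdd_eq P1 P2 X Y -> nonneg_times tt -> deq (law P1 mX) (law P2 mY).
Proof.
move=> XY htt E mE; apply: (iseq_measure_unique (G := measurable)) => //.
  by rewrite sigma_algebra_id//; exact: sigma_algebra_measurable.
move=> s hs; rewrite (lawE P1 mX) (lawE P2 mY).
pose n := size s.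
(* One tuple entry per constraint of the cylinder. A frozen coordinate gets the dummy time 0, and
   [B] tests the constant 0 in its place. *)
pose ts : n.-tuple R := map_tuple (fun p => odflt 0 (tt p.1)) (in_tuple s).
pose B : set (n.-tuple R) := \bigcap_(i in [set: 'I_n])
  [set x | let p := tnth (in_tuple s) i in p.2 (if tt p.1 is Some _ then tnth x i else 0)].
have mB : measurable B.
  apply: fin_bigcap_measurable => // i _.
  set p := tnth _ _; have ps : p \in s by exact: mem_tnth.
  rewrite /=; case tp: (tt p.1) => [t|] /=.
    by have := @measurable_tnth _ R n i measurableT _ (hs _ ps); rewrite setTI.
  by have [h|h] := pselect (p.2 0); [rewrite (_ : mkset _ = setT)|rewrite (_ : mkset _ = set0)];
    rewrite ?predeqE.
have key T (Z : R -> T -> R) : obs Z tt @^-1` cyl s =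
    [set w | B (map_tuple (fun s => Z s w) ts)].
  apply/seteqP; split => w /=.
    move=> h i _ /=; have := h _ (mem_tnth i (in_tuple s)); rewrite /obs !tnth_map.
    by case: (tt _).
  move=> h p ps; have [i /= pi] := tnthP (in_tuple s) p ps.
  have := h i I; rewrite /= /obs !tnth_map -pi.
  by case: (tt _).
rewrite !key; apply: XY => //.
apply/allP => t /mapP[p ps ->]; case E1: (tt p.1) => [u|]//=; exact: htt E1.
Qed.

Lemma obs_fdd d1 d2 (T1 : measurableType d1) (T2 : measurableType d2)
  (P1 : probability T1 R) (P2 : probability T2 R) (X : R -> T1 -> R) (Y : R -> T2 -> R)
  n (ts : n.-tuple R) (mX : measurable_fun setT (obs X (tuple_times ts)))
  (mY : measurable_fun setT (obs Y (tuple_times ts))) :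
  deq (law P1 mX) (law P2 mY) -> forall B : set (n.-tuple R), measurable B ->
    P1 [set w | B (map_tuple (fun s => X s w) ts)] =
    P2 [set w | B (map_tuple (fun s => Y s w) ts)].
Proof.
move=> h B mB; pose f (x : V) : n.-tuple R := [tuple x i | i < n].
have mf : measurable_fun setT f.
  apply/measurable_fun_tnthP => i; rewrite (_ : _ \o _ = fun x : V => x i).
    exact: measurable_coord.
  by apply/funext => x /=; rewrite tnth_mktuple.
have mfB : measurable (f @^-1` B) by rewrite -[X in measurable X]setTI; apply: mf.
have key T (Z : R -> T -> R) : [set w | B (map_tuple (fun s => Z s w) ts)] =
    obs Z (tuple_times ts) @^-1` (f @^-1` B).
  apply/seteqP; split => w /=; rewrite (_ : map_tuple _ _ = f (obs Z (tuple_times ts) w))//;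
  apply/eq_from_tnth => i; rewrite tnth_mktuple tnth_map /obs /tuple_times ltn_ord;
  by rewrite (tnth_nth 0).
by rewrite !key; exact: h.
Qed.

End paths.

(** * Expansion of a compound law over the occupied cells *)

Section compound_expansion.
Variable R : realType.
Notation V := (iseq R).
Implicit Types (mu nu : probability V R) (h p q : R).

Lemma deq_pr mu nu E : deq mu nu -> measurable E -> pr mu E = pr nu E.
Proof. by move=> h mE; rewrite /pr h. Qed.

Lemma conv_mix mu q (q01 : 0 <= q <= 1) nu E : measurable E ->
  pr (conv mu (mix q01 nu)) E = (1 - q) * pr mu E + q * pr (conv mu nu) E.
Proof.
move=> mE; have /andP[q0 q1] := q01; have q1' : 0 <= 1 - q by rewrite subr_ge0.
apply: EFin_inj; rewrite EFinD !EFinM -!prE// convE//.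
under eq_integral do rewrite mixE.
rewrite ge0_integralD//=; last 4 first.
- by move=> x _; rewrite mule_ge0.
- by apply: measurable_funeM; exact: measurable_shift_prob.
- by move=> x _; rewrite mule_ge0.
- by apply: measurable_funeM; exact: measurable_shift_prob.
rewrite !ge0_integralZl//; [|exact: measurable_shift_prob..].
rewrite -(convE mu nu mE) -(convE mu (delta0 R) mE).
by rewrite (conv_delta0r mu mE).
Qed.

(** The letters of a word tell which cells are occupied; multiplying out N mixtures gives a sum over
    such words. *)
Fixpoint sumb N (f : seq bool -> R) : R :=
  if N is N'.+1 then sumb N' (f \o cons false) + sumb N' (f \o cons true) else f [::].

Definition wt p q (b : seq bool) : R := \prod_(x <- b) (if x then q else p).

Lemma le_sumb N f g : (forall b, size b = N -> f b <= g b) -> sumb N f <= sumb N g.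
Proof.
elim: N f g => [|N ih] f g h /=; first exact: h.
by apply: lerD; apply: ih => b bN /=; apply: h; rewrite /= bN.
Qed.

Lemma eq_sumb N f g : (forall b, size b = N -> f b = g b) -> sumb N f = sumb N g.
Proof. by move=> h; apply/eqP; rewrite eq_le !le_sumb// => b /h ->. Qed.

Lemma sumbD N f g : sumb N (fun b => f b + g b) = sumb N f + sumb N g.
Proof.
elim: N f g => [//|N ih] f g /=.
by rewrite addrACA -!ih.
Qed.

Lemma sumbZ N c f : sumb N (fun b => c * f b) = c * sumb N f.
Proof. by elim: N f => [//|N ih] f /=; rewrite mulrDr -!ih. Qed.

Lemma sumb_wt N p q : sumb N (wt p q) = (p + q) ^+ N.
Proof.
elim: N => [|N ih] /=; first by rewrite /wt big_nil.
rewrite exprS mulrDl -!ih -!sumbZ; congr (_ + _);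
  by apply: eq_sumb => b _; rewrite /= /wt big_cons.
Qed.

Lemma wt_ge0 p q b : 0 <= p -> 0 <= q -> 0 <= wt p q b.
Proof. by move=> p0 q0; apply: prodr_ge0 => i _; case: ifP. Qed.

Lemma le_wt p q q' b : 0 <= p -> 0 <= q -> q <= q' -> wt p q b <= wt p q' b.
Proof.
move=> p0 q0 qq'; rewrite /wt; elim: b => [|x b ih]; first by rewrite !big_nil.
rewrite !big_cons; apply: ler_pM => //; first by case: ifP.
  exact: wt_ge0.
by case: ifP.
Qed.

(** The factor [mu] is general because it absorbs the laws of the cells already declared occupied
    during the induction. *)
Lemma conv_compound (h : {nonneg R}) (l : seq (probability V R)) mu E : measurable E ->
  pr (conv mu (convs (map (pmix h) l))) E =
  sumb (size l) (fun b => wt (expR (- h%:num)) (1 - expR (- h%:num)) b *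
                          pr (conv mu (convs (mask b l))) E).
Proof.
move=> mE; elim: l mu => [|nu l ih] mu /=; first by rewrite /wt big_nil mul1r.
transitivity (pr (conv (conv mu (convs (map (pmix h) l))) (pmix h nu)) E).
  apply: deq_pr mE.
  apply: (@deq_trans _ (conv mu (conv (convs (map (pmix h) l)) (pmix h nu)))); last exact: convA.
  by apply: conv_deq => // F mF; exact: convC.
rewrite conv_mix// opprB addrCA subrr addr0.
have -> : pr (conv (conv mu (convs (map (pmix h) l))) nu) E =
    pr (conv (conv mu nu) (convs (map (pmix h) l))) E.
  apply: deq_pr mE; apply: (@deq_trans _ (conv mu (conv (convs (map (pmix h) l)) nu))).
    exact/deqC/convA.
  apply: (@deq_trans _ (conv mu (conv nu (convs (map (pmix h) l))))); last exact: convA.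
  by apply: conv_deq => // F mF; exact: convC.
rewrite !ih -!sumbZ; congr (_ + _); apply: eq_sumb => b _ /=.
  by rewrite /wt big_cons mulrA.
rewrite {2}/wt big_cons -/(wt _ _ b) mulrA; congr (_ * _).
by apply: deq_pr mE; exact/deqC/convA.
Qed.

Lemma bernoulli_le N x : 0 <= x <= 1 -> 1 - N%:R * x <= (1 - x) ^+ N :> R.
Proof.
move=> /andP[x0 x1]; elim: N => [|N ih]; first by rewrite mul0r subr0.
rewrite exprS; apply: (@le_trans _ _ ((1 - x) * (1 - N%:R * x))); last first.
  by apply: ler_wpM2l => //; rewrite subr_ge0.
have -> : (1 - x) * (1 - N%:R * x) = 1 - N.+1%:R * x + N%:R * x ^+ 2.
  by rewrite -natr1; ring.
by rewrite lerDl mulr_ge0// sqr_ge0.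
Qed.

(** The new weight h exp(-h) is the probability of exactly one Poisson point in a cell. A cell holds
    two or more with probability at most h^2, so the weight lost over N cells is at most N h^2. *)
Lemma compound_le (h : {nonneg R}) (nu : nat -> probability V R) N E : measurable E ->
  pr (compound h nu N) E <=
  sumb N (fun b => wt (expR (- h%:num)) (h%:num * expR (- h%:num)) b *
     pr (convs (mask b (map nu (iota 0 N)))) E) + N%:R * h%:num ^+ 2.
Proof.
move=> mE; set l := map nu _; have sl : size l = N by rewrite size_map size_iota.
have -> : pr (compound h nu N) E = sumb N (fun b =>
    wt (expR (- h%:num)) (1 - expR (- h%:num)) b * pr (convs (mask b l)) E).
  transitivity (pr (conv (delta0 R) (convs (map (pmix h) l))) E).
    by rewrite /pr conv_delta0l// /compound /l -map_comp.
  rewrite conv_compound// sl; apply: eq_sumb => b _; congr (_ * _).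
  by rewrite /pr conv_delta0l.
have h0 : 0 <= h%:num by [].
move: h0 (one_sub_expN h0) (expR_ge0 (- h%:num)) (expR_ge1Dx (- h%:num)).
set x := h%:num; set p := expR _ => h0 /andP[e1 e2] p0 p1.
have q0 : 0 <= 1 - p by rewrite subr_ge0 /p -[leRHS]expR0 ler_expR oppr_le0.
have qq : x * p <= 1 - p.
  have pe : p * expR x = 1 by rewrite /p -expRD addNr expR0.
  have := ler_wpM2l p0 (expR_ge1Dx x); rewrite pe mulrDr mulr1; lra.
have xp0 : 0 <= x * p by rewrite mulr_ge0.
apply: (@le_trans _ _ (sumb N (fun b => wt p (x * p) b * pr (convs (mask b l)) E +
     (wt p (1 - p) b - wt p (x * p) b)))).
  apply: le_sumb => b _; rewrite -lerBlDl -mulrBl -[leRHS]mulr1; apply: ler_wpM2l.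
    by rewrite subr_ge0; exact: le_wt.
  exact: pr_le1.
rewrite sumbD lerD2l.
have -> : sumb N (fun b => wt p (1 - p) b - wt p (x * p) b) = 1 - (p + x * p) ^+ N.
  have -> : sumb N (fun b => wt p (1 - p) b - wt p (x * p) b) =
      sumb N (wt p (1 - p)) + sumb N (fun b => -1 * wt p (x * p) b).
    by rewrite -sumbD; apply: eq_sumb => b _; rewrite mulN1r.
  by rewrite sumbZ !sumb_wt mulN1r subrKC expr1n.
(* If N h^2 exceeds 1 the bound is trivial; otherwise Bernoulli's inequality applies to (1 -
   h^2)^N. *)
have [hN|hN] := leP (N%:R * x ^+ 2) 1; last first.
  have := exprn_ge0 N (addr_ge0 p0 xp0); lra.
have k1 : 1 - x ^+ 2 <= p + x * p.
  have : (1 - x) * (1 + x) <= p * (1 + x) by apply: ler_wpM2r => //; lra.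
  lra.
case: N {sl l E mE} hN => [|N] hN; first by rewrite !mul0r expr0 subrr.
have x1 : x ^+ 2 <= 1.
  apply: le_trans hN; rewrite -[leLHS]mul1r; apply: ler_wpM2r; first exact: sqr_ge0.
  by rewrite ler1n.
have := @bernoulli_le N.+1 (x ^+ 2); rewrite sqr_ge0 x1 => /(_ isT).
have : (1 - x ^+ 2) ^+ N.+1 <= (p + x * p) ^+ N.+1.
  by apply: lerXn2r => //; rewrite nnegrE ?subr_ge0// addr_ge0.
lra.
Qed.

Section events.
Context d (T : measurableType d) (P : probability T R).

Fixpoint event_word (C : nat -> bool -> set T) (b : seq bool) : set T :=
  if b is x :: b' then C 0%N x `&` event_word (fun c => C c.+1) b' else setT.

Lemma event_wordP C b w :
  event_word C b w <-> (forall c, (c < size b)%N -> C c (nth false b c) w).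
Proof.
elim: b C => [|x b ih] C //=; split=> [[Cx /ih h]|h].
  by case=> [|c] //=; rewrite ltnS; exact: h.
by split; [exact: (h 0%N)|apply/ih => c cb; exact: (h c.+1)].
Qed.

Lemma measurable_event_word C b : (forall c x, measurable (C c x)) ->
  measurable (event_word C b).
Proof.
by move=> mC; elim: b C mC => [|x b ih] C mC //=; apply: measurableI => //; exact: ih.
Qed.

Lemma sumb_disjoint N C D : (forall c x, measurable (C c x)) ->
  (forall c, C c false `&` C c true = set0) -> measurable D ->
  sumb N (fun b => pr P (D `&` event_word C b)) <= pr P D.
Proof.
elim: N C D => [|N ih] C D mC dC mD /=; first by rewrite setIT.
have mD' x : measurable (D `&` C 0%N x) by exact: measurableI.
have h x : sumb N ((fun b => pr P (D `&` event_word C b)) \o cons x) <=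
    pr P (D `&` C 0%N x).
  rewrite -[leLHS]/(sumb N (fun b => pr P (D `&` (C 0%N x `&` event_word (fun c => C c.+1) b)))).
  under [leLHS](@eq_sumb N) => b _ do rewrite setIA.
  exact: ih.
apply: (le_trans (lerD (h false) (h true))); rewrite -prU//; last first.
  by rewrite setIACA dC setI0.
by apply: le_pr => //; [exact: measurableU|rewrite -setIUr; exact: subIsetl].
Qed.

Lemma pr_fin_partition (F : finType) (f : T -> F) (A : set T) : measurable A ->
  (forall v, measurable (f @^-1` [set v])) ->
  pr P A = \sum_(v : F) pr P (A `&` f @^-1` [set v]).
Proof.
move=> mA mf.
have key s : uniq s -> pr P (A `&` [set w | f w \in s]) = \sum_(v <- s) pr P (A `&` f @^-1` [set v])
     /\ measurable (A `&` [set w | f w \in s]).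
  elim: s => [_|v s ih /= /andP[vs /ih[ih1 ih2]]].
    by rewrite big_nil (_ : mkset _ = set0) ?setI0 ?pr_set0//; apply/seteqP; split.
  have -> : [set w | f w \in v :: s] = f @^-1` [set v] `|` [set w | f w \in s].
    apply/seteqP; split => w /=; rewrite inE.
      by move=> /orP[/eqP|]; [left|right].
    by move=> [->|->]; rewrite ?eqxx ?orbT.
  have m1 : measurable (A `&` f @^-1` [set v]) by exact: measurableI.
  rewrite setIUr; split; last exact: measurableU.
  rewrite big_cons -ih1 prU//; apply/seteqP; split => w //= [[_ fv] [_]].
  by rewrite fv (negPf vs).
have [<- _] := key (index_enum F) (index_enum_uniq F).
by congr pr; apply/seteqP; split => w //=; [move=> Aw; rewrite mem_index_enum|case].
Qed.

End events.
End compound_expansion.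

(** * Poisson points on a grid *)

Lemma measurable_pick d d' (T : measurableType d) (U : measurableType d')
  (kappa : T -> nat) (F : nat -> T -> U) :
  (forall c, measurable (kappa @^-1` [set c])) ->
  (forall c, measurable_fun setT (F c)) ->
  measurable_fun setT (fun w => F (kappa w) w).
Proof.
move=> mk mF _ B mB; rewrite setTI.
rewrite [X in measurable X](_ : _ = \bigcup_c (kappa @^-1` [set c] `&` F c @^-1` B)).
  apply: bigcupT_measurable => c; apply: measurableI => //.
  by have := mF c measurableT B mB; rewrite setTI.
apply/seteqP; split => w /=; first by move=> h; exists (kappa w).
by move=> [c _ [/= <-]].
Qed.

Section cells.
Variables (R : realType) (h : R) (h0 : 0 < h) (N : nat).
Notation V := (iseq R).

(** All points from [N * h] on share the extra index [N], whose observation times are all frozen, so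
    that they contribute 0. *)
Definition cell (x : R) : nat := minn N (Num.truncn (x / h)).
(** The left end of cell 0 is 0, and the convention [0^-1 = 0] turns all its times into 0. A given
    point leaves that cell once the mesh is fine enough. *)
Definition cell_times (tt : times R) (c : nat) : times R :=
  if (c < N)%N then scale_times (c%:R * h)^-1 tt else no_times R.

Lemma nonneg_cell_times tt c : nonneg_times tt -> nonneg_times (cell_times tt c).
Proof.
move=> htt; rewrite /cell_times; case: ifP => // _; apply: nonneg_scale => //.
by rewrite invr_ge0 mulr_ge0// ltW.
Qed.

Definition cell_set (c : nat) : set R := `[c%:R * h, c.+1%:R * h[%classic.

Lemma cellE x c : 0 < x -> (c < N)%N -> (cell x = c) <-> cell_set c x.
Proof.
move=> x0 cN; have xh : 0 <= x / h by rewrite divr_ge0// ltW.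
rewrite /cell_set /= in_itv/= -ler_pdivlMr// -ltr_pdivrMr// -truncn_eq//.
rewrite /cell; split=> [|/eqP ->]; last by apply/minn_idPr/ltnW.
move=> e; apply/eqP; move: e; rewrite /minn; case: ltnP => // _ Nc.
by rewrite Nc ltnn in cN.
Qed.

Lemma cell_ge x : 0 < x -> (cell x = N) <-> N%:R * h <= x.
Proof.
move=> x0; have xh : 0 <= x / h by rewrite divr_ge0// ltW.
rewrite -ler_pdivlMr// /cell -truncn_ge_nat//; split.
  by move/minn_idPl.
by move/minn_idPl.
Qed.

Lemma cell_le x : (cell x <= N)%N. Proof. by rewrite /cell geq_minl. Qed.

Lemma measurable_cell d (T : measurableType d) (G : T -> R) c :
  measurable_fun setT G -> (forall w, 0 < G w) -> measurable [set w | cell (G w) = c].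
Proof.
move=> mG G0; have [cN|Nc|->] := ltngtP c N.
- rewrite (_ : mkset _ = G @^-1` cell_set c).
    by rewrite -[X in measurable X]setTI; apply: mG => //; exact: measurable_itv.
  by apply/seteqP; split => w /=; move/(cellE (G0 w) cN).
- rewrite (_ : mkset _ = set0)//; apply/seteqP; split => w //= e.
  by move: (cell_le (G w)); rewrite e leqNgt Nc.
- rewrite (_ : mkset _ = G @^-1` `[N%:R * h, +oo[%classic).
    by rewrite -[X in measurable X]setTI; apply: mG => //; exact: measurable_itv.
  apply/seteqP; split => w /=; rewrite in_itv/= andbT; by move/(cell_ge (G0 w)).
Qed.

End cells.

Section patterns.
Context d (T : measurableType d) (R : realType) (h : R) (h0 : 0 < h) (N : nat).
Variables (G : nat -> T -> R).
Hypothesis mG : forall i, measurable_fun setT (G i).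
Hypothesis G0 : forall i w, 0 < G i w.

Definition pattern I (w : T) : {ffun 'I_I -> 'I_N.+1} :=
  [ffun i : 'I_I => inord (cell h N (G i w))].

Lemma patternE I w (i : 'I_I) : pattern I w i = cell h N (G i w) :> nat.
Proof. by rewrite ffunE inordK// ltnS cell_le. Qed.

Lemma measurable_pattern I v : measurable (pattern I @^-1` [set v]).
Proof.
rewrite (_ : _ @^-1` _ = \bigcap_(i in [set: 'I_I]) [set w | cell h N (G i w) = v i]).
  by apply: fin_bigcap_measurable => // i _; exact: measurable_cell.
apply/seteqP; split => w /=.
  by move=> <- i _ /=; rewrite patternE.
by move=> H; apply/ffunP => i; apply/val_inj; rewrite /= patternE; exact: H.
Qed.

End patterns.

Lemma sigma_seq_pattern d (T : measurableType d) (R : realType) (h : R) (h0 : 0 < h) N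
  (G : nat -> T -> R) (G0 : forall i w, 0 < G i w) I v :
  sigma_seq G (pattern h N G I @^-1` [set v]).
Proof.
pose U := g_sigma_algebraType (\bigcup_(i in [set: nat])
  preimage_set_system [set: T] (G i) measurable).
have mG i : measurable_fun [set: U] (G i : U -> R).
  move=> _ C mC; rewrite setTI; apply: sub_sigma_algebra.
  by exists i => //; exists C => //; rewrite setTI.
exact: (@measurable_pattern _ U R h h0 N G mG G0).
Qed.

Definition mark_sigma d (T : measurableType d) (R : realType) (G : nat -> T -> R)
    (E : nat -> R -> T -> R) (o : option nat) : set (set T) :=
  match o with None => sigma_seq G | Some i => sigma_proc (E i) end.

Section grid.
Context d (T : measurableType d) (R : realType) (P : probability T R).
Notation V := (iseq R).
Variables (G : nat -> T -> R) (E : nat -> R -> T -> R).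
Hypothesis mG : forall i, measurable_fun setT (G i).
Hypothesis G0 : forall i w, 0 < G i w.
Hypothesis pE : forall i, is_process (E i).
Hypothesis fddE : forall i, fdd_eq P P (E i) (E 0%N).
Hypothesis ind : mutually_independent P (mark_sigma G E).
Variables (tt : times R) (htt : nonneg_times tt) (h : R) (h0 : 0 < h) (N : nat).

Let mcell i c := measurable_obs (pE i) (@nonneg_cell_times R h h0 N tt c htt).

Definition cell_law c : probability V R := law P (mcell 0%N c).

Definition grid_sum (I : nat) : T -> V :=
  vsum (fun i w => obs (E i) (cell_times h N tt (cell h N (G i w))) w) (iota 0 I).

Lemma measurable_grid_sum I : measurable_fun setT (grid_sum I).
Proof.
apply: measurable_vsum => i.
apply: (measurable_pick (F := fun c => obs (E i) (cell_times h N tt c))).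
  by move=> c; exact: measurable_cell.
by move=> c; exact: mcell.
Qed.

Let measurable_grid_pre I B : measurable B -> measurable (grid_sum I @^-1` B).
Proof. by move=> mB; rewrite -[X in measurable X]setTI; exact: measurable_grid_sum. Qed.

(** On a fixed pattern all observation times are deterministic, so the marks are independent
    summands; the pattern itself is the carried event of [indep_vsum], with index [None]. *)
Lemma pr_grid_pattern I v B : measurable B ->
  pr P (pattern h N G I @^-1` [set v] `&` grid_sum I @^-1` B) =
  pr P (pattern h N G I @^-1` [set v]) *
  pr (convs (map cell_law [seq nat_of_ord (v i) | i <- enum 'I_I])) B.
Proof.
move=> mB; pose pi i : nat := if insub i is Some j then v j else N.
pose X (o : option nat) : T -> V :=
  if o is Some i then obs (E i) (cell_times h N tt (pi i)) else fun=> v0 R.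
have mX o : measurable_fun setT (X o).
  by case: o => [i|]; [exact: mcell|exact: measurable_cst].
pose s : seq (option nat) := map Some (iota 0 I).
pose A (o : option nat) := pattern h N G I @^-1` [set v].
have mA : measurable (pattern h N G I @^-1` [set v]) by exact: measurable_pattern.
have := @indep_vsum _ _ _ P _ (mark_sigma G E) X mX s [:: None] A ind.
have H1 o B' : o \in s -> measurable B' -> mark_sigma G E o (X o @^-1` B').
  by move=> /mapP[i _ ->] mB'; apply: sigma_proc_obs => //; exact: nonneg_cell_times.
have H2 o : o \in [:: None] -> mark_sigma G E o (A o).
  by rewrite inE => /eqP ->; exact: sigma_seq_pattern.
have H3 o : o \in [:: None] -> measurable (A o) by [].
have H4 : uniq (s ++ [:: None]).
  have sinj : injective (@Some nat) by move=> ? ? [].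
  rewrite cat_uniq (map_inj_uniq sinj) iota_uniq /= orbF andbT.
  by apply/mapP => -[].
move=> /(_ H1 H2 H3 H4 _ mB); rewrite !big_seq1.
have -> : A None `&` vsum X s @^-1` B = pattern h N G I @^-1` [set v] `&` grid_sum I @^-1` B.
  have key w : pattern h N G I w = v -> vsum X s w = grid_sum I w.
    move=> wv; apply/funext => k; rewrite /vsum /s big_map; apply: eq_big_seq => i.
    rewrite mem_iota add0n /= => iI.
    have -> : cell h N (G i w) = pi i.
      by rewrite /pi insubT -wv patternE.
    by [].
  by apply/seteqP; split => w [/= wv] h1; split => //=; move: h1; rewrite key.
have -> : convs [seq law P (mX i) | i <- s] B =
    convs (map cell_law [seq nat_of_ord (v i) | i <- enum 'I_I]) B.
  rewrite /s -map_comp.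
  have -> : [seq nat_of_ord (v i) | i <- enum 'I_I] = [seq pi i | i <- iota 0 I].
    rewrite -val_enum_ord -map_comp; apply: eq_map => i /=; rewrite /pi insubT//= => iI.
    by congr (nat_of_ord (v _)); exact: val_inj.
  rewrite -map_comp; apply: (convs_deq _ mB) => i _ /=.
  exact: (fdd_obs _ _ (fddE i) (@nonneg_cell_times R h h0 N tt (pi i) htt)).
by rewrite /pr => ->; rewrite fineM// fin_num_measure.
Qed.

Lemma cell_law_out c : (N <= c)%N -> deq (cell_law c) (delta0 R).
Proof.
move=> Nc B mB; rewrite /cell_law lawE delta0E.
have oE w : obs (E 0%N) (cell_times h N tt c) w = v0 R.
  by rewrite /cell_times ltnNge Nc.
have [B0|B0] := pselect (B (v0 R)).
  rewrite indicE mem_set// -(probability_setT P); congr (P _).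
  by apply/seteqP; split => w //= _; rewrite oE.
by rewrite indicE memNset// (_ : _ @^-1` _ = set0) ?measure0//; apply/seteqP; split => w //=; rewrite oE.
Qed.

Lemma convs_cell_filter s :
  deq (convs (map cell_law s)) (convs (map cell_law [seq c <- s | (c < N)%N])).
Proof.
elim: s => [//|c s ih] /=; case: ltnP => cN /=; first exact: conv_deq.
apply: (@deq_trans _ (conv (delta0 R) (convs (map cell_law s)))).
  by apply: conv_deq => //; exact: cell_law_out.
by apply: deq_trans ih; exact: conv_delta0l.
Qed.

(** The letter is read as a number, so the cell holds exactly 0 or exactly 1 of the first [I]
    points. Configurations with two points in one cell belong to no word. *)
Definition cell_count I c (x : bool) : set T :=
  [set w | count_mem c [seq cell h N (G i w) | i <- iota 0 I] = x].

Let seq_pattern I w : [seq cell h N (G i w) | i <- iota 0 I] =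
  [seq nat_of_ord (pattern h N G I w i) | i <- enum 'I_I].
Proof.
rewrite -val_enum_ord -map_comp; apply: eq_map => i /=.
by rewrite patternE.
Qed.

Lemma measurable_cell_count I c x : measurable (cell_count I c x).
Proof.
rewrite (_ : cell_count I c x = \bigcup_(v in [set v : {ffun 'I_I -> 'I_N.+1} |
    count_mem c [seq nat_of_ord (v i) | i <- enum 'I_I] = x])
    (pattern h N G I @^-1` [set v])).
  by apply: fin_bigcup_measurable => // v _; exact: measurable_pattern.
apply/seteqP; split => w; rewrite /cell_count /= seq_pattern.
  by move=> e; exists (pattern h N G I w).
by move=> [v /= e wv]; rewrite wv.
Qed.

(** All patterns compatible with the word list the same occupied cells in some order, besides copies
    of the neutral index [N]. As convolution is commutative they give the same law, which factors
    out of the sum over patterns. *)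
Lemma pr_grid_word I b B : size b = N -> measurable B ->
  pr P (event_word (cell_count I) b `&` grid_sum I @^-1` B) =
  pr P (event_word (cell_count I) b) * pr (convs (mask b (map cell_law (iota 0 N)))) B.
Proof.
move=> bN mB; set ev := event_word _ b.
have mev : measurable ev by apply: measurable_event_word; exact: measurable_cell_count.
have mp v : measurable (pattern h N G I @^-1` [set v]) by exact: measurable_pattern.
have mgB := measurable_grid_pre I mB.
rewrite (pr_fin_partition P (measurableI _ _ mev mgB) mp) (pr_fin_partition P mev mp).
rewrite mulr_suml; apply: eq_bigr => v _.
have [[w0 /= [wv evw]]|nov] := pselect (exists w0, pattern h N G I w0 = v /\ ev w0); last first.
  rewrite (_ : ev `&` _ = set0) ?pr_set0 ?mul0r.
    rewrite (_ : _ `&` _ = set0) ?pr_set0//; apply/seteqP; split => w //= [[e _] wv].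
    by apply: nov; exists w.
  by apply/seteqP; split => w //= [e wv]; apply: nov; exists w.
have evP w : pattern h N G I w = v -> ev w.
  move=> wv'; apply/event_wordP => c cb; rewrite /cell_count /= seq_pattern wv' -wv -seq_pattern.
  by have /event_wordP := evw; apply.
have -> : ev `&` pattern h N G I @^-1` [set v] = pattern h N G I @^-1` [set v].
  by apply/setIidr => w /= /evP.
rewrite setIAC (_ : ev `&` pattern h N G I @^-1` [set v] = pattern h N G I @^-1` [set v]); last first.
  by apply/setIidr => w /= /evP.
rewrite pr_grid_pattern//; congr (_ * _).
apply: deq_pr mB; apply: deq_trans (convs_cell_filter _) _.
rewrite -map_mask; apply: convs_perm.
rewrite -wv -seq_pattern /perm_eq; apply/allP => c _ /=.
rewrite count_filter (@eq_count _ _ (fun a => (c < N)%N && (a == c))); last first.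
  by move=> a /=; case: eqP => [->|]; rewrite ?andbT ?andbF.
rewrite (@count_uniq_mem _ _ c); last by rewrite mask_uniq ?iota_uniq.
rewrite in_mask ?iota_uniq// mem_iota add0n /=.
have [cN|cN] := ltnP c N; last by rewrite count_pred0.
have -> : index c (iota 0 N) = c.
  by have := @index_uniq _ 0%N c (iota 0 N); rewrite size_iota iota_uniq nth_iota// add0n; apply.
rewrite (@eq_count _ _ (pred1 c))//.
have /event_wordP := evw => /(_ c); rewrite bN => /(_ cN); rewrite /cell_count /= => ->.
by case: nth.
Qed.

End grid.

(** * Counts of the Poisson points *)

Section poisson_series.
Variable R : realType.
Implicit Types l : R.

Lemma poisson_p_ge0 l k : 0 <= l -> 0 <= poisson_p l k.
Proof. by move=> l0; rewrite /poisson_p !mulr_ge0 ?expR_ge0 ?exprn_ge0 ?invr_ge0. Qed.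

Lemma sum_poisson_p l : 0 <= l -> (\sum_(k <oo) (poisson_p l k)%:E = 1)%E.
Proof.
move=> l0; rewrite [RHS](_ : _ = (expR (- l))%:E * (expR l)%:E)%E; last first.
  by rewrite -EFinM expRN mulVf ?gt_eqF ?expR_gt0.
under eq_eseriesr do rewrite /poisson_p -mulrA EFinM.
rewrite nneseriesZl/=; last by move=> n _; rewrite lee_fin divr_ge0// exprn_ge0.
congr (_ * _)%E; rewrite expRE -EFin_lim; last first.
  rewrite /pseries/=; under eq_fun do rewrite mulrC.
  exact: is_cvg_series_exp_coeff.
apply/congr_lim/funext => n/=; rewrite /pseries/= /series/= -sumEFin//.
by under eq_bigr do rewrite mulrC.
Qed.

Lemma mean_poisson_p l : 0 <= l -> (\sum_(k <oo) (k%:R * poisson_p l k)%:E = l%:E)%E.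
Proof.
move=> l0; have E n : (\sum_(0 <= k < n.+1) (k%:R * poisson_p l k)%:E =
    l%:E * \sum_(0 <= k < n) (poisson_p l k)%:E)%E.
  rewrite !sumEFin -EFinM; congr EFin; rewrite big_nat_recl// mul0r add0r mulr_sumr.
  apply: eq_bigr => k _; rewrite /poisson_p factS natrM exprS; field.
  by rewrite nat1r !pnatr_eq0 -lt0n fact_gt0.
have h : (l%:E * (\sum_(0 <= k < n) (poisson_p l k)%:E))%E @[n --> \oo] --> (l%:E * 1)%E.
  rewrite -(sum_poisson_p l0); apply: cvgeZl => //.
  by apply: is_cvg_nneseries => k _ _; rewrite lee_fin poisson_p_ge0.
rewrite mule1 -(funext E) in h; apply/cvg_lim => //.
by rewrite -(cvg_shiftS (fun n => \sum_(0 <= k < n) (k%:R * poisson_p l k)%:E)%E).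
Qed.

End poisson_series.

Section poisson_points.
Context d (T : measurableType d) (R : realType) (P : probability T R).
Variable G : nat -> T -> R.
Hypothesis HG : unit_poisson_pp P G.
Let mu := @lebesgue_measure R.
Let pos : set R := `]0, +oo[%classic.

Let mG i : measurable_fun setT (G i). Proof. by case: HG. Qed.
Let G0 i w : 0 < G i w. Proof. by case: HG => _ []. Qed.

Lemma measurable_Gpre i A : measurable A -> measurable (G i @^-1` A).
Proof. by move=> mA; rewrite -[X in measurable X]setTI; exact: mG. Qed.

Lemma measurable_point_count A : measurable A -> measurable_fun setT (point_count G A).
Proof.
move=> mA; apply: ge0_emeasurable_sum => [i w _ _|i _]; first by rewrite lee_fin.
apply/measurable_EFinP; exact: (measurable_indic (measurable_Gpre i mA)).
Qed.

Lemma point_count_ge0 A w : (0 <= point_count G A w)%E.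
Proof. by apply: nneseries_ge0 => i _ _; rewrite lee_fin. Qed.

Lemma point_count_fin A w I : (forall i, (I <= i)%N -> ~ A (G i w)) ->
  point_count G A w = (\sum_(i < I) \1_A (G i w))%:E.
Proof.
move=> h; rewrite /point_count; apply/cvg_lim => //; apply: cvg_near_cst.
exists I => // n /= In; rewrite sumEFin; congr EFin.
rewrite big_mkord (big_ord_widen n (fun i => \1_A (G i w)) In) [RHS]big_mkcond /=.
apply: eq_bigr => i _; case: ltnP => // Ii.
by rewrite indicE memNset//; exact: h.
Qed.

Section one_set.
Variable A : set R.
Hypotheses (mA : measurable A) (Apos : A `<=` pos) (Afin : (mu A < +oo)%E).
Let l := fine (mu A).
Let l0 : 0 <= l. Proof. exact: fine_ge0. Qed.
Let F m := [set w | point_count G A w = (m%:R)%:E].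

Let mF m : measurable (F m).
Proof.
by have := measurable_point_count mA measurableT (emeasurable_set1 (m%:R)%:E); rewrite setTI.
Qed.

Let PF m : P (F m) = (poisson_p l m)%:E.
Proof.
have [_ [_ h]] := HG; have := h 1%N (fun=> A) (fun=> m).
by rewrite !big_ord1; apply => // i j; rewrite !ord1 eqxx.
Qed.

(** The sum is the mean of the count. The Poisson probabilities sum to 1, so the events with a given
    finite count exhaust the space up to a null set, and the mean is that of the Poisson law. *)
Lemma mean_point_count : (\sum_(i <oo) P (G i @^-1` A) = mu A)%E.
Proof.
transitivity (\int[P]_w point_count G A w)%E.
  rewrite /point_count integral_nneseries//; last first.
    by move=> i; apply/measurable_EFinP; exact: (measurable_indic (measurable_Gpre i mA)).
  apply: eq_eseriesr => i _.
  by rewrite -[RHS]/(\int[P]_w (\1_(G i @^-1` A) w)%:E)%E integral_indic ?setIT//; exact: measurable_Gpre.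
have tF : trivIset setT F.
  apply/trivIsetP => i j _ _ ij; apply/seteqP; split => w //= [].
  by rewrite /F /= => -> [] /eqP; rewrite eqr_nat (negPf ij).
have mUF : measurable (\bigcup_m F m) by exact: bigcupT_measurable.
have PU : P (\bigcup_m F m) = 1%E.
  rewrite measure_bigcup//; transitivity (\sum_(k <oo) (poisson_p l k)%:E)%E.
    by rewrite eseries_mkcond; apply: eq_eseriesr => k _; rewrite in_setT; exact: PF.
  exact: sum_poisson_p.
have -> : (\int[P]_w point_count G A w = \int[P]_(w in \bigcup_m F m) point_count G A w)%E.
  rewrite -[X in (\int[P]_(w in X) _)%E](setUv (\bigcup_m F m)).
  rewrite ge0_integral_setU//=; last 4 first.
  - exact: measurableC.
  - by rewrite setUv; exact: measurable_point_count.
  - by move=> w _; exact: point_count_ge0.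
  - by rewrite disj_set2E setICr.
  rewrite [X in (_ + X)%E](_ : _ = 0%E) ?adde0//.
  apply: null_set_integral => //; first exact: measurableC.
    by apply: measurable_funTS; exact: measurable_point_count.
  by transitivity (1 - P (\bigcup_m F m))%E; [exact: probability_setC|rewrite PU subee].
rewrite ge0_integral_bigcup//=; last 2 first.
  by apply: measurable_funTS; exact: measurable_point_count.
  by move=> w _; exact: point_count_ge0.
rewrite -[RHS]fineK; last by rewrite ge0_fin_numE.
rewrite -(mean_poisson_p l0); apply: eq_eseriesr => m _.
under eq_integral => w /set_mem -> do [].
by rewrite integral_cst// EFinM; congr (_ * _)%E; exact: PF.
Qed.

Definition tail_points I := \bigcup_(i >= I) G i @^-1` A.

Lemma measurable_tail_points I : measurable (tail_points I).
Proof. by apply: bigcup_measurable => i _; exact: measurable_Gpre. Qed.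

(** Borel-Cantelli: the expected number of points in [A] is finite. *)
Lemma cvg_tail_points : pr P (tail_points I) @[I --> \oo] --> 0.
Proof.
have mGA i : measurable (G i @^-1` A) by exact: measurable_Gpre.
have S : (\sum_(i <oo) P (G i @^-1` A) < +oo)%E by rewrite mean_point_count.
have U : (P (\bigcup_(k >= 0) G k @^-1` A) < +oo)%E.
  by rewrite (le_lt_trans (probability_le1 P _)) ?ltry//; exact: (measurable_tail_points 0%N).
have := @lim_sup_set_cvg _ _ _ P (fun k => G k @^-1` A) mGA U.
rewrite (@lim_sup_set_cvg0 _ _ _ P (fun k => G k @^-1` A) mGA S) => h.
by rewrite -[0 : R]/(fine 0%E); apply: fine_cvg.
Qed.

End one_set.

Section cells.
Variables (h : R) (h0 : 0 < h) (N : nat).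

(** [unit_poisson_pp] speaks of subsets of the open half-line, whereas cell 0 contains the point
    0. *)
Definition pos_cell c : set R := cell_set h c `&` pos.

Lemma measurable_pos_cell c : measurable (pos_cell c).
Proof. by apply: measurableI; exact: measurable_itv. Qed.

Lemma mu_pos_cell c : lebesgue_measure (pos_cell c) = h%:E.
Proof.
have ch : c%:R * h < c.+1%:R * h by rewrite ltr_pM2r// ltr_nat.
have E : c.+1%:R * h - c%:R * h = h by rewrite -natr1 mulrDl mul1r addrAC subrr add0r.
case: c ch E => [|c] ch E.
  rewrite (_ : pos_cell 0 = `]0, 1%:R * h[%classic).
    by rewrite lebesgue_measure_itv/= lte_fin mul1r h0 oppr0 adde0.
  apply/seteqP; split => x; rewrite /pos_cell /cell_set /pos /= !in_itv/= mul0r ?andbT.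
    by move=> [/andP[_ ->] ->].
  by move=> /andP[x0 ->]; rewrite x0 ltW.
rewrite (_ : pos_cell _ = cell_set h c.+1).
  by rewrite /cell_set lebesgue_measure_itv/= lte_fin ch -EFinB E.
apply/setIidl => x; rewrite /cell_set /pos /= !in_itv/= andbT => /andP[cx _].
by apply: lt_le_trans cx; rewrite mulr_gt0.
Qed.

Definition cell_event c (x : bool) : set T := [set w | point_count G (pos_cell c) w = (x%:R)%:E].

Lemma measurable_cell_event c x : measurable (cell_event c x).
Proof.
have := measurable_point_count (measurable_pos_cell c) measurableT (emeasurable_set1 (x%:R)%:E).
by rewrite setTI.
Qed.

Lemma pos_cell_trunc c x : pos_cell c x -> Num.truncn (x / h) = c.
Proof.
rewrite /pos_cell /cell_set /pos /= !in_itv/= andbT => -[cx x0].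
apply/eqP; rewrite truncn_eq; last by rewrite divr_ge0// ltW.
by rewrite ler_pdivlMr// ltr_pdivrMr.
Qed.

Lemma pr_cell_events b : size b = N ->
  pr P (event_word cell_event b) = wt (expR (- h)) (h * expR (- h)) b.
Proof.
move=> bN; have [_ [_ HG']] := HG.
have := HG' N (fun j => pos_cell j) (fun j => nth false b j : nat).
have -> : \big[setI/setT]_(j < N) [set w | point_count G (pos_cell j) w =
    ((nth false b j : nat)%:R)%:E] = event_word cell_event b.
  apply/seteqP; split => w.
    rewrite -bigcap_seq /= => H; apply/event_wordP => c; rewrite bN => cN.
    by have := H (Ordinal cN); rewrite /= mem_index_enum => /(_ isT).
  move=> /event_wordP H; rewrite -bigcap_seq => j _ /=.
  by apply: H; rewrite bN.
move=> H; rewrite /pr H.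
- under eq_bigr do rewrite mu_pos_cell.
  rewrite prodEFin /= /wt (big_nth false) big_mkord bN; apply: eq_bigr => j _.
  rewrite /poisson_p; case: nth => /=; last by rewrite expr0 fact0 divr1 mulr1.
  by rewrite expr1 (_ : 1`! = 1%N)// divr1 mulrC.
- move=> j; split; first exact: measurable_pos_cell; split; first exact: subIsetr.
  by rewrite mu_pos_cell ltry.
- move=> i j ij; apply/seteqP; split => x //= [/pos_cell_trunc xi /pos_cell_trunc xj].
  by move: ij; rewrite -(inj_eq val_inj) /= -xi -xj eqxx.
Qed.

Definition below (L : R) : set R := `]0, L[%classic.

Lemma count_pos_cell I c w : (c < N)%N ->
  \sum_(i < I) \1_(pos_cell c) (G i w) =
  (count_mem c [seq cell h N (G i w) | i <- iota 0 I])%:R :> R.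
Proof.
move=> cN; rewrite -sum1_count big_map -(big_mkord xpredT (fun i => \1_(pos_cell c) (G i w))).
rewrite /index_iota subn0 natr_sum [RHS]big_mkcond /=; apply: eq_bigr => i _.
rewrite indicE; have [cc|cc] := eqVneq (cell h N (G i w)) c.
  by rewrite mem_set//; split; [apply/(cellE h0 (G0 i w) cN)|rewrite /pos /= in_itv/= andbT].
by rewrite memNset// => -[/(cellE h0 (G0 i w) cN) e _]; rewrite e eqxx in cc.
Qed.

End cells.

Variables (E : nat -> R -> T -> R).
Hypothesis pE : forall i, is_process (E i).
Hypothesis fddE : forall i, fdd_eq P P (E i) (E 0%N).
Hypothesis ind : mutually_independent P (mark_sigma G E).
Variables (tt : times R) (htt : nonneg_times tt) (h : R) (h0 : 0 < h) (N : nat).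

(** Two events are given up: two points in one cell, at a cost of N h^2 by [compound_le], and a
    point of index at least [I] below [N * h]. By [dleC] the inequality in this direction controls
    the total variation. *)
Lemma dle_compound_grid I :
  dle (compound (NngNum (ltW h0)) (cell_law P pE htt h0 N) N)
      (law P (@measurable_grid_sum d T R G E mG G0 pE tt htt h h0 N I))
      (N%:R * h ^+ 2 + pr P (tail_points (below (N%:R * h)) I)).
Proof.
move=> B mB; set W := tail_points _ I.
have mb : measurable (below (N%:R * h)) by exact: measurable_itv.
have mW : measurable W by exact: measurable_tail_points.
have mWc := measurableC mW.
apply: (le_trans (compound_le _ _ _ mB)) => /=.
set l := map _ _; rewrite addrA addrAC lerD2r.
pose C := cell_event h; pose CI := cell_count G h N I.
have mC c x : measurable (C c x) by exact: measurable_cell_event.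
have mCI c x : measurable (CI c x) by exact: measurable_cell_count.
have mwC b : measurable (event_word C b) by exact: measurable_event_word.
have mwCI b : measurable (event_word CI b) by exact: measurable_event_word.
have c1 b : 0 <= pr (convs (mask b l)) B <= 1 by rewrite pr_ge0 pr_le1.
(* Off [W] the occupation of the cells can be read from the first [I] points. The events of
   different words are disjoint, so the second terms add up to at most the probability of [W]. *)
apply: (@le_trans _ _ (sumb N (fun b => pr P (event_word CI b `&` grid_sum G E tt h N I @^-1` B)
    + pr P (W `&` event_word C b)))).
  apply: le_sumb => b bN; rewrite (pr_grid_word mG G0 pE fddE ind htt h0)//.
  have /andP[p0 p1] := c1 b.
  rewrite -(pr_cell_events h0 bN) -/C (pr_split P (mwC b) mW) mulrDl addrC; apply: lerD.
    apply: ler_wpM2r => //; apply: le_pr => //; first exact: measurableI.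
    move=> w [/event_wordP Cw nW]; apply/event_wordP => c cb.
    have := Cw c cb; rewrite /C /cell_event /CI /cell_count /= (@point_count_fin _ _ I).
      have cN : (c < N)%N by rewrite -bN.
      by rewrite (@count_pos_cell h h0 N I c w cN) => -[] /eqP; rewrite eqr_nat => /eqP ->.
    move=> i Ii cc; apply: nW; exists i => //=.
    move: cc => []; rewrite /cell_set /= in_itv/= => /andP[_ cG] _.
    rewrite /below /= in_itv/= G0 /=.
    by apply: (lt_le_trans cG); rewrite ler_pM2r// ler_nat -bN.
  rewrite setIC -[leRHS]mulr1; apply: ler_pM => //; exact: pr_ge0.
rewrite sumbD; apply: lerD.
  apply: (@le_trans _ _ (sumb N (fun b => pr P (grid_sum G E tt h N I @^-1` B `&` event_word CI b)))).
    by apply: le_sumb => b _; rewrite setIC.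
  apply: sumb_disjoint => //.
    move=> c; apply/seteqP; split => w //=; rewrite /CI /cell_count /= => -[-> //].
  by rewrite -[X in measurable X]setTI; exact: measurable_grid_sum.
apply: sumb_disjoint => //.
move=> c; apply/seteqP; split => w //=; rewrite /C /cell_event /= => -[-> []] /eqP.
by rewrite eq_sym oner_eq0.
Qed.

End poisson_points.

Lemma step_fun_right (R : realType) (f : R -> R) t : step_fun f -> 0 <= t ->
  exists2 e, 0 < e & forall x, t <= x < t + e -> f x = f t.
Proof.
move=> sf t0; have T0 : 0 < t + 1 by rewrite ltr_wpDl.
have [k [s [s0 [s_lt [Ts hs]]]]] := sf _ T0.
have ex : exists j, (j < k)%N && (s j <= t < s j.+1).
  have ts : t < s k by apply: lt_le_trans Ts; rewrite ltrDl.
  elim: k ts {s_lt Ts hs} => [|k ih] ts; first by rewrite s0 ltNge t0 in ts.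
  have [tk|kt] := ltP t (s k); last by exists k; rewrite ltnSn kt.
  have [j /andP[jk jt]] := ih tk; exists j; rewrite jt andbT; exact: ltnW.
have [j /andP[jk /andP[jt tj]]] := ex; exists (s j.+1 - t); first by rewrite subr_gt0.
move=> x /andP[tx]; rewrite addrC subrK => xj.
by rewrite (hs _ jk x) ?(le_trans jt tx)// (hs _ jk t) ?jt.
Qed.

(** Rounding [x] down to the grid moves [t / x] to the right, where a càdlàg step function keeps its
    value for a while. *)
Lemma step_fun_grid (R : realType) (f : R -> R) t x : step_fun f -> 0 <= t -> 0 < x ->
  exists2 h1, 0 < h1 & forall h, 0 < h < h1 ->
    f (((Num.truncn (x / h))%:R * h)^-1 * t) = f (x^-1 * t).
Proof.
move=> sf t0 x0; have t1 : 0 <= x^-1 * t by rewrite mulr_ge0// invr_ge0 ltW.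
have [e e0 fe] := step_fun_right sf t1.
have d0 : 0 < 2 * t + 1 by lra.
(* The first bound keeps the rounded point above [x / 2]; then the time moves by at most
   [2 * h * t / x^2], which the second bound puts below [e]. The added 1 covers [t = 0]. *)
exists (Num.min (x / 2) (e * x ^+ 2 / (2 * t + 1))).
  by rewrite lt_min !divr_gt0// mulr_gt0// exprn_gt0.
move=> h /andP[h0]; rewrite lt_min => /andP[h1 h2].
have xh : 0 <= x / h by rewrite divr_ge0// ltW.
set y := _ * h.
have yx : y <= x by rewrite /y -ler_pdivlMr// truncn_le.
have xy : x < y + h.
  have := truncnS_gt (x / h); rewrite ltr_pdivrMr// -natr1 mulrDl mul1r; exact.
have y0 : x / 2 < y by lra.
have y1 : 0 < y by apply: le_lt_trans y0; rewrite divr_ge0// ltW.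
apply: fe; apply/andP; split.
  by apply: ler_wpM2r => //; rewrite lef_pV2.
rewrite -ltrBlDl -mulrBl.
have -> : y^-1 - x^-1 = (x - y) / (x * y) by field; rewrite !gt_eqF.
have k1 : (x - y) / (x * y) <= 2 * h / x ^+ 2.
  rewrite ler_pdivrMr; last exact: mulr_gt0.
  have -> : 2 * h / x ^+ 2 * (x * y) = 2 * h * y / x by field; rewrite gt_eqF.
  apply: (@le_trans _ _ h); first lra.
  rewrite ler_pdivlMr//; have hy : 0 <= h * (2 * y - x) by apply: mulr_ge0; lra.
  lra.
apply: (le_lt_trans (ler_wpM2r t0 k1)).
move: h2; rewrite ltr_pdivlMr// => h2.
rewrite mulrAC ltr_pdivrMr ?exprn_gt0//; lra.
Qed.

(** * Truncated LePage sums and their grid laws *)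

Section coupling.
Context d (T : measurableType d) (R : realType) (P : probability T R).
Notation V := (iseq R).

Lemma dle_coupling (X Y : T -> V) (mX : measurable_fun setT X) (mY : measurable_fun setT Y) D :
  measurable D -> (forall w, ~ D w -> X w = Y w) -> dle (law P mX) (law P mY) (pr P D).
Proof.
move=> mD XY B mB; rewrite /pr (lawE P mX) (lawE P mY) -/(pr P (X @^-1` B)) -/(pr P (Y @^-1` B)) -/(pr P D).
have mXB : measurable (X @^-1` B) by rewrite -[Z in measurable Z]setTI; exact: mX.
have mYB : measurable (Y @^-1` B) by rewrite -[Z in measurable Z]setTI; exact: mY.
rewrite -[X in _ + pr P X]setCK; apply: le_pr_near => //; first exact: measurableC.
by move=> w [/= Xw /XY <-].
Qed.

Lemma ble_coupling (X Y : T -> V) (mX : measurable_fun setT X) (mY : measurable_fun setT Y) D (e : R) :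
  measurable D -> (forall w, ~ D w -> forall k, `|X w k - Y w k| <= e) ->
  ble (law P mX) (law P mY) e (pr P D).
Proof.
move=> mD XY s; rewrite /pr (lawE P mX) (lawE P mY) -/(pr P (X @^-1` _)) -/(pr P (Y @^-1` _)) -/(pr P D).
have mXB : measurable (X @^-1` box s).
  by rewrite -[Z in measurable Z]setTI; apply: mX => //; exact: measurable_box.
have mYB : measurable (Y @^-1` box (box_up e s)).
  by rewrite -[Z in measurable Z]setTI; apply: mY => //; exact: measurable_box.
rewrite -[X in _ + pr P X]setCK; apply: le_pr_near => //; first exact: measurableC.
move=> w [/= Xw /XY h] p /mapP[q qs ->] /=.
have := h q.1; rewrite ler_norml => /andP[h1 _]; have := Xw q qs; lra.
Qed.

(** The hypothesis says that the upper limit of the events is empty, so the tail unions decrease to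
    the empty set. *)
Lemma cvg_pr_eventually (D : nat -> set T) : (forall n, measurable (D n)) ->
  (forall w, exists n0, forall n, (n0 <= n)%N -> ~ D n w) -> pr P (D n) @[n --> \oo] --> 0.
Proof.
move=> mD h; pose F n := \bigcup_(k >= n) D k.
have mF n : measurable (F n) by apply: bigcup_measurable.
have F0 : \bigcap_n F n = set0.
  apply/seteqP; split => w //= hw; have [n0 hn] := h w.
  by have [k /= /hn] := hw n0 I.
have c : P (F n) @[n --> \oo] --> 0%E.
  rewrite -(measure0 P) -F0; apply: nonincreasing_cvg_mu => //.
  - by rewrite (le_lt_trans (probability_le1 P _)) ?ltry.
  - by rewrite F0.
  - by move=> m n mn; rewrite subsetEset => w [k /= nk Dk]; exists k => //=; exact: leq_trans nk.
have c' : pr P (F n) @[n --> \oo] --> 0 by apply: fine_cvg.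
apply: (squeeze_cvgr _ (cvg_cst 0) c'); apply: nearW => n.
by rewrite pr_ge0/=; apply: le_pr => // w Dw; exists n => /=.
Qed.

End coupling.

Section truncated.
Context d (T : measurableType d) (R : realType) (P : probability T R).
Notation V := (iseq R).
Variables (G : nat -> T -> R) (E : nat -> R -> T -> R).
Hypothesis mG : forall i, measurable_fun setT (G i).
Hypothesis G0 : forall i w, 0 < G i w.
Hypothesis pE : forall i, is_process (E i).
Hypothesis sE : forall i, random_step_fun (E i).
Variables (tt : times R) (htt : nonneg_times tt).

Definition mark i (w : T) : V := obs (E i) (scale_times (G i w)^-1 tt) w.

Lemma obs_cell_near i w k : exists2 h1, 0 < h1 & forall h N, (0 < h < h1) ->
  G i w < N%:R * h ->
  obs (E i) (cell_times h N tt (cell h N (G i w))) w k = mark i w k.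
Proof.
rewrite /mark /obs /scale_times; case tk: (tt k) => [t|] /=; last first.
  exists 1 => // h N _ _; rewrite /cell_times; case: ifP => // _.
  by rewrite /scale_times tk.
have [h1 h10 hh] := step_fun_grid (@sE i w) (htt tk) (G0 i w).
exists h1 => // h N /andP[h0 hh1] GL.
have cN : (cell h N (G i w) < N)%N.
  rewrite ltnNge; apply/negP => Nc.
  have /(cell_ge h0 N (G0 i w)) : cell h N (G i w) = N by apply/eqP; rewrite eqn_leq Nc cell_le.
  by rewrite leNgt GL.
rewrite /cell_times cN /scale_times tk /=.
have -> : cell h N (G i w) = Num.truncn (G i w / h).
  by move: cN; rewrite /cell gtn_min ltnn /= => /ltnW/minn_idPr.
by rewrite hh// h0.
Qed.

Lemma measurable_mark i : measurable_fun setT (mark i).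
Proof.
apply: measurable_to_iseq => k.
(* Mesh 1/(n + 1) with (n + 1)^2 cells: the mesh tends to 0 while the grid reaches up to n + 1,
   hence eventually beyond [G i w]. *)
pose f n w := obs (E i) (cell_times (n.+1%:R^-1 : R) (n.+1 ^ 2) tt
                (cell n.+1%:R^-1 (n.+1 ^ 2) (G i w))) w k.
have h0 n : 0 < n.+1%:R^-1 :> R by rewrite invr_gt0.
apply: (measurable_fun_cvg (h := f)) => [n|w _].
  apply: (@measurable_pick _ _ T _ (fun w => cell n.+1%:R^-1 (n.+1 ^ 2) (G i w))
    (fun c w => obs (E i) (cell_times n.+1%:R^-1 (n.+1 ^ 2) tt c) w k)).
    by move=> c; exact: measurable_cell.
  move=> c; apply: (measurableT_comp (measurable_coord k)).
  by apply: measurable_obs => //; exact: nonneg_cell_times.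
have [h1 h10 hh] := obs_cell_near i w k.
apply: cvg_near_cst.
exists (maxn (Num.truncn h1^-1) (Num.truncn (G i w))) => // n /=.
rewrite geq_max => /andP[n1 n2]; apply: hh.
  rewrite h0 invf_plt ?posrE//; apply: lt_le_trans (truncnS_gt _) _.
  by rewrite ler_nat ltnS.
rewrite natrX expr2 -mulrA divff ?mulr1 ?pnatr_eq0//.
by apply: lt_le_trans (truncnS_gt _) _; rewrite ler_nat ltnS.
Qed.

Definition trunc_mark (L : R) i (w : T) : V := if G i w < L then mark i w else v0 R.

Lemma measurable_trunc_mark L i : measurable_fun setT (trunc_mark L i).
Proof.
apply: measurable_fun_ifT.
- by apply: measurable_fun_ltr => //; exact: measurable_cst.
- exact: measurable_mark.
- exact: measurable_cst.
Qed.

Definition trunc_sum L I : T -> V := vsum (trunc_mark L) (iota 0 I).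

Lemma measurable_trunc_sum L I : measurable_fun setT (trunc_sum L I).
Proof. by apply: measurable_vsum => i; exact: measurable_trunc_mark. Qed.

End truncated.

Section grid_approx.
Context d (T : measurableType d) (R : realType) (P : probability T R).
Notation V := (iseq R).
Variables (G : nat -> T -> R) (E : nat -> R -> T -> R).
Hypothesis HG : unit_poisson_pp P G.
Let mG i : measurable_fun setT (G i). Proof. by case: HG. Qed.
Let G0 i w : 0 < G i w. Proof. by case: HG => _ []. Qed.
Hypothesis pE : forall i, is_process (E i).
Hypothesis sE : forall i, random_step_fun (E i).
Hypothesis fddE : forall i, fdd_eq P P (E i) (E 0%N).
Hypothesis ind : mutually_independent P (mark_sigma G E).
Variables (tt : times R) (htt : nonneg_times tt) (K : nat).
Hypothesis fin_tt : forall k, (K <= k)%N -> tt k = None.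

Lemma mesh_gt0 (L : R) n : 0 < L -> 0 < L / n.+1%:R.
Proof. by move=> L0; rewrite divr_gt0. Qed.

Definition grid_law (L : R) (L0 : 0 < L) n : probability V R :=
  compound (NngNum (ltW (mesh_gt0 n L0))) (cell_law P pE htt (mesh_gt0 n L0) n.+1) n.+1.

Let bad (L : R) n i : set T :=
  [set w | G i w < L] `&` \bigcup_(k in [set k | (k < K)%N])
  [set w | obs (E i) (cell_times (L / n.+1%:R) n.+1 tt (cell (L / n.+1%:R) n.+1 (G i w))) w k
            != mark G E tt i w k].

Let measurable_bad L n i : 0 < L -> measurable (bad L n i).
Proof.
move=> L0; apply: measurableI.
  rewrite -[X in measurable X]setTI.
  by apply: measurable_fun_ltr => //; exact: measurable_cst.
apply: bigcup_measurable => k _; rewrite -[X in measurable X]setTI.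
have mf : measurable_fun setT (fun w => obs (E i) (cell_times (L / n.+1%:R) n.+1 tt
    (cell (L / n.+1%:R) n.+1 (G i w))) w k).
  apply: (@measurable_pick _ _ T _ (fun w => cell (L / n.+1%:R) n.+1 (G i w))
    (fun c w => obs (E i) (cell_times (L / n.+1%:R) n.+1 tt c) w k)).
    by move=> c; apply: measurable_cell => //; exact: mesh_gt0.
  move=> c; apply: (measurableT_comp (measurable_coord k)).
  by apply: measurable_obs => //; apply: nonneg_cell_times => //; exact: mesh_gt0.
have mg := measurableT_comp (measurable_coord k) (measurable_mark mG G0 pE sE htt i).
by apply: measurable_neg => //; exact: measurable_fun_eqr.
Qed.

Let bad_eventually L i w : 0 < L -> exists n0, forall n, (n0 <= n)%N -> ~ bad L n i w.
Proof.
move=> L0.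
have key M : exists2 h1, 0 < h1 & forall h N k, (k < M)%N -> (0 < h < h1) -> G i w < N%:R * h ->
    obs (E i) (cell_times h N tt (cell h N (G i w))) w k = mark G E tt i w k.
  elim: M => [|M [h1 h10 ih]]; first by exists 1.
  have [h2 h20 hM] := @obs_cell_near _ _ _ G E G0 sE tt htt i w M.
  exists (Num.min h1 h2); first by rewrite lt_min h10.
  move=> h N k; rewrite ltnS leq_eqVlt lt_min => /orP[/eqP ->|kM] /and3P[h0 hh1 hh2] GN.
    by apply: hM => //; rewrite h0.
  by apply: ih => //; rewrite h0.
have [h1 h10 hh] := key K; exists (Num.truncn (L / h1)) => n nn [/= GL [k /= kK]].
rewrite hh ?eqxx//.
  rewrite mesh_gt0// ltr_pdivrMr// mulrC -ltr_pdivrMr//.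
  by apply: lt_le_trans (truncnS_gt _) _; rewrite ler_nat ltnS.
by rewrite mulrCA divff ?mulr1// pnatr_eq0.
Qed.

(** The index [I0] is fixed before the mesh, from the tail of the points below [L]. Only the
    roundings of the first [I0] points must then be controlled, which allows all later [I] at
    once. *)
Lemma dle_trunc_grid (L : R) (L0 : 0 < L) (e : R) : 0 < e ->
  exists n0, forall n, (n0 <= n)%N -> exists I0, forall I, (I0 <= I)%N ->
    dle (law P (measurable_trunc_sum mG G0 pE sE htt L I)) (grid_law L0 n) e.
Proof.
move=> e0.
have mb : measurable (below L) by exact: measurable_itv.
have bpos : below L `<=` `]0, +oo[%classic by move=> x; rewrite /below /= !in_itv/= => /andP[->].
have bfin : (@lebesgue_measure R (below L) < +oo)%E.
  by rewrite /below lebesgue_measure_itv/= lte_fin L0 ltry.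
have ct := @cvg_tail_points _ _ _ P G HG (below L) mb bpos bfin.
have mt I : measurable (tail_points G (below L) I) by exact: (measurable_tail_points HG mb).
have e4 : 0 < e / 4 by rewrite divr_gt0.
have /cvgrPdist_lt /(_ _ e4) [I0 _ hI0] := ct.
have small_tail I : (I0 <= I)%N -> pr P (tail_points G (below L) I) <= e / 4.
  by move=> /hI0 /=; rewrite sub0r normrN ger0_norm ?pr_ge0// => /ltW.
have cb M : (\sum_(i < M) pr P (bad L n i)) @[n --> \oo] --> 0.
  elim: M => [|M ih]; first by under eq_fun do rewrite big_ord0; exact: cvg_cst.
  have sE' : (fun n => \sum_(i < M.+1) pr P (bad L n i)) =
      (fun n => \sum_(i < M) pr P (bad L n i) + pr P (bad L n M)).
    by apply/funext => n; rewrite big_ord_recr.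
  suff h : pr P (bad L n M) @[n --> \oo] --> 0.
    by rewrite sE'; have h2 := cvgD ih h; rewrite addr0 in h2; exact: h2.
  apply: cvg_pr_eventually => [n|w]; first exact: measurable_bad.
  exact: bad_eventually.
have /cvgrPdist_lt /(_ _ e4) [n1 _ hn1] := cb I0.
have cL : (L ^+ 2 * n.+1%:R^-1) @[n --> \oo] --> L ^+ 2 * 0.
  by apply: cvgMr; exact: cvg_harmonic.
rewrite mulr0 in cL; have /cvgrPdist_lt /(_ _ e4) [n2 _ hn2] := cL.
exists (maxn n1 n2) => n; rewrite geq_max => /andP[/hn1 h1 /hn2 h2].
exists I0 => I II0.
have step1 := @dle_compound_grid _ _ _ P G HG E pE fddE ind tt htt _ (mesh_gt0 n L0) n.+1 I.
pose D := tail_points G (below L) I0 `|` \big[setU/set0]_(i < I0) bad L n i.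
have mD : measurable D.
  by apply: measurableU => //; apply: bigsetU_measurable => i _; exact: measurable_bad.
have step2 : dle (law P (@measurable_grid_sum d T R G E mG G0 pE tt htt _ (mesh_gt0 n L0) n.+1 I))
   (law P (measurable_trunc_sum mG G0 pE sE htt L I)) (pr P D).
  apply: dle_coupling => // w nD; apply/funext => k.
  rewrite /grid_sum /trunc_sum /vsum; apply: eq_big_seq => i _.
  have nh : n.+1%:R * (L / n.+1%:R) = L by rewrite mulrCA divff ?mulr1// pnatr_eq0.
  rewrite /trunc_mark; case: ltP => [GL|LG]; last first.
    have /(cell_ge (mesh_gt0 n L0) n.+1 (G0 i w)) : n.+1%:R * (L / n.+1%:R) <= G i w by rewrite nh.
    by move=> ->; rewrite /cell_times ltnn.
  have iI0 : (i < I0)%N.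
    rewrite ltnNge; apply/negP => Ii; apply: nD; left; exists i => //=.
    by rewrite /below /= in_itv/= G0.
  have [kK|Kk] := ltnP k K; last first.
    rewrite /mark /obs /cell_times /scale_times fin_tt//.
    by case: ifP => //= _; rewrite fin_tt.
  apply: contrapT => /eqP hne; apply: nD; right; rewrite -bigcup_seq /=.
  by exists (Ordinal iI0); rewrite /= ?mem_index_enum//; split => //; exists k.
have := dleC (dle_trans step1 step2); apply: dle_le.
have -> : n.+1%:R * (L / n.+1%:R) ^+ 2 = L ^+ 2 * n.+1%:R^-1.
  by field; rewrite addrC natr1 pnatr_eq0.
have -> : n.+1%:R * (L / n.+1%:R) = L by rewrite mulrCA divff ?mulr1// pnatr_eq0.
have t1 := small_tail _ II0; have t0 := small_tail _ (leqnn I0).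
have t2 : pr P D <= e / 4 + e / 4.
  apply: (le_trans (prU_le _ _ _)) => //.
    by apply: bigsetU_measurable => i _; exact: measurable_bad.
  apply: lerD => //; apply: (le_trans (pr_sum_le _ _ _)).
    by move=> i; exact: measurable_bad.
  by move: h1 => /=; rewrite sub0r normrN => /ltW; apply: le_trans; exact: ler_norm.
have t3 : L ^+ 2 * n.+1%:R^-1 <= e / 4.
  by move: h2 => /=; rewrite sub0r normrN => /ltW; apply: le_trans; exact: ler_norm.
apply: (le_trans (lerD (lerD t3 t1) t2)).
by rewrite le_eqVlt; apply/orP; left; apply/eqP; field.
Qed.

End grid_approx.

(** * Tails of LePage sums *)

Section image_measure.
Context d1 d2 (T1 : measurableType d1) (T2 : measurableType d2) (R : realType).

Definition image_measure (m : {measure set T1 -> \bar R}) (f : T1 -> T2)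
  (mf : measurable_fun setT f) : {measure set T2 -> \bar R}.
Proof.
pose m' : {measure set T2 -> \bar R} := pushforward m f.
exact: (m' mf).
Defined.

Lemma image_measureE m f mf A : @image_measure m f mf A = m (f @^-1` A).
Proof. by []. Qed.

Lemma ge0_integral_image m f mf D g : measurable D -> measurable_fun D g ->
  {in D, forall y, (0 <= g y)%E} ->
  (\int[@image_measure m f mf]_(y in D) g y = \int[m]_(x in f @^-1` D) g (f x))%E.
Proof. by move=> mD mg g0; rewrite -(ge0_integral_pushforward mf m mD mg g0). Qed.

End image_measure.

(** * The change of variables s = t / x *)

Section inversion.
Variable R : realType.
Let mu := @lebesgue_measure R.
Let pos : set R := `]0, +oo[%classic.

Let mpos : measurable pos. Proof. exact: measurable_itv. Qed.

Lemma measurable_invr : measurable_fun [set: R] (fun x : R => x^-1).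
Proof.
rewrite -(setvU [set 0 : R]); apply/measurable_funU => //; first exact: measurableC.
split; last exact: measurable_fun_set1.
apply: open_continuous_measurable_fun.
  by rewrite openC; exact: closed_eq.
by move=> x; rewrite inE /= => /eqP x0; exact: inv_continuous.
Qed.

Variables (t : R) (t0 : 0 < t).

Let inv_t (x : R) : R := x^-1 * t.

Let minv : measurable_fun [set: R] inv_t.
Proof. by apply: measurable_funM; [exact: measurable_invr|exact: measurable_cst]. Qed.

Let nu := image_measure mu minv.

Let dens (s : R) : R := if 0 < s then t / s ^+ 2 else 0.

Let mdens : measurable_fun [set: R] dens.
Proof.
apply: measurable_fun_ifT.
- by apply: measurable_fun_ltr; [exact: measurable_cst|exact: measurable_id].
- apply: measurable_funM; first exact: measurable_cst.
  apply: (measurableT_comp measurable_invr); apply: measurable_funX; exact: measurable_id.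
- exact: measurable_cst.
Qed.

(* The measure with density [t / s^2] is realized as the image of the area under
   the graph of its density. *)
Let sub : set (R * R) := [set p | 0 < p.2 /\ p.2 < dens p.1].

Let msub : measurable sub.
Proof.
rewrite (_ : sub = [set p | 0 < p.2] `&` [set p | p.2 < dens p.1])//.
have m2 : measurable_fun [set: R * R] (fun p : R * R => dens p.1).
  exact: (measurableT_comp mdens measurable_fst).
by apply: measurableI; rewrite -[X in measurable X]setTI; apply: measurable_fun_ltr.
Qed.

(** Points outside the area under the graph are sent to -1, where subsets of [pos] do not see
    them. *)
Let phi (p : R * R) : R := if (0 < p.2) && (p.2 < dens p.1) then p.1 else -1.

Let mphi : measurable_fun setT phi.
Proof.
have m2 : measurable_fun [set: R * R] (fun p : R * R => dens p.1).
  exact: (measurableT_comp mdens measurable_fst).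
apply: measurable_fun_ifT.
- by apply: measurable_and; apply: measurable_fun_ltr.
- exact: measurable_fst.
- exact: measurable_cst.
Qed.

Let rho := image_measure (mu \x mu)%E mphi.

Let dens0 s : 0 <= dens s.
Proof. by rewrite /dens; case: ifP => // s0; rewrite divr_ge0 ?sqr_ge0 ?ltW. Qed.

Let section_sub s : mu (xsection sub s) = (dens s)%:E.
Proof.
rewrite (_ : xsection sub s = `]0, dens s[%classic).
  rewrite /mu lebesgue_measure_itv/= lte_fin; case: ltP => h; first by rewrite -EFinB subr0.
  by congr EFin; apply/eqP; rewrite eq_le h dens0.
by apply/seteqP; split => y; rewrite /xsection /= inE /sub /= in_itv /=;
  [move=> [-> ->]|move=> /andP].
Qed.

Let phi_pre A : A `<=` pos -> phi @^-1` A = [set p | sub p /\ A p.1].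
Proof.
move=> Apos; apply/seteqP; split => -[s y] /=; rewrite /phi /sub /=.
  case: ifP => [/andP[y0 ys] As|_ /Apos]; first by [].
  by rewrite /pos /= in_itv/= andbT oppr_gt0 ltNge ler01.
by move=> [[-> ->]].
Qed.

Let rhoE A : measurable A -> A `<=` pos -> rho A = (\int[mu]_(s in A) (dens s)%:E)%E.
Proof.
move=> mA Apos; rewrite /rho image_measureE phi_pre// /product_measure1.
rewrite [RHS]integral_mkcond; apply: eq_integral => s _ /=; rewrite patchE.
case: ifPn => [|]; rewrite ?inE ?notin_setE => sA.
  rewrite -section_sub; congr (mu _); apply/seteqP; split => y; rewrite /xsection /= !inE /=.
    by move=> [].
  by move=> h; split.
rewrite (_ : xsection _ _ = set0) ?measure0//; apply/seteqP; split => y //.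
by rewrite /xsection /= inE => -[].
Qed.

Let nu_ray b : 0 < b -> nu `]b, +oo[%classic = (t / b)%:E.
Proof.
move=> b0; have h : mu `]0, t / b[%classic = (t / b)%:E.
  by rewrite /mu lebesgue_measure_itv/= lte_fin divr_gt0// -EFinB subr0.
rewrite /nu image_measureE (_ : _ @^-1` _ = `]0, t / b[%classic)//.
apply/seteqP; split => x; rewrite /inv_t /= !in_itv/= !andbT.
  move=> bx; have x0 : 0 < x.
    rewrite -invr_gt0 -(@pmulr_lgt0 _ t)//; exact: lt_trans bx.
  by rewrite x0/= ltr_pdivlMr// mulrC -ltr_pdivlMr// mulrC.
by move=> /andP[x0 xt]; rewrite mulrC ltr_pdivlMr// mulrC -ltr_pdivlMr.
Qed.

Let rho_ray b : 0 < b -> rho `]b, +oo[%classic = (t / b)%:E.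
Proof.
move=> b0; have bpos : `]b, +oo[%classic `<=` pos.
  by move=> x; rewrite /pos /= !in_itv/= !andbT; exact: lt_trans.
rewrite (rhoE (measurable_itv _) bpos).
rewrite integral_itv_obnd_cbnd; last first.
  by apply/measurable_EFinP; apply: measurable_funTS.
have -> : (\int[mu]_(x in `[b, +oo[) (dens x)%:E = \int[mu]_(x in `[b, +oo[) (t / x ^+ 2)%:E)%E.
  apply: eq_integral => x; rewrite inE /= in_itv/= andbT => bx.
  by rewrite /dens (lt_le_trans b0 bx).
have cV (x : R) : 0 < x -> {for x, continuous (@GRing.inv R)}.
  by move=> x0; apply: inv_continuous; rewrite gt_eqF.
have dF (x : R) : 0 < x -> is_derive x 1 (fun s : R => - (t * s^-1)) (t / x ^+ 2).
  move=> x0; have xn0 : x != 0 by rewrite gt_eqF.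
  have h1 := @is_deriveV R id x 1 1 xn0 (is_derive_id _ _).
  have h2 : is_derive x 1 (fun s : R => - (t *: s^-1)) (- (t *: (- x ^- 2 *: 1))).
    by apply: is_deriveN; apply: is_deriveZ.
  apply: is_derive_eq h2 _.
  by rewrite /GRing.scale /= mulr1 mulrN opprK.
rewrite (@ge0_continuous_FTC2y _ (fun x => t / x ^+ 2) (fun s => - (t * s^-1)) b 0).
- by rewrite -EFinB sub0r opprK.
- by move=> x bx; rewrite divr_ge0 ?sqr_ge0// ltW.
- apply: continuous_in_subspaceT => x; rewrite inE /= in_itv/= andbT => bx.
  have x0 : 0 < x by exact: lt_le_trans bx.
  apply: cvgM; first exact: cvg_cst.
  by apply: cvgV; [rewrite expf_neq0// gt_eqF|exact: exprn_continuous].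
- apply/cvgrPdist_le => e e0; near=> x.
  have x0 : 0 < x by near: x; exact: nbhs_pinfty_gt.
  have tx0 : 0 <= t / x by rewrite divr_ge0 // ltW.
  rewrite sub0r opprK (ger0_norm tx0) ler_pdivrMr//.
  rewrite mulrC -ler_pdivrMr//; apply: ltW; near: x; exact: nbhs_pinfty_gt.
- by move=> x bx; have [] := dF x (lt_trans b0 bx).
- apply: cvg_at_right_filter; apply: cvgN; apply: cvgM; first exact: cvg_cst.
  exact: cV.
- move=> x; rewrite in_itv/= andbT => bx; rewrite derive1E.
  by have h := dF x (lt_trans b0 bx); rewrite derive_val.
Unshelve. all: by end_near. Qed.

(** Both measures are infinite near 0 but finite on each ray, so they are identified on the rays
    first and then on [pos] by an increasing union. *)
Let ray n : set R := `]n.+1%:R^-1, +oo[%classic.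

Let nu_eq_ray n A : measurable A -> nu (ray n `&` A) = rho (ray n `&` A).
Proof.
move=> mA; have mr : measurable (ray n) by exact: measurable_itv.
have r0 : 0 < n.+1%:R^-1 :> R by rewrite invr_gt0.
have := @measure_unique _ R _ (RGenOInfty.G (R := R)) (fun k => `](- k%:R), +oo[%classic : set R)
   _ _ _ _ (mrestr nu mr) (mrestr rho mr) _ _ A mA.
rewrite /= /mrestr ![ray n `&` _]setIC; apply.
- exact: RGenOInfty.measurableE.
- move=> _ _ [x ->] [y ->]; exists (Num.max x y).
  by apply/seteqP; split => z; rewrite /ray /= !in_itv/= !andbT gt_max; [move=> [-> ->]|move=> /andP].
- by move=> k; exists (- k%:R).
- apply/seteqP; split => // x _; exists (Num.truncn `|x|).+1 => //=; rewrite in_itv/= andbT.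
  by rewrite ltrNl; apply: le_lt_trans (truncnS_gt _); rewrite -normrN ler_norm.
- move=> _ [x ->]; rewrite (_ : _ `&` _ = `]Num.max x n.+1%:R^-1, +oo[%classic).
    by rewrite nu_ray ?rho_ray// lt_max r0 orbT.
  by apply/seteqP; split => z; rewrite /ray /= !in_itv/= !andbT gt_max; [move=> [-> ->]|move=> /andP].
- move=> k; apply: (@le_lt_trans _ _ (nu (ray n))).
    by apply: le_measure; rewrite ?inE//; apply: measurableI => //; exact: measurable_itv.
  by rewrite nu_ray// ltry.
Qed.

Let nu_eq A : measurable A -> A `<=` pos -> nu A = rho A.
Proof.
move=> mA Apos; pose F n := ray n `&` A.
have mF n : measurable (F n) by apply: measurableI => //; exact: measurable_itv.
have UF : \bigcup_n F n = A.
  apply/seteqP; split => x; first by move=> [n _ []].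
  move=> Ax; exists (Num.truncn x^-1) => //; split => //.
  have := Apos _ Ax; rewrite /ray /pos /= !in_itv/= !andbT => x0.
  by rewrite invf_plt ?posrE//; exact: truncnS_gt.
have ndF : nondecreasing_seq F.
  move=> m n mn; rewrite subsetEset => x [rx Ax]; split => //.
  move: rx; rewrite /ray /= !in_itv/= !andbT; apply: le_lt_trans.
  by rewrite lef_pV2 ?posrE// ler_nat.
have mU : measurable (\bigcup_n F n) by exact: bigcupT_measurable.
have c1 := nondecreasing_cvg_mu (mu := nu) mF mU ndF.
have c2 := nondecreasing_cvg_mu (mu := rho) mF mU ndF.
rewrite UF in c1 c2; rewrite -(cvg_lim _ c1)// -(cvg_lim _ c2)//.
by apply: congr_lim; apply/funext => n /=; exact: nu_eq_ray.
Qed.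

Lemma integral_inversion (f : R -> \bar R) : measurable_fun setT f -> (forall x, 0 <= f x)%E ->
  (\int[mu]_(x in pos) f (x^-1 * t)%R = \int[mu]_(s in pos) (f s * (t / s ^+ 2)%R%:E))%E.
Proof.
move=> mf f0.
have -> : (\int[mu]_(x in pos) f (x^-1 * t)%R = \int[nu]_(s in pos) f s)%E.
  rewrite /nu ge0_integral_image//; last exact: measurable_funTS.
  congr (integral mu _ _); apply/seteqP; split => x; rewrite /pos /inv_t /= !in_itv/= !andbT.
    by move=> x0; rewrite mulr_gt0// invr_gt0.
  by rewrite pmulr_lgt0// invr_gt0.
rewrite (eq_measure_integral rho); last by move=> A mA; exact: nu_eq.
rewrite /rho ge0_integral_image//; last exact: measurable_funTS.
rewrite phi_pre// (_ : [set p | sub p /\ pos p.1] = sub); last first.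
  apply/seteqP; split => -[s y] /=; first by case.
  move=> [/= y0 ys]; split => //; rewrite /pos /= in_itv/= andbT.
  by move: (lt_trans y0 ys); rewrite /dens; case: ifP => //; rewrite ltxx.
have -> : (\int[mu \x mu]_(p in sub) f (phi p) =
    \int[mu \x mu]_p (f p.1 * (\1_sub p)%:E))%E.
  rewrite integral_mkcond; apply: eq_integral => p _; rewrite patchE indicE.
  case: ifPn => ps; last by rewrite mule0.
  by rewrite mule1 /phi; move: ps; rewrite inE => -[-> ->].
rewrite fubini_tonelli1//=; first last.
- by move=> p; rewrite mule_ge0// lee_fin.
- apply: emeasurable_funM; first exact: (measurableT_comp mf measurable_fst).
  by apply/measurable_EFinP; exact: measurable_indic.
rewrite [RHS]integral_mkcond; apply: eq_integral => s _; rewrite /fubini_F /= patchE.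
have msec : measurable (xsection sub s) by exact: measurable_xsection.
have secE : (fun y => (\1_sub (s, y))%:E) = (fun y => (\1_(xsection sub s) y)%:E) :> (R -> \bar R).
  by apply/funext => y; rewrite !indicE mem_xsection.
rewrite ge0_integralZl//=; last first.
  by rewrite secE; apply/measurable_EFinP; exact: measurable_indic.
have -> : (\int[mu]_y (\1_sub (s, y))%:E = (dens s)%:E)%E.
  by rewrite secE integral_indic// setIT; exact: section_sub.
have -> : (s \in pos) = (0 < s) by apply/idP/idP; rewrite inE /pos /= in_itv/= andbT.
by rewrite /dens; case: ifP => // _; exact: mule0.
Qed.

End inversion.

Section measurable_limit.
Context d (T : measurableType d) (R : realType).

(** Countable quantifiers only, which makes the set of convergence measurable. *)
Lemma cvgn_cauchyP (u : nat -> R) : cvgn u <->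
  (forall m, exists N, forall n, (N <= n)%N -> `|u n - u N| < m.+1%:R^-1).
Proof.
split=> [/cvg_ex[l ul] m|h].
  have e0 : 0 < m.+1%:R^-1 / 2 :> R by rewrite divr_gt0// invr_gt0.
  have /cvgrPdist_lt /(_ _ e0) [N _ hN] := ul.
  exists N => n Nn; have := hN _ Nn; have := hN _ (leqnn N) => /= h1 h2.
  have -> : u n - u N = (l - u N) - (l - u n) by ring.
  by apply: (le_lt_trans (ler_normB _ _)); rewrite [ltRHS]splitr ltrD.
apply/cauchy_cvgP; apply/cauchy_exP => e e0.
have [N hN] := h (Num.truncn e^-1); exists (u N); exists N => // n /= Nn.
rewrite /ball /= distrC; apply: (lt_trans (hN _ Nn)).
by rewrite invf_plt ?posrE//; exact: truncnS_gt.
Qed.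

Lemma measurable_limn (u : nat -> T -> R) : (forall n, measurable_fun setT (u n)) ->
  measurable_fun setT (fun w => limn (u ^~ w)).
Proof.
move=> mu; pose C := [set w | cvgn (u ^~ w)].
have mC : measurable C.
  rewrite (_ : C = \bigcap_m \bigcup_N \bigcap_(n in [set n | (N <= n)%N])
      [set w | `|u n w - u N w| < m.+1%:R^-1]).
    apply: bigcapT_measurable => m; apply: bigcupT_measurable => N.
    apply: bigcap_measurable => [|n _]; first by exists N => /=.
    rewrite -[X in measurable X]setTI.
    have mn : measurable_fun setT (fun w => `|u n w - u N w|).
      by apply: measurableT_comp => //; exact: measurable_funB.
    rewrite (_ : [set w | _] = (fun w => `|u n w - u N w|) @^-1` `]-oo, m.+1%:R^-1[%classic).
      by apply: mn => //; exact: measurable_itv.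
    by apply/seteqP; split => w; rewrite /= in_itv.
  apply/seteqP; split => w /=.
    by move=> /cvgn_cauchyP h m _; have [N hN] := h m; exists N.
  move=> h; apply/cvgn_cauchyP => m; have [N _ hN] := h m I; exists N => n Nn; exact: hN.
(* Where the sequence diverges, [limn] is the default value [point], so the approximants are given
   that value there. *)
apply: (measurable_fun_cvg (h := fun n w => if w \in C then u n w else point)).
  move=> n; apply: measurable_fun_ifT => //.
  apply: (measurable_fun_bool true); rewrite setTI.
  rewrite (_ : _ @^-1` _ = C)//; apply/seteqP; split => w /=; first by move=> /set_mem.
  by move=> Cw; rewrite mem_set.
move=> w _; have [wC|wC] := pselect (C w).
  by rewrite (mem_set wC); exact: wC.
rewrite (_ : w \in C = false); last by apply/negbTE; rewrite notin_setE.
by rewrite (dvgP wC); exact: cvg_cst.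
Qed.

End measurable_limit.

(** * Expected sums over the Poisson points *)

Section campbell.
Context d (T : measurableType d) (R : realType) (P : probability T R).
Let pos : set R := `]0, +oo[%classic.

(** The sample space is viewed with the smaller sigma-algebra generated by [C]. The pair formed by
    [X] and the identity into that space then has a product law, although [X] is a function on the
    same space. *)
Lemma indep_fubini (X : T -> R) (mX : measurable_fun setT X) (C : set (set T))
  (Cm : C `<=` measurable) (f : R -> T -> \bar R) :
  (forall A B, measurable A -> <<s C >> B -> P (X @^-1` A `&` B) = (P (X @^-1` A) * P B)%E) ->
  measurable_fun setT (fun p : R * g_sigma_algebraType C => f p.1 p.2) ->
  (forall x w, 0 <= f x w)%E ->
  (\int[P]_w f (X w) w = \int[law P mX]_x \int[P]_w f x w)%E.
Proof.
move=> ind mf f0; pose U := g_sigma_algebraType C.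
have mid : measurable_fun setT (id : T -> U).
  move=> _ B mB; rewrite setTI.
  by apply: (smallest_sub (@sigma_algebra_measurable _ T) Cm).
have mXU : measurable_fun setT (fun w => (X w, w : U)) by exact: measurable_fun_pair.
pose PU := law P mid.
transitivity (\int[image_measure P mXU]_p f p.1 p.2)%E.
  by rewrite ge0_integral_image// => p _; exact: f0.
transitivity (\int[law P mX \x PU]_p f p.1 p.2)%E.
  apply: eq_measure_integral => A mA _; apply/esym; apply: product_measure_unique mA.
  move=> A1 B1 mA1 mB1; rewrite image_measureE (_ : _ @^-1` _ = X @^-1` A1 `&` B1)//.
  exact: ind.
rewrite fubini_tonelli1//; apply: eq_integral => x _; rewrite /fubini_F /=.
transitivity (\int[image_measure P mid]_w f x w)%E; first by apply: eq_measure_integral.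
have mfx : measurable_fun setT (f x : U -> \bar R).
  have mx : measurable_fun setT (fun w : U => (x, w)).
    by apply: measurable_fun_pair => //; exact: measurable_cst.
  exact: (measurableT_comp mf mx).
by rewrite ge0_integral_image// => p _; exact: f0.
Qed.

Variable G : nat -> T -> R.
Hypothesis HG : unit_poisson_pp P G.
Let mG i : measurable_fun setT (G i). Proof. by case: HG. Qed.
Let G0 i w : 0 < G i w. Proof. by case: HG => _ []. Qed.

(** The sum of the laws of the [G i] agrees with Lebesgue measure on bounded sets by
    [mean_point_count], and then on all of [pos] by an increasing union. *)
Lemma campbell (g : R -> \bar R) : measurable_fun setT g -> (forall x, 0 <= g x)%E ->
  (\sum_(i <oo) \int[P]_w g (G i w) = \int[@lebesgue_measure R]_(x in pos) g x)%E.
Proof.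
move=> mg g0; have mpos : measurable pos by exact: measurable_itv.
pose m i : {measure set R -> \bar R} := image_measure P (mG i).
transitivity (\sum_(i <oo) \int[m i]_(x in pos) g x)%E.
  apply: eq_eseriesr => i _; rewrite ge0_integral_image//; last exact: measurable_funTS.
  congr (integral P _ _); apply/seteqP; split => w //= _.
  by rewrite /pos /= in_itv/= G0.
rewrite -ge0_integral_measure_series//; last exact: measurable_funTS.
pose M : {measure set R -> \bar R} := mseries m 0.
have mid : measurable_fun setT (id : measurableTypeR R -> R) by move=> _ B mB; rewrite setTI.
pose mu := image_measure (@lebesgue_measure R) mid.
transitivity (\int[mu]_(x in pos) g x)%E; last first.
  by rewrite ge0_integral_image//; exact: measurable_funTS.
transitivity (\int[M]_(x in pos) g x)%E => //.
rewrite (eq_measure_integral mu) // => A mA Apos.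
pose F n := below (n%:R : R) `&` A.
have mb n : measurable (below (n%:R : R)) by exact: measurable_itv.
have mF n : measurable (F n) by exact: measurableI.
have UF : \bigcup_n F n = A.
  apply/seteqP; split => x; first by move=> [n _ []].
  move=> Ax; exists (Num.truncn x).+1 => //; split => //.
  have := Apos _ Ax; rewrite /below /pos /= !in_itv/= !andbT => -> /=.
  exact: truncnS_gt.
have ndF : nondecreasing_seq F.
  move=> k n kn; rewrite subsetEset => x [rx Ax]; split => //.
  move: rx; rewrite /below /= !in_itv/= => /andP[-> /= xk].
  by apply: (lt_le_trans xk); rewrite ler_nat.
have mU : measurable (\bigcup_n F n) by exact: bigcupT_measurable.
have c1 := nondecreasing_cvg_mu (mu := mseries m 0) mF mU ndF.
have c2 := nondecreasing_cvg_mu (mu := mu) mF mU ndF.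
rewrite UF in c1 c2; rewrite -(cvg_lim _ c1)// -(cvg_lim _ c2)//.
apply: congr_lim; apply/funext => n /=.
apply: (mean_point_count HG) => //.
- by move=> x [_ /Apos].
- apply: (@le_lt_trans _ _ (@lebesgue_measure R (below n%:R))).
    change (mu (F n) <= mu (below n%:R))%E; apply: le_measure; [exact: mem_set|exact: mem_set|by move=> x []].
  rewrite /below lebesgue_measure_itv/=; case: ifP => _; last exact: ltry.
  by rewrite -EFinB ltry.
Qed.

End campbell.

Section joint.
Variable R : realType.
Definition posify (x : R) : R := if 0 < x then x else 1.

(** [posify] makes every real a legitimate point, so that results on positive random points apply to
    a free real variable. *)
Lemma posify_gt0 x : 0 < posify x. Proof. by rewrite /posify; case: ifP. Qed.

Lemma posify_id x : 0 < x -> posify x = x. Proof. by rewrite /posify => ->. Qed.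

Lemma measurable_posify : measurable_fun setT posify.
Proof.
by apply: measurable_fun_ifT => //; apply: measurable_fun_ltr.
Qed.

(** Joint measurability in point and sample is an instance of [measurable_mark]: on the product
    space the first coordinate plays the random point. *)
Lemma measurable_step_joint d (U : measurableType d) (X : R -> U -> R) t :
  is_process X -> random_step_fun X -> 0 <= t ->
  measurable_fun setT (fun p : R * U => X ((posify p.1)^-1 * t) p.2).
Proof.
move=> pX sX t0; pose E (i : nat) s (p : R * U) := X s p.2.
pose tt : times R := fun=> Some t.
have htt : nonneg_times tt by move=> k s [<-].
have mG (i : nat) : measurable_fun setT (fun p : R * U => posify p.1).
  exact: (measurableT_comp measurable_posify measurable_fst).
have G0 (i : nat) (p : R * U) : 0 < posify p.1 by exact: posify_gt0.
have pE i : is_process (E i).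
  by move=> s s0; exact: (measurableT_comp (pX s s0) measurable_snd).
have sE i : random_step_fun (E i) by move=> p; exact: sX.
have := measurable_mark mG G0 pE sE htt 0%N.
by move=> /(measurableT_comp (measurable_coord 0%N)).
Qed.

End joint.

Section sigma_process.
Context d (T : measurableType d) (R : realType).

Definition proc_gen (X : R -> T -> R) : set (set T) :=
  \bigcup_(t in [set t : R | 0 <= t]) preimage_set_system [set: T] (X t) measurable.

Lemma proc_gen_measurable X : is_process X -> proc_gen X `<=` measurable.
Proof. by move=> pX _ [t t0 [B mB <-]]; apply: pX. Qed.

Lemma is_process_gen X : is_process (X : R -> g_sigma_algebraType (proc_gen X) -> R).
Proof.
move=> t t0 _ B mB; rewrite setTI; apply: sub_sigma_algebra.
by exists t => //; exists B => //; rewrite setTI.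
Qed.

End sigma_process.

Section expected_tail.
Context d (T : measurableType d) (R : realType) (P : probability T R).
Let pos : set R := `]0, +oo[%classic.
Let mu := @lebesgue_measure R.

Let mpos : measurable pos. Proof. exact: measurable_itv. Qed.

Definition clip (X : R -> T -> R) (t x : R) (w : T) : R :=
  Num.min 1 `|X ((posify x)^-1 * t) w|.

Lemma clip_ge0 X t x w : 0 <= clip X t x w. Proof. by rewrite /clip le_min ler01 normr_ge0. Qed.

Definition mean_clip X t x : \bar R := (\int[P]_w (clip X t x w)%:E)%E.

Lemma mean_clip_ge0 X t x : (0 <= mean_clip X t x)%E.
Proof. by apply: integral_ge0 => w _; rewrite lee_fin clip_ge0. Qed.

Variable X : R -> T -> R.
Hypotheses (pX : is_process X) (sX : random_step_fun X).

Lemma measurable_clip t : 0 <= t -> measurable_fun setT (fun p : R * T => clip X t p.1 p.2).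
Proof.
move=> t0; apply: measurable_minr; first exact: measurable_cst.
exact: (measurableT_comp _ (measurable_step_joint pX sX t0)).
Qed.

Lemma measurable_mean_clip t : 0 <= t -> measurable_fun setT (mean_clip X t).
Proof.
move=> t0; apply: (@measurable_fun_fubini_tonelli_F _ _ _ _ _ P (fun p => (clip X t p.1 p.2)%:E)).
- by apply/measurable_EFinP; exact: measurable_clip.
- by move=> p; rewrite lee_fin clip_ge0.
Qed.

Lemma mean_clip_scale t x : 0 < t -> 0 < x -> mean_clip X t x = mean_clip X 1 (x^-1 * t)^-1.
Proof.
move=> t0 x0; apply: eq_integral => w _; rewrite /clip !posify_id ?invr_gt0 ?mulr_gt0 ?invr_gt0//.
by rewrite invrK mulr1.
Qed.

Hypothesis fX : (\int[P]_w (\int[mu]_(t in pos)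
   ((Num.min 1 `|X t w|) / t ^+ 2)%:E) < +oo)%E.

(** This is where the weight 1/t^2 of the integrability condition enters: the substitution s = t / x
    turns the unit intensity of the points x into t / s^2 ds, and Tonelli exchanges the
    integrals. *)
Lemma integral_mean_clip t : 0 < t -> (\int[mu]_(x in pos) mean_clip X t x < +oo)%E.
Proof.
move=> t0; pose H s := mean_clip X 1 s^-1.
have mH : measurable_fun setT H.
  exact: (measurableT_comp (measurable_mean_clip ler01) (@measurable_invr R)).
have H0 s : (0 <= H s)%E by exact: mean_clip_ge0.
have -> : (\int[mu]_(x in pos) mean_clip X t x = \int[mu]_(x in pos) H (x^-1 * t)%R)%E.
  apply: eq_integral => x; rewrite inE /pos /= in_itv/= andbT => x0.
  by rewrite mean_clip_scale.
rewrite integral_inversion//.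
have mid : measurable_fun setT (id : measurableTypeR R -> R) by move=> _ B mB; rewrite setTI.
have m2 := measurableT_comp mid (@measurable_snd _ _ T (measurableTypeR R)).
pose q (p : T * measurableTypeR R) : \bar R :=
  ((clip X 1 (p.2 : R)^-1 p.1)%:E * ((p.2 : R) ^- 2)%:E * (\1_pos (p.2 : R))%:E)%E.
have mq : measurable_fun setT q.
  apply: emeasurable_funM; first apply: emeasurable_funM.
  - apply/measurable_EFinP.
    have mp : measurable_fun setT (fun p : T * measurableTypeR R => ((p.2 : R)^-1, p.1)).
      apply: measurable_fun_pair => //.
      exact: (measurableT_comp (@measurable_invr R) m2).
    exact: (measurableT_comp (measurable_clip ler01) mp).
  - apply/measurable_EFinP; apply: (measurableT_comp (@measurable_invr R)).
    exact: measurable_funX.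
  - apply/measurable_EFinP.
    exact: (measurableT_comp (measurable_indic mpos) m2).
have q0 p : (0 <= q p)%E.
  by rewrite /q !mule_ge0// lee_fin ?clip_ge0// invr_ge0 sqr_ge0.
have fq := @fubini_tonelli _ _ T (measurableTypeR R) R P mu q mq q0.
have e1 : (\int[P]_w \int[mu]_s q (w, s) = \int[P]_w \int[mu]_(t in pos) ((Num.min 1 `|X t w|) / t ^+ 2)%:E)%E.
  apply: eq_integral => w _; rewrite [RHS]integral_mkcond; apply: eq_integral => s _.
  rewrite patchE /q /= indicE; case: ifPn => sp; last by rewrite mule0.
  rewrite mule1 -EFinM; move: sp; rewrite inE /pos /= in_itv/= andbT => s0.
  by rewrite /clip posify_id ?invr_gt0// invrK mulr1.
have e2 : (\int[mu]_s \int[P]_w q (w, s) = \int[mu]_(s in pos) (H s * (s ^- 2)%:E))%E.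
  rewrite [RHS]integral_mkcond; apply: eq_integral => s _.
  rewrite patchE /q /= indicE; case: ifPn => sp; last first.
    by under eq_integral do rewrite mule0; rewrite integral0.
  under eq_integral do rewrite mule1.
  rewrite ge0_integralZr//.
  - apply/measurable_EFinP; have mw : measurable_fun setT (fun w : T => (s^-1 : R, w)).
      by apply: measurable_fun_pair => //; exact: measurable_cst.
    exact: (measurableT_comp (measurable_clip ler01) mw).
  - by move=> w _; rewrite lee_fin clip_ge0.
  - by rewrite lee_fin invr_ge0 sqr_ge0.
have -> : (\int[mu]_(s in pos) (H s * (t / s ^+ 2)%:E) = t%:E * \int[mu]_(s in pos) (H s * (s ^- 2)%:E))%E.
  rewrite -ge0_integralZl//; first last.
  - by rewrite lee_fin ltW.
  - by move=> s _; rewrite mule_ge0// lee_fin invr_ge0 sqr_ge0.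
  - apply: measurable_funTS; apply: emeasurable_funM => //; apply/measurable_EFinP.
    by apply: (measurableT_comp (@measurable_invr R)); exact: measurable_funX.
  by apply: eq_integral => s _; rewrite EFinM muleCA.
by rewrite -e2 -fq e1 lte_mul_pinfty// ?lee_fin ?ltW.
Qed.

Definition far_clip t (L x : R) : \bar R := (mean_clip X t x * (L <= x)%R%:R%:E)%E.

Lemma far_clip_ge0 t L x : (0 <= far_clip t L x)%E.
Proof. by rewrite /far_clip mule_ge0 ?mean_clip_ge0// lee_fin. Qed.

Lemma measurable_far_clip t L : 0 <= t -> measurable_fun setT (far_clip t L).
Proof.
move=> t0; apply: emeasurable_funM; first exact: measurable_mean_clip.
apply/measurable_EFinP; rewrite (_ : (fun x => _) = (fun x => \1_(`[L, +oo[%classic) x)).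
  by apply: measurable_indic; exact: measurable_itv.
by apply/funext => x; rewrite indicE mem_setE in_itv/= andbT.
Qed.

Lemma integral_far_clip t (e : R) : 0 < t -> 0 < e ->
  exists L0, forall L, L0 <= L -> (\int[mu]_(x in pos) far_clip t L x <= e%:E)%E.
Proof.
move=> t0 e0; have mK n : measurable_fun pos (far_clip t (n%:R : R)).
  by apply: measurable_funTS; exact: measurable_far_clip (ltW t0).
have mk : measurable_fun pos (mean_clip X t).
  by apply: measurable_funTS; exact: measurable_mean_clip (ltW t0).
have ik : mu.-integrable pos (mean_clip X t).
  apply/integrableP; split => //.
  by under eq_integral => x _ do rewrite gee0_abs ?mean_clip_ge0//; exact: integral_mean_clip.
have dom : {ae mu, forall x n, pos x -> (`|far_clip t (n%:R : R) x| <= mean_clip X t x)%E}.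
  apply: aeW => x n _; rewrite gee0_abs ?far_clip_ge0// /far_clip.
  by case: (_ <= _); rewrite ?mule1// mule0 mean_clip_ge0.
have cv : {ae mu, forall x, pos x -> far_clip t (n%:R : R) x @[n --> \oo] --> (0 : \bar R)%E}.
  apply: aeW => x _; apply: cvg_near_cst; exists (Num.truncn x).+1 => // n /= xn.
  rewrite /far_clip leNgt (lt_le_trans (truncnS_gt x))//= ?mule0//.
  by rewrite ler_nat.
have [_ _] := @dominated_convergence _ (measurableTypeR R) R mu pos mpos
  (fun n => far_clip t n%:R) (cst 0%E) (mean_clip X t) mK (measurable_cst _) cv ik dom.
rewrite integral0 => /(_ [set y | (y < e%:E)%E]) [] => [|n _ hn].
  by apply: open_nbhs_nbhs; split => /=; [exact: open_ereal_lt_ereal|rewrite lte_fin].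
exists n%:R => L nL; apply: ltW; apply: le_lt_trans (hn n (leqnn n)).
apply: ge0_le_integral => //.
- by move=> x _; exact: far_clip_ge0.
- by apply: measurable_funTS; exact: measurable_far_clip (ltW t0).
- exact: mK.
- move=> x _; rewrite /far_clip; case: (leP L x) => [Lx|_] /=; last by rewrite mule0 mule_ge0// mean_clip_ge0.
  by rewrite (le_trans nL Lx).
Qed.

End expected_tail.

Lemma uniform_threshold (A : nat -> nat -> Prop) K :
  (forall k, exists n0, forall n, (n0 <= n)%N -> A k n) ->
  exists n0, forall n, (n0 <= n)%N -> forall k, (k < K)%N -> A k n.
Proof.
move=> h; elim: K => [|K [n0 h0]]; first by exists 0%N.
have [n1 h1] := h K; exists (maxn n0 n1) => n; rewrite geq_max => /andP[l0 l1] k.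
by rewrite ltnS leq_eqVlt => /orP[/eqP ->|kK]; [exact: h1|exact: h0].
Qed.

Lemma ble_le (R : realType) (mu nu : probability (iseq R) R) d (e e' : R) :
  e <= e' -> ble mu nu d e -> ble mu nu d e'.
Proof. by move=> ee h s; apply: (le_trans (h s)); rewrite lerD2l. Qed.

Section lepage_tail.
Context d (T : measurableType d) (R : realType) (P : probability T R).
Notation V := (iseq R).
Variables (G : nat -> T -> R) (E : nat -> R -> T -> R).
Hypothesis HG : unit_poisson_pp P G.
Let mG i : measurable_fun setT (G i). Proof. by case: HG. Qed.
Let G0 i w : 0 < G i w. Proof. by case: HG => _ []. Qed.
Hypothesis pE : forall i, is_process (E i).
Hypothesis sE : forall i, random_step_fun (E i).
Hypothesis fddE : forall i, fdd_eq P P (E i) (E 0%N).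
Hypothesis ind : mutually_independent P (mark_sigma G E).
Hypothesis finE : (\int[P]_w (\int[@lebesgue_measure R]_(t in `]0%R, +oo[%classic)
   ((Num.min 1 `|E 0%N t w|) / t ^+ 2)%:E) < +oo)%E.
Hypothesis cvS : forall t, 0 <= t -> {ae P, forall w, cvgn (lepage_partial G E t w)}.

Let term i t w := E i (t / G i w) w.

Let measurable_term i t : 0 <= t -> measurable_fun setT (term i t).
Proof.
move=> t0; have mp : measurable_fun setT (fun w => (G i w, w)) by exact: measurable_fun_pair.
have := measurableT_comp (measurable_step_joint (pE i) (sE i) t0) mp.
apply: eq_measurable_fun => w _; rewrite /= posify_id//.
by rewrite /term mulrC.
Qed.

Lemma measurable_lepage_partial t n : 0 <= t ->
  measurable_fun setT (fun w => lepage_partial G E t w n).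
Proof. by move=> t0; apply: measurable_sum => i; exact: measurable_term. Qed.

Lemma is_process_lepage : is_process (lepage_sum G E).
Proof. by move=> t t0; apply: measurable_limn => n; exact: measurable_lepage_partial. Qed.

Lemma mean_clip_fdd i t x : 0 <= t -> mean_clip P (E i) t x = mean_clip P (E 0%N) t x.
Proof.
move=> t0; pose tt : times R := fun=> Some ((posify x)^-1 * t).
have htt : nonneg_times tt.
  by move=> k s [<-]; rewrite mulr_ge0// invr_ge0 ltW// posify_gt0.
pose phi (x : V) : \bar R := (Num.min 1 `|x 0%N|)%:E.
have mphi : measurable_fun setT phi.
  apply/measurable_EFinP; apply: measurable_minr; first exact: measurable_cst.
  exact: (measurableT_comp _ (measurable_coord 0%N)).
have phi0 x' : (0 <= phi x')%E by rewrite lee_fin le_min ler01 normr_ge0.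
have e j : mean_clip P (E j) t x = (\int[law P (measurable_obs (pE j) htt)]_x phi x)%E.
  transitivity (\int[image_measure P (measurable_obs (pE j) htt)]_x phi x)%E; last by [].
  by rewrite ge0_integral_image.
rewrite !e; apply: eq_measure_integral => A mA _.
exact: (fdd_obs (measurable_obs (pE i) htt) (measurable_obs (pE 0%N) htt) (fddE i) htt mA).
Qed.

Definition tail_clip t L i w : R := clip (E i) t (G i w) w * (L <= G i w)%R%:R.

Lemma tail_clip_ge0 t L i w : 0 <= tail_clip t L i w.
Proof. by rewrite mulr_ge0 ?clip_ge0. Qed.

Let measurable_far L : measurable_fun setT (fun x : R => (L <= x)%R%:R : R).
Proof.
rewrite (_ : (fun x => _) = (fun x => \1_(`[L, +oo[%classic) x)).
  by apply: measurable_indic; exact: measurable_itv.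
by apply/funext => x; rewrite indicE mem_setE in_itv/= andbT.
Qed.

Lemma measurable_tail_clip t L i : 0 <= t -> measurable_fun setT (tail_clip t L i).
Proof.
move=> t0; apply: measurable_funM; last exact: (measurableT_comp (measurable_far L) (mG i)).
have mp : measurable_fun setT (fun w => (G i w, w)) by exact: measurable_fun_pair.
exact: (measurableT_comp (measurable_clip (pE i) (sE i) t0) mp).
Qed.

(** The i-th mark is independent of [G i], so the point can be frozen while the mark is averaged. *)
Lemma mean_tail_clip t L i : 0 <= t ->
  (\int[P]_w (tail_clip t L i w)%:E = \int[P]_w far_clip P (E 0%N) t L (G i w))%E.
Proof.
move=> t0; pose f x w := (clip (E i) t x w * (L <= x)%R%:R)%:E : \bar R.
have f0 x w : (0 <= f x w)%E by rewrite lee_fin mulr_ge0 ?clip_ge0.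
rewrite -[LHS]/(\int[P]_w f (G i w) w)%E.
rewrite (@indep_fubini _ _ _ _ _ (mG i) (proc_gen (E i)) _ f)//; first last.
- apply/measurable_EFinP; apply: measurable_funM.
    apply: (@measurable_clip _ (g_sigma_algebraType (proc_gen (E i)))) => //.
    exact: is_process_gen.
  exact: (measurableT_comp (measurable_far L) measurable_fst).
- move=> A B mA sB; have := @ind [:: None; Some i]
    (fun o => if o is None then G i @^-1` A else B) isT.
  rewrite !big_cons !big_nil setIT mule1; apply => o.
  rewrite !inE => /orP[] /eqP -> //=; apply: sub_sigma_algebra.
  by exists i => //; exists A => //; rewrite setTI.
- exact: proc_gen_measurable.
transitivity (\int[image_measure P (mG i)]_x far_clip P (E 0%N) t L x)%E.
  apply: eq_integral => x _; rewrite /far_clip -(mean_clip_fdd i)//.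
  rewrite /f /mean_clip -ge0_integralZr//.
  - apply/measurable_EFinP; have mx : measurable_fun setT (fun w : T => (x, w)).
      by apply: measurable_fun_pair => //; exact: measurable_cst.
    exact: (measurableT_comp (measurable_clip (pE i) (sE i) t0) mx).
  - by move=> w _; rewrite lee_fin clip_ge0.
rewrite ge0_integral_image//.
- by apply: measurable_far_clip => //; exact: sE.
- by move=> x _; exact: far_clip_ge0.
Qed.

Lemma sum_tail_clip t (e : R) : 0 < t -> 0 < e ->
  exists n0, forall n, (n0 <= n)%N -> forall I,
    (\sum_(0 <= i < I) \int[P]_w (tail_clip t (n%:R : R) i w)%:E <= e%:E)%E.
Proof.
move=> t0 e0; have [L0 hL0] := integral_far_clip (pE 0%N) (sE 0%N) finE t0 e0.
exists (Num.truncn L0).+1 => n hn I; apply: le_trans (hL0 n%:R _); last first.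
  by apply: ltW; apply: (lt_le_trans (truncnS_gt L0)); rewrite ler_nat.
rewrite -(campbell HG); last 2 first.
- by apply: measurable_far_clip; [exact: pE|exact: sE|exact: ltW].
- by move=> x; exact: far_clip_ge0.
under eq_eseriesr => i _ do rewrite -(mean_tail_clip _ _ (ltW t0)).
by apply: nneseries_lim_ge => i _ _; apply: integral_ge0 => w _; rewrite lee_fin tail_clip_ge0.
Qed.

Definition tail_event t L (r : R) I : set T := [set w | r <= \sum_(0 <= i < I) tail_clip t L i w].

Lemma measurable_tail_event t L r I : 0 <= t -> measurable (tail_event t L r I).
Proof.
move=> t0; have ms : measurable_fun setT (fun w => \sum_(0 <= i < I) tail_clip t L i w).
  by apply: measurable_sum => i; exact: measurable_tail_clip.
rewrite (_ : tail_event _ _ _ _ = (fun w => \sum_(0 <= i < I) tail_clip t L i w) @^-1` `[r, +oo[%classic).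
  by rewrite -[X in measurable X]setTI; apply: ms => //; exact: measurable_itv.
by apply/seteqP; split => w; rewrite /= in_itv/= andbT.
Qed.

(** Markov's inequality, uniform in [I] because the whole series of means is already small. *)
Lemma pr_tail_event t (r e : R) : 0 < t -> 0 < r -> 0 < e ->
  exists n0, forall n, (n0 <= n)%N -> forall I, pr P (tail_event t (n%:R : R) r I) <= e.
Proof.
move=> t0 r0 e0; have [n0 h] := sum_tail_clip t0 (mulr_gt0 e0 r0).
exists n0 => n hn I; have mD := measurable_tail_event n%:R r I (ltW t0).
have m i : measurable_fun setT (fun w => (tail_clip t (n%:R : R) i w)%:E).
  by apply/measurable_EFinP; exact: measurable_tail_clip (ltW t0).
have c0 i w : (0 <= (tail_clip t (n%:R : R) i w)%:E)%E by rewrite lee_fin tail_clip_ge0.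
rewrite -(ler_pM2r r0) -lee_fin; apply: le_trans (h n hn I).
rewrite -ge0_integral_sum//.
rewrite EFinM -(prE P mD) muleC -[in leLHS](setIT (tail_event _ _ _ _)) -integral_indic//.
rewrite -ge0_integralZl//; last 2 first.
- by apply/measurable_EFinP; exact: measurable_indic.
- by rewrite lee_fin ltW.
apply: ge0_le_integral => //.
- by move=> w _; rewrite mule_ge0// lee_fin// ltW.
- by apply: emeasurable_funM => //; apply/measurable_EFinP; exact: measurable_indic.
- by apply: emeasurable_sum => i.
move=> w _; rewrite sumEFin -EFinM lee_fin indicE.
case: (boolP (w \in _)) => [wD|_]; last by rewrite mulr0 sumr_ge0// => i _; exact: tail_clip_ge0.
by move: wD; rewrite inE mulr1.
Qed.

Definition slow_event t (r : R) n : set T :=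
  [set w | r < `|lepage_sum G E t w - lepage_partial G E t w n|].

Lemma measurable_slow_event t r n : 0 <= t -> measurable (slow_event t r n).
Proof.
move=> t0; have ms : measurable_fun setT (fun w => `|lepage_sum G E t w - lepage_partial G E t w n|).
  apply: measurableT_comp => //; apply: measurable_funB; first exact: is_process_lepage.
  exact: measurable_lepage_partial.
rewrite (_ : slow_event _ _ _ = (fun w => `|lepage_sum G E t w - lepage_partial G E t w n|) @^-1` `]r, +oo[%classic).
  by rewrite -[X in measurable X]setTI; apply: ms => //; exact: measurable_itv.
by apply/seteqP; split => w; rewrite /= in_itv/= andbT.
Qed.

Lemma pr_slow_event t (r e : R) : 0 <= t -> 0 < r -> 0 < e ->
  exists n0, forall n, (n0 <= n)%N -> pr P (slow_event t r n) <= e.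
Proof.
move=> t0 r0 e0; have [N [mN N0 subN]] := cvS t0.
pose D n := slow_event t r n `\` N.
have mD n : measurable (D n) by apply: measurableD => //; exact: measurable_slow_event.
have /cvgrPdist_lt/(_ e e0)[n0 _ h0] : pr P (D n) @[n --> \oo] --> 0.
  apply: cvg_pr_eventually => // w; have [Nw|Nw] := pselect (N w).
    by exists 0%N => n _ [_].
  have c : cvgn (lepage_partial G E t w) by apply: contrapT => /subN.
  have /cvgrPdist_lt/(_ r r0)[n0 _ h0] := c; exists n0 => n hn [+ _]; rewrite /slow_event /=.
  by have := h0 n hn; rewrite /= /lepage_sum => /ltW; rewrite leNgt => /negP.
exists n0 => n hn; have := h0 n hn; rewrite /= sub0r normrN ger0_norm ?pr_ge0// => /ltW h.
have pN : pr P N = 0 by rewrite /pr N0.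
apply: le_trans h; rewrite -[leRHS]addr0 -pN; apply: le_trans (prU_le P (mD n) mN).
apply: le_pr; [exact: measurable_slow_event|exact: measurableU|].
by move=> w Dw; have [Nw|Nw] := pselect (N w); [right|left].
Qed.

Variables (tt : times R) (htt : forall k t, tt k = Some t -> 0 < t) (K : nat).
Hypothesis fin_tt : forall k, (K <= k)%N -> tt k = None.

(** If the clipped terms beyond [L] add up to less than 1, none of them is clipped, and their sum
    bounds the discarded part itself. The second [r] pays for stopping the series at [I]. *)
Lemma lepage_trunc_close L (r : R) I w k t : tt k = Some t -> 0 < r -> r <= 1 ->
  ~ tail_event t L r I w -> ~ slow_event t r I w ->
  `|obs (lepage_sum G E) tt w k - trunc_sum G E tt L I w k| <= r + r.
Proof.
move=> tk r0 r1 /negP; rewrite -ltNge => h1 /negP; rewrite -leNgt => h2.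
rewrite /obs tk -(subrKA (lepage_partial G E t w I)).
apply: (le_trans (ler_normD _ _)); apply: lerD => //.
rewrite /lepage_partial /trunc_sum /vsum -(big_mkord xpredT (fun i => E i (t / G i w) w)).
rewrite (_ : iota 0 I = index_iota 0 I); last by rewrite /index_iota subn0.
rewrite -sumrB.
apply: le_trans (ltW h1); apply: (le_trans (ler_norm_sum _ _ _)).
rewrite [leLHS]big_nat [leRHS]big_nat; apply: ler_sum => i iI.
rewrite /trunc_mark /tail_clip (leNgt L); case: ifPn => GL /=.
  by rewrite /mark /obs /scale_times tk /= mulrC subrr normr0 mulr0.
rewrite subr0 mulr1 /clip posify_id// (mulrC t).
have : clip (E i) t (G i w) w < 1.
  apply: lt_le_trans r1; apply: le_lt_trans h1.
  rewrite (big_cat_nat (n := i))//=; last exact: ltnW.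
  rewrite (big_cat_nat (n := i.+1) (m := i))//=.
  rewrite big_nat1 {2}/tail_clip (leNgt L) GL mulr1 addrCA lerDl addr_ge0//.
    by apply: sumr_ge0 => j _; exact: tail_clip_ge0.
  by apply: sumr_ge0 => j _; exact: tail_clip_ge0.
by rewrite /clip posify_id// gt_min ltxx /= => /ltW/min_idPr ->.
Qed.

Lemma ble_lepage_trunc (e : R) : 0 < e ->
  exists n0, forall n, (n0 <= n)%N -> exists I0, forall I, (I0 <= I)%N ->
  forall (mS : measurable_fun setT (obs (lepage_sum G E) tt))
    (mY : measurable_fun setT (trunc_sum G E tt (n%:R : R) I)),
    ble (law P mS) (law P mY) e e /\ ble (law P mY) (law P mS) e e.
Proof.
move=> e0; pose r := Num.min (e / 2) 1.
have r0 : 0 < r by rewrite lt_min ltr01 divr_gt0.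
have r1 : r <= 1 by rewrite ge_min lexx orbT.
have re : r + r <= e by rewrite [leRHS]splitr lerD// ge_min lexx.
(* There are [K] observation times with two exceptional events each. *)
pose q := e / K.+1%:R / 2.
have q0 : 0 < q by rewrite !divr_gt0.
pose tk k := odflt 1 (tt k).
have tk0 k : 0 < tk k by rewrite /tk; case ttk: (tt k) => [t|] //=; exact: htt ttk.
have [n0 hn0] := uniform_threshold K (fun k => pr_tail_event (tk0 k) r0 q0).
exists n0 => n hn.
have [I0 hI0] := uniform_threshold K (fun k => pr_slow_event (ltW (tk0 k)) r0 q0).
exists I0 => I hI mS mY.
pose F k := tail_event (tk k) (n%:R : R) r I `|` slow_event (tk k) r I.
have mF k : measurable (F k).
  apply: measurableU; first exact: measurable_tail_event (ltW (tk0 k)).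
  exact: measurable_slow_event (ltW (tk0 k)).
pose D := \big[setU/set0]_(k <- iota 0 K) F k.
have mD : measurable D by apply: bigsetU_measurable => k _.
have pD : pr P D <= e.
  apply: (le_trans (pr_sum_le _ _ mF)).
  apply: (@le_trans _ _ (\sum_(k <- iota 0 K) (q + q))).
    rewrite big_seq [leRHS]big_seq; apply: ler_sum => k; rewrite mem_iota add0n => /andP[_ kK].
    apply: (le_trans (prU_le _ _ _)); first exact: measurable_tail_event (ltW (tk0 k)).
      exact: measurable_slow_event (ltW (tk0 k)).
    by apply: lerD; [exact: hn0|exact: hI0].
  rewrite big_const_seq count_predT size_iota iter_addr_0 -mulr_natl /q.
  rewrite -splitr mulrA ler_pdivrMr// mulrC ler_pM2l// ler_nat; exact: leqnSn.
have close w : ~ D w -> forall k,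
    `|obs (lepage_sum G E) tt w k - trunc_sum G E tt (n%:R : R) I w k| <= e.
  move=> Dw k; case ttk: (tt k) => [t|]; last first.
    rewrite /obs ttk /trunc_sum /vsum big1 ?subrr ?normr0 ?ltW// => i _.
    rewrite /trunc_mark; case: ifP => // _.
    by rewrite /mark /obs /scale_times ttk.
  have kK : (k < K)%N by rewrite ltnNge; apply/negP => /fin_tt; rewrite ttk.
  have nF : ~ F k w.
    move=> Fw; apply: Dw; rewrite /D -(bigcup_seq (iota 0 K) F).
    by exists k => //=; rewrite mem_iota.
  have tkE : tk k = t by rewrite /tk ttk.
  apply: le_trans re; apply: (lepage_trunc_close ttk) => // h; apply: nF; rewrite /F tkE.
    by left.
  by right.
split; apply: ble_le pD _; apply: ble_coupling => // w Dw k.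
by rewrite distrC; exact: close.
Qed.

End lepage_tail.

(** * Time-stability of LePage sums *)

(** The estimates on LePage sums concern positive times; time 0 is frozen, which changes nothing for
    a process starting at 0. *)
Definition positive_times (R : realType) (tt : times R) : times R :=
  fun k => if tt k is Some t then (if 0 < t then Some t else None) else None.

Lemma positive_timesP (R : realType) (tt : times R) k t :
  positive_times tt k = Some t -> 0 < t.
Proof. by rewrite /positive_times; case: (tt k) => // s; case: ltP => // s0 [<-]. Qed.

Lemma obs_positive (T : Type) (R : realType) (X : R -> T -> R) (tt : times R) :
  nonneg_times tt -> (forall w, X 0 w = 0) -> obs X (positive_times tt) = obs X tt.
Proof.
move=> htt X0; apply/funext => w; apply/funext => k; rewrite /obs /positive_times.
case tk: (tt k) => [t|] //; case: ltP => // t0.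
by have -> : t = 0 by apply/eqP; rewrite eq_le t0 (htt _ _ tk).
Qed.

Lemma law_eq d (T : measurableType d) (R : realType) (P : probability T R)
  (X Y : T -> iseq R) (mX : measurable_fun setT X) (mY : measurable_fun setT Y) :
  X = Y -> deq (law P mX) (law P mY).
Proof. by move=> XY B mB; rewrite (lawE P mX) (lawE P mY) XY. Qed.

Lemma pmix_deq (R : realType) (h : {nonneg R}) (mu nu : probability (iseq R) R) :
  deq mu nu -> deq (pmix h mu) (pmix h nu).
Proof. by move=> mn B mB; rewrite /pmix !mixE mn. Qed.

Lemma ble_le2 (R : realType) (mu nu : probability (iseq R) R) d d' (e e' : R) :
  d <= d' -> e <= e' -> ble mu nu d e -> ble mu nu d' e'.
Proof.
move=> dd ee h s; apply: (le_trans (h s)); apply: lerD => //.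
apply: le_pr; [exact: measurable_box..|].
move=> x hx p /mapP[p' p's ->] /=.
by have := hx _ (map_f _ p's); move=> /= /le_trans; apply; rewrite lerD2l.
Qed.

Lemma law_irrelevance d (T : measurableType d) (R : realType) (P : probability T R)
  (X : T -> iseq R) (m1 m2 : measurable_fun setT X) : law P m1 = law P m2.
Proof. by congr law; exact: Prop_irrelevance. Qed.

Section lepage_stable.
Context d (T : measurableType d) (R : realType) (P : probability T R).
Notation V := (iseq R).
Variables (G : nat -> T -> R) (E : nat -> R -> T -> R).
Hypothesis HG : unit_poisson_pp P G.
Let mG i : measurable_fun setT (G i). Proof. by case: HG. Qed.
Let G0 i w : 0 < G i w. Proof. by case: HG => _ []. Qed.
Hypothesis pE : forall i, is_process (E i).
Hypothesis sE : forall i, random_step_fun (E i).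
Hypothesis fddE : forall i, fdd_eq P P (E i) (E 0%N).
Hypothesis ind : mutually_independent P (mark_sigma G E).
Hypothesis finE : (\int[P]_w (\int[@lebesgue_measure R]_(t in `]0%R, +oo[%classic)
   ((Num.min 1 `|E 0%N t w|) / t ^+ 2)%:E) < +oo)%E.
Hypothesis cvS : forall t, 0 <= t -> {ae P, forall w, cvgn (lepage_partial G E t w)}.
Let pS : is_process (lepage_sum G E) := is_process_lepage HG pE sE.

Lemma cell_times_scale (a h : R) N (tt : times R) c : 0 < a ->
  cell_times (a * h) N (scale_times a tt) c = cell_times h N tt c.
Proof.
move=> a0; rewrite /cell_times; case: ifP => // _; rewrite scale_timesM; congr scale_times.
by rewrite mulrCA invfM mulrC mulrA mulfV ?gt_eqF// mul1r.
Qed.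

(** Multiplying the mesh and the times by [m] leaves [t / (c * h)] unchanged, so both laws have the
    same cell laws and differ only in the Poisson weight of each cell. The n + 1 cells cost
    [2 * h'^2] each, with h' = m L / (n + 1). *)
Lemma grid_law_convn (L : R) (L0 : 0 < L) (m : nat) (m0 : 0 < m%:R * L) (tt : times R)
  (htt : nonneg_times tt) (htt' : nonneg_times (scale_times m%:R tt)) n : (0 < m)%N ->
  dle (convn (grid_law P pE htt L0 n) m) (grid_law P pE htt' m0 n)
    (2 * (m%:R * L) ^+ 2 / n.+1%:R).
Proof.
move=> mp; have m1 : 0 < m%:R :> R by rewrite ltr0n.
rewrite /grid_law /compound; set h := NngNum _; set h' := NngNum _.
have hE : h'%:num = m%:R * h%:num by rewrite /h /h' /= mulrA.
have Nn : n.+1%:R != 0 :> R by rewrite pnatr_eq0.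
have -> : 2 * (m%:R * L) ^+ 2 / n.+1%:R = 0 + (size (iota 0 n.+1))%:R * (2 * h'%:num ^+ 2).
  by rewrite size_iota add0r /h' /=; field; rewrite -[1]/(1%:R) -natrD.
apply: dle_trans (deq_dle (convn_convs (fun c => pmix h (cell_law P pE htt (mesh_gt0 n L0) n.+1 c))
  (iota 0 n.+1) m)) _.
apply: convs_dle => [|c _]; first by rewrite mulr_ge0// sqr_ge0.
rewrite -[2 * _]addr0; apply: dle_trans (convn_pmix _ hE) _.
apply/deq_dle/pmix_deq/law_eq; rewrite -(cell_times_scale _ _ _ _ m1).
by congr (obs _ (cell_times _ _ _ _)); rewrite mulrA.
Qed.

Lemma lepage_stable m (tt : times R) K
  (mS : measurable_fun setT (obs (lepage_sum G E) tt))
  (mS' : measurable_fun setT (obs (lepage_sum G E) (scale_times m%:R tt))) : (0 < m)%N ->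
  (forall k t, tt k = Some t -> 0 < t) -> (forall k, (K <= k)%N -> tt k = None) ->
  deq (convn (law P mS) m) (law P mS').
Proof.
move=> mp htp fin_tt; have m1 : 0 < m%:R :> R by rewrite ltr0n.
have htp' k t : scale_times m%:R tt k = Some t -> 0 < t.
  rewrite /scale_times; case tk: (tt k) => [s|] //= [<-].
  by rewrite mulr_gt0//; exact: htp tk.
have fin_tt' k : (K <= k)%N -> scale_times m%:R tt k = None.
  by move=> /fin_tt; rewrite /scale_times => ->.
have htt : nonneg_times tt by move=> k t /htp/ltW.
have htt' : nonneg_times (scale_times m%:R tt) by move=> k t /htp'/ltW.
suff close e : 0 < e -> ble (convn (law P mS) m) (law P mS') e e /\
    ble (law P mS') (convn (law P mS) m) e e.
  by apply: ble_deq => e /close[].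
(* Five approximations are chained; the truncation and the gridding before the convolution are paid
   m times each, the other three once. *)
move=> e0; pose q := e / (2 * m%:R + 3).
have q0 : 0 < q by rewrite divr_gt0// addr_gt0// mulr_gt0.
have qE : q * (2 * m%:R + 3) = e by rewrite /q divfK// gt_eqF// addr_gt0// mulr_gt0.
have [n1 h1] := ble_lepage_trunc HG pE sE fddE ind finE cvS htp fin_tt q0.
have [n2 h2] := ble_lepage_trunc HG pE sE fddE ind finE cvS htp' fin_tt' q0.
(* The truncation levels [M] and [m * M] stand in the same ratio as the times, so both grids have
   the same number of cells. *)
pose M := (maxn n1 n2).+1.
have M0 : 0 < M%:R :> R by rewrite ltr0n.
have mM0 : 0 < m%:R * M%:R :> R by rewrite mulr_gt0.
have [I1 {}h1] := h1 M (leqW (leq_maxl _ _)).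
have [I2] := h2 (m * M)%N (leq_trans (leqW (leq_maxr n1 n2)) (leq_pmull _ mp)).
rewrite natrM => {}h2.
have [k1 g1] := dle_trunc_grid HG pE sE fddE ind htt fin_tt M0 q0.
have [k2 g2] := dle_trunc_grid HG pE sE fddE ind htt' fin_tt' mM0 q0.
pose k := maxn (maxn k1 k2) (Num.truncn (2 * (m%:R * M%:R) ^+ 2 / q)).
have [I3 {}g1] := g1 k (leq_trans (leq_maxl _ _) (leq_maxl _ _)).
have [I4 {}g2] := g2 k (leq_trans (leq_maxr _ _) (leq_maxl _ _)).
have kq : 2 * (m%:R * M%:R) ^+ 2 / k.+1%:R <= q.
  rewrite ler_pdivrMr// (mulrC q) -ler_pdivrMr//; apply: ltW.
  by apply: (lt_le_trans (truncnS_gt _)); rewrite ler_nat ltnS leq_maxr.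
have gg := dle_le kq (grid_law_convn M0 mM0 htt htt' k mp).
pose I := maxn (maxn I1 I2) (maxn I3 I4).
have [a1 b1] := h1 I (leq_trans (leq_maxl _ _) (leq_maxl _ _)) mS
  (measurable_trunc_sum mG G0 pE sE htt (M%:R : R) I).
have [a2 b2] := h2 I (leq_trans (leq_maxr _ _) (leq_maxl _ _)) mS'
  (measurable_trunc_sum mG G0 pE sE htt' (m%:R * M%:R : R) I).
have {}g1 := g1 I (leq_trans (leq_maxl _ _) (leq_maxr _ _)).
have {}g2 := g2 I (leq_trans (leq_maxr _ _) (leq_maxr _ _)).
rewrite (law_irrelevance _ _ (measurable_trunc_sum mG G0 pE sE htt (M%:R : R) I)) in g1.
rewrite (law_irrelevance _ _ (measurable_trunc_sum mG G0 pE sE htt' (m%:R * M%:R : R) I)) in g2.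
have qq := ltW q0.
split.
  have := ble_trans (ble_convn m qq a1) (ble_trans (dle_ble (convn_dle m qq g1))
    (ble_trans (dle_ble gg) (ble_trans (dle_ble (dleC g2)) b2))).
  by apply: ble_le2; rewrite -qE; lra.
have := ble_trans a2 (ble_trans (dle_ble g2) (ble_trans (dle_ble (dleC gg))
  (ble_trans (dle_ble (dleC (convn_dle m qq g1))) (ble_convn m qq b1)))).
by apply: ble_le2; rewrite -qE; lra.
Qed.

End lepage_stable.

Section time_stable_law.
Context d (T : measurableType d) (R : realType) (P : probability T R).
Variables (X : R -> T -> R).
Hypothesis pX : is_process X.

Lemma time_stable_of_law :
  (forall m K (tt : times R) (htt : nonneg_times tt) (htt' : nonneg_times (scale_times m%:R tt)),
     (1 < m)%N -> (forall k, (K <= k)%N -> tt k = None) ->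
     deq (convn (law P (measurable_obs pX htt)) m) (law P (measurable_obs pX htt'))) ->
  time_stable P X.
Proof.
move=> h n n2 d' T' P' Xs pXs eXs iXs k ts ts0 B mB.
have htt := nonneg_tuple ts0.
have htt' : nonneg_times (scale_times n%:R (tuple_times ts)) by exact: nonneg_scale.
have pXn : is_process (fun t w => X (n%:R * t) w).
  by move=> t t0; apply: pX; rewrite mulr_ge0.
have pS : is_process (fun t w => \sum_(i < n) Xs i t w).
  by move=> t t0; apply: measurable_sum => i; exact: pXs.
have mXs i := measurable_obs (pXs i) htt.
apply: (obs_fdd (mX := measurable_obs pS htt) (mY := measurable_obs pXn htt)) mB.
apply: (@deq_trans _ (convn (law P (measurable_obs pX htt)) n)); last first.
  apply: deq_trans (h n k _ htt htt' n2 _) _; last first.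
    apply: law_eq; apply/funext => w; apply/funext => j; rewrite /obs /scale_times.
    by case: (tuple_times ts j).
  by move=> j kj; rewrite /tuple_times ltnNge kj.
have eS : obs (fun t w => \sum_(i < n) Xs i t w) (tuple_times ts) =
    vsum (fun i => obs (Xs i) (tuple_times ts)) (enum 'I_n).
  apply/funext => w; apply/funext => j; rewrite /obs /vsum big_enum /=.
  by case: (tuple_times ts j) => //; rewrite big1.
apply: (@deq_trans _ (convs (map (fun i => law P' (mXs i)) (enum 'I_n)))).
  move=> A mA; rewrite (lawE P' (measurable_obs pS htt)) eS.
  have := indep_vsum mXs (s := enum 'I_n) (J := [::]) (A := fun=> setT) iXs.
  rewrite big_nil cats0 => hv; rewrite -[X in P' X]setTI hv//.
  - by rewrite probability_setT mul1e.
  - by move=> i C _ mC; exact: sigma_proc_obs.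
  - exact: enum_uniq.
have -> : convn (law P (measurable_obs pX htt)) n =
    convs (map (fun _ : 'I_n => law P (measurable_obs pX htt)) (enum 'I_n)).
  rewrite /convn; congr convs; apply: (@eq_from_nth _ (law P (measurable_obs pX htt))).
    by rewrite size_nseq size_map size_enum_ord.
  move=> i; rewrite size_nseq => iN; rewrite nth_nseq iN (nth_map (Ordinal iN)) ?size_enum_ord//.
by apply: convs_deq => i _; exact: fdd_obs.
Qed.

End time_stable_law.

Section reverse.
Context d (T : measurableType d) (R : realType) (P : probability T R).
Variables (X : R -> T -> R).
Hypothesis pX : is_process X.
Hypothesis X0 : forall w, X 0 w = 0.
Context d' (T' : measurableType d') (P' : probability T' R).
Variables (G : nat -> T' -> R) (E : nat -> R -> T' -> R).
Hypothesis HG : unit_poisson_pp P' G.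
Hypothesis pE : forall i, is_process (E i).
Hypothesis sE : forall i, random_step_fun (E i).
Hypothesis fddE : forall i, fdd_eq P' P' (E i) (E 0%N).
Hypothesis ind : mutually_independent P' (mark_sigma G E).
Hypothesis finE : (\int[P']_w (\int[@lebesgue_measure R]_(t in `]0%R, +oo[%classic)
   ((Num.min 1 `|E 0%N t w|) / t ^+ 2)%:E) < +oo)%E.
Hypothesis cvS : forall t, 0 <= t -> {ae P', forall w, cvgn (lepage_partial G E t w)}.

Lemma lepage_time_stable : fdd_eq P P' X (lepage_sum G E) -> time_stable P X.
Proof.
move=> XS; apply: (time_stable_of_law (pX := pX)) => m K tt htt htt' m1 fin_tt.
have mp : (0 < m)%N by exact: ltnW.
have pS := is_process_lepage HG pE sE.
pose tp := positive_times tt.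
have tpp k t : tp k = Some t -> 0 < t by exact: positive_timesP.
have htp : nonneg_times tp by move=> k t /tpp/ltW.
have htp' : nonneg_times (scale_times m%:R tp) by exact: nonneg_scale.
have fin_tp k : (K <= k)%N -> tp k = None by move=> /fin_tt; rewrite /tp /positive_times => ->.
have e1 : deq (law P (measurable_obs pX htt)) (law P' (measurable_obs pS htp)).
  apply: deq_trans _ (fdd_obs (measurable_obs pX htp) (measurable_obs pS htp) XS htp).
  by apply: law_eq; rewrite /tp obs_positive.
have e2 : deq (law P (measurable_obs pX htt')) (law P' (measurable_obs pS htp')).
  apply: deq_trans _ (fdd_obs (measurable_obs pX htp') (measurable_obs pS htp') XS htp').
  apply: law_eq; apply/funext => w; apply/funext => k; rewrite /obs /scale_times /tp /positive_times.
  case tk: (tt k) => [t|] //=; case: ltP => //= t0.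
  have -> : t = 0 by apply/eqP; rewrite eq_le t0 (htt _ _ tk).
  by rewrite mulr0 X0.
apply: deq_trans (convn_deq m e1) _; apply: deq_trans _ (deqC e2).
exact: (lepage_stable HG pE sE fddE ind finE cvS _ _ mp tpp fin_tp).
Qed.

End reverse.

(** * Independent copies on the sequence space *)

Section finite_product.
Context d (T : measurableType d) (R : realType).
Implicit Types P : nat -> probability T R.

Definition cons_iseq (p : T * iseq T) : iseq T := fun k => if k is k'.+1 then p.2 k' else p.1.

Lemma measurable_cons_iseq : measurable_fun setT cons_iseq.
Proof.
apply: measurable_to_iseq => -[|k]; first exact: measurable_fst.
exact: (measurableT_comp (measurable_coord k) measurable_snd).
Qed.

(** Only the first [n] coordinates are random; the others are the constant [point]. *)
Fixpoint copies P n : probability (iseq T) R :=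
  if n is n'.+1 then law ((P 0%N \x copies (P \o succn) n')%E : probability (T * iseq T)%type R) measurable_cons_iseq
  else \d_((fun=> point) : iseq T).

Definition rect n (A : nat -> set T) : set (iseq T) := [set s | forall i, (i < n)%N -> A i (s i)].

Lemma measurable_rect n A : (forall i, measurable (A i)) -> measurable (rect n A).
Proof.
move=> mA; rewrite (_ : rect n A = \bigcap_(i in [set i | (i < n)%N]) [set s : iseq T | A i (s i)]).
  apply: bigcap_measurableType => i _.
  by have := @measurable_coord _ T i measurableT _ (mA i); rewrite setTI.
by apply/seteqP; split.
Qed.

Lemma copies_rect P n (A : nat -> set T) : (forall i, measurable (A i)) ->
  copies P n (rect n A) = (\prod_(i < n) P i (A i))%E.
Proof.
elim: n P A => [|n ih] P A mA.
  by rewrite big_ord0 (_ : rect 0 A = setT) ?probability_setT//; apply/seteqP; split.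
rewrite big_ord_recl -(ih (P \o succn) (fun i => A i.+1))// -product_measure1E//; last exact: measurable_rect.
transitivity ((P 0%N \x copies (P \o succn) n)%E (cons_iseq @^-1` rect n.+1 A)) => //; congr (_ _).
apply/seteqP; split => -[w s] /=.
  by move=> h; split; [exact: (h 0%N)|move=> i iN; exact: (h i.+1)].
by move=> [h0 h] [|i] //; exact: h.
Qed.

Lemma copies_coord P n i A : (i < n)%N -> measurable A -> copies P n [set s | A (s i)] = P i A.
Proof.
move=> iN mA; pose B j := if j == i then A else setT.
have mB j : measurable (B j) by rewrite /B; case: eqP.
rewrite (_ : [set s | _] = rect n B); last first.
  apply/seteqP; split => s /=; first by move=> h j _; rewrite /B; case: eqP => // ->.
  by move=> /(_ i iN); rewrite /B eqxx.
rewrite copies_rect// (bigD1 (Ordinal iN))//= big1 ?mule1 /B ?eqxx// => j ji.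
by rewrite ifF ?probability_setT//; apply: contraNF ji => /eqP ji; apply/eqP/val_inj.
Qed.

Lemma copies_indep P n (F : 'I_n -> set (set (iseq T))) :
  (forall i A, F i A -> exists2 C, measurable C & A = [set s | C (s i)]) ->
  mutually_independent (copies P n) F.
Proof.
move=> hF J A uJ FA.
have hC (i : 'I_n) : exists C, measurable C /\ (i \in J -> A i = [set s | C (s i)]).
  have [iJ|_] := boolP (i \in J); last by exists setT.
  by have [C mC AC] := hF i _ (FA _ iJ); exists C.
pose C i := projT1 (cid (hC i)).
have mC i : measurable (C i) by rewrite /C; case: cid => ? [].
have AC i : i \in J -> A i = [set s | C i (s i)] by rewrite /C; case: cid => ? [].
pose D k : set T := if insub k is Some i then (if i \in J then C i else setT) else setT.
have DE (i : 'I_n) : D i = if i \in J then C i else setT by rewrite /D valK.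
have mD k : measurable (D k) by rewrite /D; case: insub => // i; case: ifP.
rewrite (_ : \big[setI/setT]_(i <- J) A i = rect n D); last first.
  rewrite -bigcap_seq; apply/seteqP; split => s h.
    move=> k kn; have -> : k = Ordinal kn by [].
    by rewrite DE; case: ifP => // kJ; have := h _ kJ; rewrite AC.
  by move=> i /= iJ; rewrite AC//; have := h i (ltn_ord i); rewrite DE iJ.
rewrite copies_rect// (big_uniq _ uJ) [RHS]big_mkcond; apply: eq_bigr => i _; rewrite DE.
by case: ifP => iJ; rewrite ?probability_setT// AC// copies_coord.
Qed.

End finite_product.

Lemma sigma_proc_comp d1 d2 (T1 : measurableType d1) (T2 : measurableType d2) (R : realType)
  (X : R -> T1 -> R) (f : T2 -> T1) A : is_process X ->
  sigma_proc (fun t s => X t (f s)) A -> exists2 C, measurable C & A = f @^-1` C.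
Proof.
move=> pX.
suff : sigma_proc (fun t s => X t (f s)) `<=` preimage_set_system setT f measurable.
  by move=> h /h[C mC <-]; exists C => //; rewrite setTI.
apply: smallest_sub.
  by apply: sigma_algebra_preimage; exact: sigma_algebra_measurable.
move=> _ [t t0 [B mB <-]]; exists (X t @^-1` B); last by rewrite !setTI.
by have := pX t t0 measurableT B mB; rewrite setTI.
Qed.

Section law_of_time_stable.
Context d (T : measurableType d) (R : realType) (P : probability T R).
Variables (X : R -> T -> R).
Hypotheses (pX : is_process X) (sX : time_stable P X).

(** [time_stable] is about given i.i.d. copies; it is applied to those realized by [copies]. Here
    infinitely many observation times are allowed, which [zero_before] will require. *)
Lemma time_stable_law n (tt : times R) (mX : measurable_fun setT (obs X tt))
  (mX' : measurable_fun setT (obs X (scale_times n%:R tt))) :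
  nonneg_times tt -> (0 < n)%N -> deq (convn (law P mX) n) (law P mX').
Proof.
(* The definition starts at n = 2; the case n = 1 is the neutrality of the unit mass at 0. *)
move=> htt; case: n mX' => [|[|n']] // mX' _.
  apply: deq_trans (conv_delta0r _) _; apply: law_eq.
  by rewrite scale_times1.
set n := n'.+2 in mX' *; have n2 : (1 < n)%N by [].
pose Xs (i : 'I_n) t (s : iseq T) := X t (s i).
have pXs i : is_process (Xs i).
  by move=> t t0; exact: (measurableT_comp (pX t0) (measurable_coord i)).
have Xs_law i tt' (m1 : measurable_fun setT (obs (Xs i) tt')) (m2 : measurable_fun setT (obs X tt')) :
    deq (law (copies (fun=> P) n) m1) (law P m2).
  move=> B mB; rewrite (lawE _ m1) (lawE _ m2) -(@copies_coord _ _ _ (fun=> P) n i)//.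
  by rewrite -[Y in measurable Y]setTI; exact: m2.
have eXs i : fdd_eq (copies (fun=> P) n) P (Xs i) X.
  move=> k ts ts0 B mB; have ht := nonneg_tuple ts0.
  exact: (obs_fdd (mX := measurable_obs (pXs i) ht) (mY := measurable_obs pX ht)).
have iXs : mutually_independent (copies (fun=> P) n) (fun i => sigma_proc (Xs i)).
  apply: copies_indep => i A /(sigma_proc_comp pX)[C mC ->].
  by exists C.
have XS := sX n2 pXs eXs iXs.
pose S t s := \sum_(i < n) Xs i t s.
have pS : is_process S by move=> t t0; apply: measurable_sum => i; exact: pXs.
have pXn : is_process (fun t w => X (n%:R * t) w).
  by move=> t t0; apply: pX; rewrite mulr_ge0.
have mXs i := measurable_obs (pXs i) htt.
apply: deq_trans _ (@deq_trans _ (law P (measurable_obs pXn htt)) _ _ _ _); last first.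
- apply: law_eq; apply/funext => w; apply/funext => j; rewrite /obs /scale_times.
  by case: (tt j).
- exact: (fdd_obs (measurable_obs pS htt) (measurable_obs pXn htt) XS htt).
have -> : convn (law P mX) n = convs (map (fun _ : 'I_n => law P mX) (enum 'I_n)).
  rewrite /convn; congr convs; apply: (@eq_from_nth _ (law P mX)).
    by rewrite size_nseq size_map size_enum_ord.
  move=> i; rewrite size_nseq => iN; rewrite nth_nseq iN (nth_map (Ordinal iN)) ?size_enum_ord//.
apply: (@deq_trans _ (convs (map (fun i => law (copies (fun=> P) n) (mXs i)) (enum 'I_n)))).
  by apply: convs_deq => i _; apply: deqC; exact: Xs_law.
have eS : obs S tt = vsum (fun i => obs (Xs i) tt) (enum 'I_n).
  apply/funext => w; apply/funext => j; rewrite /obs /vsum big_enum /=.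
  by case: (tt j) => //; rewrite big1.
move=> A mA; rewrite (lawE _ (measurable_obs pS htt)) eS.
have := indep_vsum mXs (s := enum 'I_n) (J := [::]) (A := fun=> setT) iXs.
rewrite big_nil cats0 => hv; rewrite -[X in _ = copies (fun=> P) n X]setTI hv//.
- by rewrite probability_setT mul1e.
- by move=> i C _ mC; exact: sigma_proc_obs.
- exact: enum_uniq.
Qed.

End law_of_time_stable.

(** * Jump intensities of a time-stable process *)

Section rational_times.
Variable R : realType.

(** An enumeration of the non-negative rationals with repetitions: several indices may stand for the
    same time. *)
Definition nnrat (k : nat) : R := `|ratr (odflt 0 (unpickle k)) : R|.

Lemma nnrat_ge0 k : 0 <= nnrat k. Proof. exact: normr_ge0. Qed.

Lemma nnrat_surj q : 0 <= q -> exists k, nnrat k = ratr q.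
Proof. by move=> q0; exists (pickle q); rewrite /nnrat pickleK /= ger0_norm// ler0q. Qed.

Lemma nnratP k : exists2 q : rat, 0 <= q & nnrat k = ratr q.
Proof.
by exists `|(odflt 0 (unpickle k) : rat)|; rewrite ?normr_ge0// /nnrat ratr_norm.
Qed.

Lemma nnrat_dense (x y : R) : 0 <= x -> x < y -> exists2 k, x < nnrat k & nnrat k < y.
Proof.
move=> x0 xy; have [q] := rat_in_itvoo xy; rewrite in_itv/= => /andP[xq qy].
have q0 : 0 <= q by rewrite -(ler0q R); apply: (le_trans x0); exact: ltW.
by have [k kq] := nnrat_surj q0; exists k; rewrite kq.
Qed.

Definition upto (s : R) : times R := fun k => if nnrat k < s then Some (nnrat k) else None.

Lemma nonneg_upto s : nonneg_times (upto s).
Proof. by move=> k t; rewrite /upto; case: ifP => // _ [<-]; exact: nnrat_ge0. Qed.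

Definition zero_before (T : Type) (X : R -> T -> R) (s : R) : set T :=
  [set w | forall t, 0 <= t < s -> X t w = 0].

(** Right-continuity lets the scaled rationals decide, so that an event about a whole interval
    becomes one about a single observation in [iseq R]. *)
Lemma zero_beforeE (T : Type) (X : R -> T -> R) (c s : R) w : 0 < c ->
  step_fun (fun t => X t w) ->
  zero_before X (c * s) w <-> obs X (scale_times c (upto s)) w = v0 R.
Proof.
move=> c0 sX; split => [h|h t /andP[t0 ts]].
  apply/funext => k; rewrite /obs /scale_times /upto; case: ifP => //= ks.
  by rewrite h// mulr_ge0 ?nnrat_ge0 ?ltW//= ltr_pM2l.
have [e e0 he] := step_fun_right sX t0.
have [k k1 k2] : exists2 k, t / c < nnrat k & nnrat k < Num.min s ((t + e) / c).
  apply: nnrat_dense; first by rewrite divr_ge0// ltW.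
  by rewrite lt_min ltr_pdivrMr// mulrC ts ltr_pM2r ?invr_gt0// ltrDl.
move: k2; rewrite lt_min => /andP[ks ke].
rewrite -(he (c * nnrat k)); last first.
  by rewrite mulrC -ler_pdivrMr// ltW//= -ltr_pdivlMr.
by have /(congr1 (fun x : iseq R => x k)) := h; rewrite /obs /scale_times /upto ks.
Qed.

Lemma measurable_zero_before d (T : measurableType d) (X : R -> T -> R) s :
  is_process X -> random_step_fun X -> measurable (zero_before X s).
Proof.
move=> pX sX; have m := measurable_obs pX (nonneg_scale ler01 (@nonneg_upto s)).
rewrite (_ : zero_before X s = obs X (scale_times 1 (upto s)) @^-1` (~` @nz R)).
  rewrite -[Y in measurable Y]setTI; apply: m => //; apply: measurableC; exact: measurable_nz.
apply/seteqP; split => w /=.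
  by rewrite -{1}[s]mul1r => /(zero_beforeE _ ltr01 (sX w)) -> /(_ erefl).
by move=> /contrapT/(zero_beforeE _ ltr01 (sX w)); rewrite mul1r.
Qed.

End rational_times.

Section linear_bound.
Context d (T : measurableType d) (R : realType) (P : probability T R).
Variables (X : R -> T -> R).
Hypotheses (pX : is_process X) (jX : pure_jump_process X) (tsX : time_stable P X).

Let sX : random_step_fun X. Proof. by move=> w; case: (jX w). Qed.

Definition early s := pr P (~` zero_before X s).

Let mZ s : measurable (zero_before X s). Proof. exact: measurable_zero_before. Qed.

Lemma early_ge0 s : 0 <= early s. Proof. exact: pr_ge0. Qed.

Lemma early_le1 s : early s <= 1. Proof. by apply: pr_le1; exact: measurableC. Qed.

Lemma le_early s t : s <= t -> early s <= early t.
Proof.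
move=> st; apply: le_pr; [exact: measurableC|exact: measurableC|].
by apply: subsetC => w h u /andP[u0 us]; apply: h; rewrite u0 (lt_le_trans us).
Qed.

Lemma early_law (c s : R) (m : measurable_fun setT (obs X (scale_times c (upto s)))) : 0 < c ->
  early (c * s) = pr (law P m) (@nz R).
Proof.
move=> c0; rewrite /early /pr (lawE P m); congr (fine (P _)); apply/seteqP; split => w /=.
  by move=> h1 h2; apply: h1; apply/(zero_beforeE _ c0 (sX w)).
by move=> h1 /(zero_beforeE _ c0 (sX w)) h2; apply: h1.
Qed.

(** Observed at all rationals, the path before [s] has the law of a twofold convolution, and
    [conv_first_order] on the set [nz] gives the quadratic correction. *)
Lemma early_half s : 2 * early (s / 2) - 2 * early (s / 2) ^+ 2 <= early s.
Proof.
have c2 : 0 < 2^-1 :> R by rewrite invr_gt0.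
have h0 := nonneg_scale (ltW c2) (@nonneg_upto R s).
have h1 := @nonneg_scale R 2 _ (ler0n _ 2) h0.
have m0 := measurable_obs pX h0; have m1 := measurable_obs pX h1.
have e1 : early s = pr (law P m1) (@nz R).
  have m2 := measurable_obs pX (nonneg_scale ler01 (@nonneg_upto R s)).
  rewrite -[s in LHS]mul1r (early_law m2)//; apply: deq_pr; last exact: measurable_nz.
  by apply: law_eq; rewrite scale_timesM mulfV.
rewrite e1 (mulrC s) (early_law m0)//.
have := time_stable_law pX tsX m0 m1 h0 (n := 2) isT.
move=> /deqC/deq_pr -> //; last exact: measurable_nz.
have := conv_first_order (law P m0) (law P m0) (@measurable_nz R) (fun h => h erefl).
rewrite ler_norml => /andP[h _].
have e2 : pr (convn (law P m0) 2) (@nz R) = pr (conv (law P m0) (law P m0)) (@nz R).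
  apply: deq_pr; last exact: measurable_nz.
  by apply: conv_deq => //; exact: conv_delta0r.
rewrite e2; move: h; rewrite expr2; lra.
Qed.

Lemma early_cvg0 (e : R) : 0 < e -> exists2 s, 0 < s & early s <= e.
Proof.
move=> e0; have /cvgrPdist_lt/(_ e e0)[n0 _ h0] : early n.+1%:R^-1 @[n --> \oo] --> 0.
  apply: cvg_pr_eventually => [n|w]; first exact: measurableC.
  have [u u0 hu] := step_fun_right (sX w) (lexx 0).
  exists (Num.truncn u^-1) => n hn; apply: contrapT; rewrite /= notE => h; apply: h => t /andP[t0 tn].
  have [_ X0] := jX w; rewrite -[RHS]X0; apply: hu; rewrite t0 add0r/=.
  apply: (lt_le_trans tn); rewrite -[leRHS]invrK lef_pV2 ?posrE ?invr_gt0//.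
  by apply: ltW; apply: (lt_le_trans (truncnS_gt _)); rewrite ler_nat.
exists n0.+1%:R^-1; first by rewrite invr_gt0.
by have := h0 n0 (leqnn _); rewrite /= sub0r normrN ger0_norm ?early_ge0// => /ltW.
Qed.

(* By [early_half], [early (s / 2 ^ k) / (1 - 2 early (s / 2 ^ k))] at least halves when [k]
   increases by one. *)
Lemma early_linear : exists2 K : R, 0 < K & forall x, 0 < x -> early x <= K * x.
Proof.
(* Starting from 1/4 keeps the factor [1 - 2 * early] at least 1/2 throughout the induction. *)
have [s s0 hs] := early_cvg0 (e := 1 / 4) ltac:(lra).
have hk k : early (s / 2 ^+ k) <= 2 ^- k * (1 - 2 * early (s / 2 ^+ k)) /\ early (s / 2 ^+ k) <= 1 / 4.
  elim: k => [|k [ih1 ih2]].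
    by rewrite expr0 divr1 invr1; split => //; lra.
  have q0 := early_ge0 (s / 2 ^+ k.+1).
  have := early_half (s / 2 ^+ k).
  have -> : s / 2 ^+ k / 2 = s / 2 ^+ k.+1 by rewrite exprSr invfM mulrA.
  have qp : early (s / 2 ^+ k.+1) <= early (s / 2 ^+ k).
    apply: le_early; rewrite ler_pM2l// lef_pV2 ?posrE ?exprn_gt0// exprS ler_peMl ?exprn_ge0//.
    by rewrite ler1n.
  move: ih1 ih2 qp q0; move: (early (s / 2 ^+ k)) (early (s / 2 ^+ k.+1)) => p q.
  have -> : 2 ^- k.+1 = 2 ^- k / 2 :> R by rewrite exprSr invfM.
  have : 0 < 2 ^- k :> R by rewrite invr_gt0 exprn_gt0.
  move: (2 ^- k) => z z0 ih1 ih2 qp q0 h; split; last by lra.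
  nra.
(* For x between s / 2^(k+1) and s / 2^k the bound at s / 2^k is 2^-k, at most 2 x / s. *)
exists (2 / s); first by rewrite divr_gt0.
move=> x x0; have [sx|xs] := ltP s x.
  apply: (le_trans (early_le1 _)).
  rewrite mulrAC ler_pdivlMr// mul1r; apply: (le_trans (ltW sx)).
  by rewrite ler_peMl ?ltW// ltr1n.
have ex : exists k, s / 2 ^+ k < x.
  exists (Num.truncn (s / x)).+1; rewrite ltr_pdivrMr ?exprn_gt0// mulrC -ltr_pdivrMr//.
  apply: (lt_le_trans (truncnS_gt _)); rewrite -natrX ler_nat ltnW//; exact: ltn_expl.
case: (ex_minnP ex) => -[|k] kx kmin; first by move: kx; rewrite expr0 divr1 ltNge xs.
have xk : x <= s / 2 ^+ k by rewrite leNgt; apply/negP => /kmin; rewrite ltnn.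
apply: (le_trans (le_early xk)); have [h1 h2] := hk k.
have e0 := early_ge0 (s / 2 ^+ k).
apply: (@le_trans _ _ (2 ^- k)).
  apply: (le_trans h1); rewrite ler_piMr ?invr_ge0 ?exprn_ge0//; lra.
rewrite mulrAC ler_pdivlMr// mulrC; apply: ltW.
move: kx; rewrite exprSr ltr_pdivrMr ?mulr_gt0 ?exprn_gt0// => kx.
rewrite ltr_pdivrMr ?exprn_gt0//.
by have -> : 2 * x * 2 ^+ k = x * (2 ^+ k * 2) by ring.
Qed.

End linear_bound.

Section linear_rate.
Variable R : realType.

Lemma le0_div_nat (a C : R) : (forall n, a <= C / n.+1%:R) -> a <= 0.
Proof.
move=> h; rewrite leNgt; apply/negP => a0.
have := h (Num.truncn (C / a)); apply/negP; rewrite -ltNge.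
by rewrite ltr_pdivrMr// mulrC -ltr_pdivrMr//; exact: truncnS_gt.
Qed.

Lemma eq_div_nat (a b C : R) : (forall n, `|a - b| <= C / n.+1%:R) -> a = b.
Proof. by move=> /le0_div_nat; rewrite normr_le0 subr_eq0 => /eqP. Qed.

(** Two terms are compared through their common refinement at the product of the indices; this gives
    both the Cauchy property and the rate. *)
Lemma refine_limit (u : nat -> R) C : 
  (forall n m, `|u n.+1 - u (n.+1 * m.+1)%N| <= C / n.+1%:R) ->
  forall n, `|limn (fun n => u n.+1) - u n.+1| <= C / n.+1%:R.
Proof.
move=> h.
have C0 : 0 <= C by have := le_trans (normr_ge0 _) (h 0%N 0%N); rewrite divr1.
have hh n m : `|u n.+1 - u m.+1| <= C / n.+1%:R + C / m.+1%:R.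
  have -> : u n.+1 - u m.+1 = (u n.+1 - u (n.+1 * m.+1)%N) - (u m.+1 - u (m.+1 * n.+1)%N).
    by rewrite mulnC; ring.
  by apply: (le_trans (ler_normB _ _)); rewrite lerD.
have cu : cvgn (fun n => u n.+1).
  apply/cvgn_cauchyP => m; exists (Num.truncn (C * 2 * m.+1%:R)) => n Nn.
  set N := Num.truncn _ in Nn; have N1 : C * 2 * m.+1%:R < N.+1%:R by exact: truncnS_gt.
  apply: (le_lt_trans (hh _ _)); apply: (@le_lt_trans _ _ (C * 2 / N.+1%:R)).
    rewrite -/N (_ : C * 2 / N.+1%:R = C / N.+1%:R + C / N.+1%:R); last by ring.
    by rewrite lerD// ler_wpM2l// lef_pV2 ?posrE// ler_nat.
  by rewrite ltr_pdivrMr// -(ltr_pM2r (x := m.+1%:R))// [ltRHS]mulrAC mulVf ?pnatr_eq0// mul1r.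
move=> n; have c2 : (`|u m.+1 - u n.+1| : R) @[m --> \oo] --> `|limn (fun n => u n.+1) - u n.+1|.
  by apply: cvg_norm; apply: cvgB; [exact: cu|exact: cvg_cst].
have c3 : (C / m.+1%:R + C / n.+1%:R : R) @[m --> \oo] --> (C * 0 + C / n.+1%:R : R).
  apply: cvgD; last exact: cvg_cst.
  by apply: cvgM; [exact: cvg_cst|exact: cvg_harmonic].
have := ler_cvg_to c2 c3; rewrite mulr0 add0r; apply.
by apply: nearW => m; exact: hh.
Qed.

End linear_rate.

Section interleave.
Variable R : realType.
Notation V := (iseq R).

(* Interleaving [tt] with the rational times below [y] turns a jump event into an event for
   a single observation. *)
Definition interleave (A : Type) (f g : nat -> A) (k : nat) : A := if odd k then g k./2 else f k./2.

Definition evens (x : V) : V := fun k => x k.*2.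
Definition odds (x : V) : V := fun k => x k.*2.+1.

Lemma measurable_evens : measurable_fun setT evens.
Proof. by apply: measurable_to_iseq => k; exact: measurable_coord. Qed.

Lemma measurable_odds : measurable_fun setT odds.
Proof. by apply: measurable_to_iseq => k; exact: measurable_coord. Qed.

Lemma scale_interleave c (t1 t2 : times R) :
  scale_times c (interleave t1 t2) = interleave (scale_times c t1) (scale_times c t2).
Proof. by apply/funext => k; rewrite /scale_times /interleave; case: ifP. Qed.

Lemma evens_obs T (X : R -> T -> R) t1 t2 w : evens (obs X (interleave t1 t2) w) = obs X t1 w.
Proof.
by apply/funext => k; rewrite /evens /obs /interleave odd_double doubleK.
Qed.

Lemma odds_obs T (X : R -> T -> R) t1 t2 w : odds (obs X (interleave t1 t2) w) = obs X t2 w.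
Proof.
by apply/funext => k; rewrite /odds /obs /interleave /= odd_double /= uphalf_double.
Qed.

Definition mask (p : pred nat) (x : V) : V := fun k => if p k then x k else 0.

Lemma measurable_mask p : measurable_fun setT (mask p).
Proof.
apply: measurable_to_iseq => k; rewrite /mask.
by case: (p k); [exact: measurable_coord|exact: measurable_cst].
Qed.

End interleave.

Section intensity.
Context d (T : measurableType d) (R : realType) (P : probability T R).
Notation V := (iseq R).
Variables (X : R -> T -> R).
Hypotheses (pX : is_process X) (jX : pure_jump_process X) (tsX : time_stable P X).

Let sX : random_step_fun X. Proof. by move=> w; case: (jX w). Qed.

(** The set difference expresses that the path first leaves 0 within [[c * x, c * y[]. *)
Definition jump_event (c : R) (tt : times R) (E : set V) (x y : R) : set T :=
  obs X (scale_times c tt) @^-1` E `&` (zero_before X (c * x) `\` zero_before X (c * y)).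

Lemma jump_event_scale c r tt E x y :
  jump_event c (scale_times r tt) E (r * x) (r * y) = jump_event (c * r) tt E x y.
Proof. by rewrite /jump_event scale_timesM !mulrA. Qed.

Lemma measurable_jump_event c tt E x y : 0 <= c -> nonneg_times tt -> measurable E ->
  measurable (jump_event c tt E x y).
Proof.
move=> c0 htt mE; apply: measurableI.
  by rewrite -[Y in measurable Y]setTI; apply: measurable_obs => //; exact: nonneg_scale.
by apply: measurableD; exact: measurable_zero_before.
Qed.

Definition jump_rate (tt : times R) E x y n : R :=
  n%:R * pr P (jump_event n%:R^-1 tt E x y).

(** The Lévy measure of the process, seen through the observation times and restricted by the first
    jump time. *)
Definition intensity tt E x y : R := limn (fun n => jump_rate tt E x y n.+1).

Definition bounded_times (tt : times R) (M : R) := forall k t, tt k = Some t -> 0 <= t < M.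

Lemma bounded_nonneg tt M : bounded_times tt M -> nonneg_times tt.
Proof. by move=> h k t /h/andP[]. Qed.

Let joint_event (E : set V) (x : R) : set V :=
  [set z | E (evens z)] `&` ([set z | mask (fun k => nnrat R k < x) (odds z) = v0 R] `&` [set z | @nz R (odds z)]).

Let measurable_joint_event E x : measurable E -> measurable (joint_event E x).
Proof.
move=> mE; apply: measurableI.
  by have := @measurable_evens R measurableT _ mE; rewrite setTI.
apply: measurableI; last first.
  by have := @measurable_odds R measurableT _ (@measurable_nz R); rewrite setTI.
have m0 := measurableC (@measurable_nz R).
have := measurableT_comp (@measurable_mask R (fun k => nnrat R k < x)) (@measurable_odds R).
move=> /(_ measurableT _ m0); rewrite setTI; congr (measurable _).
by apply/seteqP; split => z /=; [move=> /contrapT|move=> -> /(_ erefl)].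
Qed.

Let joint_eventE c tt E x y : 0 < c -> x <= y ->
  obs X (scale_times c (interleave tt (upto y))) @^-1` joint_event E x = jump_event c tt E x y.
Proof.
move=> c0 xy; rewrite scale_interleave; apply/seteqP; split => w.
  rewrite /joint_event /= evens_obs odds_obs => -[Ew [h1 h2]]; split => //; split.
    apply/(zero_beforeE _ c0 (sX w)); rewrite -h1; apply/funext => k.
    rewrite /mask /obs /scale_times /upto; case: ifP => //= kx.
    by rewrite (lt_le_trans kx xy).
  by move=> /(zero_beforeE _ c0 (sX w)).
rewrite /joint_event /= evens_obs odds_obs => -[Ew [h1 h2]]; split => //; split.
  move: h1 => /(zero_beforeE _ c0 (sX w)) <-; apply/funext => k.
  rewrite /mask /obs /scale_times /upto; case: ifP => //= kx.
  by rewrite (lt_le_trans kx xy).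
by move=> h; apply: h2; apply/(zero_beforeE _ c0 (sX w)).
Qed.

(** By stability the law at scale 1/n is an m-fold convolution of the law at scale 1/(n m). By the
    linear bound the latter is non-zero with probability at most K M / (n m), so the expansion errs
    by at most (K M / n)^2, and the rate by n times this. *)
Lemma jump_rate_refine : exists2 C : R, 0 <= C & forall tt M, bounded_times tt M -> 0 < M ->
  forall E x y, measurable E -> x <= y <= M -> forall n m,
  `|jump_rate tt E x y n.+1 - jump_rate tt E x y (n.+1 * m.+1)| <= C * M ^+ 2 / n.+1%:R.
Proof.
have [K K0 hK] := early_linear pX jX tsX.
exists (K ^+ 2); first exact: sqr_ge0.
move=> tt M bM M0 E x y mE /andP[xy yM] n m.
pose tj := interleave tt (upto y).
have htj : nonneg_times tj.
  move=> k t; rewrite /tj /interleave; case: ifP => _; first exact: nonneg_upto.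
  exact: (bounded_nonneg bM).
have n0 : 0 < n.+1%:R :> R by []. have m0 : 0 < m.+1%:R :> R by [].
have nm0 : 0 < (n.+1 * m.+1)%:R^-1 :> R by rewrite invr_gt0 ltr0n muln_gt0.
have h1 := nonneg_scale (ltW nm0) htj.
have h2 := nonneg_scale (ler0n R m.+1) h1.
have m1 := measurable_obs pX h1; have m2 := measurable_obs pX h2.
have st := time_stable_law pX tsX m1 m2 h1 (isT : (0 < m.+1)%N).
have mJ := @measurable_joint_event E x mE.
have J0 : ~ joint_event E x (v0 R) by move=> [_ [_ /(_ erefl)]].
have e1 : pr P (jump_event (n.+1 * m.+1)%:R^-1 tt E x y) = pr (law P m1) (joint_event E x).
  by rewrite /pr (lawE P m1) joint_eventE.
have e2 : pr P (jump_event n.+1%:R^-1 tt E x y) = pr (convn (law P m1) m.+1) (joint_event E x).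
  rewrite (deq_pr st mJ) /pr (lawE P m2); congr (fine (P _)).
  rewrite scale_timesM (_ : m.+1%:R * _ = n.+1%:R^-1) ?joint_eventE ?invr_gt0//.
  by rewrite natrM invfM mulrCA mulfV ?mulr1.
have := convn_first_order (law P m1) m.+1 mJ J0; rewrite -e1 -e2 => h.
have p1 : pr (law P m1) (@nz R) <= K * (M / (n.+1 * m.+1)%:R).
  apply: (le_trans _ (hK _ _)); last by rewrite divr_gt0// ltr0n muln_gt0.
  rewrite {1}/pr (lawE P m1); apply: le_pr.
  - by have := m1 measurableT _ (@measurable_nz R); rewrite setTI.
  - by apply: measurableC; exact: measurable_zero_before.
  move=> w /= hn hz; apply: hn; apply/funext => k; rewrite /obs /scale_times.
  case tk: (tj k) => [t|] //=; apply: hz.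
  have /andP[t0 tM] : 0 <= t < M.
    move: tk; rewrite /tj /interleave; case: ifP => _; last exact: bM.
    by rewrite /upto; case: ifP => // ky [<-]; rewrite nnrat_ge0 (lt_le_trans ky).
  by apply/andP; split; [rewrite mulr_ge0// ltW|rewrite mulrC ltr_pM2r].
have p0 : 0 <= pr (law P m1) (@nz R) by exact: pr_ge0.
have p2 : m.+1%:R * pr (law P m1) (@nz R) <= K * M / n.+1%:R.
  apply: (le_trans (ler_wpM2l _ p1)); first exact: ltW.
  rewrite natrM invfM le_eqVlt; apply/orP; left; apply/eqP; field.
  by rewrite !nat1r !pnatr_eq0.
have fac (a b : R) : n.+1%:R * a - (n.+1 * m.+1)%:R * b = n.+1%:R * (a - m.+1%:R * b).
  by rewrite natrM; ring.
rewrite /jump_rate fac normrM (gtr0_norm n0).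
apply: (le_trans (ler_wpM2l (ltW n0) h)).
have -> : K ^+ 2 * M ^+ 2 / n.+1%:R = n.+1%:R * (K * M / n.+1%:R) ^+ 2.
  by field; rewrite !nat1r !pnatr_eq0.
rewrite ler_pM2l// ler_pXn2r// nnegrE; first by rewrite mulr_ge0.
by rewrite divr_ge0 ?mulr_ge0 ?ltW.
Qed.

Definition intensity_const : R := projT1 (cid2 jump_rate_refine).

Lemma intensity_const_ge0 : 0 <= intensity_const.
Proof. by rewrite /intensity_const; case: cid2. Qed.

Lemma intensity_err tt M E x y n : bounded_times tt M -> 0 < M -> measurable E -> x <= y <= M ->
  `|intensity tt E x y - jump_rate tt E x y n.+1| <= intensity_const * M ^+ 2 / n.+1%:R.
Proof.
move=> bM M0 mE xyM; rewrite /intensity_const; case: cid2 => C C0 /= hC.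
by apply: refine_limit => {}n m; exact: hC.
Qed.

(** Scaling by p / q matches the rate of index p k on one side with that of index q k on the other,
    up to the factor p / q; the indices being integers, the ratio is rational. *)
Lemma intensity_scale tt M E x y p q : bounded_times tt M -> 0 < M -> measurable E -> x <= y <= M ->
  let r : R := p.+1%:R / q.+1%:R in
  intensity (scale_times r tt) E (r * x) (r * y) = r * intensity tt E x y.
Proof.
move=> bM M0 mE xyM r; have r0 : 0 < r by rewrite divr_gt0.
have brM : bounded_times (scale_times r tt) (r * M).
  move=> k t; rewrite /scale_times; case tk: (tt k) => [s|] //= [<-].
  have /andP[s0 sM] := bM _ _ tk.
  by apply/andP; split; [exact: mulr_ge0 (ltW r0) s0|rewrite ltr_pM2l].
pose C := intensity_const * (r * M) ^+ 2 + r * (intensity_const * M ^+ 2).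
apply: (@eq_div_nat _ _ _ C) => k.
have p0 : (0 < p.+1 * k.+1)%N by []. have q0 : (0 < q.+1 * k.+1)%N by [].
have e : jump_rate (scale_times r tt) E (r * x) (r * y) (p.+1 * k.+1) =
    r * jump_rate tt E x y (q.+1 * k.+1).
  rewrite /jump_rate jump_event_scale.
  have -> : (p.+1 * k.+1)%:R^-1 * r = (q.+1 * k.+1)%:R^-1 :> R.
    by rewrite /r !natrM [X in X^-1 * _ = _]mulrC mulrA invfM mulfVK ?pnatr_eq0// mulrC -invfM.
  by rewrite mulrA; congr (_ * _); rewrite /r !natrM mulrA mulfVK ?pnatr_eq0.
have rxy : r * x <= r * y <= r * M by rewrite !ler_pM2l.
have h1 := intensity_err (p.+1 * k.+1).-1 brM (mulr_gt0 r0 M0) mE rxy.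
have h2 := intensity_err (q.+1 * k.+1).-1 bM M0 mE xyM.
rewrite !prednK// in h1 h2.
have -> : intensity (scale_times r tt) E (r * x) (r * y) - r * intensity tt E x y =
   (intensity (scale_times r tt) E (r * x) (r * y) - jump_rate (scale_times r tt) E (r * x) (r * y) (p.+1 * k.+1))
   - r * (intensity tt E x y - jump_rate tt E x y (q.+1 * k.+1)) by rewrite e; ring.
apply: (le_trans (ler_normB _ _)); rewrite /C mulrDl; apply: lerD.
  apply: (le_trans h1); rewrite ler_wpM2l ?mulr_ge0 ?intensity_const_ge0 ?(ltW M0) ?(ltW r0)//.
  by rewrite lef_pV2 ?posrE ?ltr0n// ler_nat leq_pmull.
rewrite normrM gtr0_norm// -[leRHS]mulrA ler_pM2l//.
apply: (le_trans h2); rewrite ler_wpM2l ?mulr_ge0 ?intensity_const_ge0 ?(ltW M0) ?(ltW r0)//.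
by rewrite lef_pV2 ?posrE ?ltr0n// ler_nat leq_pmull.
Qed.

End intensity.

(** * Construction of the mark process *)

Section limit_measure.
Context d (T : measurableType d) (R : realType).
Variables (f : set T -> R) (nu : nat -> {measure set T -> \bar R}) (C : R).
Hypothesis nu_fin : forall n E, measurable E -> (nu n E < +oo)%E.
Hypothesis f_nu : forall n E, measurable E -> `|f E - fine (nu n E)| <= C / n.+1%:R.

Let nuE n E : measurable E -> nu n E = (fine (nu n E))%:E.
Proof. by move=> mE; rewrite fineK// ge0_fin_numE//; exact: nu_fin. Qed.

Let f0 : f set0 = 0.
Proof. by apply: (@eq_div_nat _ _ _ C) => n; have := f_nu n measurable0; rewrite measure0. Qed.

Let f_ge0 E : measurable E -> 0 <= f E.
Proof.
move=> mE; rewrite -oppr_le0; apply: (@le0_div_nat _ _ C) => n.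
have := f_nu n mE; rewrite ler_norml => /andP[h _].
have : 0 <= fine (nu n E) by rewrite fine_ge0.
by move: h; move: (fine _) (f E) (C / _) => a b c; lra.
Qed.

Let fU A B : measurable A -> measurable B -> A `&` B = set0 -> f (A `|` B) = f A + f B.
Proof.
move=> mA mB AB; apply: (@eq_div_nat _ _ _ (3 * C)) => n.
have h1 := f_nu n mA; have h2 := f_nu n mB; have h3 := f_nu n (measurableU _ _ mA mB).
have e : fine (nu n (A `|` B)) = fine (nu n A) + fine (nu n B).
  by rewrite -fineD ?ge0_fin_numE ?nu_fin// -measureU.
rewrite e in h3; have -> : 3 * C / n.+1%:R = C / n.+1%:R + C / n.+1%:R + C / n.+1%:R by ring.
move: h1 h2 h3; move: (C / _) (fine _) (fine _) => c x y.
rewrite !ler_norml => /andP[? ?] /andP[? ?] /andP[? ?]; apply/andP; split; lra.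
Qed.

(** A measure is a non-negative function on all sets, and [f] is controlled only on the measurable
    ones. *)
Let g (E : set T) : \bar R := if `[< measurable E >] then (f E)%:E else 0%E.

Let gE E : measurable E -> g E = (f E)%:E.
Proof. by move=> mE; rewrite /g asboolT. Qed.

Let g0 : g set0 = 0%E. Proof. by rewrite gE// f0. Qed.

Let g_ge0 E : (0 <= g E)%E.
Proof. by rewrite /g; case: asboolP => // mE; rewrite lee_fin f_ge0. Qed.

(** Uniform closeness to one genuine measure [nu N] replaces continuity from above: on sets
    decreasing to the empty set [f] is at most [nu N] plus a small constant. *)
Let g_sigma : semi_sigma_additive g.
Proof.
move=> F mF tF mU.
pose U n := \big[setU/set0]_(i < n) F i.
have mUn n : measurable (U n) by apply: bigsetU_measurable => i _.
have sumE n : (\sum_(0 <= i < n) g (F i) = (f (U n))%:E)%E.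
  elim: n => [|n ih]; first by rewrite big_geq// /U big_ord0 f0.
  rewrite big_nat_recr//= ih gE// -EFinD -fU//; first by rewrite /U big_ord_recr.
  apply/seteqP; split => x //= -[]; rewrite /U -bigcup_mkord => -[i /= iN Fi] Fn.
  by move: tF => /trivIsetP/(_ i n I I); rewrite ltn_eqF// => /(_ isT)/seteqP[/(_ x)/(_ (conj Fi Fn))].
rewrite (_ : (fun n => _) = (fun n => (f (U n))%:E)); last by apply/funext => n; exact: sumE.
rewrite gE//; apply: cvg_EFin; first exact: nearW.
rewrite (_ : fine \o _ = fun n => f (U n)); last by apply/funext.
pose D n := \bigcup_i F i `\` U n.
have mD n : measurable (D n) by exact: measurableD.
have fD n : f (\bigcup_i F i) - f (U n) = f (D n).
  have -> : \bigcup_i F i = U n `|` D n.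
    apply/seteqP; split => x; last by move=> [|[]//]; rewrite /U -bigcup_mkord => -[i _ ?]; exists i.
    by move=> Fx; have [Ux|Ux] := pselect (U n x); [left|right].
  rewrite fU//; first by rewrite addrC addKr.
  by apply/seteqP; split => x //= [? []].
apply/cvgrPdist_lt => e e0.
pose N := Num.truncn (C / (e / 2)).
have CN : C / N.+1%:R < e / 2.
  by rewrite ltr_pdivrMr// mulrC -ltr_pdivrMr ?divr_gt0//; exact: truncnS_gt.
have cD : nu N (D n) @[n --> \oo] --> 0%E.
  have D0 : \bigcap_n D n = set0.
    apply/seteqP; split => x //= h; have [[i _ Fi] _] := h 0%N I.
    by have [_] := h i.+1 I; apply; rewrite /U -bigcup_mkord; exists i => /=.
  rewrite -(measure0 (nu N)) -D0; apply: nonincreasing_cvg_mu => //.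
  - exact: nu_fin.
  - by rewrite D0.
  - move=> n m nm; rewrite subsetEset => x [Fx nU]; split => // Ux; apply: nU.
    move: Ux; rewrite /U -!bigcup_mkord => -[i /= im Fi]; exists i => //=.
    exact: leq_trans nm.
have e2 : 0 < e / 2 by rewrite divr_gt0.
have /fine_cvgP[_] := cD => /cvgrPdist_lt/(_ _ e2)[n0 _ h0].
exists n0 => // n hn; have := h0 n hn; rewrite /= sub0r normrN fD => h1.
have := f_nu N (mD n); rewrite ger0_norm ?fine_ge0// in h1 => h2.
rewrite ger0_norm; last exact: f_ge0.
move: h1 CN h2; rewrite ler_norml => h1 CN /andP[_].
by move: h1 CN; move: (fine _) (f (D n)) (C / _) (e : R) => a b c e'; lra.
Qed.

Let gT := isMeasure.Build _ _ _ g g0 g_ge0 g_sigma.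
HB.instance Definition _ := gT.

Lemma limit_measure : exists mu : {measure set T -> \bar R}, forall E, measurable E -> mu E = (f E)%:E.
Proof. by exists g => E mE; exact: gE. Qed.

End limit_measure.

Section to_prob.
Context d (T : measurableType d) (R : realType).
Variables (m : {measure set T -> \bar R}) (mT : m setT = 1%E).

(** The proof of total mass 1 is kept inside the term, so that the probability instance can be
    attached to it. *)
Definition to_prob : set T -> \bar R := let _ := mT in m.

HB.instance Definition _ := Measure.on to_prob.
HB.instance Definition _ := Measure_isProbability.Build _ _ _ to_prob mT.

End to_prob.

Section mark_law.
Context d (T : measurableType d) (R : realType) (P : probability T R).
Notation V := (iseq R).
Variables (X : R -> T -> R).
Hypotheses (pX : is_process X) (jX : pure_jump_process X) (tsX : time_stable P X).

Let sX : random_step_fun X. Proof. by move=> w; case: (jX w). Qed.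

Lemma intensity_measure tt M x y : bounded_times tt M -> 0 < M -> x <= y <= M ->
  exists mu : {measure set V -> \bar R}, forall E, measurable E ->
    mu E = (intensity P X tt E x y)%:E.
Proof.
move=> bM M0 xyM; have htt := bounded_nonneg bM.
have c0 n : 0 <= n.+1%:R^-1 :> R by rewrite invr_ge0.
pose W n := zero_before X (n.+1%:R^-1 * x) `\` zero_before X (n.+1%:R^-1 * y).
have mW n : measurable (W n) by apply: measurableD; exact: measurable_zero_before.
have mo n := measurable_obs pX (nonneg_scale (c0 n) htt).
pose nu n : {measure set V -> \bar R} :=
  image_measure (mscale (NngNum (ler0n R n.+1)) (mrestr P (mW n))) (mo n).
have nuE n E : measurable E -> nu n E = (jump_rate P X tt E x y n.+1)%:E.
  move=> mE; rewrite /nu image_measureE /mscale /= /mrestr /jump_rate EFinM -prE//.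
  exact: measurable_jump_event.
apply: (@limit_measure _ _ _ _ nu (intensity_const pX jX tsX * M ^+ 2)) => n E mE.
  by rewrite nuE// ltry.
by rewrite nuE//=; exact: intensity_err.
Qed.

Lemma mark_law_exists (k : R) tt M x y : bounded_times tt M -> 0 < M -> x <= y <= M ->
  0 <= k -> k * intensity P X tt setT x y <= 1 ->
  exists mu : probability V R, forall E, measurable E ->
    pr mu E = k * intensity P X tt E x y +
      (1 - k * intensity P X tt setT x y) * (v0 R \in E)%:R.
Proof.
move=> bM M0 xyM k0 k1; have [mu muE] := intensity_measure bM M0 xyM.
have q0 : 0 <= 1 - k * intensity P X tt setT x y by rewrite subr_ge0.
pose m : {measure set V -> \bar R} :=
  measure_add (mscale (NngNum k0) mu) (mscale (NngNum q0) (delta0 R)).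
have mE E : measurable E -> m E = (k * intensity P X tt E x y +
      (1 - k * intensity P X tt setT x y) * (v0 R \in E)%:R)%:E.
  move=> mE; transitivity ((k%:E * mu E + (1 - k * intensity P X tt setT x y)%:E * delta0 R E)%E).
    exact: measure_addE.
  by rewrite muE// delta0E indicE -!EFinM -EFinD.
have mT : m setT = 1%E by rewrite mE// in_setT mulr1 addrC subrK.
exists (to_prob mT) => E mE'.
by rewrite -[LHS]/(fine (m E)) mE.
Qed.

End mark_law.

(** * Random sequences on the unit interval *)

Section unit_interval.
Variable R : realType.

Let mid : measurable_fun setT (id : measurableTypeR R -> R).
Proof. by move=> _ B mB; rewrite setTI. Qed.

Let mI : measurable (`[0, 1[%classic : set R). Proof. exact: measurable_itv. Qed.

Let m01 : {measure set R -> \bar R} :=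
  image_measure (mrestr (@lebesgue_measure R) mI) mid.

Let m01E (A : set R) : m01 A = @lebesgue_measure R (A `&` `[0, 1[%classic).
Proof. by []. Qed.

Let m01T : m01 setT = 1%E.
Proof. by rewrite m01E setTI lebesgue_measure_itv/= lte_fin ltr01 oppr0 adde0. Qed.

Definition unif : probability R R := to_prob m01T.

Lemma unifE (A : set R) : unif A = @lebesgue_measure R (A `&` `[0, 1[%classic).
Proof. by []. Qed.

Lemma unif_itv (a b : R) : 0 <= a -> a <= b -> b <= 1 -> unif `[a, b[%classic = (b - a)%:E.
Proof.
move=> a0 ab b1; rewrite unifE (_ : _ `&` _ = `[a, b[%classic); last first.
  apply/seteqP; split => x; rewrite /= !in_itv/=; first by case.
  by move=> /andP[ax xb]; split; rewrite ?ax// (le_trans a0 ax) (lt_le_trans xb).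
rewrite lebesgue_measure_itv/= lte_fin; case: ltP => // ba.
have -> : b = a by apply/eqP; rewrite eq_le ba ab.
by rewrite subrr.
Qed.

End unit_interval.

Section bit_process.
Variable R : realType.
(* words are read from the last letter to the first *)
Variable p : seq bool -> R.
Hypothesis p_ge0 : forall w, 0 <= p w.
Hypothesis p_nil : p [::] = 1.
Hypothesis p_cons : forall w, p w = p (false :: w) + p (true :: w).

(** Nested intervals: the word [w] owns [[word_left w, word_left w + p w[], which its two extensions
    share, [false] on the left. *)
Fixpoint word_left (w : seq bool) : R :=
  if w is b :: w' then word_left w' + (if b then p (false :: w') else 0) else 0.

Fixpoint word (n : nat) (u : R) : seq bool :=
  if n is n'.+1 then let w := word n' u in (word_left w + p (false :: w) <= u) :: w else [::].

Lemma size_word n u : size (word n u) = n.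
Proof. by elim: n => //= n ->. Qed.

Lemma word_bounds w : 0 <= word_left w /\ word_left w + p w <= 1.
Proof.
elim: w => [|b w [h0 h1]] /=; first by rewrite p_nil add0r.
have := p_ge0 (false :: w); have := p_ge0 (true :: w); have := p_cons w.
by case: b; lra.
Qed.

Lemma wordP u w : 0 <= u < 1 -> word (size w) u = w <-> word_left w <= u < word_left w + p w.
Proof.
move=> u01; elim: w => [|b w ih] /=; first by rewrite p_nil add0r u01.
have q0 := p_ge0 (false :: w); have q1 := p_ge0 (true :: w); have q := p_cons w.
split.
  move=> [/= + hw]; rewrite hw; have /andP[h1 h2] := ih.1 hw; case: b => h.
    by rewrite h -addrA -q.
  move/negbT: h; rewrite -ltNge => h.
  by rewrite addr0 h h1.
move=> /andP[h1 h2]; have hw : word (size w) u = w.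
  by apply/ih; case: b h1 h2; lra.
rewrite hw; congr (_ :: _).
by case: b h1 h2 => h1 h2; [rewrite h1|apply/negbTE; rewrite -ltNge; move: h2; rewrite addr0].
Qed.

Definition bits (u : R) : iseq bool := fun n => head false (word n.+1 u).

Lemma wordE n u : word n u = rev (mkseq (bits u) n).
Proof. by elim: n => // n ih; rewrite mkseqS rev_rcons -ih. Qed.

Lemma unif_word w : unif R [set u | word (size w) u = w] = (p w)%:E.
Proof.
have [h0 h1] := word_bounds w.
transitivity (unif R `[word_left w, (word_left w + p w)[%classic); last first.
  by rewrite unif_itv// ?lerDl// addrAC subrr add0r.
rewrite !unifE; congr (lebesgue_measure _); apply/seteqP; split => u [].
  by move=> + u01; move: (u01); rewrite /= !in_itv/= => + /wordP h => /h.
by move=> + u01; move: (u01); rewrite /= !in_itv/= => + /wordP h => /h.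
Qed.

Let measurable_word_lt n w : measurable [set u | word n u = w].
Proof.
elim: n w => [|n ih] w /=.
  by case: w => [|b w]; [rewrite (_ : [set _ | _] = setT)|rewrite (_ : [set _ | _] = set0)];
    rewrite ?predeqE.
case: w => [|b w]; first by rewrite (_ : [set _ | _] = set0) ?predeqE.
rewrite (_ : [set u | _] = [set u | word n u = w] `&`
   (if b then `[word_left w + p (false :: w), +oo[%classic else `]-oo, word_left w + p (false :: w)[%classic)).
  by apply: measurableI => //; case: b; exact: measurable_itv.
apply/seteqP; split => u /=.
  by move=> [<- <-]; split => //; case: ifPn => //=; rewrite in_itv/= ?andbT// ltNge.
move=> [-> h]; congr (_ :: _); case: b h; rewrite /= in_itv/= ?andbT// => h.
by apply/negbTE; rewrite -ltNge.
Qed.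

Let word_tuple n u : n.-tuple bool := Tuple (introT eqP (size_word n u)).

Let measurable_word_tuple n v : measurable (word_tuple n @^-1` [set v]).
Proof.
rewrite (_ : _ @^-1` _ = [set u | word n u = v :> seq bool]); first exact: measurable_word_lt.
by apply/seteqP; split => u /=; [move=> <-|move=> h; exact: val_inj].
Qed.

Lemma measurable_word n (Q : set (seq bool)) : measurable [set u | Q (word n u)].
Proof.
rewrite (_ : [set u | _] = \bigcup_(v in [set v : n.-tuple bool | Q v]) (word_tuple n @^-1` [set v])).
  by apply: fin_bigcup_measurable => // v _; exact: measurable_word_tuple.
by apply/seteqP; split => u /=; [move=> h; exists (word_tuple n u)|move=> [v Qv /(congr1 val) /= ->]].
Qed.

Lemma measurable_bits : measurable_fun setT bits.
Proof.
apply: measurable_to_iseq => k; apply: (measurable_fun_bool true); rewrite setTI.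
exact: (measurable_word k.+1 [set w | head false w = true]).
Qed.

Lemma unif_prefix n (Q : set (seq bool)) :
  pr (unif R) [set u | Q (word n u)] = \sum_(w : n.-tuple bool) p w * `[< Q w >]%:R.
Proof.
rewrite (pr_fin_partition _ (measurable_word n Q) (measurable_word_tuple (n := n))).
apply: eq_bigr => v _; have -> : p v = pr (unif R) (word_tuple n @^-1` [set v]).
  rewrite /pr -[p v]/(fine (p v)%:E) -unif_word size_tuple; congr (fine (unif R _)).
  by apply/seteqP; split => u /=; [move=> h; exact: val_inj|move=> <-].
case: asboolP => Qv; last first.
  rewrite mulr0 (_ : _ `&` _ = set0) ?pr_set0//; apply/seteqP; split => u //= -[+ /(congr1 val) /= h].
  by rewrite h.
rewrite mulr1; congr (pr _ _); apply/seteqP; split => u /=; first by case.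
by move=> h; split => //; have /(congr1 val) /= -> := h.
Qed.

End bit_process.

Section kolmogorov.
Variable R : realType.
Notation V := (iseq R).

Definition rat_enum (j : nat) : R := ratr (odflt 0 (unpickle j : option rat)).

Let dec (n : nat) : nat * nat := odflt (0, 0)%N (unpickle n).

(* the bits of a sequence are the Dedekind cuts of its coordinates *)
Definition dedekind (x : V) : iseq bool := fun n => x (dec n).1 <= rat_enum (dec n).2.

Lemma measurable_dedekind : measurable_fun setT dedekind.
Proof.
apply: measurable_to_iseq => n; apply: measurable_fun_ler; last exact: measurable_cst.
exact: measurable_coord.
Qed.

(** The least of the first [n] rationals that the bits place at or above coordinate [k]; the cap [n]
    makes the minimum meaningful from the start and is harmless in the limit. *)
Let approx (n k : nat) (b : iseq bool) : R :=
  \big[Num.min/n%:R]_(j < n) (if b (pickle (k, nat_of_ord j)) then rat_enum j else n%:R).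

Definition undedekind (b : iseq bool) : V := fun k => limn (fun n => approx n k b).

Lemma measurable_undedekind : measurable_fun setT undedekind.
Proof.
apply: measurable_to_iseq => k; apply: measurable_limn => n; rewrite /approx.
elim: (index_enum _) => [|j s ih].
  by rewrite (_ : (fun b => _) = cst n%:R)//; apply/funext => b; rewrite big_nil.
rewrite (_ : (fun b => _) = fun b : iseq bool =>
    Num.min (if b (pickle (k, nat_of_ord j)) then rat_enum j else n%:R)
    (\big[Num.min/n%:R]_(j <- s) (if b (pickle (k, nat_of_ord j)) then rat_enum j else n%:R))).
  apply: measurable_minr => //; apply: measurable_fun_ifT; [|exact: measurable_cst..].
  exact: measurable_coord.
by apply/funext => b; rewrite big_cons.
Qed.

Lemma dedekindK x : undedekind (dedekind x) = x.
Proof.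
apply/funext => k; rewrite /undedekind; apply/cvg_lim => //.
apply/cvgrPdist_lt => e e0.
have xe : x k < x k + e by rewrite ltrDl.
have [q] := rat_in_itvoo xe; rewrite in_itv/= => /andP[xq qe].
pose N := (maxn (pickle q) (Num.truncn `|x k|)).+1.
exists N => // n /= Nn.
have xn : x k <= n%:R.
  apply: (le_trans (ler_norm _)); apply: ltW; apply: (lt_le_trans (truncnS_gt _)).
  by rewrite ler_nat (leq_trans _ Nn)// ltnS leq_maxr.
have dE j : dec (pickle (k, j)) = (k, j) by rewrite /dec pickleK.
have h1 : x k <= approx n k (dedekind x).
  rewrite /approx; elim/big_ind : _ => // [a b ha hb|j _]; first by rewrite le_min ha.
  by rewrite /dedekind dE /=; case: ifP.
have qn : (pickle q < n)%N by rewrite (leq_trans _ Nn)// ltnS leq_maxl.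
have h2 : approx n k (dedekind x) <= ratr q.
  rewrite /approx (bigD1 (Ordinal qn))//= ge_min; apply/orP; left.
  by rewrite /dedekind dE /rat_enum pickleK /= (ltW xq).
rewrite distrC ger0_norm ?subr_ge0//; lra.
Qed.

(** The number of leading coordinates that determine the first [n] bits. *)
Let width n := (\max_(i < n) (dec i).1).+1.

Let le_width i n : (i < n)%N -> ((dec i).1 < width n)%N.
Proof. by move=> iN; rewrite ltnS (leq_bigmax (Ordinal iN)). Qed.

Definition first_coords N : V -> V := mask (fun k => (k < N)%N).

Variable m : nat -> probability V R.
Hypothesis mP : forall N E, measurable E ->
  pr (m N.+1) (first_coords N @^-1` E) = pr (m N) (first_coords N @^-1` E).

Let mfirst N E : measurable E -> measurable (first_coords N @^-1` E).
Proof. by move=> mE; have := @measurable_mask R (fun k => (k < N)%N) measurableT _ mE; rewrite setTI. Qed.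

Let first_first N M x : (N <= M)%N -> first_coords N (first_coords M x) = first_coords N x.
Proof.
move=> NM; apply/funext => k; rewrite /first_coords /mask; case: ltnP => // kN.
by rewrite (leq_trans kN NM).
Qed.

Let consistent N M E : (N <= M)%N -> measurable E ->
  pr (m M) (first_coords N @^-1` E) = pr (m N) (first_coords N @^-1` E).
Proof.
move=> + mE; elim: M => [|M ih]; first by rewrite leqn0 => /eqP ->.
rewrite leq_eqVlt => /orP[/eqP ->//|]; rewrite ltnS => NM; rewrite -ih//.
rewrite (_ : first_coords N @^-1` E = first_coords M @^-1` (first_coords N @^-1` E)).
  by apply: mP; exact: mfirst.
by apply/seteqP; split => x /=; rewrite first_first.
Qed.

Let code_word n x := rev (mkseq (dedekind x) n).

Let code_tuple n x : n.-tuple bool := @Tuple _ _ (code_word n x)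
  (introT eqP (etrans (size_rev _) (size_mkseq _ _))).

Let code_word_first n M x : (width n <= M)%N -> code_word n (first_coords M x) = code_word n x.
Proof.
move=> nM; congr rev; apply/eq_in_map => i; rewrite mem_iota add0n => /= iN.
by rewrite /dedekind /first_coords /mask (leq_trans (le_width iN) nM).
Qed.

Let measurable_code_tuple n v : measurable (code_tuple n @^-1` [set v]).
Proof.
rewrite (_ : _ @^-1` _ = \bigcap_(i in [set i | (i < n)%N]) [set x | dedekind x i = nth false (rev v) i]).
  apply: bigcap_measurableType => i _.
  have := measurableT_comp (measurable_coord i) measurable_dedekind.
  by move=> /(_ measurableT [set nth false (rev v) i] I); rewrite setTI.
apply/seteqP; split => x /=.
  by move=> <- i /= iN; rewrite revK nth_mkseq.
move=> h; apply/val_inj => /=; rewrite -[RHS]revK; congr rev.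
apply: (@eq_from_nth _ false); first by rewrite size_mkseq size_rev size_tuple.
by move=> i; rewrite size_mkseq => iN; rewrite nth_mkseq// h.
Qed.

Let measurable_code_word n (Q : set (seq bool)) : measurable [set x | Q (code_word n x)].
Proof.
rewrite (_ : [set x | _] = \bigcup_(v in [set v : n.-tuple bool | Q v]) (code_tuple n @^-1` [set v])).
  by apply: fin_bigcup_measurable => // v _; exact: measurable_code_tuple.
by apply/seteqP; split => u /=; [move=> h; exists (code_tuple n u)|move=> [v Qv /(congr1 val) /= ->]].
Qed.

Let p (w : seq bool) : R := pr (m (width (size w))) [set x | code_word (size w) x = w].

Let pE w M : (width (size w) <= M)%N -> p w = pr (m M) [set x | code_word (size w) x = w].
Proof.
move=> wM; have mE := measurable_code_word (size w) [set w].
rewrite /p (_ : [set x | _] = first_coords (width (size w)) @^-1` [set x | code_word (size w) x = w]).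
  by rewrite (consistent wM).
by apply/seteqP; split => x /=; rewrite code_word_first.
Qed.

Let p_ge0 w : 0 <= p w. Proof. exact: pr_ge0. Qed.

Let p_nil : p [::] = 1.
Proof. by rewrite /p (_ : [set _ | _] = setT) ?pr_setT//; apply/seteqP; split. Qed.

Let p_cons w : p w = p (false :: w) + p (true :: w).
Proof.
have ww : (width (size w) <= width (size w).+1)%N.
  rewrite ltnS; apply/bigmax_leqP => i _.
  exact: (leq_bigmax (widen_ord (leqnSn _) i)).
rewrite (pE ww) -prU.
- congr (pr _ _); apply/seteqP; split => x /=.
    move=> h; rewrite /code_word mkseqS rev_rcons -/(code_word _ _) h.
    by case: (dedekind x _); [right|left].
  by rewrite /code_word mkseqS rev_rcons => -[[]|[]].
- exact: (measurable_code_word (size w).+1 [set (false :: w)]).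
- exact: (measurable_code_word (size w).+1 [set (true :: w)]).
- by apply/seteqP; split => x //= [->] [].
Qed.

(** Probabilities of bit words are consistent and are realized by nested intervals; decoding the
    bits gives [Y]. The laws are compared before decoding, so it suffices that decoding is
    measurable and inverts [dedekind]. *)
Lemma kolmogorov_extension : exists2 Y : R -> V, measurable_fun setT Y &
  forall N E, measurable E ->
    pr (unif R) [set u | E (first_coords N (Y u))] = pr (m N) [set x | E (first_coords N x)].
Proof.
pose B := bits p; have mB : measurable_fun setT B by exact: measurable_bits.
exists (undedekind \o B); first exact: (measurableT_comp measurable_undedekind mB).
move=> N E mE.
(* Bits of coordinates from [N] on are erased: they do not affect the first [N] decoded coordinates,
   and [m N] says nothing about them. *)
pose r (b : iseq bool) : iseq bool := fun n => if ((dec n).1 < N)%N then b n else false.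
have mr : measurable_fun setT r.
  apply: measurable_to_iseq => n; rewrite /r.
  by case: (_ < _)%N; [exact: measurable_coord|exact: measurable_cst].
have decode_r b : first_coords N (undedekind (r b)) = first_coords N (undedekind b).
  apply/funext => k; rewrite /first_coords /mask; case: ifP => // kN.
  rewrite /undedekind; congr (limn _); apply/funext => n; rewrite /approx; apply: eq_bigr => j _.
  by rewrite /r /dec pickleK /= kN.
have mrB := measurableT_comp mr mB; have mrc := measurableT_comp mr measurable_dedekind.
pose mu1 := law (unif R) mrB; pose mu2 := law (m N) mrc.
have mF : measurable [set b : iseq bool | E (first_coords N (undedekind b))].
  have := measurableT_comp (@measurable_mask R (fun k => (k < N)%N)) measurable_undedekind.
  by move=> /(_ measurableT _ mE); rewrite setTI.
suff h : mu1 [set b : iseq bool | E (first_coords N (undedekind b))] =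
         mu2 [set b : iseq bool | E (first_coords N (undedekind b))].
  rewrite /pr; congr fine.
  have := h; rewrite (lawE _ mrB) (lawE _ mrc) => hh.
  rewrite (_ : [set u | _] = (r \o B) @^-1` [set b | E (first_coords N (undedekind b))]).
    rewrite hh; congr (m N _); apply/seteqP; split => x /=; by rewrite decode_r dedekindK.
  by apply/seteqP; split => u /=; rewrite decode_r.
apply: (iseq_measure_unique (G := measurable)) => //.
  by rewrite sigma_algebra_id//; exact: sigma_algebra_measurable.
move=> s _.
have [n sn] : exists n, forall q, q \in s -> (q.1 < n)%N.
  by exists (\max_(q <- s) q.1).+1 => q qs; rewrite ltnS; exact: (leq_bigmax_seq _ qs).
pose Q : set (seq bool) := fun w => forall q, q \in s ->
  q.2 (if ((dec q.1).1 < N)%N then nth false (rev w) q.1 else false).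
have e1 : (r \o B) @^-1` cyl s = [set u | Q (word p n u)].
  apply/seteqP; split => u /= h q qs; have := h q qs; rewrite /r wordE revK nth_mkseq//; exact: sn.
have e2 : (r \o dedekind) @^-1` cyl s = [set x | Q (code_word n x)].
  by apply/seteqP; split => u /= h q qs; have := h q qs; rewrite /r /code_word revK nth_mkseq//; exact: sn.
rewrite (lawE _ mrB) (lawE _ mrc) e1 e2.
rewrite (prE _ (measurable_word p n Q)) (prE _ (measurable_code_word n Q)); congr EFin.
pose M := maxn N (width n).
have Qfirst : [set x | Q (code_word n x)] = first_coords N @^-1` [set x | Q (code_word n x)].
  apply/seteqP; split => x /= h q qs; have := h q qs; have qn := sn q qs;
  rewrite /code_word !revK !nth_mkseq// /dedekind /first_coords /mask; by case: ifP => // ->.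
rewrite Qfirst -(consistent (leq_maxl N (width n)) (measurable_code_word n Q)) -Qfirst.
rewrite unif_prefix// (pr_fin_partition _ (measurable_code_word n Q) (measurable_code_tuple (n := n))).
apply: eq_bigr => v _; have -> : p v = pr (m M) (code_tuple n @^-1` [set v]).
  rewrite (@pE v M) ?size_tuple ?leq_maxr//; congr (pr _ _).
  by apply/seteqP; split => x /=; [move=> h; exact: val_inj|move=> <-].
case: asboolP => Qv; last first.
  rewrite mulr0 (_ : _ `&` _ = set0) ?pr_set0//; apply/seteqP; split => u //= -[+ /(congr1 val) /= h].
  by rewrite h.
rewrite mulr1; congr (pr _ _); apply/seteqP; split => u /=; last by case.
by move=> h; split => //; have /(congr1 val) /= -> := h.
Qed.

End kolmogorov.

Section indep_sequence.
Variables (R : realType) (mu : nat -> probability R R).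
Notation V := (iseq R).

Let cut N (s : seq (nat * set R)) k : set R :=
  if (k < N)%N then [set x | forall q, q \in s -> q.1 = k -> q.2 x] else setT.

Let measurable_cut N s k : (forall q, q \in s -> measurable q.2) -> measurable (cut N s k).
Proof.
move=> ms; rewrite /cut; case: ifP => // _.
elim: s ms => [|q s ih] ms; first by rewrite (_ : [set _ | _] = setT)// predeqE.
rewrite (_ : [set x | _] = [set x | forall p, p \in s -> p.1 = k -> p.2 x] `&`
   (if q.1 == k then q.2 else setT)).
  apply: measurableI; first by apply: ih => p ps; apply: ms; rewrite inE ps orbT.
  by case: ifP => // _; apply: ms; rewrite mem_head.
apply/seteqP; split => x /=.
  move=> h; split; first by move=> p ps; apply: h; rewrite inE ps orbT.
  by case: eqP => // qk; apply: h => //; rewrite mem_head.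
by move=> [h1 h2] p; rewrite inE => /orP[/eqP -> pk|/h1//]; move: h2; rewrite pk eqxx.
Qed.

Let first_cyl N M (s : seq (nat * set R)) : (N <= M)%N ->
  (forall q, q \in s -> (N <= q.1)%N -> q.2 0) ->
  first_coords N @^-1` cyl s = rect M (cut N s) :> set V.
Proof.
move=> NM hs; apply/seteqP; split => x h.
  move=> k kM; rewrite /cut; case: ifP => // kN q qs qk.
  by have := h q qs; rewrite /= /first_coords /mask qk kN.
move=> q qs; rewrite /= /first_coords /mask; case: ltnP => qN; last exact: hs.
by have := h q.1 (leq_trans qN NM); rewrite /cut qN; apply.
Qed.

Let copies_first N E : measurable E ->
  pr (copies mu N.+1) (first_coords N @^-1` E) = pr (copies mu N) (first_coords N @^-1` E).
Proof.
move=> mE; have mF : measurable_fun setT (@first_coords R N) by exact: measurable_mask.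
suff h : law (copies mu N.+1) mF E = law (copies mu N) mF E by exact: (congr1 fine h).
apply: (iseq_measure_unique (G := measurable)) mE => //.
  by rewrite sigma_algebra_id//; exact: sigma_algebra_measurable.
move=> s hs; rewrite (lawE _ mF) (lawE _ mF).
have [h|h] := pselect (forall q, q \in s -> (N <= q.1)%N -> q.2 0); last first.
  by rewrite (_ : _ @^-1` _ = set0) ?measure0//; apply/seteqP; split => x // hx;
    apply: h => q qs Nq; have := hx q qs; rewrite /= /first_coords /mask ltnNge Nq.
rewrite [X in copies _ N.+1 X](first_cyl (leqnSn N) h) [X in copies _ N X](first_cyl (leqnn N) h).
rewrite !copies_rect//; [|by move=> i; exact: measurable_cut..].
have cN : cut N s N = setT by rewrite /cut ltnn.
transitivity ((\prod_(i < N) mu i (cut N s i)) * mu N (cut N s N))%E.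
  by rewrite big_ord_recr.
by rewrite cN probability_setT mule1.
Qed.

Lemma indep_sequence : exists2 Y : R -> V, measurable_fun setT Y &
  forall n (A : nat -> set R), (forall i, measurable (A i)) ->
  unif R [set u | forall i, (i < n)%N -> A i (Y u i)] = (\prod_(i < n) mu i (A i))%E.
Proof.
have [Y mY hY] := kolmogorov_extension (m := copies mu) copies_first.
exists Y => // n A mA; have mE := measurable_rect n mA.
have key x : rect n A (first_coords n x) <-> rect n A x.
  by split=> h i iN; have := h i iN; rewrite /first_coords /mask iN.
have mYE : measurable [set u | rect n A (Y u)] by have := mY measurableT _ mE; rewrite setTI.
rewrite -copies_rect// (prE (unif R) mYE) (prE _ mE); congr EFin.
have := hY n _ mE; rewrite (_ : [set u | _] = [set u | rect n A (Y u)]); last first.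
  by apply/seteqP; split => u /=; rewrite key.
by rewrite (_ : [set x | _] = rect n A)//; apply/seteqP; split => u /=; rewrite key.
Qed.

End indep_sequence.

Lemma big_setIP (I : eqType) (T : Type) (s : seq I) (F : I -> set T) w :
  (\big[setI/setT]_(i <- s) F i) w <-> forall i, i \in s -> F i w.
Proof.
elim: s => [|i s ih]; first by rewrite big_nil; split.
rewrite big_cons; split => [[Fi /ih h] j|h].
  by rewrite inE => /orP[/eqP ->|/h].
split; first by apply: h; rewrite mem_head.
by apply/ih => j js; apply: h; rewrite inE js orbT.
Qed.

(** The injection [idx] assigns to each family its own coordinate of one independent sequence;
    coordinates outside its range are left unconstrained. *)
Lemma indep_of_rect d1 d2 (T : measurableType d1) (S : measurableType d2) (R : realType)
  (P : probability T R) (Y : nat -> T -> S) (I : eqType) (idx : I -> nat)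
  (F : I -> set (set T)) :
  (forall i, measurable_fun setT (Y i)) ->
  (forall n (A : nat -> set S), (forall i, measurable (A i)) ->
     P [set w | forall i, (i < n)%N -> A i (Y i w)] = (\prod_(i < n) P (Y i @^-1` A i))%E) ->
  injective idx ->
  (forall i A, F i A -> exists2 C, measurable C & A = Y (idx i) @^-1` C) ->
  mutually_independent P F.
Proof.
move=> mY hY inj hF J A uJ FA.
have hC (i : I) : exists C, measurable C /\ (i \in J -> A i = Y (idx i) @^-1` C).
  have [iJ|_] := boolP (i \in J); last by exists setT.
  by have [C mC AC] := hF i _ (FA _ iJ); exists C.
pose C i := projT1 (cid (hC i)).
have mC i : measurable (C i) by rewrite /C; case: cid => ? [].
have AC i : i \in J -> A i = Y (idx i) @^-1` C i by rewrite /C; case: cid => ? [].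
pose D k : set S := if pselect (exists i, i \in J /\ idx i = k) is left h then C (projT1 (cid h)) else setT.
have DE i : i \in J -> D (idx i) = C i.
  move=> iJ; rewrite /D; case: pselect => [h|[]]; last by exists i.
  by case: cid => j [jJ /= /inj ->].
have DN k : k \notin map idx J -> D k = setT.
  move=> /negP kJ; rewrite /D; case: pselect => // h; exfalso; apply: kJ.
  by have [i [iJ <-]] := h; exact: map_f.
have mD k : measurable (D k) by rewrite /D; case: pselect.
have [n Jn] : exists n, forall k, k \in map idx J -> (k < n)%N.
  by exists (\max_(k <- map idx J) k).+1 => k kJ; rewrite ltnS (leq_bigmax_seq _ kJ).
rewrite (_ : \big[setI/setT]_(i <- J) A i = [set w | forall k, (k < n)%N -> D k (Y k w)]); last first.
  apply/seteqP; split => w; first move/big_setIP => h.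
    move=> k kn; have [/mapP[i iJ ->]|kJ] := boolP (k \in map idx J); last by rewrite DN.
    by rewrite DE//; have := h i iJ; rewrite AC.
  move=> h; apply/big_setIP => i iJ; rewrite AC//; have := h (idx i); rewrite DE//; apply.
  by apply: Jn; exact: map_f.
rewrite hY// -(big_mkord xpredT (fun k => P (Y k @^-1` D k))) /index_iota subn0.
rewrite (bigID (fun k => k \in map idx J))/= [X in (_ * X)%E]big1 ?mule1; last first.
  by move=> k kJ; rewrite DN// preimage_setT probability_setT.
rewrite -big_filter (perm_big (map idx J)) /=; last first.
  apply: uniq_perm; first by rewrite filter_uniq// iota_uniq.
    by rewrite map_inj_uniq.
  move=> k; rewrite mem_filter mem_iota add0n leq0n /=.
  by case: (boolP (k \in _)) => // /Jn ->.
rewrite big_map big_seq [RHS]big_seq; apply: eq_bigr => i iJ.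
by rewrite DE// AC.
Qed.

(** * Step functions determined by their rational values *)

Section step_criterion.
Variable R : realType.

(** A supremum argument: if the end points of finite partitions were bounded, their supremum would
    be attained by constancy on its left and exceeded by constancy on its right. *)
Lemma step_fun_of_germs (f : R -> R) :
  (forall t, 0 <= t -> exists2 e, 0 < e & forall x, t <= x < t + e -> f x = f t) ->
  (forall t, 0 < t -> exists2 e, 0 < e & forall x y, t - e < x < t -> t - e < y < t -> f x = f y) ->
  step_fun f.
Proof.
move=> fr fl.
pose grid (T : R) := exists (k : nat) (s : nat -> R),
    s 0%N = 0 /\ (forall j, (j < k)%N -> s j < s j.+1) /\ s k = T /\
    forall j, (j < k)%N -> forall x, s j <= x < s j.+1 -> f x = f (s j).
have grid0 : grid 0 by exists 0%N, (fun=> 0).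
have gridS T T' : grid T -> T < T' -> (forall x, T <= x < T' -> f x = f T) -> grid T'.
  move=> [k [s [s0 [si [sk sf]]]]] TT' fT.
  exists k.+1, (fun j => if (j <= k)%N then s j else T'); split; first by [].
  split; first move=> j; first rewrite ltnS => jk.
    rewrite jk; case: ltnP => [jk'|kj]; first exact: si.
    have -> : j = k by apply/eqP; rewrite eqn_leq jk kj.
    by rewrite sk.
  rewrite ltnn; split=> // j; rewrite ltnS => jk x; rewrite jk; case: ltnP => [jk'|kj].
    exact: sf.
  have -> : j = k by apply/eqP; rewrite eqn_leq jk kj.
  by rewrite sk; exact: fT.
move=> T T0.
suff [S ST gS] : exists2 S, T <= S & grid S.
  by move: gS => [k [s [s0 [si [sk sf]]]]]; exists k, s; rewrite sk.
apply: contrapT => h.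
pose A := [set S | grid S].
have A0 : A !=set0 by exists 0.
have Aub : ubound A T.
  by move=> S gS; rewrite leNgt; apply/negP => TS; apply: h; exists S => //; exact: ltW.
have hA : has_sup A by split => //; exists T.
pose S := sup A.
have S0 : 0 <= S by apply: ub_le_sup; [exists T|].
have gS : grid S.
  have [S1|S1] := ltP 0 S; last by have -> : S = 0 by apply/eqP; rewrite eq_le S1 S0.
  have [e e0 he] := fl _ S1.
  have [S' gS' SS'] := sup_adherent e0 hA.
  have : S' <= S by apply: ub_le_sup => //; exists T.
  rewrite le_eqVlt => /orP[/eqP <- //|S'S].
  apply: (gridS _ _ gS' S'S) => x /andP[x1 x2]; apply: he; rewrite ?SS' ?S'S// x2 andbT.
  exact: lt_le_trans x1.
have [e e0 he] := fr _ S0.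
have : grid (S + e) by apply: (gridS _ _ gS) => //; rewrite ltrDl.
move=> /(ub_le_sup (ex_intro _ T Aub)); rewrite -/S gerDl leNgt e0//.
Qed.

End step_criterion.

Section valid_paths.
Variable R : realType.
Notation V := (iseq R).
Notation q := (@nnrat R).

Definition right_cst (M : R) : set V := \bigcap_(i in [set i | q i < M])
  \bigcup_(j in [set j | q i < q j])
  \bigcap_(k in [set k | q i <= q k /\ q k < q j /\ q k < M]) [set x : V | x k = x i].

(** For some mesh 1/(p + 1) every cell sees at most one change of value: among three increasing
    times the middle value agrees with a neighbour. Countable operations only, so the set is
    measurable. *)
Definition few_jumps (M : R) : set V := \bigcup_p \bigcap_(c in [set: nat])
  \bigcap_k1 \bigcap_(k2 in [set k2 | q k1 < q k2]) \bigcap_(k3 in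
     [set k3 | q k2 < q k3 /\ (q k3 < M /\ (c%:R <= q k1 * p.+1%:R /\ q k3 * p.+1%:R < c.+1%:R))])
   ([set x : V | x k1 = x k2] `|` [set x : V | x k2 = x k3]).

Let measurable_eq_coord i j : measurable [set x : V | x i = x j].
Proof.
rewrite (_ : [set _ | _] = (fun x : V => x i - x j) @^-1` [set 0]); last first.
  by apply/seteqP; split => x /=; [move=> ->; rewrite subrr|move=> /eqP; rewrite subr_eq0 => /eqP].
rewrite -[X in measurable X]setTI; apply: measurable_funB => //; exact: measurable_coord.
Qed.

Lemma measurable_right_cst M : measurable (right_cst M).
Proof.
apply: bigcap_measurableType => i _; apply: bigcup_measurable => j _.
by apply: bigcap_measurableType => k _.
Qed.

Lemma measurable_few_jumps M : measurable (few_jumps M).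
Proof.
apply: bigcup_measurable => p _; do 4 (apply: bigcap_measurableType => ? _).
exact: measurableU.
Qed.

Lemma right_cst_step (T : Type) (X : R -> T -> R) w c M : 0 < c -> step_fun (fun t => X t w) ->
  right_cst M (obs X (scale_times c (upto M)) w).
Proof.
move=> c0 sf i /= iM.
have ci0 : 0 <= c * q i by rewrite mulr_ge0 ?nnrat_ge0// ltW.
have [e e0 he] := step_fun_right sf ci0.
have [j ij je] : exists2 j, q i < q j & q j < q i + e / c.
  by apply: nnrat_dense; rewrite ?nnrat_ge0// ltrDl divr_gt0.
exists j => // k /= [ik [kj kM]].
rewrite /obs /scale_times /upto kM iM /=; apply: he.
rewrite ler_pM2l// ik/= -[e](divfK (lt0r_neq0 c0)) (mulrC (e / c)) -mulrDr ltr_pM2l//.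
exact: lt_trans je.
Qed.

Lemma few_jumps_step (T : Type) (X : R -> T -> R) w c M : 0 < c -> 0 < M ->
  step_fun (fun t => X t w) -> few_jumps M (obs X (scale_times c (upto M)) w).
Proof.
move=> c0 M0 sf; have [k [s [s0 [si [sM cs]]]]] := sf _ (mulr_gt0 c0 M0).
have [g g0 hg] : exists2 g, 0 < g & forall j, (j < k)%N -> g <= s j.+1 - s j.
  elim: k si {sM cs} => [|k ih] si; first by exists 1.
  have [|g g0 hg] := ih; first by move=> j jk; apply: si; exact: ltnW.
  exists (Num.min g (s k.+1 - s k)); first by rewrite lt_min g0 subr_gt0 si.
  move=> j; rewrite ltnS leq_eqVlt => /orP[/eqP ->|jk]; rewrite ge_min ?lexx ?orbT//.
  by rewrite hg.
have sle i j : (i <= j)%N -> (j <= k)%N -> s i <= s j.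
  elim: j => [|j ih]; first by rewrite leqn0 => /eqP ->.
  rewrite leq_eqVlt => /orP[/eqP -> //|]; rewrite ltnS => ij jk.
  by apply: (le_trans (ih ij (ltnW jk))); apply: ltW; exact: si.
have loc x : 0 <= x < c * M -> exists j, (j < k)%N /\ s j <= x < s j.+1.
  move=> /andP[x0 xM]; have xk : x < s k by exact: lt_le_trans sM.
  elim: (k) xk => [|k' ih]; first by rewrite s0 ltNge x0.
  move=> xk; have [xk'|xk'] := ltP x (s k'); last by exists k'; rewrite xk' xk.
  by have [j [jk jx]] := ih xk'; exists j; rewrite (ltn_trans jk).
(* The scaled mesh is shorter than the least gap [g] of the partition, so times from one cell lie in
   at most two neighbouring intervals. *)
exists (Num.truncn (c / g)) => // cc _ k1 _ k2 /= k12 k3 /= [k23 [k3M [c1 c3]]].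
set p := (Num.truncn (c / g)).+1 in c1 c3.
have pg : c / p%:R < g.
  by rewrite ltr_pdivrMr ?ltr0n// mulrC -ltr_pdivrMr//; exact: truncnS_gt.
have k2M := lt_trans k23 k3M; have k1M := lt_trans k12 k2M.
have cq i : q i < M -> 0 <= c * q i < c * M.
  by move=> iM; rewrite mulr_ge0 ?nnrat_ge0 ?(ltW c0)//= ltr_pM2l.
have [j1 [j1k /andP[a1 b1]]] := loc _ (cq _ k1M).
have [j2 [j2k /andP[a2 b2]]] := loc _ (cq _ k2M).
have [j3 [j3k /andP[a3 b3]]] := loc _ (cq _ k3M).
have p0 : 0 < p%:R :> R by rewrite ltr0n.
have len : c * q k3 - c * q k1 < g.
  apply: lt_trans pg; rewrite -mulrBr ltr_pM2l// -[ltRHS]div1r ltr_pdivlMr// mulrBl.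
  by move: c1 c3; rewrite -natr1; move: (q k1 * _) (q k3 * _) => x y; lra.
rewrite /obs /scale_times /upto k1M k2M k3M /=.
have [e12|n12] := eqVneq j1 j2.
  by left; rewrite (cs j1)// ?a1// (cs j1)//; rewrite e12 a2.
right; have [e23|n23] := eqVneq j2 j3.
  by rewrite (cs j2)// ?a2// (cs j2)//; rewrite e23 a3.
exfalso.
have j12 : (j1 < j2)%N.
  rewrite ltn_neqAle n12 leqNgt; apply/negP => j21.
  have := sle _ _ j21 (ltnW j1k); have : c * q k1 < c * q k2 by rewrite ltr_pM2l.
  move: a1 b2; lra.
have j23 : (j2 < j3)%N.
  rewrite ltn_neqAle n23 leqNgt; apply/negP => j32.
  have := sle _ _ j32 (ltnW j2k); have : c * q k2 < c * q k3 by rewrite ltr_pM2l.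
  move: a2 b3; lra.
have := sle _ _ j12 (ltnW j2k); have := sle _ _ j23 (ltnW j3k); have := hg _ j2k.
move: b1 a3 len; lra.
Qed.

(* the value at t is read along rationals strictly to the right of t *)
Definition right_index (t : R) (n : nat) : nat :=
  pickle ((Num.truncn (t * n.+1%:R)).+1%:R / n.+1%:R : rat).

Definition right_ext (x : V) (t : R) : R := limn (fun n => x (right_index t n)).

Lemma right_indexE t n : q (right_index t n) = (Num.truncn (t * n.+1%:R)).+1%:R / n.+1%:R.
Proof.
rewrite /nnrat /right_index pickleK /= ger0_norm ?ler0q ?divr_ge0//.
by rewrite fmorph_div /= !ratr_nat.
Qed.

Lemma right_index_near t n : 0 <= t -> t < q (right_index t n) <= t + n.+1%:R^-1.
Proof.
move=> t0; rewrite right_indexE; apply/andP; split.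
  by rewrite ltr_pdivlMr//; exact: truncnS_gt.
rewrite ler_pdivrMr// mulrDl mulVf ?pnatr_eq0// -natr1 lerD2r.
by rewrite truncn_le mulr_ge0.
Qed.

Lemma measurable_right_ext t : measurable_fun setT (right_ext ^~ t).
Proof. by apply: measurable_limn => n; exact: measurable_coord. Qed.

Lemma right_extE x t v e : 0 <= t -> 0 < e ->
  (forall k, t < q k < t + e -> x k = v) -> right_ext x t = v.
Proof.
move=> t0 e0 h; apply/cvg_lim => //; apply: cvg_near_cst.
exists (Num.truncn e^-1) => // n /= en; apply: h.
have /andP[h1 h2] := right_index_near n t0; rewrite h1 /=; apply: (le_lt_trans h2).
rewrite ltrD2l invf_plt ?posrE//; apply: (lt_le_trans (truncnS_gt _)).
by rewrite ler_nat ltnS.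
Qed.

(** If two values differ, the values before the first time and after the second are frozen; if none
    differ, the sequence is constant on the interval. *)
Let three_point (x : V) (al be : R) : 0 <= al -> al < be ->
  (forall k1 k2 k3, al < q k1 -> q k1 < q k2 -> q k2 < q k3 -> q k3 < be -> x k1 = x k2 \/ x k2 = x k3) ->
  (forall k1 k2, q k1 = q k2 -> q k1 < be -> x k1 = x k2) ->
  (exists2 e, 0 < e /\ al + e <= be & exists v, forall k, al < q k < al + e -> x k = v) /\
  (exists2 e, 0 < e /\ al <= be - e & exists v, forall k, be - e < q k < be -> x k = v).
Proof.
move=> al0 ab h3 h2.
have [[k1 [k2 [a1 [l12 [b2 ne]]]]]|nex] :=
  pselect (exists k1 k2, al < q k1 /\ q k1 < q k2 /\ q k2 < be /\ x k1 <> x k2).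
  split.
    exists (q k1 - al); first by rewrite subr_gt0 a1 subrKC; split => //; apply: ltW; exact: lt_trans b2.
    exists (x k1) => k; rewrite subrKC => /andP[ak kk1].
    by have [//|//] := h3 k k1 k2 ak kk1 l12 b2.
  exists (be - q k2); first by rewrite subr_gt0 b2 subKr; split => //; apply: ltW; exact: lt_trans l12.
  exists (x k2) => k; rewrite subKr => /andP[k2k kb].
  by have [//|->] := h3 k1 k2 k a1 l12 k2k kb.
have eqx k k' : al < q k < be -> al < q k' < be -> x k = x k'.
  move=> /andP[a1 b1] /andP[a2 b2]; apply: contrapT => ne; apply: nex.
  have [l|l|e] := ltgtP (q k) (q k').
  - by exists k, k'.
  - by exists k', k; do !split => //; exact: nesym.
  - by exfalso; apply: ne; exact: h2.
have [k0 a0 b0] := nnrat_dense al0 ab.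
split; exists (be - al); rewrite ?subr_gt0 ?subrKC ?subKr//; exists (x k0) => k kk;
  by apply: eqx => //; rewrite a0.
Qed.

Section valid.
Variable x : V.
Hypothesis vx : forall M : nat, right_cst M%:R x /\ few_jumps M%:R x.

Let big (t : R) : t < (Num.truncn t).+1%:R. Proof. exact: truncnS_gt. Qed.

(** The weak inequality [q i <= q k] in [right_cst] serves here: indices of the same rational carry
    the same value. *)
Let dup k1 k2 : q k1 = q k2 -> x k1 = x k2.
Proof.
move=> e; have [r _] := vx (Num.truncn (q k1)).+1.
have [j /= j1 h] := r k1 (big _); apply/esym; apply: h => /=.
by rewrite -e lexx; split => //; split => //; exact: big.
Qed.

Let germs t : 0 <= t ->
  (exists2 e, 0 < e & exists v, forall k, t < q k < t + e -> x k = v) /\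
  (0 < t -> exists2 e, 0 < e /\ 0 <= t - e & exists v, forall k, t - e < q k < t -> x k = v).
Proof.
move=> t0; set M := (Num.truncn t).+1; have [_ [p _ hp]] := vx M.
have tM : t < M%:R by exact: big.
have P0 : 0 < p.+1%:R :> R by [].
split.
  pose c := Num.truncn (t * p.+1%:R); pose be : R := Num.min M%:R (c.+1%:R / p.+1%:R).
  have cx : c%:R <= t * p.+1%:R by rewrite truncn_le mulr_ge0.
  have tb : t < be by rewrite lt_min tM ltr_pdivlMr//; exact: truncnS_gt.
  have [||[e [e0 _] h] _] := @three_point x t be t0 tb; last by exists e.
    move=> k1 k2 k3 a1 l12 l23; rewrite lt_min ltr_pdivlMr// => /andP[b3 b3'].
    apply: (hp c I k1 I k2 l12 k3) => /=; do !split => //.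
    by apply: (le_trans cx); rewrite ler_pM2r// ltW.
  by move=> k1 k2 e _; exact: dup.
move=> t1; have [c c1 c2] : exists2 c : nat, c%:R < t * p.+1%:R & t * p.+1%:R <= c.+1%:R.
  have ex : exists n : nat, t * p.+1%:R <= n%:R.
    by exists (Num.truncn (t * p.+1%:R)).+1; apply: ltW; exact: truncnS_gt.
  case: (ex_minnP ex) => -[|c] tc cmin.
    by move: tc; rewrite leNgt mulr_gt0.
  exists c => //; rewrite ltNge; apply/negP => /cmin; by rewrite ltnn.
pose al : R := c%:R / p.+1%:R.
have al0 : 0 <= al by rewrite divr_ge0.
have at_ : al < t by rewrite ltr_pdivrMr.
have [||_ [e [e0 le] h]] := @three_point x al t al0 at_.
- move=> k1 k2 k3; rewrite ltr_pdivrMr// => a1 l12 l23 b3.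
  apply: (hp c I k1 I k2 l12 k3) => /=; do !split => //.
  + exact: lt_trans tM.
  + exact: ltW.
  + by apply: lt_le_trans c2; rewrite ltr_pM2r.
- by move=> k1 k2 e _; exact: dup.
by exists e => //; split => //; exact: le_trans le.
Qed.

Lemma step_right_ext : step_fun (right_ext x).
Proof.
apply: step_fun_of_germs => t t0.
  have [[e e0 [v hv]] _] := germs t0; exists e => // y /andP[ty ye].
  rewrite (right_extE t0 e0 hv); apply: (@right_extE _ _ _ (t + e - y)).
  - exact: le_trans ty.
  - by rewrite subr_gt0.
  - by move=> k /andP[yk]; rewrite subrKC => ke; apply: hv; rewrite (le_lt_trans ty).
have [_ /(_ t0)[e [e0 te] [v hv]]] := germs (ltW t0); exists e => //.
suff h y : t - e < y < t -> right_ext x y = v by move=> y z /h -> /h ->.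
move=> /andP[y1 y2]; apply: (@right_extE _ _ _ (t - y)).
- by apply: ltW; exact: le_lt_trans y1.
- by rewrite subr_gt0.
- by move=> k /andP[yk]; rewrite subrKC => ke; apply: hv; rewrite (lt_trans y1).
Qed.

Lemma right_ext_rat i : right_ext x (q i) = x i.
Proof.
set M := (Num.truncn (q i)).+1; have iM : q i < M%:R by exact: big.
have [r _] := vx M; have [j /= ij h] := r i iM.
apply: (@right_extE _ _ _ (Num.min (q j) M%:R - q i)); first exact: nnrat_ge0.
  by rewrite subr_gt0 lt_min ij iM.
move=> k /andP[ik]; rewrite subrKC lt_min => /andP[kj kM].
by apply: h; rewrite /= (ltW ik).
Qed.

End valid.

End valid_paths.

Lemma eq_in_set (T : Type) (A B : set T) x : (A x <-> B x) -> (x \in A) = (x \in B).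
Proof. by move=> h; apply/idP/idP => /set_mem/h/mem_set. Qed.

(** * The mark with first jump in [a, 2a[ *)

Section mark_process.
Context d (T : measurableType d) (R : realType) (P : probability T R).
Notation V := (iseq R).
Notation q := (@nnrat R).
Variables (X : R -> T -> R).
Hypotheses (pX : is_process X) (jX : pure_jump_process X) (tsX : time_stable P X).

Let sX : random_step_fun X. Proof. by move=> w; case: (jX w). Qed.

Lemma eq_intensity tt tt' E E' x y :
  (forall c, 0 < c -> jump_event X c tt E x y = jump_event X c tt' E' x y) ->
  intensity P X tt E x y = intensity P X tt' E' x y.
Proof.
move=> h; rewrite /intensity; congr (limn _); apply/funext => n.
by rewrite /jump_rate h// invr_gt0.
Qed.

Lemma intensity_eq0 tt E x y : (forall c, 0 < c -> jump_event X c tt E x y = set0) ->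
  intensity P X tt E x y = 0.
Proof.
move=> h; rewrite /intensity (_ : (fun n => _) = fun=> 0); first exact: lim_cst.
by apply/funext => n; rewrite /jump_rate h ?invr_gt0// pr_set0 mulr0.
Qed.

Lemma intensity_setT tt x y : intensity P X tt setT x y = intensity P X (no_times R) setT x y.
Proof. by apply: eq_intensity => c _; rewrite /jump_event !preimage_setT. Qed.

Variables (k a : R).
Hypotheses (k0 : 0 <= k) (a0 : 0 < a).
Hypothesis k1 : k * intensity P X (no_times R) setT a (2 * a) <= 1.

Definition mark_pr tt (E : set V) : R := k * intensity P X tt E a (2 * a) +
  (1 - k * intensity P X (no_times R) setT a (2 * a)) * (v0 R \in E)%:R.

Lemma eq_mark_pr tt tt' E E' :
  (forall c, 0 < c -> jump_event X c tt E a (2 * a) = jump_event X c tt' E' a (2 * a)) ->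
  (v0 R \in E) = (v0 R \in E') -> mark_pr tt E = mark_pr tt' E'.
Proof. by move=> h1 h2; rewrite /mark_pr h2; congr (_ * _ + _); exact: eq_intensity. Qed.

Let mark_law tt M : bounded_times tt M ->
  exists mu : probability V R, forall E, measurable E -> pr mu E = mark_pr tt E.
Proof.
move=> bM; pose M' := Num.max M (2 * a).
have bM' : bounded_times tt M'.
  by move=> i t /bM/andP[-> tM]; rewrite lt_max tM.
have M0 : 0 < M' by rewrite lt_max mulr_gt0 ?orbT.
have aM : a <= 2 * a <= M'.
  by rewrite le_max lexx orbT andbT ler_peMl ?ltW// ltr1n.
have := mark_law_exists pX jX tsX bM' M0 aM k0; rewrite intensity_setT => /(_ k1)[mu h].
by exists mu.
Qed.

Let q_times N : times R := fun j => if (j < N)%N then Some (q j) else None.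

Let bounded_q N : exists M, bounded_times (q_times N) M.
Proof.
exists (\sum_(j < N) q j + 1) => i t; rewrite /q_times; case: ltnP => // iN [<-].
rewrite nnrat_ge0/= (bigD1 (Ordinal iN))//= -addrA ltrDl ltr_wpDl//.
by apply: sumr_ge0 => j _; exact: nnrat_ge0.
Qed.

Let bounded_upto M : bounded_times (upto M) (M : R).
Proof. by move=> i t; rewrite /upto; case: ifP => // iM [<-]; rewrite nnrat_ge0. Qed.

Let m_ex N : exists mu : probability V R, forall E, measurable E -> pr mu E = mark_pr (q_times N) E.
Proof. by have [M bM] := bounded_q N; exact: mark_law bM. Qed.

Let m N := projT1 (cid (m_ex N)).

Let mE N E : measurable E -> pr (m N) E = mark_pr (q_times N) E.
Proof. by rewrite /m; case: cid => mu /= h /h. Qed.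

Let mfirst N E : measurable E -> measurable (@first_coords R N @^-1` E).
Proof. by move=> mEE; have := @measurable_mask R (fun k => (k < N)%N) measurableT _ mEE; rewrite setTI. Qed.

Let mP N E : measurable E ->
  pr (m N.+1) (@first_coords R N @^-1` E) = pr (m N) (@first_coords R N @^-1` E).
Proof.
move=> mEE; rewrite !mE; [|exact: mfirst..]; apply: eq_mark_pr => // c c0.
rewrite /jump_event; congr (_ `&` _); apply/seteqP; split => w /=;
rewrite (_ : first_coords N _ = first_coords N (obs X (scale_times c (q_times N)) w))//;
apply/funext => j; rewrite /first_coords /mask /obs /scale_times /q_times; case: ltnP => // jN;
by rewrite ?ltnS ?(ltnW jN) ?jN //= ltnS ltnW.
Qed.

(** Kolmogorov extension gives the values at rational times. Every path of the original process is
    regular, so irregular sequences have intensity 0 and the extended values are almost surely those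
    of a step function. *)
Lemma mark_process_exists : exists eps : R -> R -> R,
  [/\ is_process eps, random_step_fun eps, forall t u, 0 <= t < a -> eps t u = 0 &
   forall tt M (mo : measurable_fun setT (obs eps tt)) E,
     (forall i t, tt i = Some t -> t < M /\ exists j, t = q j) -> measurable E ->
     pr (law (unif R) mo) E = mark_pr tt E].
Proof.
have [Y mY hY] := kolmogorov_extension mP.
pose cutM (M : R) : V -> V := mask (fun j => q j < M).
have mcut M : measurable_fun setT (cutM M) by exact: measurable_mask.
have mYc M := measurableT_comp (mcut M) mY.
(* Regularity involves all rationals below [M] at once; a law with these values exists by
   [mark_law], and cylinders identify it with that of [Y]. *)
have Ycut (M : R) E : measurable E -> pr (unif R) [set u | E (cutM M (Y u))] = mark_pr (upto M) E.
  move=> mEE; have [mu hmu] := mark_law (@bounded_upto M); rewrite -hmu//.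
  suff h : law (unif R) (mYc M) E = mu E by exact: (congr1 fine h).
  apply: (iseq_measure_unique (G := measurable)) mEE => //.
    by rewrite sigma_algebra_id//; exact: sigma_algebra_measurable.
  move=> s hs; have mC : measurable (cyl s) by exact: measurable_cyl.
  have [N sN] : exists N, forall p, p \in s -> (p.1 < N)%N.
    by exists (\max_(p <- s) p.1).+1 => p ps; rewrite ltnS; exact: (leq_bigmax_seq _ ps).
  have mcC : measurable (cutM M @^-1` cyl s) by have := mcut M measurableT _ mC; rewrite setTI.
  have mYC : measurable [set u | cyl s (cutM M (Y u))] by have := mYc M measurableT _ mC; rewrite setTI.
  rewrite (lawE _ (mYc M)) (prE mu mC) (prE (unif R) mYC) hmu//; congr EFin.
  have cylN x : cyl s (cutM M (first_coords N x)) <-> cyl s (cutM M x).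
    by split => h p ps; have := h p ps; rewrite /cutM /mask /first_coords /mask sN.
  have -> : [set u | cyl s (cutM M (Y u))] = [set u | (cutM M @^-1` cyl s) (first_coords N (Y u))].
    by apply/seteqP; split => u /=; rewrite cylN.
  rewrite hY// mE; last exact: mfirst.
  apply: eq_mark_pr => [c c0|]; last first.
    apply: eq_in_set => /=; rewrite cylN.
    by split => h p ps; have := h p ps; rewrite /cutM /mask; case: ifP.
  rewrite /jump_event; congr (_ `&` _); apply/seteqP; split => w /=.
    by move=> /cylN h p ps; have := h p ps; rewrite /cutM /mask /obs /scale_times /q_times /upto sN//=; case: ifP.
  move=> h; apply/cylN => p ps; have := h p ps.
  by rewrite /cutM /mask /obs /scale_times /q_times /upto sN//=; case: ifP.
pose early_zero (M : R) : set V := [set x | forall j, q j < M -> x j = 0].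
have m_early M : measurable (early_zero M).
  rewrite (_ : early_zero M = \bigcap_(j in [set j | q j < M]) [set x | x j = 0]).
    apply: bigcap_measurableType => j _.
    by have := @measurable_coord _ R j measurableT [set 0]; rewrite setTI; apply.
  by apply/seteqP; split => x h j jM; exact: h.
pose good (M : R) : set V := right_cst M `&` (few_jumps M `&` early_zero (Num.min a M)).
have mgood M : measurable (good M).
  by apply: measurableI; [exact: measurable_right_cst|apply: measurableI; first exact: measurable_few_jumps].
have goodE M x : good M x <-> good M (cutM M x).
  have e j : q j < M -> cutM M x j = x j by rewrite /cutM /mask => ->.
  have r : right_cst M x <-> right_cst M (cutM M x).
    split => h i iM; have [j ij hj] := h i iM; exists j => // l lj; have := hj l lj;
    by case: lj => _ [_ lM]; rewrite /= !e.
  have f : few_jumps M x <-> few_jumps M (cutM M x).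
    split => -[p _ h]; exists p => // c _ l1 _ l2 l12 l3 /= l3'; have := h c I l1 I l2 l12 l3 l3';
    by case: (l3') => l23 [l3M _]; rewrite /= !e ?(lt_trans l23)//; apply: lt_trans l12 _; exact: lt_trans l3M.
  have z : early_zero (Num.min a M) x <-> early_zero (Num.min a M) (cutM M x).
    by split => h j jM; have := h j jM; rewrite e//; apply: lt_le_trans jM _; rewrite ge_min lexx orbT.
  by rewrite /good /=; split => -[h1 [h2 h3]]; (split; [exact/r|split; [exact/f|exact/z]]).
have good_null (M : R) : 0 < M -> pr (unif R) [set u | ~ good M (Y u)] = 0.
  move=> M0; rewrite (_ : [set u | _] = [set u | (~` good M) (cutM M (Y u))]); last first.
    by apply/seteqP; split => u /= h1 h2; apply: h1; move: h2; have [] := goodE M (Y u).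
  rewrite Ycut; last exact: measurableC.
  (* The complement of [good] has intensity 0 because every path with first jump in the window is
     good, and no mass at 0 because the zero sequence is good. *)
  rewrite /mark_pr intensity_eq0 ?mulr0 ?add0r => [|c c0].
    rewrite memNset ?mulr0// => h; apply: h; split; last split; last by [].
      move=> i _; have [j ij _] := @nnrat_dense R (q i) (q i + 1) (nnrat_ge0 _ _) ltac:(by rewrite ltrDl).
      by exists j.
    by exists 0%N => // l _ l1 _ l2 _ l3 _; left.
  apply/seteqP; split => w //= -[+ [zw _]]; apply.
  have rc := @right_cst_step _ _ X w c M c0 (sX w).
  split; first by exact: rc.
  split; first exact: (@few_jumps_step _ _ X w c M c0 M0 (sX w)).
  move=> j; rewrite lt_min => /andP[ja jM]; rewrite /obs /scale_times /upto jM /=.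
  by apply: zw; rewrite mulr_ge0 ?nnrat_ge0 ?ltW//= ltr_pM2l.
pose Good := \bigcap_(M in [set: nat]) [set u | good M.+1%:R (Y u)].
have mGM (M : nat) : measurable [set u | good M.+1%:R (Y u)].
  by have := mY measurableT _ (mgood M.+1%:R); rewrite setTI.
have mG : measurable Good by apply: bigcap_measurableType => M _.
have G0 : pr (unif R) (~` Good) = 0.
  have h : (unif R).-negligible (\bigcup_M (~` [set u | good M.+1%:R (Y u)])).
    apply: negligible_bigcup => M; apply/negligibleP; first exact: measurableC.
    by apply: etrans (prE (unif R) (measurableC (mGM M))) _; congr EFin; exact: good_null.
  rewrite /Good setC_bigcap.
  have mB : measurable (\bigcup_M (~` [set u | good M.+1%:R (Y u)])).
    by apply: bigcup_measurable => M _; exact: measurableC.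
  have e : unif R (\bigcup_M (~` [set u | good M.+1%:R (Y u)])) = 0%E by apply/negligibleP.
  exact: (congr1 fine e).
have vG u : Good u -> forall M : nat, right_cst M%:R (Y u) /\ few_jumps M%:R (Y u).
  move=> Gu [|M]; last by have [h1 [h2 _]] := Gu M I.
  split; first by move=> i /=; rewrite ltNge nnrat_ge0.
  exists 0%N => // l _ l1 _ l2 _ l3 /= [_ [+ _]].
  by rewrite ltNge nnrat_ge0.
(* On the null set of irregular samples the zero path is substituted, so that every path is a step
   function. *)
pose eps t u := if u \in Good then right_ext (Y u) t else 0.
have pe : is_process eps.
  move=> t t0; apply: measurable_fun_ifT; last exact: measurable_cst.
    apply: (measurable_fun_bool true); rewrite setTI (_ : _ @^-1` _ = Good)//.
    by apply/seteqP; split => u /=; [move=> /set_mem|move=> /mem_set ->].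
  exact: (measurableT_comp (@measurable_right_ext R t) mY).
have step0 : step_fun (fun=> 0 : R).
  move=> L L0; exists 1%N, (fun j => j%:R * L); rewrite mul0r mul1r; split => //; split => //.
  by case => // _; rewrite mul0r mul1r.
exists eps; split => //.
- move=> u; have [Gu|Gu] := pselect (Good u).
    rewrite (_ : (fun t => _) = right_ext (Y u)); first exact: step_right_ext (vG _ Gu).
    by apply/funext => t; rewrite /eps mem_set.
  by rewrite (_ : (fun t => _) = fun=> 0)//; apply/funext => t; rewrite /eps memNset.
- move=> t u /andP[t0 ta]; rewrite /eps; case: ifP => // /set_mem Gu.
  apply: (@right_extE _ _ _ _ (a - t)) => //; first by rewrite subr_gt0.
  move=> i /andP[_]; rewrite subrKC => ia; have [_ [_ z]] := Gu (Num.truncn (q i)) I.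
  by apply: z; rewrite lt_min ia truncnS_gt.
move=> tt M mo E htt mEE.
have hj i : exists j, forall t, tt i = Some t -> t = q j.
  case ti: (tt i) => [t|]; last by exists 0%N.
  by have [_ [j tj]] := htt _ _ ti; exists j => s [<-].
pose j i := projT1 (cid (hj i)).
have jP i t : tt i = Some t -> t = q (j i) by rewrite /j; case: cid => l /= h /h.
pose phi (x : V) : V := fun i => if tt i is Some _ then x (j i) else 0.
have mphi : measurable_fun setT phi.
  apply: measurable_to_iseq => i; rewrite /phi.
  by case: (tt i) => [t|]; [exact: measurable_coord|exact: measurable_cst].
have mphiE : measurable (phi @^-1` E) by have := mphi measurableT _ mEE; rewrite setTI.
have obs_phi u : Good u -> obs eps tt u = phi (cutM M (Y u)).
  move=> Gu; apply/funext => i; rewrite /obs /phi; case ti: (tt i) => [t|] //.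
  have [tM _] := htt _ _ ti; have tj := jP _ _ ti.
  by rewrite /eps mem_set// /cutM /mask -tj tM tj right_ext_rat//; exact: vG.
have mA : measurable (obs eps tt @^-1` E) by have := mo measurableT _ mEE; rewrite setTI.
have mB : measurable [set u | (phi @^-1` E) (cutM M (Y u))].
  by have := mYc M measurableT _ mphiE; rewrite setTI.
have -> : pr (law (unif R) mo) E = pr (unif R) [set u | (phi @^-1` E) (cutM M (Y u))].
  rewrite {1}/pr (lawE _ mo) -/(pr (unif R) (obs eps tt @^-1` E)); apply/eqP; rewrite eq_le; apply/andP; split.
    rewrite -[leRHS]addr0 -G0; apply: le_pr_near => // u [/= + /obs_phi Gu].
    by rewrite Gu.
  rewrite -[leRHS]addr0 -G0; apply: le_pr_near => // u [/= + /obs_phi Gu].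
  by rewrite Gu.
rewrite Ycut//; apply: eq_mark_pr => [c c0|]; last first.
  by apply: eq_in_set; rewrite /= (_ : phi (v0 R) = v0 R)//; apply/funext => i; rewrite /phi; case: (tt i).
have e w : phi (obs X (scale_times c (upto M)) w) = obs X (scale_times c tt) w.
  apply/funext => i; rewrite /phi /obs /scale_times /upto; case ti: (tt i) => [t|] //.
  by have [tM _] := htt _ _ ti; have tj := jP _ _ ti; rewrite -tj tM /= tj.
by rewrite /jump_event; congr (_ `&` _); apply/seteqP; split => w /=; rewrite e.
Qed.

End mark_process.

(** * Existence of a Poisson process *)

Section poisson_law.
Variables (R : realType) (l : R).
Hypothesis l0 : 0 <= l.

Let m : {measure set R -> \bar R} :=
  mseries (fun k => mscale (NngNum (poisson_p_ge0 k l0)) (\d_(k%:R : R))) 0.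

Let mE A : m A = (\sum_(k <oo) (poisson_p l k * \1_A (k%:R : R))%:E)%E.
Proof. by apply: eq_eseriesr => k _. Qed.

Let mT : m setT = 1%E.
Proof.
by rewrite mE -(sum_poisson_p l0); apply: eq_eseriesr => k _; rewrite indicT mulr1.
Qed.

Definition poisson_law : probability R R := to_prob mT.

Lemma poisson_lawE k : poisson_law [set x | Num.truncn x = k] = (poisson_p l k)%:E.
Proof.
rewrite -[LHS]/(m _) mE (nneseriesD1 (n := k))//; last first.
  by move=> i _; rewrite lee_fin mulr_ge0// poisson_p_ge0.
rewrite indicE mem_set ?mulr1/=; last by rewrite natrK.
rewrite eseries0 ?adde0// => i _ ik.
rewrite indicE memNset ?mulr0//= natrK => h.
by move: ik; rewrite h eqxx.
Qed.

End poisson_law.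

Lemma eq_leRL (R : realType) (x y : \bar R) : x = y -> (x <= y)%E.
Proof. by move=> ->. Qed.

(** * Generating functions and Laplace transforms *)

Section power_series_unique.
Variables (R : realType) (b c : nat -> R) (B : R).
Hypotheses (b0 : forall m, 0 <= b m) (c0 : forall m, 0 <= c m).
Hypothesis bB : (\sum_(m <oo) (b m)%:E <= B%:E)%E.
Hypothesis cB : (\sum_(m <oo) (c m)%:E <= B%:E)%E.
Hypothesis bc : forall s, 0 < s <= 1 ->
  (\sum_(m <oo) (b m * s ^+ m)%:E = \sum_(m <oo) (c m * s ^+ m)%:E)%E.

(** The terms below m cancel; after division by s^m, those beyond m contribute at most s B. With s =
    1/(k + 1) the coefficients of order m agree in the limit. *)
Let half (f g : nat -> R) m s : (forall m, 0 <= f m) -> (forall m, 0 <= g m) ->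
  (\sum_(m <oo) (g m)%:E <= B%:E)%E -> 0 < s <= 1 ->
  (\sum_(m <oo) (f m * s ^+ m)%:E = \sum_(m <oo) (g m * s ^+ m)%:E)%E ->
  (forall i, (i < m)%N -> f i = g i) -> f m <= g m + s * B.
Proof.
move=> f0 g0 gB /andP[s0 s1] fg ih.
have h1 : (\sum_(0 <= i < m.+1) (f i * s ^+ i)%:E <= \sum_(i <oo) (f i * s ^+ i)%:E)%E.
  by apply: nneseries_lim_ge => i _ _; rewrite lee_fin mulr_ge0// exprn_ge0// ltW.
have gs0 i : (0 <= (g i * s ^+ i)%:E)%E by rewrite lee_fin mulr_ge0// exprn_ge0// ltW.
have h2 : (\sum_(i <oo) (g i * s ^+ i)%:E <= (\sum_(0 <= i < m.+1) (g i * s ^+ i))%:E + (s ^+ m.+1 * B)%:E)%E.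
  rewrite (nneseries_split 0 m.+1)// add0n sumEFin; apply: leeD => //.
  apply: (@le_trans _ _ (\sum_(m.+1 <= i <oo) (s ^+ m.+1)%:E * (g i)%:E)%E).
    rewrite eseries_cond [leRHS]eseries_cond.
    apply: lee_nneseries => [i _ _|i im]; first exact: gs0.
    rewrite -EFinM lee_fin mulrC ler_wpM2r// -(subnK (im : (m.+1 <= i)%N)) exprD.
    by rewrite ler_piMl ?exprn_ge0 ?exprn_ile1 ?(ltW s0).
  rewrite nneseriesZl//; last by move=> i _; rewrite lee_fin.
  rewrite EFinM lee_wpmul2l ?lee_fin ?exprn_ge0 ?(ltW s0)//.
  apply: le_trans gB; rewrite [leRHS](nneseries_split 0 m.+1)//; last by move=> i _; rewrite lee_fin.
  by rewrite leeDr// sume_ge0// => i _; rewrite lee_fin.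
have := le_trans h1 (le_trans (eq_leRL fg) h2).
rewrite sumEFin -EFinD lee_fin !big_nat_recr//=.
have -> : \sum_(0 <= i < m) f i * s ^+ i = \sum_(0 <= i < m) g i * s ^+ i.
  by rewrite !big_nat; apply: eq_bigr => i /andP[_ im]; rewrite ih.
rewrite -addrA lerD2l exprSr -mulrA (mulrC (g m)) -mulrDr (mulrC (f m)) ler_pM2l//.
exact: exprn_gt0.
Qed.

Lemma power_series_unique m : b m = c m.
Proof.
have [n mn] := ubnP m; elim: n m mn => // n ih m; rewrite ltnS => mn.
have ihm i : (i < m)%N -> b i = c i by move=> im; apply: ih; exact: leq_trans mn.
have B0 : 0 <= B.
  rewrite -lee_fin; apply: le_trans bB; apply: nneseries_ge0 => i _ _; by rewrite lee_fin.
apply: (@eq_div_nat _ _ _ B) => k; pose s : R := k.+1%:R^-1.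
have s01 : 0 < s <= 1 by rewrite invr_gt0 ltr0n /= invf_le1// ler1n.
have h1 := half b0 c0 cB s01 (bc s01) ihm.
have h2 := half c0 b0 bB s01 (esym (bc s01)) (fun i im => esym (ihm i im)).
have -> : B / k.+1%:R = s * B by rewrite mulrC.
move: h1 h2; move: (s * B) (b m) (c m) => z x y h1 h2.
by rewrite ler_norml; apply/andP; split; lra.
Qed.

End power_series_unique.

Section laplace.
Variable R : realType.
Notation V := (iseq R).

Definition expm (k : nat) (th : nat -> R) (x : V) : R := expR (- (\sum_(j < k) th j * x j)).

Lemma expmD k th x y : expm k th (vadd x y) = expm k th x * expm k th y.
Proof.
rewrite /expm -expRD -opprD -big_split /=; congr (expR (- _)).
by apply: eq_bigr => j _; rewrite -mulrDr.
Qed.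

Lemma expm_gt0 k th x : 0 < expm k th x. Proof. exact: expR_gt0. Qed.

Lemma measurable_expm k th : measurable_fun setT (expm k th).
Proof.
apply: (measurableT_comp (@measurable_expR R)); apply: measurableT_comp => //.
apply: measurable_sum => j; apply: measurable_funM; first exact: measurable_cst.
exact: measurable_coord.
Qed.

Definition laplace k th (mu : probability V R) : \bar R := (\int[mu]_x (expm k th x)%:E)%E.

Lemma laplace_deq k th mu nu : deq mu nu -> laplace k th mu = laplace k th nu.
Proof. by move=> h; apply: eq_measure_integral => A mA _; exact: h. Qed.

Lemma laplace_delta0 k th : laplace k th (delta0 R) = 1%E.
Proof.
rewrite /laplace integral_dirac//; last by apply/measurable_EFinP; exact: measurable_expm.
rewrite diracT mul1e /expm big1 ?oppr0 ?expR0// => j _.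
by rewrite mulr0.
Qed.

Lemma laplace_conv k th mu nu : laplace k th (conv mu nu) = (laplace k th mu * laplace k th nu)%E.
Proof.
have mE : measurable_fun setT (fun x : V => (expm k th x)%:E).
  by apply/measurable_EFinP; exact: measurable_expm.
have E0 x : (0 <= (expm k th x)%:E)%E by rewrite lee_fin ltW// expm_gt0.
rewrite {1}/laplace /conv /law ge0_integral_distribution//=.
rewrite fubini_tonelli1//=; last first.
  by apply: (measurableT_comp mE); exact: measurable_vadd.
transitivity (\int[mu]_x ((expm k th x)%:E * laplace k th nu))%E.
  apply: eq_integral => x _; rewrite /fubini_F /laplace -ge0_integralZl//.
  by apply: eq_integral => y _; rewrite /= expmD EFinM.
rewrite ge0_integralZr//; apply: integral_ge0 => y _; exact: E0.
Qed.

Lemma laplace_convs k th (I : Type) (f : I -> probability V R) (s : seq I) :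
  laplace k th (convs (map f s)) = (\prod_(i <- s) laplace k th (f i))%E.
Proof.
elim: s => [|i s ih] /=; first by rewrite big_nil laplace_delta0.
by rewrite big_cons -ih laplace_conv.
Qed.

End laplace.

Lemma indep_sequence_marginal (R : realType) (mu : nat -> probability R R) (Y : R -> iseq R) :
  (forall n (A : nat -> set R), (forall i, measurable (A i)) ->
    unif R [set u | forall i, (i < n)%N -> A i (Y u i)] = (\prod_(i < n) mu i (A i))%E) ->
  forall i A, measurable A -> unif R [set u | A (Y u i)] = mu i A.
Proof.
move=> h i A mA; pose B j := if j == i then A else setT.
have mB j : measurable (B j) by rewrite /B; case: eqP.
rewrite (_ : [set u | _] = [set u | forall j, (j < i.+1)%N -> B j (Y u j)]); last first.
  apply/seteqP; split => u /=; first by move=> Au j _; rewrite /B; case: eqP => // ->.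
  by move=> /(_ i (ltnSn i)); rewrite /B eqxx.
rewrite h// big_ord_recr/= [X in (X * _)%E]big1 ?mul1e ?/B ?eqxx// => j _.
by rewrite ltn_eqF// probability_setT.
Qed.

(** * Poisson points in a unit cell *)

Section cell.
Variables (R : realType) (l : nat).
Notation V := (iseq R).

Definition cell_itv : set R := `]l%:R, l.+1%:R]%classic.

Let mcell : measurable cell_itv. Proof. exact: measurable_itv. Qed.

Let mid : measurable_fun setT (id : measurableTypeR R -> R).
Proof. by move=> _ B mB; rewrite setTI. Qed.

Let m : {measure set R -> \bar R} := image_measure (mrestr (@lebesgue_measure R) mcell) mid.

Let mT : m setT = 1%E.
Proof.
transitivity (@lebesgue_measure R `]l%:R, l.+1%:R]%classic).
  by rewrite [LHS]/(lebesgue_measure (setT `&` cell_itv)) setTI.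
rewrite lebesgue_measure_itv/= lte_fin ltr_nat ltnSn.
by rewrite -EFinB -natrB// subSnn.
Qed.

Definition cell_unif : probability R R := to_prob mT.

Lemma cell_unifE A : cell_unif A = @lebesgue_measure R (A `&` cell_itv).
Proof. by []. Qed.

Definition marks (A : nat -> set R) (x : R) : V := fun j => \1_(A j) (posify x).

Lemma measurable_marks A : (forall j, measurable (A j)) -> measurable_fun setT (marks A).
Proof.
move=> mA; apply: measurable_to_iseq => j.
exact: (measurableT_comp (measurable_indic (mA j)) (@measurable_posify R)).
Qed.

Section mark_cell.
Variables (k : nat) (A : nat -> set R).
Hypothesis mA : forall j, measurable (A j).
Hypothesis dA : forall i j, (i < k)%N -> (j < k)%N -> i != j -> A i `&` A j = set0.

Let ma j : R := fine (@lebesgue_measure R (A j `&` cell_itv)).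

Let leb_cell_fin j : (@lebesgue_measure R (A j `&` cell_itv) < +oo)%E.
Proof.
rewrite -cell_unifE; apply: (@le_lt_trans _ _ 1%E); last exact: ltry.
exact: probability_le1.
Qed.

Definition mark_cell : probability V R := law cell_unif (measurable_marks mA).

(** By disjointness at most one indicator equals 1, so the exponential is the affine function 1 -
    sum of (1 - exp(-th j)) times the indicators. *)
Lemma laplace_mark_cell th : (forall j, 0 <= th j) ->
  laplace k th mark_cell = (1 - \sum_(j < k) (1 - expR (- th j)) * ma j)%:E.
Proof.
move=> th0; pose f j x := ((1 - expR (- th j)) * \1_(A j) (posify x))%:E : \bar R.
have c0 j : 0 <= 1 - expR (- th j).
  by rewrite subr_ge0 -[leRHS]expR0 ler_expR oppr_le0.
have mi j : measurable_fun setT (fun x : R => (\1_(A j) (posify x) : R)).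
  exact: (measurableT_comp (measurable_indic (mA j)) (@measurable_posify R)).
have mf j : measurable_fun setT (f j).
  by apply/measurable_EFinP; apply: measurable_funM => //; exact: measurable_cst.
have f0 j x : (0 <= f j x)%E by rewrite lee_fin mulr_ge0.
have ef j : (\int[cell_unif]_x f j x = ((1 - expR (- th j)) * ma j)%:E)%E.
  rewrite /f; under eq_integral do rewrite EFinM.
  rewrite ge0_integralZl//; [|exact/measurable_EFinP|by rewrite lee_fin].
  have e : (fun x => (\1_(A j) (posify x))%:E) = (fun x => (\1_(@posify R @^-1` A j) x)%:E) :> (R -> \bar R).
    by apply/funext => x; rewrite !indicE; congr (_%:R%:E); apply: eq_in_set.
  rewrite e integral_indic//; last first.
    by have := @measurable_posify R measurableT _ (mA j); rewrite setTI.
  rewrite setIT EFinM; congr (_ * _)%E.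
  rewrite /ma fineK ?ge0_fin_numE// -cell_unifE !cell_unifE; congr lebesgue_measure.
  apply/seteqP; split => x /= [Ax cx]; have x0 : 0 < x by
    move: cx; rewrite /cell_itv /= in_itv/= => /andP[+ _]; apply: le_lt_trans.
    by move: Ax; rewrite posify_id.
  by rewrite posify_id.
have mg : measurable_fun setT (fun x : R => (expm k th (marks A x))%:E).
  by apply/measurable_EFinP; apply: (measurableT_comp (measurable_expm k th)); exact: measurable_marks.
have L : laplace k th mark_cell = (\int[cell_unif]_x (expm k th (marks A x))%:E)%E.
  transitivity (\int[image_measure cell_unif (measurable_marks mA)]_x (expm k th x)%:E)%E => //.
  rewrite ge0_integral_image//; first by apply/measurable_EFinP; exact: measurable_expm.
  by move=> x _; rewrite lee_fin ltW// expm_gt0.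
have key : (laplace k th mark_cell + \sum_(j < k) ((1 - expR (- th j)) * ma j)%:E = 1)%E.
  rewrite L; under eq_bigr => j _ do rewrite -ef.
  rewrite -ge0_integral_sum// -ge0_integralD//.
  - transitivity (\int[cell_unif]_x 1%:E)%E; last by rewrite integral_cst// mul1e; exact: probability_setT.
    apply: eq_integral => x _; rewrite /f sumEFin -EFinD; congr EFin.
    have [[j [jk Aj]]|nA] := pselect (exists j, (j < k)%N /\ A j (posify x)).
      have A0 i : (i < k)%N -> i != j -> \1_(A i) (posify x) = 0 :> R.
        move=> ik ij; rewrite indicE memNset// => Ai.
        by have /seteqP[/(_ (posify x))] := dA ik jk ij => /(_ (conj Ai Aj)).
      rewrite /expm (bigD1 (Ordinal jk))//= big1 ?addr0; last first.
        by move=> i ij; rewrite /marks A0 ?mulr0.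
      rewrite [X in _ + X](bigD1 (Ordinal jk))//= big1 ?addr0; last first.
        by move=> i ij; rewrite A0 ?mulr0.
      by rewrite /marks indicE mem_set// !mulr1 addrC subrK.
    have A0 (i : 'I_k) : \1_(A i) (posify x) = 0 :> R.
      by rewrite indicE memNset// => Ai; apply: nA; exists i.
    rewrite /expm !big1 ?oppr0 ?expR0 ?addr0// => i _; rewrite ?/marks A0 mulr0//.
  - by move=> x _; rewrite lee_fin ltW// expm_gt0.
  - by move=> x _; rewrite sume_ge0.
  - exact: emeasurable_sum.
have : laplace k th mark_cell \is a fin_num.
  move: key; rewrite sumEFin; case: (laplace _ _ _) => //.
rewrite sumEFin in key; move=> /fineK lf; move: key; rewrite -lf -EFinD => -[].
by move=> h; congr EFin; apply/eqP; rewrite eq_sym subr_eq h.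
Qed.

End mark_cell.

(** A Poisson number, of mean 1, of independent uniform points. Given the count n the Laplace
    transform is q^n, and averaging over n gives exp(q - 1). *)
Lemma cell_process_exists : exists (N : R -> nat) (pt : nat -> R -> R) ,
  [/\ forall n, measurable (N @^-1` [set n]),
      forall i, measurable_fun setT (pt i),
      forall i u, 0 < pt i u,
      forall n, unif R (N @^-1` [set n]) = (poisson_p 1 n)%:E &
      forall (A : nat -> set R) k (mA : forall j, measurable (A j))
        (mv : measurable_fun setT (fun u => (fun j => \sum_(0 <= i < N u) \1_(A j) (pt i u)) : V)) th,
        (forall i j, (i < k)%N -> (j < k)%N -> i != j -> A i `&` A j = set0) ->
        (forall j, 0 <= th j) ->
        laplace k th (law (unif R) mv) =
        (expR (- \sum_(j < k) (1 - expR (- th j)) * fine (@lebesgue_measure R (A j `&` cell_itv))))%:E].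
Proof.
(* Coordinate 0 provides the number of points, the later ones their positions. *)
pose mu (i : nat) : probability R R := if i is 0 then poisson_law ler01 else cell_unif.
have [Y mY hY] := indep_sequence mu.
have margY := indep_sequence_marginal hY.
have mYi i : measurable_fun setT (fun u => Y u i).
  exact: (measurableT_comp (measurable_coord i) mY).
pose N u := Num.truncn (Y u 0%N).
have mtr n : measurable [set x : R | Num.truncn x = n].
  rewrite (_ : [set x | _] = if n is 0 then `]-oo, 1[%classic else `[n%:R, n.+1%:R[%classic).
    by case: n => [|n]; exact: measurable_itv.
  apply/seteqP; split => x; case: n => [|n] /=.
  - by move=> h; rewrite in_itv/= -[1]/(1%:R) -h; exact: truncnS_gt.
  - move=> h; rewrite in_itv/= -h truncn_le truncnS_gt andbT.
    by move: h; rewrite truncn_floor; case: ifP.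
  - by rewrite in_itv/= => h; apply/eqP; rewrite -leqn0 truncn_le_nat.
  - rewrite in_itv/= => /andP[h1 h2]; apply/eqP; rewrite eqn_leq truncn_le_nat h2 /=.
    by rewrite truncn_ge_nat// (le_trans _ h1).
have mN n : measurable (N @^-1` [set n]).
  by have := mYi 0%N measurableT _ (mtr n); rewrite setTI.
have PN n : unif R (N @^-1` [set n]) = (poisson_p 1 n)%:E.
  exact: etrans (margY 0%N _ (mtr n)) (poisson_lawE (@ler01 R) n).
exists N, (fun i u => posify (Y u i.+1)); split => //.
- by move=> i; exact: (measurableT_comp (@measurable_posify R) (mYi i.+1)).
- by move=> i u; exact: posify_gt0.
move=> B K mB mv th dB th0; pose X i u := marks B (Y u i).
have mX i : measurable_fun setT (X i) by exact: (measurableT_comp (measurable_marks mB) (mYi i)).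
pose F i : set (set R) := [set D | exists2 C, measurable C & D = (fun u => Y u i) @^-1` C].
have indF : mutually_independent (unif R) F.
  apply: (indep_of_rect (Y := fun i u => Y u i) (idx := id)) => //.
  by move=> n C mC; rewrite hY//; apply: eq_bigr => i _; rewrite -margY.
pose vec u : V := fun j => \sum_(0 <= i < N u) \1_(B j) (posify (Y u i.+1)).
pose mk := mark_cell mB.
have vecE n u : N u = n -> vec u = vsum X (iota 1 n) u.
  move=> Nn; apply/funext => j; rewrite /vec /vsum Nn /X /marks.
  by rewrite -[iota 1 n]/(iota (1 + 0) n) iotaDl big_map /index_iota subn0.
have lawX i : deq (law (unif R) (mX i.+1)) mk.
  move=> E mE; rewrite (lawE _ (mX i.+1)) (lawE _ (measurable_marks mB)).
  have mmE : measurable (marks B @^-1` E) by have := measurable_marks mB measurableT mE; rewrite setTI.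
  exact: (margY i.+1 _ mmE).
have lawn n : deq (convs (map (fun i => law (unif R) (mX i)) (iota 1 n))) (convn mk n).
  rewrite -[iota 1 n]/(iota (1 + 0) n) iotaDl -map_comp.
  apply: deq_trans (convs_deq (g := fun=> mk) _) _ => [i _|]; first exact: lawX.
  rewrite /convn (_ : map _ _ = nseq n mk)//.
  by elim: n 0%N => // n ih i /=; rewrite ih.
have split_law E : measurable E ->
    (law (unif R) mv E = \sum_(n <oo) (poisson_p 1 n)%:E * convn mk n E)%E.
  move=> mE; rewrite (lawE _ mv) -/vec.
  have mvE : measurable (vec @^-1` E) by have := mv measurableT _ mE; rewrite setTI.
  have -> : vec @^-1` E = \bigcup_n (N @^-1` [set n] `&` vec @^-1` E).
    by apply/seteqP; split => u /=; [move=> h; exists (N u)|move=> [n _ []]].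
  rewrite measure_semi_bigcup//; last 3 first.
  - by move=> n; exact: measurableI.
  - by apply/trivIsetP => i j _ _ ij; apply/seteqP; split => u //= [[Ni _] [Nj _]];
      move: ij; rewrite -Ni -Nj eqxx.
  - by apply: bigcupT_measurable => n; exact: measurableI.
  apply: eq_eseriesr => n _.
  have := indep_vsum mX (s := iota 1 n) (J := [:: 0%N]) (A := fun=> N @^-1` [set n]) indF.
  rewrite big_cons big_nil setIT PN => hv.
  rewrite -(lawn n E mE) -hv//.
  - by congr (unif R _); apply/seteqP; split => u /= [Nn]; rewrite (vecE _ _ Nn).
  - move=> i C _ mC; exists (marks B @^-1` C) => //.
    by have := measurable_marks mB measurableT mC; rewrite setTI.
  - by move=> j; rewrite inE => /eqP ->; exists [set x | Num.truncn x = n].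
  - by rewrite cats1 rcons_uniq iota_uniq mem_iota.
pose M : {measure set V -> \bar R} :=
  mseries (fun n => mscale (NngNum (poisson_p_ge0 n (@ler01 R))) (convn mk n)) 0.
have mexp : measurable_fun setT (fun x : V => (expm K th x)%:E).
  by apply/measurable_EFinP; exact: measurable_expm.
have exp0 x : (0 <= (expm K th x)%:E)%E by rewrite lee_fin ltW// expm_gt0.
have lq := laplace_mark_cell mB dB th0.
set q := (1 - _) in lq.
have q0 : 0 <= q.
  by rewrite -lee_fin -lq; apply: integral_ge0 => x _; exact: exp0.
transitivity (\int[M]_x (expm K th x)%:E)%E.
  by apply: eq_measure_integral => E mE _; exact: split_law.
rewrite ge0_integral_measure_series//.
transitivity (\sum_(n <oo) (expR (q - 1))%:E * (poisson_p q n)%:E)%E.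
  apply: eq_eseriesr => n _; rewrite ge0_integral_mscale//=.
  have -> : (\int[convn mk n]_x (expm K th x)%:E = (q ^+ n)%:E)%E.
    transitivity (laplace K th (convs (map id (nseq n mk)))); first by rewrite map_id.
    rewrite laplace_convs big_nseq lq; elim: n => //= n ->.
    by rewrite exprS EFinM.
  rewrite -!EFinM; congr EFin; rewrite /poisson_p expr1n mulr1 expRD !expRN.
  by field; rewrite pnatr_eq0 -lt0n fact_gt0 !gt_eqF ?expR_gt0.
rewrite nneseriesZl//; last by move=> n _; rewrite lee_fin poisson_p_ge0.
by rewrite sum_poisson_p// mule1 /q addrAC subrr add0r.
Qed.

End cell.

(** * Gluing the cells into one sequence of points *)

Section enumeration.
Variables (T : Type) (a : nat -> nat) (p : nat -> nat -> T) (x0 : T).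

Definition partial L : nat := \sum_(0 <= l < L) a l.

Lemma partialS L : partial L.+1 = (partial L + a L)%N.
Proof. by rewrite /partial big_nat_recr. Qed.

Lemma le_partial L M : (L <= M)%N -> (partial L <= partial M)%N.
Proof. by move=> LM; rewrite /partial (@big_cat_nat _ _ _ L 0%N M)//= leq_addr. Qed.

Lemma partial_cell_unique n c c' : (partial c <= n < partial c.+1)%N ->
  (partial c' <= n < partial c'.+1)%N -> c = c'.
Proof.
move=> /andP[c1 c2] /andP[d1 d2]; apply/eqP; rewrite eqn_leq; apply/andP; split; rewrite leqNgt; apply/negP.
- by move=> /le_partial; rewrite leqNgt (leq_ltn_trans c1 d2).
- by move=> /le_partial; rewrite leqNgt (leq_ltn_trans d1 c2).
Qed.

(* [0] when the index [n] lies beyond all cells, [c.+1] when it lies in cell [c] *)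
Definition cell_index n : nat :=
  if pselect (exists c, (partial c <= n < partial c.+1)%N) is left h
  then (projT1 (cid h)).+1 else 0%N.

Lemma cell_index_eq n c : (cell_index n = c.+1) <-> (partial c <= n < partial c.+1)%N.
Proof.
rewrite /cell_index; case: pselect => [h|h]; last by split => // hc; case: h; exists c.
case: cid => c' /= hc'; split; first by move=> [<-].
by move=> hc; congr S; exact: partial_cell_unique hc' hc.
Qed.

Definition enumerate n : T :=
  if cell_index n is c.+1 then p c (n - partial c) else x0.

Lemma enumerate_cell c i : (i < a c)%N -> enumerate (partial c + i) = p c i.
Proof.
move=> ic; rewrite /enumerate (_ : cell_index _ = c.+1) ?addKn//.
by apply/cell_index_eq; rewrite leq_addr partialS ltn_add2l.
Qed.

Lemma sum_enumerate (R : pzSemiRingType) (f : T -> R) L :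
  \sum_(0 <= n < partial L) f (enumerate n) =
  \sum_(0 <= l < L) \sum_(0 <= i < a l) f (p l i).
Proof.
elim: L => [|L ih]; first by rewrite /partial !big_geq.
rewrite big_nat_recr//= -ih (@big_cat_nat _ _ _ (partial L) 0%N) ?le_partial//=.
congr (_ + _); rewrite partialS -{1}[partial L]add0n big_addn addKn.
by rewrite big_nat_cond [RHS]big_nat_cond; apply: eq_bigr => i; rewrite andbT => /andP[_ ia]; rewrite addnC enumerate_cell.
Qed.

End enumeration.

Section integer_laplace.
Context d (T : measurableType d) (R : realType) (P : probability T R).
Variables (k : nat) (C : nat -> T -> nat) (ell : nat -> R).
Hypothesis mC : forall j m, measurable [set w | C j w = m].
Hypothesis ell0 : forall j, 0 <= ell j.
Hypothesis gen : forall s : nat -> R, (forall j, 0 < s j <= 1) ->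
  (\int[P]_w (\prod_(j < k) s j ^+ C j w)%:E = (\prod_(j < k) expR (- ((1 - s j) * ell j)))%:E)%E.
Variable m : nat -> nat.

(** Interpolates between the generating function, at [i = 0], and the joint event, at [i = k], by
    treating one count at a time. *)
Let fac (s : nat -> R) i j w : R := if (j < i)%N then (C j w == m j)%:R else s j ^+ C j w.

Let facc (s : nat -> R) i j : R :=
  if (j < i)%N then poisson_p (ell j) (m j) else expR (- ((1 - s j) * ell j)).

Let mCf j : measurable_fun setT (C j).
Proof.
move=> _ B _; rewrite setTI (_ : _ @^-1` _ = \bigcup_(n in B) [set w | C j w = n]).
  by apply: bigcup_measurable.
by apply/seteqP; split => w /=; [move=> h; exists (C j w)|move=> [n Bn ->]].
Qed.

Let mnat (g : nat -> R) j : measurable_fun setT (fun w => g (C j w)).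
Proof. by apply: (measurableT_comp _ (mCf j)) => _ B mB. Qed.

Let mfac s i j : measurable_fun setT (fac s i j).
Proof.
rewrite /fac; case: (j < i)%N; first exact: (mnat (fun c => (c == m j)%:R)).
exact: (mnat (fun c => s j ^+ c)).
Qed.

Let fac0 s i j w : (forall j, 0 < s j <= 1) -> 0 <= fac s i j w.
Proof. by move=> s01; rewrite /fac; case: ifP => // _; rewrite exprn_ge0// ltW//; case/andP: (s01 j). Qed.

Let fac1 s i j w : (forall j, 0 < s j <= 1) -> fac s i j w <= 1.
Proof.
move=> s01; rewrite /fac; case: ifP => _; first by case: eqP.
by have /andP[s0 s1] := s01 j; rewrite exprn_ile1// ltW.
Qed.

Let facc0 s i j : (forall j, 0 < s j <= 1) -> 0 <= facc s i j.
Proof. by move=> s01; rewrite /facc; case: ifP => // _; rewrite ?expR_ge0// poisson_p_ge0. Qed.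

(** With the other factors frozen in [rest], the induction hypothesis equates two power series in
    [s i]; their coefficients of order [m i] give the next case. *)
Let step i s : (i <= k)%N -> (forall j, 0 < s j <= 1) ->
  (\int[P]_w (\prod_(j < k) fac s i j w)%:E = (\prod_(j < k) facc s i j)%:E)%E.
Proof.
elim: i s => [|i ih] s ik s01; first exact: gen.
pose j0 := Ordinal ik.
pose rest w := \prod_(j < k | j != j0) fac s i j w.
pose K := \prod_(j < k | j != j0) facc s i j.
have neq (j : 'I_k) : j != j0 -> (j < i.+1)%N = (j < i)%N.
  by move=> jj; rewrite ltnS leq_eqVlt; case: eqP => // ji; case/eqP: jj; exact: val_inj.
have e1 w : \prod_(j < k) fac s i.+1 j w = rest w * (C i w == m i)%:R.
  rewrite (bigD1 j0)//= mulrC; congr (_ * _); last by rewrite /fac ltnSn.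
  by apply: eq_bigr => j /neq h; rewrite /fac h.
have e2 : \prod_(j < k) facc s i.+1 j = K * poisson_p (ell i) (m i).
  rewrite (bigD1 j0)//= mulrC; congr (_ * _); last by rewrite /facc ltnSn.
  by apply: eq_bigr => j /neq h; rewrite /facc h.
have r0 w : 0 <= rest w by apply: prodr_ge0 => j _; exact: fac0.
have r1 w : rest w <= 1.
  suff: 0 <= rest w <= 1 by case/andP.
  apply: (big_ind (fun x => 0 <= x <= 1)) => [|x y /andP[x0 x1] /andP[y0 y1]|j _].
  - by rewrite ler01 lexx.
  - by rewrite mulr_ge0// mulr_ile1.
  - by rewrite fac0 ?fac1.
have mr : measurable_fun setT rest by rewrite /rest; under eq_fun do rewrite -big_filter; apply: measurable_prod => j _; exact: mfac.
have K0 : 0 <= K by apply: prodr_ge0 => j _; exact: facc0.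
pose g n w : \bar R := (rest w * (C i w == n)%:R)%:E.
have mg n : measurable_fun setT (g n).
  by apply/measurable_EFinP; apply: measurable_funM => //; exact: (mnat (fun c => (c == n)%:R)).
have g0 n w : (0 <= g n w)%E by rewrite lee_fin mulr_ge0.
have sumg (c : nat -> R) w : (forall n, 0 <= c n) ->
    (\sum_(n <oo) (c n)%:E * g n w = (rest w * c (C i w))%:E)%E.
  move=> c0; rewrite (@nneseriesD1 _ _ (C i w))//; last first.
    by move=> n _; rewrite mule_ge0// lee_fin.
  rewrite eseries0 ?adde0; first by rewrite /g eqxx mulr1 -EFinM mulrC.
  by move=> n _ /negbTE nC; rewrite /g eq_sym nC mulr0 mule0.
have ib n : (\int[P]_w g n w <= 1)%E.
  rewrite -(@probability_setT _ _ _ P) -[leRHS]mul1e -integral_cst//.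
  apply: ge0_le_integral => //.
  by move=> w _; rewrite lee_fin mulr_ile1//; case: eqP.
pose b n := fine (\int[P]_w g n w)%E.
have bE n : (\int[P]_w g n w = (b n)%:E)%E.
  rewrite /b fineK// ge0_fin_numE ?(le_lt_trans (ib n)) ?ltry//.
  exact: integral_ge0.
have b0 n : 0 <= b n by rewrite -lee_fin -bE; exact: integral_ge0.
have sb (c : nat -> R) : (forall n, 0 <= c n) ->
    (\sum_(n <oo) (b n * c n)%:E = \int[P]_w (rest w * c (C i w))%:E)%E.
  move=> c0; under eq_integral => w _ do rewrite -sumg//.
  rewrite integral_nneseries//; last 2 first.
  - by move=> n; apply: measurable_funeM.
  - by move=> n w _; rewrite mule_ge0// lee_fin.
  by apply: eq_eseriesr => n _; rewrite ge0_integralZl ?lee_fin// bE mulrC.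
have main : b (m i) = K * poisson_p (ell i) (m i).
  apply: (@power_series_unique R b (fun n => K * poisson_p (ell i) n) (1 + K)) => //.
  - by move=> n; rewrite mulr_ge0// poisson_p_ge0.
  - have := sb (fun=> 1) (fun=> ler01); under eq_eseriesr do rewrite mulr1.
    move=> ->; apply: (@le_trans _ _ 1%E); last by rewrite lee_fin lerDl.
    rewrite -(@probability_setT _ _ _ P) -[leRHS]mul1e -integral_cst//.
    apply: ge0_le_integral => //.
    + by move=> w _; rewrite lee_fin mulr1.
    + by apply/measurable_EFinP; apply: measurable_funM.
    + by move=> w _; rewrite lee_fin mulr1.
  - under eq_eseriesr do rewrite EFinM.
    rewrite nneseriesZl//; last by move=> n _; rewrite lee_fin poisson_p_ge0.
    by rewrite sum_poisson_p// mule1 lee_fin lerDr.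
  - move=> r r01; have /andP[r00 r1'] := r01.
    rewrite (sb (fun n => r ^+ n)); last by move=> n; rewrite exprn_ge0// ltW.
    pose s' j := if j == i then r else s j.
    have s'01 j : 0 < s' j <= 1 by rewrite /s'; case: eqP.
    have := ih s' (ltnW ik) s'01.
    have -> : (fun w => (\prod_(j < k) fac s' i j w)%:E) = (fun w => (rest w * r ^+ C i w)%:E).
      apply/funext => w; congr EFin; rewrite (bigD1 j0)//= mulrC; congr (_ * _).
        by apply: eq_bigr => j jj; rewrite /fac /s'; case: (@eqP _ (nat_of_ord j) i) => // ji;
          case/eqP: jj; exact: val_inj.
      by rewrite /fac ltnn /s' eqxx.
    move=> ->; rewrite (bigD1 j0)//= mulrC [X in (X * _)%:E](_ : _ = K); last first.
      by apply: eq_bigr => j jj; rewrite /facc /s'; case: (@eqP _ (nat_of_ord j) i) => // ji;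
          case/eqP: jj; exact: val_inj.
    rewrite /facc ltnn /s' eqxx.
    under [RHS]eq_eseriesr do rewrite -mulrA EFinM.
    rewrite nneseriesZl//; last first.
      by move=> n _; rewrite lee_fin mulr_ge0 ?poisson_p_ge0// exprn_ge0// ltW.
    rewrite EFinM; congr (_ * _)%E.
    have rl0 : 0 <= r * ell i by rewrite mulr_ge0// ltW.
    transitivity (\sum_(n <oo) (expR (- ((1 - r) * ell i)))%:E * (poisson_p (r * ell i) n)%:E)%E.
      rewrite nneseriesZl//; last by move=> n _; rewrite lee_fin poisson_p_ge0.
      by rewrite sum_poisson_p// mule1.
    apply: eq_eseriesr => n _; rewrite -EFinM; congr EFin; rewrite /poisson_p exprMn.
    rewrite (_ : - ell i = - ((1 - r) * ell i) + - (r * ell i)); last by ring.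
    by rewrite expRD; ring.
under eq_integral do rewrite e1.
by rewrite e2 -main -bE.
Qed.

Lemma joint_poisson : P [set w | forall j, (j < k)%N -> C j w = m j] =
  (\prod_(j < k) poisson_p (ell j) (m j))%:E.
Proof.
have s1 (j : nat) : 0 < (fun=> 1 : R) j <= 1 by rewrite ltr01 lexx.
have := step (leqnn k) s1.
rewrite [X in _ = X%:E](_ : _ = \prod_(j < k) poisson_p (ell j) (m j)); last first.
  by apply: eq_bigr => j _; rewrite /facc ltn_ord.
move=> <-; rewrite (_ : (fun w => _) = (fun w => (\1_[set w | forall j, (j < k)%N -> C j w = m j] w)%:E)).
  rewrite integral_indic// ?setIT//.
  rewrite (_ : [set w | _] = \bigcap_(j in [set j | (j < k)%N]) [set w | C j w = m j]).
    by apply: bigcap_measurableType => j _; exact: mC.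
  by apply/seteqP; split => w.
apply/funext => w; congr EFin; rewrite indicE.
have [h|h] := pselect (forall j, (j < k)%N -> C j w = m j).
  by rewrite mem_set// big1// => j _; rewrite /fac ltn_ord h ?eqxx.
rewrite memNset//; have [j [jk nj]] : exists j, (j < k)%N /\ C j w != m j.
  apply: contrapT => hh; apply: h => j jk; apply: contrapT => nj; apply: hh.
  by exists j; split => //; apply/eqP.
by rewrite (bigD1 (Ordinal jk))//= /fac jk (negbTE nj) mul0r.
Qed.

End integer_laplace.

Section counting.
Context d (T : measurableType d) (R : realType).
Variable G : nat -> T -> R.

Definition hits (A : set R) (w : T) n : nat := (\sum_(0 <= i < n) (G i w \in A))%N.

Lemma hitsS A w n : hits A w n.+1 = (hits A w n + (G n w \in A))%N.
Proof. by rewrite /hits big_nat_recr. Qed.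

Lemma le_hits A w n p : (n <= p)%N -> (hits A w n <= hits A w p)%N.
Proof.
move=> /subnKC <-; elim: (p - n)%N => [|k ih]; first by rewrite addn0.
by rewrite addnS hitsS (leq_trans ih)// leq_addr.
Qed.

Lemma hitsE A w n : ((hits A w n)%:R : R) = \sum_(i < n) \1_A (G i w).
Proof.
by rewrite /hits natr_sum big_mkord; apply: eq_bigr => i _; rewrite indicE.
Qed.

Lemma point_countP A w m : point_count G A w = (m%:R)%:E <->
  exists n0, forall n, (n0 <= n)%N -> hits A w n = m.
Proof.
have le_pc n : (((hits A w n)%:R)%:E <= point_count G A w)%E.
  rewrite hitsE -sumEFin -(big_mkord xpredT (fun i => (\1_A (G i w))%:E)).
  by apply: nneseries_lim_ge => i _ _; rewrite lee_fin.
split=> [h|[n0 h]].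
  have le_m n : (hits A w n <= m)%N by rewrite -(ler_nat R) -lee_fin -h.
  have [[n0 hn]|no] := pselect (exists n, hits A w n = m).
    by exists n0 => n nn; apply/eqP; rewrite eqn_leq le_m -hn le_hits.
  have lt_m n : (hits A w n < m)%N.
    by rewrite ltn_neqAle le_m andbT; apply/eqP => e; apply: no; exists n.
  have m0 : (0 < m)%N by apply: leq_ltn_trans (lt_m 0%N).
  have : (point_count G A w <= (m.-1%:R)%:E)%E.
    apply: lime_le; first by apply: is_cvg_nneseries => i _ _; rewrite lee_fin.
    apply: nearW => n /=; rewrite big_mkord sumEFin -hitsE lee_fin ler_nat.
    by rewrite -ltnS prednK.
  by rewrite h lee_fin ler_nat leqNgt prednK ?leqnn.
rewrite (@point_count_fin _ _ _ _ _ _ n0) -?hitsE ?h// => i ni Ai.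
have := hitsS A w i; rewrite !h ?(leq_trans ni)// mem_set//= addn1 => e; exact: (n_Sn _ e).
Qed.

End counting.

Section poisson_process.
Variable R : realType.
Notation V := (iseq R).
Variables (N : nat -> R -> nat) (pt : nat -> nat -> R -> R) (Z : R -> V).
Hypothesis mN : forall l n, measurable (N l @^-1` [set n]).
Hypothesis mpt : forall l i, measurable_fun setT (pt l i).
Hypothesis pt0 : forall l i u, 0 < pt l i u.
Hypothesis PN : forall l n, unif R (N l @^-1` [set n]) = (poisson_p 1 n)%:E.
Hypothesis cellL : forall l (A : nat -> set R) k (mA : forall j, measurable (A j))
  (mv : measurable_fun setT (fun u => (fun j => \sum_(0 <= i < N l u) \1_(A j) (pt l i u)) : V)) th,
  (forall i j, (i < k)%N -> (j < k)%N -> i != j -> A i `&` A j = set0) ->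
  (forall j, 0 <= th j) ->
  laplace k th (law (unif R) mv) =
  (expR (- \sum_(j < k) (1 - expR (- th j)) * fine (@lebesgue_measure R (A j `&` @cell_itv R l))))%:E.
Hypothesis mZ : measurable_fun setT Z.
Hypothesis hZ : forall n (A : nat -> set R), (forall i, measurable (A i)) ->
  unif R [set u | forall i, (i < n)%N -> A i (Z u i)] = (\prod_(i < n) unif R (A i))%E.

Let P := unif R.
Let Nl u l := N l (Z u l).
Let Pl u l i := pt l i (Z u l).

(** Points are listed cell after cell. The default 1 shows up only if all cells are empty from some
    index on, which is a null event by [bad0]. *)
Definition lex_points n (u : R) : R := enumerate (Nl u) (Pl u) 1 n.

Let mZi l : measurable_fun setT (fun u => Z u l).
Proof. exact: (measurableT_comp (measurable_coord l) mZ). Qed.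

Let mNl l n : measurable [set u | Nl u l = n].
Proof. by have := mZi l measurableT (mN l n); rewrite setTI. Qed.

Let to_nat (g : R -> nat) : (forall n, measurable [set u | g u = n]) -> measurable_fun setT g.
Proof.
move=> mg _ B _; rewrite setTI (_ : _ @^-1` _ = \bigcup_(n in B) [set w | g w = n]).
  by apply: bigcup_measurable.
by apply/seteqP; split => w /=; [move=> h; exists (g w)|move=> [n Bn ->]].
Qed.

Let mpartial L : measurable_fun setT (fun u => partial (Nl u) L).
Proof.
elim: L => [|L ih].
  by rewrite /partial; under eq_fun do rewrite big_geq//; exact: measurable_cst.
under eq_fun do rewrite partialS.
by apply: measurable_fun_addn => //; exact: to_nat.
Qed.

Let mindex n c : measurable [set u | cell_index (Nl u) n = c].
Proof.
have mS c' : measurable [set u | cell_index (Nl u) n = c'.+1].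
  rewrite (_ : [set u | _] = [set u | (partial (Nl u) c' <= n)%N] `&` [set u | (n < partial (Nl u) c'.+1)%N]).
    apply: measurableI.
    - by have := mpartial c' measurableT (Y := [set m | (m <= n)%N]) I; rewrite setTI.
    - by have := mpartial c'.+1 measurableT (Y := [set m | (n < m)%N]) I; rewrite setTI.
  by apply/seteqP; split => u /=; rewrite cell_index_eq; [move=> /andP[]|move=> [-> ->]].
case: c => [|c]; last exact: mS.
rewrite (_ : [set u | _] = ~` \bigcup_c [set u | cell_index (Nl u) n = c.+1]).
  by apply: measurableC; apply: bigcup_measurable.
apply/seteqP; split => u /=; first by move=> h [c' _] /=; rewrite h.
by case e : (cell_index _ _) => [//|c] h; case: h; exists c.
Qed.

Lemma measurable_lex_points n : measurable_fun setT (lex_points n).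
Proof.
pose F c u : R := if c is c'.+1 then Pl u c' (n - partial (Nl u) c') else 1.
have -> : lex_points n = fun u => F (cell_index (Nl u) n) u by [].
apply: measurable_pick => [c|[|c]]; first exact: mindex; first exact: measurable_cst.
apply: (measurable_pick (kappa := fun u => (n - partial (Nl u) c)%N) (F := fun i u => Pl u c i)).
- move=> i; have := @measurable_fun_subn _ R setT (cst n) _ (measurable_cst _) (mpartial c).
  by move=> /(_ measurableT [set i] I); rewrite setTI.
- by move=> i; exact: (measurableT_comp (mpt c i) (mZi c)).
Qed.

Lemma lex_points_gt0 n u : 0 < lex_points n u.
Proof. by rewrite /lex_points /enumerate; case: cell_index => [|c]; rewrite ?ltr01// pt0. Qed.

Let bad L0 : set R := [set u | forall l, (L0 <= l)%N -> Nl u l = 0%N].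

Let mbad L0 : measurable (bad L0).
Proof. by apply: bigcap_measurableType => l _; exact: mNl. Qed.

Let bad0 L0 : P (bad L0) = 0%E.
Proof.
rewrite (prE P (mbad L0)); congr EFin; apply/eqP; rewrite eq_le pr_ge0 andbT.
apply: (@le0_div_nat _ _ 1) => q.
(* Only [q] cells after [L0] are asked to be empty; this has probability exp(-q), at most 1/(q +
   1). *)
pose A l : set R := if (L0 <= l)%N then N l @^-1` [set 0%N] else setT.
have mA l : measurable (A l) by rewrite /A; case: ifP.
pose D := [set u | forall l, (l < L0 + q)%N -> A l (Z u l)].
have mD : measurable D.
  apply: bigcap_measurableType => l _.
  by have := mZi l measurableT (mA l); rewrite setTI.
have -> : 1 / q.+1%:R = q.+1%:R^-1 :> R by rewrite div1r.
apply: (@le_trans _ _ (expR (- q%:R))); last first.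
  by rewrite expRN lef_pV2 ?posrE ?expR_gt0// -natr1 addrC expR_ge1Dx.
apply: (@le_trans _ _ (pr P D)).
  by apply: le_pr => // u hu l _; rewrite /A; case: ifP => // Ll; exact: hu.
rewrite -lee_fin -prE// /P hZ//.
have -> : (\prod_(i < L0 + q) unif R (A i) = \prod_(i < q) (expR (- 1))%:E)%E.
  rewrite big_split_ord; transitivity (1 * \prod_(i < q) (expR (- 1))%:E : \bar R)%E; last by rewrite mul1e.
  apply: (congr2 mule).
    apply: big1 => i _; rewrite /A (_ : (L0 <= lshift q i)%N = false); first exact: probability_setT.
    by rewrite leqNgt/= ltn_ord.
  apply: eq_bigr => i _; rewrite /A (_ : (L0 <= rshift L0 i)%N) ?leq_addr// PN; congr EFin.
  by rewrite /poisson_p expr0 mulr1 fact0 divr1.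
rewrite prodEFin lee_fin prodr_const card_ord -expRM_natl.
by rewrite le_eqVlt; apply/orP; left; apply/eqP; congr expR; ring.
Qed.

Let good u := forall n, exists L, (n <= partial (Nl u) L)%N.

Let good_or_bad u : good u \/ exists L0, bad L0 u.
Proof.
have [[L0 h]|h] := pselect (exists L0, bad L0 u); first by right; exists L0.
left; elim=> [|n [L hL]]; first by exists 0%N.
have [l [Ll l0]] : exists l, (L <= l)%N /\ (0 < Nl u l)%N.
  apply: contrapT => no; apply: h; exists L => l Ll; apply: contrapT => /eqP.
  by rewrite -lt0n => l0; apply: no; exists l.
exists l.+1; rewrite partialS -addn1 leq_add//.
exact: leq_trans hL (le_partial _ Ll).
Qed.

Section counts.
Variables (k : nat) (A : nat -> set R).
Hypothesis mA : forall j, measurable (A j).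
Hypothesis Apos : forall j, A j `<=` (`]0, +oo[%classic : set R).
Hypothesis Afin : forall j, (@lebesgue_measure R (A j) < +oo)%E.
Hypothesis dA : forall i j, (i < k)%N -> (j < k)%N -> i != j -> A i `&` A j = set0.

Let cnt L j u : nat := hits lex_points (A j) u (partial (Nl u) L).
Let cellvec l v : V := fun j => \sum_(0 <= i < N l v) \1_(A j) (pt l i v).

Let mcellvec l : measurable_fun setT (cellvec l).
Proof.
apply: measurable_to_iseq => j.
have h := @measurable_pick _ _ R R (N l) (fun n v => \sum_(0 <= i < n) \1_(A j) (pt l i v)).
apply: h => // n; apply: measurable_sum => i; exact: (measurableT_comp (measurable_indic (mA j)) (mpt l i)).
Qed.

Let X l u := cellvec l (Z u l).

Let mX l : measurable_fun setT (X l).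
Proof. exact: (measurableT_comp (mcellvec l) (mZi l)). Qed.

Let cntE L j u : (cnt L j u)%:R = vsum X (iota 0 L) u j :> R.
Proof.
rewrite /cnt hitsE -(big_mkord xpredT (fun i => \1_(A j) (lex_points i u))).
rewrite (sum_enumerate (Nl u) (Pl u) 1 (\1_(A j) : R -> R)) /vsum.
by rewrite /index_iota subn0.
Qed.

Let mcnt L j m : measurable [set u | cnt L j u = m].
Proof.
have h : measurable_fun setT (fun u => vsum X (iota 0 L) u j).
  exact: (measurableT_comp (measurable_coord j) (measurable_vsum _ mX)).
rewrite (_ : [set u | _] = setT `&` (fun u => vsum X (iota 0 L) u j) @^-1` [set m%:R]); first exact: h.
rewrite setTI; apply/seteqP; split => u /=; rewrite -cntE; first by move=> ->.
by move=> /eqP; rewrite eqr_nat => /eqP.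
Qed.

Let leb l j := fine (@lebesgue_measure R (A j `&` @cell_itv R l)).
Let ell L j : R := \sum_(l < L) leb l j.

Let leb0 l j : 0 <= leb l j. Proof. exact: fine_ge0. Qed.

Let vsum_laplace L th : (forall j, 0 <= th j) ->
  laplace k th (law P (measurable_vsum (iota 0 L) mX)) =
  (expR (- \sum_(j < k) (1 - expR (- th j)) * ell L j))%:E.
Proof.
move=> th0.
have lawX l : deq (law P (mX l)) (law P (mcellvec l)).
  move=> E mE; rewrite (lawE _ (mX l)) (lawE _ (mcellvec l)).
  have mE' : measurable (cellvec l @^-1` E) by have := mcellvec l measurableT mE; rewrite setTI.
  exact: (indep_sequence_marginal (mu := fun=> unif R) hZ l mE').
pose F i : set (set R) := [set D | exists2 C, measurable C & D = (fun u => Z u i) @^-1` C].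
have indF : mutually_independent P F.
  apply: (indep_of_rect (Y := fun i u => Z u i) (idx := id)) => //.
  move=> n C mC; rewrite hZ//; apply: eq_bigr => i _.
  by rewrite -(indep_sequence_marginal (mu := fun=> unif R) hZ i (mC i)).
have D : deq (law P (measurable_vsum (iota 0 L) mX)) (convs (map (fun l => law P (mX l)) (iota 0 L))).
  move=> E mE; rewrite (lawE _ (measurable_vsum (iota 0 L) mX)).
  have hX i C : i \in iota 0 L -> measurable C -> F i (X i @^-1` C).
    move=> _ mC; exists (cellvec i @^-1` C) => //.
    by have := mcellvec i measurableT mC; rewrite setTI.
  have us : uniq (iota 0 L ++ [::]) by rewrite cats0 iota_uniq.
  have := @indep_vsum _ _ _ _ _ F X mX (iota 0 L) [::] (fun=> setT) indF hX _ _ us E mE.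
  rewrite big_nil setTI => -> //.
  by rewrite (_ : P setT = 1%E) ?mul1e//; exact: probability_setT.
rewrite (laplace_deq _ _ D) laplace_convs.
have -> : (\prod_(l <- iota 0 L) laplace k th (law P (mX l)) =
  \prod_(l < L) (expR (- \sum_(j < k) (1 - expR (- th j)) * leb l j))%:E)%E.
  rewrite -(big_mkord xpredT (fun l => (expR (- \sum_(j < k) (1 - expR (- th j)) * leb l j))%:E)).
  rewrite /index_iota subn0; apply: eq_bigr => l _.
  by rewrite (laplace_deq _ _ (lawX l)) (cellL mA).
rewrite prodEFin -expR_sum; congr (expR _)%:E.
rewrite sumrN exchange_big/=; congr (- _); apply: eq_bigr => j _.
by rewrite /ell mulr_sumr.
Qed.

Let count_law L m : P [set u | forall j, (j < k)%N -> cnt L j u = m j] =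
  (\prod_(j < k) poisson_p (ell L j) (m j))%:E.
Proof.
apply: joint_poisson => [j n|j|s s01].
- exact: mcnt.
- by apply: sumr_ge0 => l _.
pose th j := - ln (s j).
have s0 j : 0 < s j by case/andP: (s01 j).
have th0 j : 0 <= th j by rewrite oppr_ge0 ln_le0//; case/andP: (s01 j).
have eth j : expR (- th j) = s j by rewrite /th opprK lnK ?posrE.
transitivity (laplace k th (law P (measurable_vsum (iota 0 L) mX))).
  transitivity (\int[image_measure P (measurable_vsum (iota 0 L) mX)]_x (expm k th x)%:E)%E => //.
  rewrite ge0_integral_image//; last 2 first.
  - by apply/measurable_EFinP; exact: measurable_expm.
  - by move=> x _; rewrite lee_fin ltW// expm_gt0.
  apply: eq_integral => u _; congr EFin.
  rewrite /expm -sumrN expR_sum; apply: eq_bigr => j _.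
  by rewrite -cntE -mulNr mulrC expRM_natl eth.
rewrite vsum_laplace// -sumrN expR_sum; congr EFin.
by apply: eq_bigr => j _; rewrite eth.
Qed.

Let cvg_ell j : ell L j @[L --> \oo] --> fine (@lebesgue_measure R (A j)).
Proof.
have mc l : measurable (A j `&` @cell_itv R l) by apply: measurableI => //; exact: measurable_itv.
have leb_fin l : (@lebesgue_measure R (A j `&` @cell_itv R l) \is a fin_num).
  rewrite ge0_fin_numE//; apply: le_lt_trans (Afin j).
  by apply: le_measure; [rewrite inE; exact: mc|rewrite inE; exact: mA|move=> x []].
have e : lebesgue_measure (A j) = (\sum_(l <oo) lebesgue_measure (A j `&` @cell_itv R l))%E.
  rewrite -measure_semi_bigcup//; last 2 first.
  - apply/trivIsetP => a b _ _ ab; apply/seteqP; split => x //= [[_ xa] [_ xb]].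
    move: xa xb; rewrite /cell_itv /= !in_itv/= => /andP[a1 a2] /andP[b1 b2].
    case: (ltngtP a b) ab => // h _.
      by have := lt_le_trans b1 a2; rewrite ltr_nat ltnS leqNgt h.
    by have := lt_le_trans a1 b2; rewrite ltr_nat ltnS leqNgt h.
  - by apply: bigcup_measurable => l _; exact: mc.
  congr lebesgue_measure; apply/seteqP; split => x /=; last by move=> [l _ []].
  move=> Ax; have x0 : 0 < x by have := Apos Ax; rewrite /= in_itv/= andbT.
  have exl : exists l, x <= l.+1%:R by exists (Num.truncn x); exact: ltW (truncnS_gt x).
  case: (ex_minnP exl) => l xl min; exists l => //; split => //.
  rewrite /cell_itv /= in_itv/= xl andbT; case: l xl min => [//|l _ min].
  by rewrite ltNge; apply/negP => /min; rewrite ltnn.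
rewrite (_ : (fun L => _) = (fun L => fine (\sum_(0 <= l < L) lebesgue_measure (A j `&` @cell_itv R l))%E)); last first.
  apply/funext => L; rewrite big_mkord (_ : (\sum_(l < L) _)%R = (ell L j)%:E)//.
  by rewrite /ell -sumEFin; apply: eq_bigr => l _; rewrite /leb fineK.
apply: fine_cvg; rewrite fineK; last by rewrite ge0_fin_numE.
by rewrite e; apply: is_cvg_nneseries.
Qed.

Let cvg_poisson m : \prod_(j < k) poisson_p (ell L j) (m j) @[L --> \oo] -->
  \prod_(j < k) poisson_p (fine (@lebesgue_measure R (A j))) (m j).
Proof.
apply: (@cvg_big R 'I_k *%R 1 xpredT _ nat \oo) => [|j _]; first exact: mul_continuous.
rewrite /poisson_p; apply: cvgMl; apply: cvgM.
  by apply: continuous_cvg; [exact: continuous_expR|apply: cvgN; exact: cvg_ell].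
elim: (m j) => [|p ih]; first by under eq_fun do rewrite expr0; rewrite expr0; exact: cvg_cst.
by under eq_fun do rewrite exprS; rewrite exprS; apply: cvgM => //; exact: cvg_ell.
Qed.

(** The counts over the first [L] cells are independent Poisson variables whose means tend to the
    Lebesgue measures. Almost surely the event for these counts eventually coincides with the event
    for the full counts. *)
Lemma lex_points_law (m : nat -> nat) :
  P [set u | forall j, (j < k)%N -> point_count lex_points (A j) u = ((m j)%:R)%:E] =
  (\prod_(j < k) poisson_p (fine (@lebesgue_measure R (A j))) (m j))%:E.
Proof.
set D := [set u | _].
have mD : measurable D.
  apply: bigcap_measurableType => j _.
  have mpc : measurable_fun setT (point_count lex_points (A j)).
    apply: ge0_emeasurable_sum => [n u _ _|n _]; first by rewrite lee_fin.
    apply/measurable_EFinP.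
    exact: (measurableT_comp (measurable_indic (mA j)) (measurable_lex_points n)).
  by have := mpc measurableT _ (emeasurable_set1 ((m j)%:R)%:E); rewrite setTI.
pose DL L := [set u | forall j, (j < k)%N -> cnt L j u = m j].
have mDL L : measurable (DL L) by apply: bigcap_measurableType => j _; exact: mcnt.
pose B := \bigcup_L0 bad L0.
have mB : measurable B by exact: bigcup_measurable.
have PB : pr P B = 0.
  apply/eqP; rewrite eq_le pr_ge0 andbT -lee_fin -prE//.
  apply: le_trans (generalized_Boole_inequality _ mbad mB) _.
  by rewrite eseries0// => n _ _; exact: bad0.
pose Q L := ((D `\` DL L) `|` (DL L `\` D)) `\` B.
have mQ L : measurable (Q L).
  by apply: measurableD => //; apply: measurableU; apply: measurableD.
have Q0 : pr P (Q L) @[L --> \oo] --> 0.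
  apply: cvg_pr_eventually => // u.
  have [gu|[L0 hb]] := good_or_bad u; last by exists 0%N => L _ [_ nB]; apply: nB; exists L0.
  have hitP j : point_count lex_points (A j) u = ((m j)%:R)%:E <->
      exists L0, forall L, (L0 <= L)%N -> cnt L j u = m j.
    rewrite point_countP; split=> [[n0 h]|[L0 h]].
      have [L0 hL0] := gu n0; exists L0 => L LL; apply: h.
      exact: leq_trans hL0 (le_partial _ LL).
    exists (partial (Nl u) L0) => n hn; have [L1 hL1] := gu n.
    apply/eqP; rewrite eqn_leq; apply/andP; split.
      rewrite -(h (maxn L0 L1) (leq_maxl _ _)); apply: le_hits.
      exact: leq_trans hL1 (le_partial _ (leq_maxr _ _)).
    by rewrite -(h L0 (leqnn _)); exact: le_hits.
  have cnt_mono j L L' : (L <= L')%N -> (cnt L j u <= cnt L' j u)%N.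
    by move=> LL; apply: le_hits; exact: le_partial.
  have [Du|nDu] := pselect (D u).
    have [|L0 h] := @uniform_threshold (fun j L => (j < k)%N -> cnt L j u = m j) k.
      move=> j; have [jk|_] := boolP (j < k)%N; last by exists 0%N.
      by have [L0 h] := (hitP j).1 (Du j jk); exists L0 => L LL _; exact: h.
    by exists L0 => L LL [[[_ nDL]|[_ nD]] _]; [apply: nDL => j jk; exact: h|exact: nD].
  have [j [jk nj]] : exists j, (j < k)%N /\ point_count lex_points (A j) u <> ((m j)%:R)%:E.
    by apply: contrapT => no; apply: nDu => j jk; apply: contrapT => nj; apply: no; exists j.
  suff [L0 h] : exists L0, forall L, (L0 <= L)%N -> cnt L j u <> m j.
    by exists L0 => L LL [[[Du _]|[DLu _]] _]; [exact: nDu|exact: h LL (DLu j jk)].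
  (* A count above [m j] stays above. If no count exceeds [m j], one equal to it would stay there,
     and the full count would be [m j]. *)
  have [[L0 hL0]|no] := pselect (exists L, (m j < cnt L j u)%N).
    by exists L0 => L LL e; have := cnt_mono j _ _ LL; rewrite e leqNgt hL0.
  exists 0%N => L _ e; apply: nj; apply/hitP; exists L => L' LL'.
  apply/eqP; rewrite eqn_leq -{2}e cnt_mono// andbT leqNgt; apply/negP => h.
  by apply: no; exists L'.
have h : pr P (DL L) @[L --> \oo] --> pr P D.
  apply/cvgrPdist_le => e e0; near=> L.
  have qe : pr P (Q L) <= e.
    near: L; have /cvgrPdist_le/(_ e e0) := Q0; apply: filterS => L.
    by rewrite sub0r normrN ger0_norm ?pr_ge0.
  have mQB : measurable (Q L `|` B) by exact: measurableU.
  have qb : pr P (~` ~` (Q L `|` B)) <= e.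
    by rewrite setCK (le_trans (prU_le _ _ _))// PB addr0.
  have h1 : pr P D <= pr P (DL L) + pr P (~` ~` (Q L `|` B)).
    apply: le_pr_near => //; first exact: measurableC.
    move=> u [Du nQ]; apply: contrapT => nDL; apply: nQ.
    by have [Bu|nB] := pselect (B u); [right|left; split => //; left].
  have h2 : pr P (DL L) <= pr P D + pr P (~` ~` (Q L `|` B)).
    apply: le_pr_near => //; first exact: measurableC.
    move=> u [Du nQ]; apply: contrapT => nDL; apply: nQ.
    by have [Bu|nB] := pselect (B u); [right|left; split => //; right].
  move: h1 h2 qb; move: (pr P D) (pr P (DL L)) (pr P _) => x y z h1 h2 h3.
  by rewrite ler_norml; apply/andP; split; lra.
rewrite prE//; congr EFin.
have h' : pr P (DL L) @[L --> \oo] --> \prod_(j < k) poisson_p (fine (@lebesgue_measure R (A j))) (m j).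
  rewrite (_ : (fun L => _) = (fun L => \prod_(j < k) poisson_p (ell L j) (m j))).
    exact: cvg_poisson.
  by apply/funext => L; rewrite /pr count_law.
exact: (cvg_unique _ h h').
Unshelve. all: by end_near.
Qed.

End counts.

Lemma lex_points_pp : unit_poisson_pp (unif R) lex_points.
Proof.
split; first exact: measurable_lex_points.
split; first exact: lex_points_gt0.
move=> k A m hA dA.
pose A' (j : nat) : set R := if insub j is Some i then A i else set0.
pose m' (j : nat) : nat := if insub j is Some i then m i else 0%N.
have A'E (j : 'I_k) : A' j = A j by rewrite /A' valK.
have m'E (j : 'I_k) : m' j = m j by rewrite /m' valK.
have := @lex_points_law k A' _ _ _ _ m'.
have -> : \big[setI/setT]_(j < k) [set w | point_count lex_points (A j) w = ((m j)%:R)%:E] =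
  [set u | forall j, (j < k)%N -> point_count lex_points (A' j) u = ((m' j)%:R)%:E].
  apply/seteqP; split => u /=.
    move=> /big_setIP h j jk; have := h (Ordinal jk) (mem_index_enum _).
    by rewrite /= -A'E -m'E.
  by move=> h; apply/big_setIP => j _ /=; rewrite -A'E -m'E; apply: h.
move=> ->.
- by rewrite -prodEFin; apply: eq_bigr => j _; rewrite A'E m'E.
- by move=> j; rewrite /A'; case: insub => // i; case: (hA i).
- by move=> j; rewrite /A'; case: insub => // i; case: (hA i) => _ [].
- by move=> j; rewrite /A'; case: insub => [i|]; [case: (hA i) => _ []|rewrite measure0 ltry].
- move=> i j ik jk ij; rewrite (A'E (Ordinal ik)) (A'E (Ordinal jk)).
  exact: dA.
Qed.

End poisson_process.

Lemma poisson_process_exists (R : realType) : exists G : nat -> R -> R, unit_poisson_pp (unif R) G.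
Proof.
have [N /choice[pt h]] := choice (fun l => cell_process_exists R l).
have [Z mZ hZ] := indep_sequence (fun=> unif R).
exists (lex_points N pt Z); apply: lex_points_pp => // l; by case: (h l).
Qed.

(** * Comparison with the LePage sum *)

Section harmonic_window.
Variable R : realType.

Definition harm (j : nat) : R := \sum_(j./2.+1 <= c < j.+1) c%:R^-1.

Lemma harm_odd i : harm i.*2.+1 = harm i.*2 + i.*2.+1%:R^-1.
Proof.
by rewrite /harm big_nat_recr/= ?uphalf_double ?doubleK// ltnS -addnn leq_addr.
Qed.

Lemma harm_even i : harm i.*2.+2 = harm i.*2.+1 + i.*2.+2%:R^-1 - i.+1%:R^-1.
Proof.
rewrite /harm big_nat_recr/= ?uphalf_double ?doubleK ?ltnS -?addnn ?leq_addr//.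
rewrite [X in _ = X + _ - _]big_ltn ?ltnS ?leq_addr//.
by rewrite [X in _ = X + _ - _]addrC -!addrA; congr (_ + _); rewrite addrC addrNK.
Qed.

Lemma harm_ge0 j : 0 <= harm j.
Proof. by apply: sumr_ge0 => c _; rewrite invr_ge0. Qed.

Lemma harm_double_le1 i : harm i.*2 <= 1.
Proof.
case: i => [|i]; first by rewrite /harm big_geq.
apply: (@le_trans _ _ (\sum_(i.+2 <= c < i.+1.*2.+1) i.+1%:R^-1)).
  rewrite /harm doubleK; apply: ler_sum_nat => c /andP[ci _].
  by rewrite lef_pV2 ?posrE ?ltr0n ?ler_nat//; [exact: ltnW|exact: leq_trans ci].
rewrite sumr_const_nat (_ : (_ - _)%N = i.+1); last by rewrite -addnn subSS addnK.
by rewrite -[X in X <= _]mulr_natr mulVf.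
Qed.

Lemma harm_le2 j : harm j <= 2.
Proof.
have [oj|ej] := boolP (odd j); last first.
  by rewrite -(even_halfK ej) (le_trans (harm_double_le1 _))// ler1n.
have -> : j = j./2.*2.+1 by rewrite -[LHS]odd_double_half oj.
rewrite harm_odd (_ : 2 = 1 + 1)// lerD ?harm_double_le1//.
by rewrite invf_le1 ?ler1n.
Qed.

(** Along even indices the sums increase, since 1/(2i+1) + 1/(2i+2) >= 1/(i+1), and stay below 1; an
    odd index j adds only 1/j. The limit is kept as an abstract positive [l]. *)
Lemma harm_cvg : exists2 l : R, 0 < l &
  forall e, 0 < e -> exists J, forall j, (J <= j)%N -> `|harm j - l| <= e.
Proof.
pose u i := harm i.*2.
have ndu : nondecreasing_seq u.
  apply/nondecreasing_seqP => i; rewrite /u doubleS harm_even harm_odd.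
  have hz : i.+1%:R^-1 = i.*2.+2%:R^-1 + i.*2.+2%:R^-1 :> R.
    have e2 : i.*2.+2%:R = 2 * i.+1%:R :> R by rewrite -doubleS -mul2n natrM.
    have z0 : i.+1%:R != 0 :> R by rewrite pnatr_eq0.
    by move: e2 z0; move: (i.+1%:R) (i.*2.+2%:R) => x y -> x0; field.
  have hxy : i.*2.+2%:R^-1 <= i.*2.+1%:R^-1 :> R by rewrite lef_pV2 ?posrE ?ltr0n// ler_nat.
  by move: hz hxy; move: (i.+1%:R^-1) (i.*2.+1%:R^-1) (i.*2.+2%:R^-1) => x y z; lra.
have cu : cvgn u.
  apply: nondecreasing_is_cvgn => //; exists 1 => _ [i _ <-]; exact: harm_double_le1.
exists (limn u).
  apply: (@lt_le_trans _ _ (u 1%N)); last exact: nondecreasing_cvgn_le.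
  by rewrite /u /harm big_nat1 invr_gt0.
move=> e e0.
have e2 : 0 < e / 2 by rewrite divr_gt0.
have [n0 _ hn] := (cvgrPdist_le _ _).1 cu (e / 2) e2.
have [n1 hn1] : exists n1, 2 / e <= n1.+1%:R by exists (Num.truncn (2 / e)); exact: ltW (truncnS_gt _).
exists (maxn n0.*2.+1 n1.+1) => j; rewrite geq_max => /andP[j0 j1].
have hj : (n0 <= j./2)%N by rewrite -[n0]doubleK half_leq// ltnW.
have := hn _ hj; rewrite /= distrC => h.
have jd : harm j - u j./2 = (odd j)%:R / j%:R.
  have [oj|ej] := boolP (odd j); last by rewrite /u even_halfK// subrr mul0r.
  have ej : j = j./2.*2.+1 by rewrite -[LHS]odd_double_half oj.
  by rewrite {1}ej harm_odd -ej /u addrAC subrr add0r mul1r.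
have jle : `|harm j - u j./2| <= e / 2.
  rewrite jd ger0_norm//; apply: (@le_trans _ _ (j%:R^-1)).
    by case: odd; rewrite ?mul1r// mul0r.
  rewrite -[e / 2]invrK lef_pV2 ?posrE ?invr_gt0 ?ltr0n//; last exact: leq_trans j1.
  by rewrite invf_div (le_trans hn1)// ler_nat.
rewrite (_ : _ - _ = (harm j - u j./2) + (u j./2 - limn u)); last by ring.
apply: le_trans (ler_normD _ _) _; move: jle h; move: `|_| `|_| => x y; lra.
Qed.

End harmonic_window.

Section intensity_theory.
Context d (T : measurableType d) (R : realType) (P : probability T R).
Notation V := (iseq R).
Variables (X : R -> T -> R).
Hypotheses (pX : is_process X) (jX : pure_jump_process X) (tsX : time_stable P X).

Let sX : random_step_fun X. Proof. by move=> w; case: (jX w). Qed.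

Let inv0 n : 0 < n.+1%:R^-1 :> R. Proof. by rewrite invr_gt0. Qed.

Lemma zero_before_le (s t : R) : s <= t -> zero_before X t `<=` zero_before X s.
Proof. by move=> st w h u /andP[u0 us]; apply: h; rewrite u0 (lt_le_trans us). Qed.

Lemma jump_rate_ge0 tt E x y n : 0 <= jump_rate P X tt E x y n.
Proof. by rewrite /jump_rate mulr_ge0// pr_ge0. Qed.

Lemma intensity_ge0 tt M E x y : bounded_times tt M -> 0 < M -> measurable E -> x <= y <= M ->
  0 <= intensity P X tt E x y.
Proof.
move=> bM M0 mE xy; rewrite -oppr_le0; apply: (@le0_div_nat _ _ (intensity_const pX jX tsX * M ^+ 2)) => n.
have := intensity_err pX jX tsX n bM M0 mE xy; have := jump_rate_ge0 tt E x y n.+1.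
by rewrite ler_norml => + /andP[]; move: (_ / _) (intensity _ _ _ _ _ _) (jump_rate _ _ _ _ _ _ _) => a b c; lra.
Qed.

Lemma intensityD tt M E x y z : bounded_times tt M -> 0 < M -> measurable E ->
  x <= y -> y <= z -> z <= M ->
  intensity P X tt E x z = intensity P X tt E x y + intensity P X tt E y z.
Proof.
move=> bM M0 mE xy yz zM.
apply: (@eq_div_nat _ _ _ (3 * (intensity_const pX jX tsX * M ^+ 2))) => n.
have xz : x <= z <= M by rewrite (le_trans xy).
have xy' : x <= y <= M by rewrite xy (le_trans yz).
have yz' : y <= z <= M by rewrite yz.
have := intensity_err pX jX tsX n bM M0 mE xz.
have := intensity_err pX jX tsX n bM M0 mE xy'.
have := intensity_err pX jX tsX n bM M0 mE yz'.
have -> : jump_rate P X tt E x z n.+1 = jump_rate P X tt E x y n.+1 + jump_rate P X tt E y z n.+1.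
  rewrite /jump_rate -mulrDr; congr (_ * _).
  have i0 := inv0 n; move: (n.+1%:R^-1) i0 => c c0.
  have mj a b : measurable (jump_event X c tt E a b).
    by apply: measurable_jump_event => //; [exact: ltW|exact: bounded_nonneg bM].
  have cxy : c * x <= c * y by rewrite ler_pM2l.
  have cyz : c * y <= c * z by rewrite ler_pM2l.
  rewrite -prU//.
    congr (pr P _); apply/seteqP; split => w /=.
      move=> [Ew [zx nz]]; have [zy|zy] := pselect (zero_before X (c * y) w); [right|left] => //.
    move=> [[Ew [zx ny]]|[Ew [zy nz]]]; split => //; split => //.
    - by move=> zz; apply: ny; exact: zero_before_le cyz _ zz.
    - exact: zero_before_le cxy _ zy.
  by apply/seteqP; split => w //= [[_ [_ ny]] [_ [zy _]]].
rewrite -[3 * _ / _]mulrA; move: (_ * M ^+ 2 / _) => B.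
move: (intensity _ _ _ _ _ _) (intensity _ _ _ _ _ _) (intensity _ _ _ _ _ _) => i1 i2 i3.
move: (jump_rate _ _ _ _ _ _ _) (jump_rate _ _ _ _ _ _ _) => j1 j2.
by rewrite !ler_norml => /andP[a1 a2] /andP[b1 b2] /andP[c1 c2]; apply/andP; split; lra.
Qed.

(** When the first jump comes after all observation times, the observed vector is 0, outside [E]. *)
Lemma intensity_far tt M E x y : bounded_times tt M -> ~ E (v0 R) -> M <= x ->
  intensity P X tt E x y = 0.
Proof.
move=> bM E0 Mx; apply: intensity_eq0 => c c0; apply/seteqP; split => w //= [Ew [zx _]].
apply: E0; rewrite (_ : v0 R = obs X (scale_times c tt) w)//.
apply/funext => k; rewrite /v0 /obs /scale_times; case e : (tt k) => [t|]//=.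
have /andP[t0 tM] := bM _ _ e; rewrite zx// mulr_ge0 ?(ltW c0)//= ltr_pM2l//.
exact: lt_le_trans Mx.
Qed.

Lemma intensity_le K tt M E x y : (forall s, 0 < s -> early P X s <= K * s) ->
  bounded_times tt M -> 0 < M -> measurable E -> 0 < y -> x <= y <= M ->
  intensity P X tt E x y <= K * y.
Proof.
move=> hK bM M0 mE y0 xy; rewrite -subr_le0.
apply: (@le0_div_nat _ _ (intensity_const pX jX tsX * M ^+ 2)) => n.
have := intensity_err pX jX tsX n bM M0 mE xy.
have : jump_rate P X tt E x y n.+1 <= K * y.
  have n0 : (0 : R) < n.+1%:R by rewrite ltr0n.
  rewrite /jump_rate mulrC -ler_pdivlMr//.
  apply: (@le_trans _ _ (early P X (n.+1%:R^-1 * y))).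
    apply: le_pr.
    - by apply: measurable_jump_event => //; exact: bounded_nonneg bM.
    - by apply: measurableC; exact: measurable_zero_before.
    - by move=> w [_ []].
  by apply: le_trans (hK _ _) _; [rewrite mulr_gt0|rewrite [_^-1 * y]mulrC mulrA].
move: (_ / _) (intensity _ _ _ _ _ _) (jump_rate _ _ _ _ _ _ _) => a b c.
by rewrite ler_norml => h /andP[h1 h2]; lra.
Qed.

Variables (l : R) (l0 : 0 < l).
Hypothesis hl : forall e, 0 < e -> exists J, forall j, (J <= j)%N -> `|harm R j - l| <= e.

(* Each slice [j d, (j+1) d[ of the first jump time lies in the windows [c d, 2c d[ with
   j/2 < c <= j, so the weighted windows give it total weight harm j / l, close to 1. *)
Lemma intensity_riemann tt (M : nat) E : bounded_times tt M.+1%:R -> measurable E -> ~ E (v0 R) ->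
  forall e : R, 0 < e -> exists n0, forall n, (n0 <= n)%N ->
  forall h : R, h = M.+1%:R / n.+1%:R ->
  `|\sum_(1 <= c < n.+1) (l^-1 / c%:R) * intensity P X tt E (c%:R * h) (c%:R * h *+ 2)
     - intensity P X tt E 0 M.+1%:R| <= e.
Proof.
move=> bM mE E0 e e0; have [K K0 hK] := early_linear pX jX tsX.
have M0 : (0 : R) < M.+1%:R by rewrite ltr0n.
(* A crude bound for the deviation of [harm j / l] from 1, used for the finitely many indices below
   [J]; from [J] on the deviation is at most [eta]. *)
pose B := l^-1 * 2 + 1; have B0 : 0 < B by rewrite addr_gt0// mulr_gt0// invr_gt0.
pose eta := e / (2 * (K * M.+1%:R)).
have KM0 : 0 < K * M.+1%:R by rewrite mulr_gt0.
have eta0 : 0 < eta by rewrite divr_gt0// mulr_gt0.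
have [J hJ] := hl (mulr_gt0 l0 eta0).
have [n0 hn0] : exists n0, B * K * J.+1%:R * M.+1%:R * 2 / e <= n0.+1%:R.
  by exists (Num.truncn (B * K * J.+1%:R * M.+1%:R * 2 / e)); exact: ltW (truncnS_gt _).
exists (maxn n0 J) => n; rewrite geq_max => /andP[n0n Jn] h hE.
have N0 : (0 : R) < n.+1%:R by rewrite ltr0n.
have h0 : 0 < h by rewrite hE divr_gt0.
have hN : n.+1%:R * h = M.+1%:R by rewrite hE mulrC divfK// gt_eqF.
pose lam j := intensity P X tt E (j%:R * h) (j.+1%:R * h).
(* The windows extend to twice their left end, so intensities are needed up to twice the time
   bound. *)
pose M2 : R := 2 * M.+1%:R.
have M20 : 0 < M2 by rewrite mulr_gt0.
have bM2 : bounded_times tt M2.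
  move=> k t /bM /andP[t0 tM]; rewrite t0 (lt_trans tM)// /M2 ltr_pMl// ltr1n//.
have le_grid (i j : nat) : (i <= j)%N -> i%:R * h <= j%:R * h by move=> ij; rewrite ler_pM2r// ler_nat.
have grid_M2 j : (j <= n.+1.*2)%N -> j%:R * h <= M2.
  by move=> /le_grid/le_trans; apply; rewrite -addnn natrD mulrDl hN /M2; lra.
have split_int i j : (i <= j)%N -> (j <= n.+1.*2)%N ->
    intensity P X tt E (i%:R * h) (j%:R * h) = \sum_(i <= k < j) lam k.
  move=> /subnKC <-; elim: (j - i)%N => [|k ih] hk.
    rewrite addn0 big_geq//; have := intensityD bM2 M20 mE (lexx (i%:R * h)) (lexx (i%:R * h)) (grid_M2 _ _).
    rewrite addn0 in hk; move=> /(_ hk); move: (intensity _ _ _ _ _ _) => z; lra.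
  rewrite addnS in hk *; rewrite big_nat_recr ?leq_addr//= -ih; last exact: ltnW.
  apply: (intensityD bM2) => //; [exact/le_grid/leq_addr|exact: le_grid|exact: grid_M2].
have lam0 j : (j < n.+1)%N -> 0 <= lam j.
  move=> jn; apply: (intensity_ge0 bM2) => //; rewrite le_grid//= grid_M2//.
  by rewrite (leq_trans jn)// -addnn leq_addr.
have lam_far j : (n.+1 <= j)%N -> lam j = 0.
  by move=> nj; apply: (intensity_far _ bM E0); rewrite -hN le_grid.
have total : intensity P X tt E 0 M.+1%:R = \sum_(0 <= j < n.+1) lam j.
  by rewrite -split_int -?addnn ?leq_addr// mul0r hN.
have window c : (1 <= c < n.+1)%N -> intensity P X tt E (c%:R * h) (c%:R * h *+ 2) =
    \sum_(0 <= j < n.+1 | (c <= j < c.*2)%N) lam j.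
  move=> /andP[c1 cn]; have -> : c%:R * h *+ 2 = c.*2%:R * h by rewrite -muln2 natrM mulrAC mulr_natr.
  have cc : (c <= c.*2)%N by rewrite -addnn leq_addr.
  rewrite split_int//; last by rewrite leq_double ltnW.
  rewrite [LHS](_ : _ = \sum_(0 <= j < n.+1.*2 | (c <= j < c.*2)%N) lam j); last first.
    rewrite (big_nat_widenl _ 0)// (big_nat_widen _ _ n.+1.*2) ?leq_double 1?ltnW//.
  rewrite (@big_cat_nat _ _ _ n.+1 0%N n.+1.*2)//=; last by rewrite -addnn leq_addr.
  rewrite [X in _ + X]big_nat_cond [X in _ + X]big1 ?addr0// => j /andP[/andP[nj _] _].
  exact: lam_far.
have weight j : (j < n.+1)%N ->
    \sum_(1 <= c < n.+1 | (c <= j < c.*2)%N) l^-1 / c%:R = l^-1 * harm R j.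
  move=> jn; rewrite -mulr_sumr; congr (_ * _); rewrite /harm.
  rewrite [RHS](big_nat_widenl _ 1)// [RHS](big_nat_widen _ _ n.+1)//.
  by apply: eq_bigl => c; rewrite /= ltnS ltn_half_double; case: (c <= j)%N; case: (j < c.*2)%N.
rewrite [X in `|X - _|](_ : _ = \sum_(0 <= j < n.+1) (l^-1 * harm R j) * lam j); last first.
  transitivity (\sum_(1 <= c < n.+1) \sum_(0 <= j < n.+1 | (c <= j < c.*2)%N) l^-1 / c%:R * lam j).
    by apply: eq_big_nat => c cn; rewrite window// mulr_sumr.
  rewrite (exchange_big_dep_nat xpredT)//=; apply: eq_big_nat => j /andP[_ jn].
  by rewrite -weight// mulr_suml.
rewrite total -sumrB.
apply: le_trans (ler_norm_sum _ _ _) _.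
have harmB j : `|l^-1 * harm R j - 1| <= B.
  apply: le_trans (ler_normB _ _) _; rewrite normr1 lerD2r ger0_norm; last first.
    by rewrite mulr_ge0 ?harm_ge0// invr_ge0 ltW.
  by rewrite ler_pM2l ?invr_gt0// harm_le2.
have harmE j : (J <= j)%N -> `|l^-1 * harm R j - 1| <= eta.
  move=> Jj; rewrite (_ : _ - 1 = l^-1 * (harm R j - l)); last by rewrite mulrBr mulVf ?gt_eqF.
  rewrite normrM ger0_norm ?invr_ge0 ?(ltW l0)// mulrC ler_pdivrMr// mulrC.
  exact: hJ.
(* The first [J] slices have total intensity of order [J * h] by the linear bound, small for a fine
   grid; the others have weights close to 1. *)
rewrite (@big_cat_nat _ _ _ J 0%N n.+1)//=; last exact: leqW.
apply: (@le_trans _ _ (B * \sum_(0 <= j < J) lam j + eta * \sum_(J <= j < n.+1) lam j)).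
  rewrite !mulr_sumr; apply: lerD; apply: ler_sum_nat => j /andP[j1 j2].
  - rewrite -[X in _ - X]mul1r -mulrBl normrM [`|lam _|]ger0_norm ?lam0//.
      by rewrite ler_wpM2r// lam0// (leq_trans j2)// leqW.
    by rewrite (leq_trans j2)// leqW.
  - rewrite -[X in _ - X]mul1r -mulrBl normrM [`|lam _|]ger0_norm ?lam0//.
    by rewrite ler_wpM2r// ?lam0// harmE.
have t1 : \sum_(0 <= j < J) lam j <= K * (J.+1%:R * h).
  apply: (@le_trans _ _ (\sum_(0 <= j < J.+1) lam j)).
    by rewrite big_nat_recr//= lerDl lam0.
  rewrite -split_int//; last by rewrite -addnn (leq_trans _ (leq_addr _ _)).
  rewrite mul0r; apply: (intensity_le hK bM2) => //; first by rewrite mulr_gt0// ltr0n.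
  by rewrite mulr_ge0 ?(ltW h0)//= grid_M2// -addnn (leq_trans _ (leq_addr _ _)).
have t2 : \sum_(J <= j < n.+1) lam j <= K * M.+1%:R.
  apply: (@le_trans _ _ (\sum_(0 <= j < n.+1) lam j)).
    rewrite [leRHS](@big_cat_nat _ _ _ J 0%N n.+1)//=; last exact: leqW.
    by rewrite lerDr big_nat_cond sumr_ge0// => j /andP[/andP[_ jJ] _]; rewrite lam0// (leq_trans jJ)// leqW.
  rewrite -total; apply: (intensity_le hK bM2) => //.
  by rewrite ltW//= /M2 ler_pMl// ler1n.
have t3 : B * (K * (J.+1%:R * h)) <= e / 2.
  rewrite hE (_ : B * _ = B * K * J.+1%:R * M.+1%:R / n.+1%:R); last by rewrite !mulrA.
  rewrite ler_pdivrMr//; have : B * K * J.+1%:R * M.+1%:R * 2 / e <= n.+1%:R.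
    by rewrite (le_trans hn0)// ler_nat ltnS.
  by rewrite ler_pdivrMr//; move: (B * K * _ * _) (n.+1%:R) => x y; lra.
have t4 : eta * (K * M.+1%:R) = e / 2.
  by rewrite /eta; field; rewrite !gt_eqF.
have u1 : B * \sum_(0 <= j < J) lam j <= e / 2 by rewrite (le_trans _ t3)// ler_pM2l.
have u2 : eta * \sum_(J <= j < n.+1) lam j <= e / 2 by rewrite -t4 ler_pM2l.
by move: u1 u2; move: (B * _) (eta * _) => x y; lra.
Qed.

End intensity_theory.

(** Stated without measurability of [f] and [g], so that it applies to the inner integrals of an
    arbitrary [X] in [integrable_mark]; it compares suprema over simple functions. *)
Lemma ge0_integral_mono d (T : measurableType d) (R : realType) (mu : {measure set T -> \bar R})
  (D : set T) (f g : T -> \bar R) : (forall x, D x -> (0 <= f x)%E) ->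
  (forall x, D x -> (f x <= g x)%E) -> (\int[mu]_(x in D) f x <= \int[mu]_(x in D) g x)%E.
Proof.
move=> f0 fg; rewrite integral_mkcond [leRHS]integral_mkcond.
have f0' x : (0 <= (f \_ D) x)%E by rewrite /patch; case: ifP => // /set_mem; exact: f0.
have fg' x : ((f \_ D) x <= (g \_ D) x)%E by rewrite /patch; case: ifP => // /set_mem; exact: fg.
have g0' x : (0 <= (g \_ D) x)%E by apply: le_trans (f0' x) (fg' x).
rewrite !ge0_integralTE//; apply: ub_ereal_sup => _ [h hf <-]; apply: ereal_sup_ubound.
by exists h => // x; apply: le_trans (hf x) (fg' x).
Qed.

Section integrable_mark.
Context d (T : measurableType d) (R : realType) (P : probability T R).
Variables (a : R) (a0 : 0 < a).

(** The inversion x = 1/s turns the integral into the length of the interval from 0 to 1/a. *)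
Lemma integral_inv_square :
  (\int[@lebesgue_measure R]_(t in `]0%R, +oo[%classic) ((a <= t)%R%:R / t ^+ 2)%:E < +oo)%E.
Proof.
pose f (s : R) : \bar R := ((a <= s)%R%:R)%:E.
have mf : measurable_fun setT f.
  apply/measurable_EFinP; rewrite (_ : (fun s => _) = \1_`[a, +oo[%classic).
    by apply: measurable_indic; exact: measurable_itv.
  apply/funext => s; rewrite indicE; congr (_%:R).
  by rewrite mem_setE in_itv/= andbT.
have f0 x : (0 <= f x)%E by rewrite lee_fin.
have inv := integral_inversion ltr01 mf f0.
have -> : (\int[@lebesgue_measure R]_(t in `]0%R, +oo[%classic) ((a <= t)%R%:R / t ^+ 2)%:E =
    \int[@lebesgue_measure R]_(s in `]0%R, +oo[%classic) (f s * (1 / s ^+ 2)%R%:E))%E.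
  by apply: eq_integral => s _; rewrite /f -EFinM div1r.
rewrite -inv.
apply: (@le_lt_trans _ _ (\int[@lebesgue_measure R]_(x in `]0%R, +oo[%classic) (\1_(`]0, a^-1]%classic) x)%:E)%E).
  apply: ge0_integral_mono => x; rewrite /= in_itv/= andbT => x0; first exact: f0.
  rewrite /f mulr1 lee_fin indicE mem_setE in_itv/= x0/=.
  by rewrite -[a in leLHS]invrK lef_pV2 ?posrE ?invr_gt0.
rewrite integral_indic ?setIidl//; try exact: measurable_itv; last first.
  by move=> x /=; rewrite !in_itv/= => /andP[->].
change (@lebesgue_measure R `]0%R, (a^-1)%R]%classic < +oo)%E.
by rewrite lebesgue_measure_itv/= lte_fin invr_gt0 a0 -EFinB ltry.
Qed.

Lemma integrable_mark (X : R -> T -> R) : (forall t w, 0 <= t < a -> X t w = 0) ->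
  (\int[P]_w (\int[@lebesgue_measure R]_(t in `]0%R, +oo[%classic)
     ((Num.min 1 `|X t w|) / t ^+ 2)%:E) < +oo)%E.
Proof.
move=> X0.
pose J := (\int[@lebesgue_measure R]_(t in `]0%R, +oo[%classic) ((a <= t)%R%:R / t ^+ 2)%:E)%E.
apply: (@le_lt_trans _ _ (\int[P]_w J)%E); last first.
  by rewrite integral_cst//= probability_setT mule1; exact: integral_inv_square.
apply: ge0_integral_mono => w _.
  by apply: integral_ge0 => t _; rewrite lee_fin divr_ge0 ?sqr_ge0// le_min ler01 normr_ge0.
apply: ge0_integral_mono => t /=; rewrite in_itv/= andbT => t0.
  by rewrite lee_fin divr_ge0 ?sqr_ge0// le_min ler01 normr_ge0.
rewrite lee_fin ler_wpM2r ?invr_ge0 ?sqr_ge0//; case: (lerP a t) => [_|ta].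
  by rewrite ge_min lexx.
have -> : X t w = 0 by apply: X0; rewrite (ltW t0).
by rewrite normr0 ge_min lexx orbT.
Qed.

End integrable_mark.

Lemma sigma_seq_comp d1 d2 (T1 : measurableType d1) (T2 : measurableType d2) (R : realType)
  (G : nat -> T1 -> R) (f : T2 -> T1) A : (forall i, measurable_fun setT (G i)) ->
  sigma_seq (fun i s => G i (f s)) A -> exists2 C, measurable C & A = f @^-1` C.
Proof.
move=> mG.
suff : sigma_seq (fun i s => G i (f s)) `<=` preimage_set_system setT f measurable.
  by move=> h /h[C mC <-]; exists C => //; rewrite setTI.
apply: smallest_sub.
  by apply: sigma_algebra_preimage; exact: sigma_algebra_measurable.
move=> _ [i _ [B mB <-]]; exists (G i @^-1` B); last by rewrite !setTI.
by have := mG i measurableT B mB; rewrite setTI.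
Qed.

Section iid_model.
Variable R : realType.

Lemma unit_poisson_pp_comp (f : R -> R) (G : nat -> R -> R) : measurable_fun setT f ->
  (forall A, measurable A -> unif R (f @^-1` A) = unif R A) ->
  unit_poisson_pp (unif R) G -> unit_poisson_pp (unif R) (fun i u => G i (f u)).
Proof.
move=> mf hf HG; have [mG [G0 hG]] := HG; split.
  by move=> i; exact: (measurableT_comp (mG i) mf).
split=> [i u|k A m hA dA]; first exact: G0.
rewrite -hG// -[RHS]hf.
  congr (unif R _); apply/seteqP; split => u /= /big_setIP h; apply/big_setIP => j jj; exact: h j jj.
apply: bigsetI_measurable => j _; have [mA _] := hA j.
have := measurable_point_count HG mA measurableT (emeasurable_set1 ((m j)%:R)%:E).
by rewrite setTI.
Qed.

Lemma iid_marks_exist (eps : R -> R -> R) : is_process eps -> random_step_fun eps ->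
  exists (G : nat -> R -> R) (E : nat -> R -> R -> R),
  [/\ unit_poisson_pp (unif R) G,
      forall i, is_process (E i) /\ random_step_fun (E i) /\ fdd_eq (unif R) (unif R) (E i) (E 0%N),
      mutually_independent (unif R) (mark_sigma G E),
      fdd_eq (unif R) (unif R) (E 0%N) eps &
      forall i t u, exists v, E i t u = eps t v].
Proof.
move=> pe se; have [G HG] := poisson_process_exists R; have [mG [G0 _]] := HG.
have [Y mY hY] := indep_sequence (fun=> unif R).
have margY := indep_sequence_marginal (mu := fun=> unif R) hY.
have mYi i : measurable_fun setT (fun u => Y u i).
  exact: (measurableT_comp (measurable_coord i) mY).
(* Coordinate 0 of an independent uniform sequence drives the Poisson points and coordinate i + 1
   the i-th mark. *)
exists (fun i u => G i (Y u 0%N)), (fun i t u => eps t (Y u i.+1)).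
have pE i : is_process (fun t u => eps t (Y u i.+1)).
  by move=> t t0; exact: (measurableT_comp (pe t t0) (mYi i.+1)).
have fE i : fdd_eq (unif R) (unif R) (fun t u => eps t (Y u i.+1)) eps.
  move=> n ts ts0 B mB.
  apply: (margY i.+1 [set v | B (map_tuple (fun s => eps s v) ts)]).
  have mX : measurable_fun setT (fun v => map_tuple (fun s => eps s v) ts).
    apply/measurable_fun_tnthP => j; rewrite (_ : _ \o _ = eps (tnth ts j)).
      by apply: pe; move/allP: ts0; apply; exact: mem_tnth.
    by apply/funext => v; rewrite /= tnth_map.
  by have := mX measurableT B mB; rewrite setTI.
split.
- apply: unit_poisson_pp_comp => // A mA; exact: (margY 0%N A mA).
- move=> i; split => //; split; first by move=> u; exact: se.
  by move=> n ts ts0 B mB; rewrite (fE i)// (fE 0%N).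
- apply: (indep_of_rect (Y := fun i u => Y u i) (idx := fun o => if o is Some i then i.+1 else 0%N)) => //.
  + by move=> n A mA; rewrite hY//; apply: eq_bigr => i _; rewrite -(margY i _ (mA i)).
  + by move=> [i|] [j|]//= [->].
  + by move=> [i|] A /=; [exact: (@sigma_proc_comp _ _ _ _ _ eps)|exact: (@sigma_seq_comp _ _ _ _ _ G)].
- exact: fE.
- by move=> i t u; exists (Y u i.+1).
Qed.

End iid_model.

(** * LePage sums whose marks vanish near time 0 *)

Section finite_lepage.
Context d (T : measurableType d) (R : realType) (P : probability T R).
Variables (G : nat -> T -> R) (E : nat -> R -> T -> R) (a : R).
Hypothesis HG : unit_poisson_pp P G.
Hypothesis a0 : 0 < a.
Hypothesis E0 : forall i t w, 0 <= t < a -> E i t w = 0.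

Let mG i : measurable_fun setT (G i). Proof. by case: HG. Qed.
Let G0 i w : 0 < G i w. Proof. by case: HG => _ []. Qed.

(** Infinitely many points in some bounded interval. Off this null event the sum is finite and
    locally uniformly so in time, because a mark needs [t / G i w >= a] to contribute. *)
Definition crowded : set T := \bigcup_L \bigcap_I tail_points G (below (L%:R : R)) I.

Let mtail L I : measurable (tail_points G (below (L%:R : R)) I).
Proof. by apply: (measurable_tail_points HG); exact: measurable_itv. Qed.

Lemma measurable_crowded : measurable crowded.
Proof. by apply: bigcup_measurable => L _; apply: bigcap_measurableType => I _. Qed.

Lemma crowded0 : P crowded = 0%E.
Proof.
apply/eqP; rewrite eq_le measure_ge0 andbT.
have mI L : measurable (\bigcap_I tail_points G (below (L%:R : R)) I).
  by apply: bigcap_measurableType => I _.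
suff h L : P (\bigcap_I tail_points G (below (L%:R : R)) I) = 0%E.
  apply: le_trans (generalized_Boole_inequality _ mI measurable_crowded) _.
  by rewrite eseries0// => L _ _; exact: h.
rewrite (prE P (mI L)); congr EFin; apply/eqP; rewrite eq_le pr_ge0 andbT.
apply/ler_addgt0Pl => e e0; rewrite addr0.
have fin : (@lebesgue_measure R (below (L%:R : R)) < +oo)%E.
  by rewrite lebesgue_measure_itv/=; case: ifP => _; rewrite ?ltry// -EFinB ltry.
have sub : below (L%:R : R) `<=` `]0, +oo[%classic.
  by move=> x; rewrite /below /= !in_itv/= andbT => /andP[].
have /cvgrPdist_le/(_ e e0)[I _ /(_ I (leqnn I))] := cvg_tail_points HG (measurable_itv _) sub fin.
rewrite sub0r normrN ger0_norm ?pr_ge0//; apply: le_trans.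
by apply: le_pr; [exact: mI|exact: mtail|move=> w; apply].
Qed.

Lemma far_points w : ~ crowded w -> forall L : nat, exists I, forall i, (I <= i)%N -> L%:R <= G i w.
Proof.
move=> nc L; apply: contrapT => h; apply: nc; exists L => // I _.
apply: contrapT => nt; apply: h; exists I => i Ii; rewrite leNgt; apply/negP => GL.
by apply: nt; exists i => //=; rewrite /below /= in_itv/= G0.
Qed.

Lemma far_term L i s w : L <= G i w -> 0 <= s -> s < a * L -> E i (s / G i w) w = 0.
Proof.
move=> LG s0 sL; apply: E0; rewrite divr_ge0 ?(ltW (G0 i w))//= ltr_pdivrMr//.
by apply: lt_le_trans sL _; rewrite ler_pM2l.
Qed.

Lemma cvg_lepage_finite L I s w : (forall i, (I <= i)%N -> L <= G i w) -> 0 <= s -> s < a * L ->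
  lepage_partial G E s w n @[n --> \oo] --> \sum_(i < I) E i (s / G i w) w.
Proof.
move=> LG s0 sL; apply: cvg_near_cst; exists I => // n /= In.
rewrite /lepage_partial -!(big_mkord xpredT (fun i => E i (s / G i w) w)).
rewrite (@big_cat_nat _ _ _ I 0%N n)//= [X in _ + X]big_nat_cond [X in _ + X]big1 ?addr0//.
by move=> i /andP[/andP[Ii _] _]; apply: (@far_term L) => //; exact: LG.
Qed.

Lemma lepage_finite L I s w : (forall i, (I <= i)%N -> L <= G i w) -> 0 <= s -> s < a * L ->
  lepage_sum G E s w = \sum_(i < I) E i (s / G i w) w.
Proof. by move=> LG s0 sL; apply: cvg_lim => //; exact: cvg_lepage_finite sL. Qed.

Lemma exists_bound (s : R) : exists L : nat, s < a * L%:R.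
Proof.
exists (Num.truncn (s / a)).+1.
by rewrite mulrC -ltr_pdivrMr// truncnS_gt.
Qed.

Lemma lepage_cvg t : 0 <= t -> {ae P, forall w, cvgn (lepage_partial G E t w)}.
Proof.
move=> t0; exists crowded; split; [exact: measurable_crowded|exact: crowded0|].
move=> w /= nc; apply: contrapT => /far_points h; apply: nc.
have [L tL] := exists_bound t; have [I hI] := h L.
by apply/cvg_ex; exists (\sum_(i < I) E i (t / G i w) w); exact: cvg_lepage_finite tL.
Qed.

Hypothesis sE : forall i, random_step_fun (E i).

Lemma lepage_right w t : ~ crowded w -> 0 <= t ->
  exists2 e, 0 < e & forall x, t <= x < t + e -> lepage_sum G E x w = lepage_sum G E t w.
Proof.
move=> nc t0; have [L tL] := exists_bound (t + 1); have [I hI] := far_points nc L.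
have sum_right J : exists2 e, 0 < e & forall x, t <= x < t + e ->
    \sum_(i < J) E i (x / G i w) w = \sum_(i < J) E i (t / G i w) w.
  elim: J => [|J [e e0 he]]; first by exists 1 => // x _; rewrite !big_ord0.
  have tG : 0 <= t / G J w by rewrite divr_ge0// ltW.
  have [e' e'0 he'] := step_fun_right (sE J w) tG.
  exists (Num.min e (e' * G J w)); first by rewrite lt_min e0 mulr_gt0.
  move=> x /andP[tx]; rewrite -ltrBlDl lt_min => /andP[xe xe'].
  rewrite !big_ord_recr/= he ?tx//= -?ltrBlDl//; congr (_ + _); apply: he'.
  by rewrite ler_pM2r ?invr_gt0//= ?tx -ltrBlDl -mulrBl ltr_pdivrMr.
have [e e0 he] := sum_right I.
exists (Num.min e 1); first by rewrite lt_min e0 ltr01.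
move=> x /andP[tx]; rewrite -ltrBlDl lt_min => /andP[xe x1].
rewrite (lepage_finite hI) ?(le_trans t0)//; last first.
  by apply: lt_trans tL; rewrite -ltrBlDl.
rewrite (lepage_finite hI)//; last by apply: le_lt_trans tL; rewrite lerDl.
by apply: he; rewrite tx -ltrBlDl.
Qed.

End finite_lepage.

(** * First-order comparison of the process with the LePage sum *)

Section comparison.
Context d (T : measurableType d) (R : realType) (P : probability T R).
Context d' (U : measurableType d') (Q : probability U R).
Notation V := (iseq R).
Variables (X : R -> T -> R) (G : nat -> U -> R) (E : nat -> R -> U -> R).
Hypotheses (pX : is_process X) (jX : pure_jump_process X) (tsX : time_stable P X).
Hypothesis HG : unit_poisson_pp Q G.
Hypothesis pE : forall i, is_process (E i).
Hypothesis sE : forall i, random_step_fun (E i).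
Hypothesis fddE : forall i, fdd_eq Q Q (E i) (E 0%N).
Hypothesis ind : mutually_independent Q (mark_sigma G E).
Variables (A : nat) (l : R).
(** The reciprocal of an integer keeps every scale ratio below rational, as [intensity_scale]
    requires. *)
Let a : R := A.+1%:R^-1.
Hypothesis E0 : forall i t w, 0 <= t < a -> E i t w = 0.
Hypothesis l0 : 0 < l.
Hypothesis hl : forall e, 0 < e -> exists J, forall j, (J <= j)%N -> `|harm R j - l| <= e.
Hypothesis hE : forall tt M (mo : measurable_fun setT (obs (E 0%N) tt)) B,
  (forall i t, tt i = Some t -> t < M /\ exists j, t = nnrat R j) -> measurable B ->
  pr (law Q mo) B = mark_pr P X l^-1 a tt B.

Let a0 : 0 < a. Proof. by rewrite invr_gt0. Qed.
Let mG i : measurable_fun setT (G i). Proof. by case: HG. Qed.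
Let G0 i w : 0 < G i w. Proof. by case: HG => _ []. Qed.
Let finE := integrable_mark Q a0 (E0 0%N).
Let cvS := lepage_cvg HG a0 E0.
Let pS : is_process (lepage_sum G E) := is_process_lepage HG pE sE.

Definition rational_times (tt : times R) := forall k t, tt k = Some t -> exists j, t = nnrat R j.

Lemma rational_scale (p q : nat) tt : rational_times tt ->
  rational_times (scale_times (p%:R / q%:R) tt).
Proof.
move=> rt k t; rewrite /scale_times; case e : (tt k) => [s|]//= [<-].
have [j ->] := rt _ _ e; have [r r0 ->] := nnratP R j.
have [j' hj'] := @nnrat_surj R (p%:R / q%:R * r) (mulr_ge0 (divr_ge0 (ler0n _ _) (ler0n _ _)) r0).
by exists j'; rewrite hj' !rmorphM/= fmorphV/= !rmorph_nat.
Qed.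

Section fixed_times.
Variables (tt : times R) (M K : nat).
Hypothesis bM : bounded_times tt M.+1%:R.
Hypothesis pos : forall k t, tt k = Some t -> 0 < t.
Hypothesis rat : rational_times tt.
Hypothesis fin : forall k, (K <= k)%N -> tt k = None.

Let M0 : (0 : R) < M.+1%:R. Proof. by rewrite ltr0n. Qed.

Section fixed_scale.
Variable m : nat.
Let m0 : (0 : R) < m.+1%:R. Proof. by rewrite ltr0n. Qed.
Let tt' := scale_times m.+1%:R^-1 tt.

Let htt' : nonneg_times tt'.
Proof. by apply: nonneg_scale; [rewrite invr_ge0|exact: bounded_nonneg bM]. Qed.

Let fin' k : (K <= k)%N -> tt' k = None.
Proof. by move=> /fin; rewrite /tt' /scale_times => ->. Qed.

(** The times are below M / m, up to the successors, and marks vanish before [a]; hence points from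
    [L] on do not contribute. *)
Let L : R := M.+1%:R / (m.+1%:R * a).
Let L0 : 0 < L. Proof. by rewrite divr_gt0// mulr_gt0. Qed.

Let I c (h : R) B := intensity P X tt B (c%:R * h) (c%:R * h *+ 2).

(** In cell [c] the mark is observed at the times [r * tt], and homogeneity moves the window [a, 2a[
    to the first jump window starting at c times M.+1 / n.+1. In cell 0 all times are 0, where marks
    vanish. *)
Let cell_pr (n c : nat) (B : set V) : measurable B -> ~ B (v0 R) -> (c < n.+1)%N ->
  pr (cell_law Q pE htt' (mesh_gt0 n L0) n.+1 c) B =
  if c is 0 then 0 else l^-1 * (a / (c%:R * (M.+1%:R / n.+1%:R))) * I c (M.+1%:R / n.+1%:R) B.
Proof.
move=> mB B0 cn; set h := L / n.+1%:R; set dl := M.+1%:R / n.+1%:R.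
have dl0 : 0 < dl by rewrite divr_gt0.
case: c cn => [|c] cn.
  rewrite /cell_law /pr (_ : law _ _ _ = 0%E)//.
  transitivity (Q (obs (E 0%N) (cell_times h n.+1 tt' 0) @^-1` B)); first exact: lawE.
  rewrite (_ : _ @^-1` B = set0) ?measure0//; apply/seteqP; split => u //= Bu; apply: B0.
  rewrite (_ : v0 R = obs (E 0%N) (cell_times h n.+1 tt' 0) u)//.
  apply/funext => k; rewrite /v0 /obs /cell_times /= mul0r invr0 /scale_times.
  by case: (tt' k) => [t|]//=; rewrite mul0r E0// lexx.
set r : R := a / (c.+1%:R * dl).
have ct : cell_times h n.+1 tt' c.+1 = scale_times r tt.
  rewrite /cell_times cn scale_timesM; congr scale_times; rewrite /r /h /dl /L.
  by field; rewrite !gt_eqF ?ltr0n// a0.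
have er : r = n.+1%:R / (A.+1 * c.+1 * M.+1)%:R.
  have [q1 q2 q3 q4] : [/\ A.+1%:R != 0 :> R, c.+1%:R != 0 :> R, M.+1%:R != 0 :> R & n.+1%:R != 0 :> R].
    by rewrite !pnatr_eq0.
  rewrite /r /dl !natrM /a; move: q1 q2 q3 q4.
  by move: (A.+1%:R) (c.+1%:R) (M.+1%:R) (n.+1%:R) => x y z w q1 q2 q3 q4; field; rewrite q1 q2 q3 q4.
have cr : r * (c.+1%:R * dl) = a by rewrite /r divfK// gt_eqF// mulr_gt0// ltr0n.
rewrite /cell_law; set mo := measurable_obs _ _.
rewrite (hE (M := r * M.+1%:R) mo _ mB); last first.
  move=> i t; rewrite ct => hi; split; last by move: hi; rewrite er; apply: rational_scale.
  move: hi; rewrite /scale_times; case e : (tt i) => [s|]//= [<-].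
  have /andP[_ sM] := bM e; rewrite ltr_pM2l// /r divr_gt0// mulr_gt0// ltr0n.
rewrite /mark_pr memNset// mulr0 addr0 -mulrA; congr (_ * _); rewrite ct.
pose q := (A.+1 * c.+1 * M.+1).-1.
have eq : q.+1 = (A.+1 * c.+1 * M.+1)%N by rewrite prednK// !muln_gt0.
have bM2 : bounded_times tt (2 * M.+1%:R).
  by move=> k t /bM /andP[t0 tM]; rewrite t0 (lt_trans tM)// ltr_pMl// ltr1n.
have xy : c.+1%:R * dl <= c.+1%:R * dl *+ 2 <= 2 * M.+1%:R.
  have x0 : 0 < c.+1%:R * dl by rewrite mulr_gt0// ltr0n.
  have x1 : c.+1%:R * dl <= M.+1%:R.
    by rewrite /dl mulrCA ler_piMr ?(ltW M0)// ler_pdivrMr ?ltr0n// mul1r ler_nat ltnW.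
  by rewrite mulr_natl; apply/andP; split; lra.
have := intensity_scale pX jX tsX n q bM2 (mulr_gt0 (ltr0n _ 2) M0) mB xy.
cbv zeta; rewrite eq -er cr (_ : r * (c.+1%:R * dl *+ 2) = 2 * a) => [->//|].
by rewrite mulrnAr cr mulr_natl.
Qed.

(** After multiplication by the mesh and by [m.+1], the factors from [cell_pr] collapse to the
    harmonic weights of [intensity_riemann]. One L^2 comes from expanding the convolution, the other
    from replacing 1 - exp(-h) by h; neither depends on [n]. *)
Let grid_first_order n B : measurable B -> ~ B (v0 R) ->
  `|m.+1%:R * pr (grid_law Q pE htt' L0 n) B -
    \sum_(1 <= c < n.+1) (l^-1 / c%:R) * I c (M.+1%:R / n.+1%:R) B|
  <= 2 * (M.+1%:R / a) ^+ 2 / m.+1%:R.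
Proof.
move=> mB B0; pose hn : {nonneg R} := NngNum (ltW (mesh_gt0 n L0)).
pose nu := cell_law Q pE htt' (mesh_gt0 n L0) n.+1.
have n0 : (0 : R) < n.+1%:R by rewrite ltr0n.
have hE' : hn%:num = L / n.+1%:R by [].
have h0 : 0 <= hn%:num by [].
have hL : n.+1%:R * hn%:num = L by rewrite hE' mulrC divfK// gt_eqF.
have [_ e1] := andP (one_sub_expN h0); have [e2 _] := andP (one_sub_expN h0).
have q0 : 0 <= 1 - expR (- hn%:num) by rewrite subr_ge0 -expR0 ler_expR oppr_le0.
have fo := @convs_first_order R nat (fun c => pmix hn (nu c)) (iota 0 n.+1) hn%:num B h0 _ mB B0.
have nzle c : c \in iota 0 n.+1 -> pr (pmix hn (nu c)) (@nz R) <= hn%:num.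
  move=> _; rewrite pr_pmix; [|exact: measurable_nz|by move=> h; exact: h].
  apply: le_trans e1; rewrite ler_piMr// pr_le1//; exact: measurable_nz.
move: (fo nzle); rewrite size_iota hL => {}fo.
have sumE : \sum_(i <- iota 0 n.+1) pr (pmix hn (nu i)) B =
    (1 - expR (- hn%:num)) * \sum_(0 <= c < n.+1) pr (nu c) B.
  rewrite mulr_sumr /index_iota subn0; apply: eq_bigr => c _; exact: pr_pmix.
rewrite sumE in fo.
set S := \sum_(0 <= c < n.+1) pr (nu c) B in fo.
have S0 : 0 <= S by apply: sumr_ge0 => c _; exact: pr_ge0.
have Sn : S <= n.+1%:R.
  apply: (@le_trans _ _ (\sum_(0 <= c < n.+1) 1)); last by rewrite sumr_const_nat subn0.
  by apply: ler_sum => c _; exact: pr_le1.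
have target : m.+1%:R * (hn%:num * S) = \sum_(1 <= c < n.+1) (l^-1 / c%:R) * I c (M.+1%:R / n.+1%:R) B.
  rewrite /S big_ltn// cell_pr// add0r mulrA mulr_sumr; apply: eq_big_nat => c /andP[c1 cn].
  rewrite cell_pr//; case: c c1 cn => [//|c] _ cn; rewrite [LHS]mulrA; congr (_ * _).
  rewrite hE' /L; field; rewrite !gt_eqF ?ltr0n//.
rewrite -target -mulrBr normrM gtr0_norm//.
have -> : 2 * (M.+1%:R / a) ^+ 2 / m.+1%:R = m.+1%:R * (2 * L ^+ 2).
  by rewrite /L; field; rewrite !gt_eqF.
rewrite ler_pM2l//.
have dd : `|(1 - expR (- hn%:num)) * S - hn%:num * S| <= L ^+ 2.
  rewrite -mulrBl normrM (ger0_norm S0); apply: (@le_trans _ _ (hn%:num ^+ 2 * n.+1%:R)).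
    apply: ler_pM => //; move: e1 e2; move: (hn%:num) (1 - expR _) => x y h1 h2.
    by rewrite ler_norml; apply/andP; split; nra.
  have n1 : (1 : R) <= n.+1%:R by rewrite ler1n.
  rewrite -hL; move: h0 n1; move: (hn%:num) (n.+1%:R) => x y x0 y1.
  have y1' : 0 <= y - 1 by rewrite subr_ge0.
  have := mulr_ge0 (mulr_ge0 (sqr_ge0 x) (le_trans ler01 y1)) y1'.
  by rewrite !expr2; nra.
rewrite /grid_law /compound -/hn -/nu.
move: fo dd; set p := pr (convs _) B; move: p (_ * S) (_ * S) (L ^+ 2) => x y z w.
by rewrite !ler_norml => /andP[h1 h2] /andP[h3 h4]; apply/andP; split; lra.
Qed.

Lemma lepage_first_order (mS : measurable_fun setT (obs (lepage_sum G E) tt')) B :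
  measurable B -> ~ B (v0 R) ->
  `|m.+1%:R * pr (law Q mS) B - intensity P X tt B 0 M.+1%:R| <= 2 * (M.+1%:R / a) ^+ 2 / m.+1%:R.
Proof.
move=> mB B0; apply/ler_addgt0Pr => e e0.
have e2 : 0 < e / 2 by rewrite divr_gt0.
(* Total variation errors get multiplied by [m.+1] and occur twice, for the truncation and for the
   grid. *)
pose e3 := e / 2 / (2 * m.+1%:R); have e30 : 0 < e3 by rewrite divr_gt0// mulr_gt0.
have [n1 hn1] := @dle_trunc_grid _ _ R Q G E HG pE sE fddE ind tt' htt' K fin' L L0 e3 e30.
have [n2 hn2] := intensity_riemann pX jX tsX l0 hl bM mB B0 e2.
pose n := maxn n1 n2.
have [I0 hI0] := hn1 n (leq_maxl _ _).
have leb_fin : (@lebesgue_measure R (below L) < +oo)%E.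
  by rewrite lebesgue_measure_itv/=; case: ifP => _; rewrite ?ltry// -EFinB ltry.
have sub : below L `<=` `]0, +oo[%classic.
  by move=> x; rewrite /below /= !in_itv/= andbT => /andP[].
have /cvgrPdist_le/(_ e3 e30)[I1 _ hI1] := cvg_tail_points HG (measurable_itv _) sub leb_fin.
pose J := maxn I0 I1.
have tJ : pr Q (tail_points G (below L) J) <= e3.
  by have := hI1 J (leq_maxr _ _); rewrite sub0r normrN ger0_norm ?pr_ge0.
have mtail : measurable (tail_points G (below L) J).
  by apply: (measurable_tail_points HG); exact: measurable_itv.
have mT := measurable_trunc_sum mG G0 pE sE htt' L J.
have same w : ~ tail_points G (below L) J w ->
    obs (lepage_sum G E) tt' w = trunc_sum G E tt' L J w.
  move=> nt; have far i : (J <= i)%N -> L <= G i w.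
    move=> Ji; rewrite leNgt; apply/negP => GL; apply: nt; exists i => //=.
    by rewrite /below /= in_itv/= G0.
  apply/funext => k; rewrite /trunc_sum /vsum /obs; case et : (tt' k) => [t|]; last first.
    rewrite big1// => i _; rewrite /trunc_mark; case: ifP => // _.
    by rewrite /mark /obs /scale_times et.
  have t0 : 0 <= t := htt' et.
  have tL : t < a * L.
    move: et; rewrite /tt' /scale_times; case es : (tt k) => [s|]//= [<-].
    have /andP[_ sM] := bM es; rewrite /L invfM mulrCA [a * _]mulrCA mulfV ?gt_eqF// mulr1.
    by rewrite mulrC ltr_pM2r ?invr_gt0.
  rewrite (lepage_finite HG a0 E0 far t0 tL) -(big_mkord xpredT (fun i => E i (t / G i w) w)).
  rewrite /index_iota subn0; apply: eq_bigr => i _; rewrite /trunc_mark; case: ltP => GL.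
    by rewrite /mark /obs /scale_times et /= mulrC.
  exact: (far_term HG a0 E0 GL t0 tL).
have D1 : dle (law Q mS) (law Q mT) e3.
  by apply: dle_le tJ _; exact: dle_coupling.
have D2 := hI0 J (leq_maxl _ _).
have D : dle (law Q mS) (grid_law Q pE htt' L0 n) (e3 + e3).
  apply: dle_trans D1 _; rewrite (law_irrelevance Q mT (measurable_trunc_sum mG G0 pE sE htt' L J)).
  exact: D2.
have h1 := D _ mB; have h2 := dleC D mB.
have h3 := @grid_first_order n B mB B0.
have h4 := hn2 n (leq_maxr _ _) _ erefl.
have h5 : m.+1%:R * (e3 + e3) = e / 2 by rewrite /e3; field; rewrite gt_eqF.
have h1' : m.+1%:R * pr (law Q mS) B <= m.+1%:R * pr (grid_law Q pE htt' L0 n) B + e / 2.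
  by rewrite -h5 -mulrDr ler_pM2l.
have h2' : m.+1%:R * pr (grid_law Q pE htt' L0 n) B <= m.+1%:R * pr (law Q mS) B + e / 2.
  by rewrite -h5 -mulrDr ler_pM2l.
move: h3 h4; rewrite /I.
move: h1' h2'; move: (_ * pr (law Q mS) B) (_ * pr (grid_law _ _ _ _ _) B) => x y.
move: (\sum_(1 <= _ < _) _) (intensity _ _ _ _ _ _) (_ / m.+1%:R) => s i w h1' h2'.
by rewrite !ler_norml => /andP[? ?] /andP[? ?]; apply/andP; split; lra.
Qed.

(** A non-zero observation forces a jump before the time bound, so the window from 0 to [M.+1]
    imposes no further restriction and [intensity_err] applies directly. *)
Lemma process_first_order (mX : measurable_fun setT (obs X tt')) B : measurable B -> ~ B (v0 R) ->
  `|m.+1%:R * pr (law P mX) B - intensity P X tt B 0 M.+1%:R| <=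
  intensity_const pX jX tsX * M.+1%:R ^+ 2 / m.+1%:R.
Proof.
move=> mB B0; rewrite distrC.
have xy : (0 <= (M.+1%:R : R)) && ((M.+1%:R : R) <= M.+1%:R) by apply/andP; split; [exact: ltW|exact: lexx].
have := intensity_err pX jX tsX m bM M0 mB xy; rewrite /jump_rate.
rewrite (_ : jump_event _ _ _ _ _ _ = obs X tt' @^-1` B)//.
apply/seteqP; split => w /=; first by case.
move=> Bw; split => //; split; first by move=> t; rewrite mulr0 => /andP[t0 /(le_lt_trans t0)]; rewrite ltxx.
move=> z; apply: B0; rewrite (_ : v0 R = obs X tt' w)//; apply/funext => k.
rewrite /v0 /obs /tt' /scale_times; case e : (tt k) => [t|]//=.
have /andP[t0 tM] := bM e.
by rewrite z// mulr_ge0 ?invr_ge0//= ltr_pM2l ?invr_gt0.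
Qed.

End fixed_scale.

Lemma deq_rational (mX : measurable_fun setT (obs X tt))
  (mS : measurable_fun setT (obs (lepage_sum G E) tt)) : deq (law P mX) (law Q mS).
Proof.
have htt := bounded_nonneg bM.
pose C1 := intensity_const pX jX tsX * M.+1%:R ^+ 2; pose C2 := 2 * (M.+1%:R / a) ^+ 2.
pose C := C1 + C2.
have C0 : 0 <= C.
  apply: addr_ge0; first by rewrite mulr_ge0 ?sqr_ge0// intensity_const_ge0.
  by rewrite mulr_ge0 ?sqr_ge0.
have D m : dle (law P mX) (law Q mS) (C / m.+1%:R).
  have m0 : (0 : R) < m.+1%:R by rewrite ltr0n.
  pose tt' := scale_times m.+1%:R^-1 tt.
  have htt' : nonneg_times tt' by apply: nonneg_scale => //; rewrite invr_ge0.
  have ett : scale_times m.+1%:R tt' = tt.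
    by rewrite /tt' scale_timesM mulfV ?gt_eqF// scale_times1.
  have mX' := measurable_obs pX htt'; have mS' := measurable_obs pS htt'.
  have mXe : measurable_fun setT (obs X (scale_times m.+1%:R tt')) by rewrite ett.
  have mSe : measurable_fun setT (obs (lepage_sum G E) (scale_times m.+1%:R tt')) by rewrite ett.
  have eX : deq (convn (law P mX') m.+1) (law P mX).
    apply: deq_trans (time_stable_law pX tsX mX' mXe htt' (ltn0Sn m)) _.
    by apply: law_eq; rewrite ett.
  have eS : deq (convn (law Q mS') m.+1) (law Q mS).
    apply: deq_trans (lepage_stable (K := K) HG pE sE fddE ind finE cvS mS' mSe (ltn0Sn m) _ _) _.
    - move=> k t; rewrite /tt' /scale_times; case e : (tt k) => [s|]//= [<-].
      by rewrite mulr_gt0 ?invr_gt0// (pos e).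
    - by move=> k kK; rewrite /tt' /scale_times fin.
    - by apply: law_eq; rewrite ett.
  have e0 : 0 <= C / m.+1%:R ^+ 2 by rewrite divr_ge0 ?sqr_ge0.
  have Dm : dle (law P mX') (law Q mS') (C / m.+1%:R ^+ 2).
    apply: dle_avoid0 => B mB B0.
    have h1 := process_first_order mX' mB B0; have h2 := lepage_first_order mS' mB B0.
    rewrite -(ler_pM2l m0) -[X in X * `|_|](gtr0_norm m0) -normrM mulrBr.
    rewrite (_ : m.+1%:R * (C / m.+1%:R ^+ 2) = C / m.+1%:R); last by field; rewrite gt_eqF.
    move: h1 h2; rewrite [C / _]mulrDl -/C1 -/C2.
    move: (C1 / _) (C2 / _) (_ * pr (law P _) B) (_ * pr (law Q _) B) (intensity _ _ _ _ _ _) => u v x y z.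
    by rewrite !ler_norml => /andP[? ?] /andP[? ?]; apply/andP; split; lra.
  have := convn_dle m.+1 e0 Dm.
  rewrite (_ : m.+1%:R * (C / m.+1%:R ^+ 2) = C / m.+1%:R); last by field; rewrite gt_eqF.
  move=> Dc B mB; rewrite -(deq_pr eX mB) -(deq_pr eS mB); exact: Dc.
move=> B mB; rewrite !prE//; congr EFin; apply/eqP; rewrite eq_le; apply/andP; split; rewrite -subr_le0.
  by apply: (@le0_div_nat _ _ C) => m; rewrite lerBlDl; exact: D.
by apply: (@le0_div_nat _ _ C) => m; rewrite lerBlDl; exact: (dleC (D m)).
Qed.

End fixed_times.

End comparison.

(** * From rational times to all times *)

Section eventual_equality.
Context d (T : measurableType d) (R : realType) (P : probability T R).
Notation V := (iseq R).

Lemma measurable_neq (f g : T -> V) : measurable_fun setT f -> measurable_fun setT g ->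
  measurable [set w | f w <> g w].
Proof.
move=> mf mg; rewrite (_ : [set w | _] = \bigcup_k ~` ((fun w => f w k - g w k) @^-1` [set 0])).
  apply: bigcup_measurable => k _; apply: measurableC.
  have mh : measurable_fun setT (fun w => f w k - g w k).
    by apply: measurable_funB; apply: (measurableT_comp (measurable_coord k)).
  by have := mh measurableT _ (measurable_set1 0); rewrite setTI.
apply/seteqP; split => w /=.
  move=> fg; apply: contrapT => h; apply: fg; apply/funext => k; apply/eqP.
  rewrite -subr_eq0; apply/eqP; apply: contrapT => hk; apply: h; exists k => //.
by move=> [k _ /= h] fg; apply: h; rewrite fg subrr.
Qed.

Lemma dle_eventually (X : T -> V) (Y : nat -> T -> V) (mX : measurable_fun setT X)
  (mY : forall n, measurable_fun setT (Y n)) B : measurable B -> P B = 0%E ->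
  (forall w, ~ B w -> exists n0, forall n, (n0 <= n)%N -> Y n w = X w) ->
  forall e : R, 0 < e -> exists n0, forall n, (n0 <= n)%N -> dle (law P mX) (law P (mY n)) e.
Proof.
move=> mB PB h e e0; pose D n := [set w | X w <> Y n w] `\` B.
have mD n : measurable (D n) by apply: measurableD => //; exact: measurable_neq.
have /cvgrPdist_le/(_ e e0)[n0 _ hn] : pr P (D n) @[n --> \oo] --> 0.
  apply: cvg_pr_eventually => // w; have [Bw|nB] := pselect (B w); first by exists 0%N => n _ [].
  by have [n0 hn] := h _ nB; exists n0 => n nn [+ _]; rewrite /= hn.
exists n0 => n nn; have := hn n nn; rewrite /= sub0r normrN ger0_norm ?pr_ge0// => De.
have prB : pr P B = 0 by rewrite /pr PB.
apply: (@dle_le _ _ _ (pr P (D n `|` B))); first by rewrite (le_trans (prU_le _ _ _))// prB addr0.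
apply: dle_coupling; first exact: measurableU.
move=> w nDB; apply: contrapT => XY; apply: nDB.
by have [Bw|nB] := pselect (B w); [right|left].
Qed.

End eventual_equality.

Section right_limits.
Context d (T : measurableType d) (R : realType) (P : probability T R).
Notation V := (iseq R).

Definition right_times (tt : times R) p : times R :=
  fun k => omap (fun t => nnrat R (right_index t p)) (tt k).

Lemma right_times_eventually (X : R -> T -> R) tt K w : nonneg_times tt ->
  (forall k, (K <= k)%N -> tt k = None) ->
  (forall t, 0 <= t -> exists2 e, 0 < e & forall x, t <= x < t + e -> X x w = X t w) ->
  exists n0, forall n, (n0 <= n)%N -> obs X (right_times tt n) w = obs X tt w.
Proof.
move=> htt fin hX.
have [|n0 h] := @uniform_threshold
    (fun k n => obs X (right_times tt n) w k = obs X tt w k) K.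
  move=> k; rewrite /obs /right_times; case e : (tt k) => [t|]; last by exists 0%N.
  have t0 := htt _ _ e; have [r r0 hr] := hX t t0.
  exists (Num.truncn r^-1) => n nn /=; apply: hr.
  have /andP[q1 q2] := right_index_near n t0; rewrite (ltW q1)/=.
  apply: le_lt_trans q2 _; rewrite ltrD2l -[r]invrK ltf_pV2 ?posrE ?invr_gt0//.
  by apply: lt_le_trans (truncnS_gt _) _; rewrite ler_nat.
exists n0 => n nn; apply/funext => k; have [kK|kK] := ltnP k K; first exact: h.
by rewrite /obs /right_times fin.
Qed.

End right_limits.

(** Times are approached strictly from the right by positive rationals, so time 0 is covered as
    well. Paths are locally constant to the right, so the observations become equal, not merely
    close, and total variation passes to the limit. *)
Lemma fdd_eq_of_rational d1 d2 (T1 : measurableType d1) (T2 : measurableType d2) (R : realType)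
  (P1 : probability T1 R) (P2 : probability T2 R) (X : R -> T1 -> R) (Y : R -> T2 -> R) B :
  is_process X -> is_process Y -> random_step_fun X -> measurable B -> P2 B = 0%E ->
  (forall w t, ~ B w -> 0 <= t ->
     exists2 e, 0 < e & forall x, t <= x < t + e -> Y x w = Y t w) ->
  (forall tt M K (mX : measurable_fun setT (obs X tt)) (mY : measurable_fun setT (obs Y tt)),
     bounded_times tt M.+1%:R -> (forall k t, tt k = Some t -> 0 < t) -> rational_times tt ->
     (forall k, (K <= k)%N -> tt k = None) -> deq (law P1 mX) (law P2 mY)) ->
  fdd_eq P1 P2 X Y.
Proof.
move=> pX pY sX mB PB rY h n ts ts0 C mC.
have htt := nonneg_tuple ts0; set tt := tuple_times ts in htt.
have fin k : (n <= k)%N -> tt k = None by rewrite /tt /tuple_times leqNgt; case: ltnP.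
have hr p : nonneg_times (right_times tt p).
  by move=> k t; rewrite /right_times; case: (tt k) => [s|]//= [<-]; exact: nnrat_ge0.
have mX := measurable_obs pX htt; have mY := measurable_obs pY htt.
have mXp p := measurable_obs pX (hr p); have mYp p := measurable_obs pY (hr p).
have eqp p : deq (law P1 (mXp p)) (law P2 (mYp p)).
  have [M hM] : exists M : nat, forall k t, right_times tt p k = Some t -> t < M.+1%:R.
    have [|M hM] := @uniform_threshold
        (fun k M => forall t, right_times tt p k = Some t -> t < M.+1%:R) n.
      move=> k; case: (right_times tt p k) => [t|]; last by exists 0%N.
      exists (Num.truncn t) => M tM _ [<-].
      by apply: lt_le_trans (truncnS_gt _) _; rewrite ler_nat.
    exists M => k t; have [kn|kn] := ltnP k n; first exact: hM.
    by rewrite /right_times fin.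
  apply: (h _ M n).
  - by move=> k t e; rewrite (hr p k t e)/=; exact: hM e.
  - move=> k t; rewrite /right_times; case e : (tt k) => [s|]//= [<-].
    by have /andP[q1 _] := right_index_near p (htt _ _ e); exact: le_lt_trans (htt _ _ e) q1.
  - by move=> k t; rewrite /right_times; case: (tt k) => [s|]//= [<-]; eexists.
  - by move=> k kn; rewrite /right_times fin.
have cX := dle_eventually mX mXp measurable0 (measure0 P1).
have cY := dle_eventually mY mYp mB PB.
have D (e : R) : 0 < e -> dle (law P1 mX) (law P2 mY) e.
  move=> e0; have e2 : 0 < e / 2 by rewrite divr_gt0.
  have [n1 h1] := cX (fun w _ => right_times_eventually htt fin (fun t => step_fun_right (sX w))) _ e2.
  have [n2 h2] := cY (fun w nB => right_times_eventually htt fin (fun t => rY w t nB)) _ e2.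
  pose p := maxn n1 n2.
  rewrite (splitr e); apply: dle_trans (h1 p (leq_maxl _ _)) _.
  rewrite -[e / 2]add0r; apply: dle_trans (deq_dle (eqp p)) _.
  by apply: dleC; exact: h2 p (leq_maxr _ _).
apply: (obs_fdd (mX := mX) (mY := mY)) => // E mE.
rewrite !prE//; congr EFin; apply/eqP; rewrite eq_le; apply/andP; split.
  by apply/ler_addgt0Pr => e e0; exact: (D e e0).
by apply/ler_addgt0Pr => e e0; exact: (dleC (D e e0)).
Qed.

Section forward.
Context d (T : measurableType d) (R : realType) (P : probability T R).
Variable X : R -> T -> R.
Hypotheses (pX : is_process X) (jX : pure_jump_process X) (tsX : time_stable P X).

Lemma lepage_of_time_stable : exists (G : nat -> R -> R) (E : nat -> R -> R -> R),
  unit_poisson_pp (unif R) G /\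
  (forall i, is_process (E i) /\ random_step_fun (E i) /\
             fdd_eq (unif R) (unif R) (E i) (E 0%N)) /\
  mutually_independent (unif R) (mark_sigma G E) /\
  (\int[unif R]_w (\int[@lebesgue_measure R]_(t in `]0%R, +oo[%classic)
       ((Num.min 1 `|E 0%N t w|) / t ^+ 2)%:E) < +oo)%E /\
  (forall t : R, 0 <= t -> {ae unif R, forall w, cvgn (lepage_partial G E t w)}) /\
  fdd_eq P (unif R) X (lepage_sum G E).
Proof.
have [l l0 hl] := harm_cvg R; have [K K0 hK] := early_linear pX jX tsX.
(* The linear bound gives the window [a, 2a[ intensity at most 2 K a, so this choice keeps the mass
   of the normalized mark law at most 1. *)
have [A hA] : exists A, 2 * K / l <= A.+1%:R.
  by exists (Num.truncn (2 * K / l)); exact: ltW (truncnS_gt _).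
pose a : R := A.+1%:R^-1.
have a0 : 0 < a by rewrite invr_gt0.
have k1 : l^-1 * intensity P X (no_times R) setT a (2 * a) <= 1.
  have bn : bounded_times (no_times R) (2 * a) by [].
  have aa : a <= 2 * a <= 2 * a by rewrite lexx andbT ler_peMl ?ler1n// ltW.
  have a2 : 0 < 2 * a by rewrite mulr_gt0.
  have h := intensity_le pX jX tsX hK bn a2 measurableT a2 aa.
  rewrite mulrC ler_pdivrMr// mul1r; apply: le_trans h _.
  by rewrite mulrCA mulrA ler_pdivrMr// [l * _]mulrC -ler_pdivrMr.
have l0' : 0 <= l^-1 by rewrite invr_ge0 ltW.
have [eps [pe se e0 eE]] := mark_process_exists pX jX tsX l0' a0 k1.
have [G [E [HG hE ind fE vE]]] := iid_marks_exist pe se.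
have pE i : is_process (E i) by case: (hE i).
have sE i : random_step_fun (E i) by case: (hE i) => _ [].
have fddE i : fdd_eq (unif R) (unif R) (E i) (E 0%N) by case: (hE i) => _ [].
have E0 i t w : 0 <= t < a -> E i t w = 0.
  by move=> ta; have [v ->] := vE i t w; exact: e0.
have markE tt M (mo : measurable_fun setT (obs (E 0%N) tt)) B :
    (forall i t, tt i = Some t -> t < M /\ exists j, t = nnrat R j) -> measurable B ->
    pr (law (unif R) mo) B = mark_pr P X l^-1 a tt B.
  move=> hM mB; have htt : nonneg_times tt.
    by move=> k t /hM[_ [j ->]]; exact: nnrat_ge0.
  by rewrite (deq_pr (fdd_obs mo (measurable_obs pe htt) fE htt) mB) (eE _ M).
exists G, E; do 3 (split=> //); split; first exact: (integrable_mark _ a0 (E0 0%N)).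
split; first exact: (lepage_cvg HG a0 E0).
have pS := is_process_lepage HG pE sE.
apply: (fdd_eq_of_rational pX pS _ (measurable_crowded HG) (crowded0 HG)).
- by move=> w; case: (jX w).
- by move=> w t nc t0; exact: (lepage_right HG a0 E0 sE nc t0).
- move=> tt M K' mX mS bM pos rat fin.
  exact: (deq_rational pX jX tsX HG pE sE fddE ind E0 l0 hl markE bM pos rat fin).
Qed.

End forward.

Theorem theorem5p5 (R : realType) (d : measure_display) (Omega : measurableType d)
  (P : probability Omega R) (xi : R -> Omega -> R) :
  is_process xi -> stoch_cont P xi -> pure_jump_process xi ->
  time_stable P xi <->
  exists (d' : measure_display) (Omega' : measurableType d')
         (P' : probability Omega' R) (G : nat -> Omega' -> R)
         (eps : nat -> R -> Omega' -> R),
    unit_poisson_pp P' G /\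
    (forall i, is_process (eps i) /\ random_step_fun (eps i) /\
               fdd_eq P' P' (eps i) (eps 0%N)) /\
    mutually_independent P'
      (fun o : option nat => match o with
                             | None => sigma_seq G
                             | Some i => sigma_proc (eps i) end) /\
    (\int[P']_w (\int[@lebesgue_measure R]_(t in `]0%R, +oo[%classic)
         ((Num.min 1 `|eps 0%N t w|) / t ^+ 2)%:E) < +oo)%E /\
    (forall t : R, 0 <= t -> {ae P', forall w, cvgn (lepage_partial G eps t w)}) /\
    fdd_eq P P' xi (lepage_sum G eps).
Proof.
move=> pX _ jX; split.
  move=> /(lepage_of_time_stable pX jX)[G [E h]].
  by exists _, (R : measurableType _), (unif R), G, E.
move=> [d' [T' [Q [G [E [HG [hE [ind [finE [cvS fdd]]]]]]]]]].
apply: (lepage_time_stable pX _ HG _ _ _ ind finE cvS fdd).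
- by move=> w; case: (jX w).
- by move=> i; case: (hE i).
- by move=> i; case: (hE i) => _ [].
- by move=> i; case: (hE i) => _ [].
Qed.
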